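(* Let $\mathcal{J}_0=\bigoplus_{a,b,c\in\mathbb{N}_0,\ b\le\min(a,c)}\bigoplus_{k\in2\mathbb{Z}}J^w_{k,\begin{pmatrix}2a&2b\\2b&2c\end{pmatrix}}$. As a $\mathcal{J}_0$-module, $$\bigoplus_{\substack{a,b,c\in\mathbb{N}_0\\ b<\min(a,c)}}\ \bigoplus_{k\in2\mathbb{Z}}J^w_{k,\begin{pmatrix}2a&2b+1\\2b+1&2c\end{pmatrix}}$$ is spanned by the two forms $\Phi_{-2,A}$ and $\Phi_{0,A}$.
   Context: Notation: $\mathbb{H}$ upper half-plane, $q=e^{2\pi i\tau}$, $\zeta=e^{2\pi iz}$. For a symmetric positive semidefinite $n\times n$ integer matrix $M$ (diagonal may be odd, $M$ may be singular) let $Q(\mathfrak z)=\tfrac12\mathfrak z^TM\mathfrak z$. A weak Jacobi form of weight $k\in\mathbb{Z}$ and index $M$ is a holomorphic $f:\mathbb{H}\times\mathbb{C}^n\to\mathbb{C}$ with (i) $f\big(\frac{a\tau+b}{c\tau+d},\frac{\mathfrak z}{c\tau+d}\big)=(c\tau+d)^k\exp\big(\frac{2\pi i c\,Q(\mathfrak z)}{c\tau+d}\big)f(\tau,\mathfrak z)$ for $\begin{pmatrix}a&b\\c&d\end{pmatrix}\in\mathrm{SL}_2(\mathbb{Z})$; (ii) $f(\tau,\mathfrak z+\lambda\tau+\mu)=(-1)^{2Q(\lambda)+2Q(\mu)}\exp\big(-2\pi i\tau Q(\lambda)-2\pi i\lambda^TM\mathfrak z\big)f(\tau,\mathfrak z)$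 for $\lambda,\mu\in\mathbb{Z}^n$; (iii) only nonnegative powers of $q$ occur in its Fourier expansion. $J^w_{k,M}$ is their space; for $n=2$ forms are written $f(\tau,z,w)$. The module structure is multiplication of functions (weights and indices add). Let $\vartheta(\tau,z)=q^{1/8}\zeta^{1/2}\sum_{n\in\mathbb{Z}}q^{n(n+1)/2}(-\zeta)^n$, $\vartheta'=\partial_z\vartheta$, $\eta(\tau)=q^{1/24}\prod_{n\ge1}(1-q^n)$, $E_2=1-24\sum_{n\ge1}\sigma_1(n)q^n$. Serre derivative: for a weak Jacobi form $f=\sum_{m\ge0}\sum_{r\in\frac12\mathbb{Z}^n}c(m,r)q^me^{2\pi i r^T\mathfrak z}$ of weight $k$ and positive definite index $M$ of size $n$, $\mathcal{S}f=\sum c(m,r)\big(m-\tfrac12r^TM^{-1}r\big)q^me^{2\pi ir^T\mathfrak z}-\big(\tfrac{k}{12}-\tfrac{n}{24}\big)E_2f$, a weak Jacobi form of weight $k+2$ and index $M$. With $A=\begin{pmatrix}2&1\\1&2\end{pmatrix}$: $\Phi_{-3,A}=\vartheta(\tau,z)\vartheta(\tau,w)\vartheta(\tau,z+w)/\eta^9$, $\Phi_{-2,A}=\big(\frac{\vartheta'(\tau,z)}{\vartheta(\tau,z)}+\frac{\vartheta'(\tau,w)}{\vartheta(\tau,w)}-\frac{\vartheta'(\tau,z+w)}{\vartheta(\tau,z+w)}\big)\Phi_{-3,A}$, $\Phi_{0,A}=-12\,\mathcal{S}(\Phi_{-2,A})$; these are weak Jacobi forms of index $A$ and weights $-3,-2,0$.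 *)

(* Defs.v *)
From HB Require Import structures.
From mathcomp Require Import all_boot all_order all_algebra.
From mathcomp Require Import finmap complex.
From mathcomp Require Import all_classical all_reals all_analysis.
From mathcomp Require Import ring.
From mathcomp Require summability.

Set Implicit Arguments.
Unset Strict Implicit.
Unset Printing Implicit Defensive.

Import Order.TTheory GRing.Theory Num.Theory.
Import numFieldNormedType.Exports.

Local Open Scope classical_set_scope.
Local Open Scope ring_scope.
Local Open Scope complex_scope.

(* The complex numbers are R[i], with the topology of its norm, so [differentiable] and [derive1] below are taken over the
   field R[i], i.e. they are complex differentiability. *)
HB.instance Definition _ (R : realType) := NormedModule.copy R[i] R[i]^o.

(* exp(2 pi i z) *)
Definition expi (R : realType) (z : R[i]) : R[i] :=
  let w := (2 * pi)*i * z in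
  (expR (complex.Re w))%:C * (cos (complex.Im w) +i* sin (complex.Im w)).

(* Unconditional convergence of a family indexed by I (along its finite
   subfamilies) to l, and its value. *)
Definition has_sum (R : realType) (I : choiceType) (x : I -> R[i]) (l : R[i]) :=
  summability.partial_sum x @ @summability.totally I --> l.

Definition csum (R : realType) (I : choiceType) (x : I -> R[i]) : R[i] :=
  summability.sum x.

Section JacobiForms.
Variables (R : realType) (n : nat).

Definition intv (v : 'cV[int]_n) : 'cV[R[i]]_n := map_mx intr v.

Definition intm (M : 'M[int]_n) : 'M[R[i]]_n := map_mx intr M.

Definition bil (M : 'M[R[i]]_n) (x y : 'cV[R[i]]_n) : R[i] :=
  (x^T *m M *m y) 0 0.

Definition quad (M : 'M[R[i]]_n) (z : 'cV[R[i]]_n) : R[i] := 2^-1 * bil M z z.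

(* A function on H x C^n is represented by its extension by zero to C x C^n. *)
Definition onH (f : R[i] * 'cV[R[i]]_n -> R[i]) (p : R[i] * 'cV[R[i]]_n) :=
  if 0 < complex.Im p.1 then f p else 0.

(* Fourier frequencies r range over (1/2)Z^n: the index s : 'cV[int]_n stands
   for r = s / 2. *)
Definition freq (s : 'cV[int]_n) : 'cV[R[i]]_n := 2^-1 *: intv s.

(* q^m e^{2 pi i r^T z} *)
Definition fmono (p : R[i] * 'cV[R[i]]_n) (m : nat) (s : 'cV[int]_n) : R[i] :=
  expi (m%:R * p.1 + ((freq s)^T *m p.2) 0 0).

Definition fourier_expansion (f : R[i] * 'cV[R[i]]_n -> R[i])
    (c : nat * 'cV[int]_n -> R[i]) :=
  forall p : R[i] * 'cV[R[i]]_n, 0 < complex.Im p.1 ->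
    has_sum (fun i => c i * fmono p i.1 i.2) (f p).

Definition fourier_coef (f : R[i] * 'cV[R[i]]_n -> R[i]) :
    nat * 'cV[int]_n -> R[i] :=
  xget (fun=> 0) [set c | fourier_expansion f c].

(* J^w_{k, M}; the index M is meant to be symmetric positive semidefinite. *)
Record weak_jacobi (k : int) (M : 'M[int]_n)
    (f : R[i] * 'cV[R[i]]_n -> R[i]) : Prop := WeakJacobi {
  wj_onH : onH f = f ;
  wj_holomorphic : forall p : R[i] * 'cV[R[i]]_n,
    0 < complex.Im p.1 -> differentiable f p ;
  wj_modular : forall (a b c d : int) (tau : R[i]) (z : 'cV[R[i]]_n),
    a * d - b * c = 1 -> 0 < complex.Im tau ->
    let j := c%:~R * tau + d%:~R in
    f ((a%:~R * tau + b%:~R) / j, j^-1 *: z) =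
      j ^ k * expi (c%:~R * quad (intm M) z / j) * f (tau, z) ;
  wj_elliptic : forall (l m : 'cV[int]_n) (tau : R[i]) (z : 'cV[R[i]]_n),
    0 < complex.Im tau ->
    f (tau, z + tau *: intv l + intv m) =
      (-1) ^ ((l^T *m M *m l) 0 0 + (m^T *m M *m m) 0 0) *
      expi (- (tau * quad (intm M) (intv l)) - bil (intm M) (intv l) z) *
      f (tau, z) ;
  wj_fourier : exists c, fourier_expansion f c
}.

Definition sigma1 (m : nat) : nat := (\sum_(d <- divisors m) d)%N.

Definition E2 (tau : R[i]) : R[i] :=
  1 - 24 * lim (\sum_(1 <= m < N) (sigma1 m)%:R * expi tau ^+ m @[N --> \oo]).

Definition serre (k : int) (M : 'M[int]_n)
    (f : R[i] * 'cV[R[i]]_n -> R[i]) : R[i] * 'cV[R[i]]_n -> R[i] :=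
  onH (fun p =>
    csum (fun i => fourier_coef f i
                   * (i.1%:R - quad (invmx (intm M)) (freq i.2))
                   * fmono p i.1 i.2)
    - (k%:~R / 12 - n%:R / 24) * E2 p.1 * f p).

End JacobiForms.

Section Forms.
Variable R : realType.

Definition theta (tau z : R[i]) : R[i] :=
  expi (tau / 8) * expi (z / 2) *
  csum (fun m : int => expi ((m * (m + 1))%:~R / 2 * tau) * (- expi z) ^ m).

Definition dtheta (tau z : R[i]) : R[i] := (theta tau)^`()%classic z.

Definition dedekind_eta (tau : R[i]) : R[i] :=
  expi (tau / 24) * lim (\prod_(1 <= m < N) (1 - expi tau ^+ m) @[N --> \oo]).

Definition sym2 (a b c : int) : 'M[int]_2 :=
  \matrix_(i, j) if i == j then (if i == 0 then a else c) else b.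

Definition indexA : 'M[int]_2 := sym2 2 1 2.

Definition form2 : Type := R[i] * 'cV[R[i]]_2 -> R[i].

Definition Phi_m3 : form2 := onH (fun p =>
  let: (tau, z, w) := (p.1, p.2 0 0, p.2 1 0) in
  theta tau z * theta tau w * theta tau (z + w) / dedekind_eta tau ^+ 9).

(* (theta'/theta(z) + theta'/theta(w) - theta'/theta(z+w)) * Phi_m3 with the
   removable singularities along the zeros of the thetas filled in by cancelling
   the denominators (a literal _ / 0 would give the value 0 there); see
   [Phi_m2E]. *)
Definition Phi_m2 : form2 := onH (fun p =>
  let: (tau, z, w) := (p.1, p.2 0 0, p.2 1 0) in
  (dtheta tau z * theta tau w * theta tau (z + w)
   + theta tau z * dtheta tau w * theta tau (z + w)
   - theta tau z * theta tau w * dtheta tau (z + w)) / dedekind_eta tau ^+ 9).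

Fact log_derivative_product (K : fieldType) (a b c a' b' c' e : K) :
  a != 0 -> b != 0 -> c != 0 ->
  (a' * b * c + a * b' * c - a * b * c') / e =
  (a' / a + b' / b - c' / c) * (a * b * c / e).
Proof.
move=> a0 b0 c0; rewrite [RHS]mulrA; congr (_ / _).
by field; rewrite a0 b0 c0.
Qed.

Lemma Phi_m2E (p : R[i] * 'cV[R[i]]_2) :
  let: (tau, z, w) := (p.1, p.2 0 0, p.2 1 0) in
  theta tau z != 0 -> theta tau w != 0 -> theta tau (z + w) != 0 ->
  Phi_m2 p = (dtheta tau z / theta tau z + dtheta tau w / theta tau w
              - dtheta tau (z + w) / theta tau (z + w)) * Phi_m3 p.
Proof.
rewrite /Phi_m2 /Phi_m3 /onH; case: ifP => _; last by rewrite mulr0.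
exact: log_derivative_product.
Qed.

Definition Phi_0 : form2 := fun p => -12 * serre (-2) indexA Phi_m2 p.

(* Degrees (weight, index) add under multiplication of forms. *)
Definition degree : Type := (int * 'M[int]_2)%type.
HB.instance Definition _ := GRing.Zmodule.on degree.

(* External direct sum of the spaces J^w_{k, M} over (k, M) in D: finitely
   supported families of forms. *)
Definition jacobi_dsum (D : set degree) : set (degree -> form2) :=
  [set F | finite_set [set d | F d <> (fun=> 0)] /\
    forall d, (D d -> weak_jacobi d.1 d.2 (F d)) /\
              (~ D d -> F d = (fun=> 0))].

Definition homog (d : degree) (f : form2) : degree -> form2 :=
  fun e => if e == d then f else (fun=> 0).

(* Graded multiplication: (G F)_d = sum_{e + e' = d} G_e F_e', where the sum
   over e is finite as soon as G is finitely supported. *)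
Definition gmul (G F : degree -> form2) : degree -> form2 :=
  fun d p => \sum_(e \in [set: degree]) (G e p * F (d - e) p).

Definition gadd (F G : degree -> form2) : degree -> form2 :=
  fun d p => F d p + G d p.

Definition even_degree : set degree :=
  [set d | (2 %| d.1)%Z /\ exists a b c : nat, (b <= minn a c)%N /\
           d.2 = sym2 (2 * a%:Z) (2 * b%:Z) (2 * c%:Z)].

Definition odd_degree : set degree :=
  [set d | (2 %| d.1)%Z /\ exists a b c : nat, (b < minn a c)%N /\
           d.2 = sym2 (2 * a%:Z) (2 * b%:Z + 1) (2 * c%:Z)].

End Forms.

(* Main.v *)
(* Put phi = theta / eta^3, a form of weight -1 and index 1 whose zeros are simple and fill the lattice. Up to the
   factor 2 pi i, Phi_{-2,A} and Phi_{0,A} are X = D P and Y = -2 D^3 P + (3/2) E2 X, where D^k P is the k-th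
   t-derivative at 0, in units of 2 pi i, of phi(z + t) phi(w + t) phi(z + w - t). The quadratic form
   (z + t)^2 + (w + t)^2 + (z + w - t)^2 has no cross term in t, so the transformation laws of X and Y
   come from differentiating the law of theta.

   An odd index is A z^2 + B w^2 + C (z + w)^2 with A, B, C odd and positive, and X, Y are invariant under the
   permutations of the three squares, so one may assume C <= A <= B. At w = 0 the forms X, Y become phi^2 and a form F
   with F(0) = 12, and a one-variable form of even weight and positive index is F h1 + phi^2 h2; subtracting lifts of
   h2 X and h1 Y makes f vanish at w = 0, i.e. f = phi(w) g. The form g(z, 0) has odd weight, so it vanishes
   at the 2-torsion points and is a multiple of phi(2z); since F(z) X - phi(z)^2 Y = phi(w) N with
   N(z, 0) = 6 phi(2z), one more subtraction makes f divisible by phi(w)^2. This lowers B by 2, and the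
   descent ends at (A, B, C) = (1, -1, 1), for which there are no nonzero forms. *)
From HB Require Import structures.
Require Import Defs.
From mathcomp Require Import all_boot all_order all_algebra.
From mathcomp Require Import finmap complex.
From mathcomp Require Import all_classical all_reals all_analysis.
From mathcomp Require Import ring lra zify.
From mathcomp Require summability.

Set Implicit Arguments.
Unset Strict Implicit.
Unset Printing Implicit Defensive.

Import Order.TTheory GRing.Theory Num.Theory.
Import numFieldNormedType.Exports.

Local Open Scope classical_set_scope.
Local Open Scope ring_scope.
Local Open Scope complex_scope.

(** * Unconditional sums of complex numbers *)

(** Divisibility by [phi] carries most of the work: a form that vanishes on the zeros of [phi] in a
    linear form must have a quotient that again expands in nonnegative powers of q on all of H x
    C^n. For one factor 1 - x with x a monomial, vanishing on x = 1 means that the coefficients sum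
    to zero along each orbit of exponents under x. Hence the geometric expansions of the quotient
    for |x| < 1 and for |x| > 1 have the same coefficients, and these converge everywhere. Finitely
    many factors of the product for [phi] are divided out in this way, the rest are inverted on a
    region, and the regions exhaust the domain. Averages over dyadic grids take the place of
    integrals over a period.

    The shape of Y comes from the heat equation. If D1, D2, D3 differentiate the three factors of P,
    it turns the operator m - r^T A^-1 r / 2 into (D1^2 + D2^2 + D3^2) / 2 - ((D1 + D3)^2 - (D1 +
    D3)(D2 + D3) + (D2 + D3)^2) / 3 = (D1 + D2 - D3)^2 / 6, up to E2 terms. Applied to X = D P with
    D = D1 + D2 - D3, this produces D^3 P. *)

Notation nc := ComplexField.Normc.normc.

Section ComplexNorm.
Variable R : realType.
Implicit Types (x y : R[i]) (r : R).

(** The norm on [R[i]] takes values in [R[i]]; [nc] is its real-valued version, so that estimates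
    take place in the ordered field [R]. *)
Lemma ncE x : `|x| = (nc x)%:C. Proof. by []. Qed.

Lemma nc_ge0 x : 0 <= nc x. Proof. by case: x => a b; rewrite sqrtr_ge0. Qed.

Lemma nc0 : nc (0 : R[i]) = 0. Proof. exact: Normc.normc0. Qed.
Lemma nc1 : nc (1 : R[i]) = 1. Proof. exact: Normc.normc1. Qed.

Lemma ncM x y : nc (x * y) = nc x * nc y. Proof. exact: Normc.normcM. Qed.

Lemma ncV x : nc x^-1 = (nc x)^-1. Proof. exact: Normc.normcV. Qed.

Lemma ncD x y : nc (x + y) <= nc x + nc y. Proof. exact: le_normcD. Qed.

Lemma ncN x : nc (- x) = nc x. Proof. exact: normcN. Qed.

Lemma ncB x y : nc (x - y) <= nc x + nc y.
Proof. by rewrite -(ncN y); exact: ncD. Qed.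

Lemma ncBC x y : nc (x - y) = nc (y - x).
Proof. by rewrite -opprB ncN. Qed.

Lemma ncX x n : nc (x ^+ n) = nc x ^+ n.
Proof. by elim: n => [|n IH]; rewrite ?expr0 ?nc1 // !exprS ncM IH. Qed.

Lemma nc_eq0 x : (nc x == 0) = (x == 0).
Proof. by apply/eqP/eqP => [/Normc.eq0_normc//|->]; exact: nc0. Qed.

Lemma nc_real r : nc r%:C = `|r|.
Proof. by rewrite /= expr0n /= addr0 sqrtr_sqr. Qed.

Lemma nc_gt0 x : (0 < nc x) = (x != 0).
Proof. by rewrite lt0r nc_ge0 andbT nc_eq0. Qed.

Lemma nc_nat n : nc (n%:R : R[i]) = n%:R.
Proof.
have -> : (n%:R : R[i]) = (n%:R)%:C by rewrite rmorph_nat.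
by rewrite nc_real ger0_norm.
Qed.

Lemma nc_Re x : `|complex.Re x| <= nc x.
Proof.
by case: x => a b /=; rewrite -sqrtr_sqr ler_wsqrtr // lerDl sqr_ge0.
Qed.

Lemma nc_Im x : `|complex.Im x| <= nc x.
Proof.
by case: x => a b /=; rewrite -sqrtr_sqr ler_wsqrtr // lerDr sqr_ge0.
Qed.

Lemma nc_ReIm x : nc x <= `|complex.Re x| + `|complex.Im x|.
Proof.
case: x => a b; have -> : a +i* b = a%:C + 'i%C * b%:C by simpc.
apply: le_trans (ncD _ _) _; rewrite ncM !nc_real.
have -> : nc ('i : R[i]) = 1 by rewrite /= expr0n /= add0r expr1n sqrtr1.
by rewrite mul1r; simpc.
Qed.

Lemma nc_sum (I : Type) (s : seq I) (P : pred I) (F : I -> R[i]) :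
  nc (\sum_(i <- s | P i) F i) <= \sum_(i <- s | P i) nc (F i).
Proof.
elim/big_ind2: _ => [|u a v b ua vb|//]; first by rewrite nc0.
exact: le_trans (ncD _ _) (lerD ua vb).
Qed.

Lemma nc_lip x y : nc x - nc y <= nc (x - y).
Proof. by rewrite lerBlDr; apply: le_trans (ncD _ _); rewrite subrK. Qed.

Lemma ccvgP (T : Type) (F : set_system T) (FF : Filter F) (f : T -> R[i]) (l : R[i]) :
  f @ F --> l <-> forall e : R, 0 < e -> \forall t \near F, nc (f t - l) < e.
Proof.
rewrite cvgrPdist_lt; split=> h e e0.
  have := h e%:C; rewrite ltcR => /(_ e0); apply: filterS => t.
  by rewrite ncE ltcR -opprB ncN.
have eR : e = (complex.Re e)%:C by rewrite RRe_real // gtr0_real.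
rewrite eR ltcR in e0; have := h _ e0; apply: filterS => t.
by rewrite ncE eR ltcR -opprB ncN.
Qed.

Lemma nat_ccvgP (f : nat -> R[i]) (l : R[i]) :
  f @ \oo --> l <-> forall e : R, 0 < e -> exists N, forall n, (N <= n)%N -> nc (f n - l) < e.
Proof.
split=> [/ccvgP h e /h [N _ hN]|h]; first by exists N => n; exact: hN.
by apply/ccvgP => e /h [N hN]; exists N => // n; exact: hN.
Qed.

Lemma ccvg_unique (T : Type) (F : set_system T) (FF : ProperFilter F) (f : T -> R[i]) (l m : R[i]) :
  f @ F --> l -> f @ F --> m -> l = m.
Proof. by move=> h1 h2; apply: cvg_unique h1 h2; exact: norm_hausdorff. Qed.

Lemma ccvg_lim (T : Type) (F : set_system T) (FF : ProperFilter F) (f : T -> R[i]) (l : R[i]) :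
  f @ F --> l -> lim (f @ F) = l.
Proof. by apply: cvg_lim; exact: norm_hausdorff. Qed.

End ComplexNorm.

Section Sums.
Variable R : realType.
#[local] Existing Instance summability.totally_filter.
Local Open Scope fset_scope.
Local Open Scope ring_scope.

Lemma fsum_split (V : nmodType) (I : choiceType) (A B : {fset I}) (F : I -> V) :
  A `<=` B -> \sum_(i <- B) F i = \sum_(i <- A) F i + \sum_(i <- B `\` A) F i.
Proof.
move=> AB; rewrite (big_fsetID _ (mem A)) /=; congr (_ + _).
  apply: eq_fbigl => i; rewrite !inE /= andbC.
  by case iA: (i \in A) => //=; exact: (fsubsetP AB).
by apply: eq_fbigl => i; rewrite !inE /= andbC.
Qed.

Lemma fsum_le (I : choiceType) (A B : {fset I}) (F : I -> R) :
  (forall i, 0 <= F i) -> A `<=` B -> \sum_(i <- A) F i <= \sum_(i <- B) F i.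
Proof.
by move=> F0 AB; rewrite (fsum_split F AB) lerDl sumr_ge0.
Qed.

Lemma fsum_U (V : nmodType) (I : choiceType) (A B : {fset I}) (F : I -> V) :
  [disjoint A & B] -> \sum_(i <- A `|` B) F i = \sum_(i <- A) F i + \sum_(i <- B) F i.
Proof.
move=> dAB; rewrite (@fsum_split V I A); last exact: fsubsetUl.
congr (_ + _); apply: eq_fbigl => i; rewrite !inE.
case iA: (i \in A) => //=; apply/esym/negP => iB.
by move/fdisjointP: dAB => /(_ _ iA); rewrite iB.
Qed.

Section OneFamily.
Variable I : choiceType.
Implicit Types (x y : I -> R[i]) (A B : {fset I}).

Lemma partial_sumE x A : summability.partial_sum x A = \sum_(i <- A) x i.
Proof. by rewrite /summability.partial_sum -(big_seq_fsetE _ A xpredT). Qed.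

Lemma hsP x l : has_sum x l <->
  forall e : R, 0 < e -> exists A, forall B, A `<=` B -> nc (\sum_(i <- B) x i - l) < e.
Proof.
rewrite /has_sum; split=> [/ccvgP h e /h [A _ hA]|h].
  by exists A => B AB; have := hA B AB; rewrite /= partial_sumE.
apply/ccvgP => e /h [A hA]; exists A => // B AB /=.
by rewrite partial_sumE; exact: hA.
Qed.

Lemma has_sum_unique x l m : has_sum x l -> has_sum x m -> l = m.
Proof. exact: ccvg_unique. Qed.

Lemma csumE x l : has_sum x l -> csum x = l.
Proof. exact: ccvg_lim. Qed.

(** Absolute summability. It is equivalent to unconditional summability ([bsum_has], [has_bsum]),
    and it is the side of the equivalence on which comparison arguments work. *)
Definition bsum x := exists M : R, forall A, \sum_(i <- A) nc (x i) <= M.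

Lemma real_hs_ge0 (y : I -> R) (M : R) : (forall i, 0 <= y i) ->
  (forall A, \sum_(i <- A) y i <= M) ->
  exists l, forall e : R, 0 < e -> exists A, forall B, A `<=` B -> `|\sum_(i <- B) y i - l| < e.
Proof.
move=> y0 yM; pose S := [set s | exists A, s = \sum_(i <- A) y i].
have hS : has_sup S.
  split; first by exists (\sum_(i <- fset0) y i); exists fset0.
  by exists M => _ [A ->]; exact: yM.
exists (sup S) => e e0; have [_ [A ->] hA] := sup_adherent e0 hS.
exists A => B AB; rewrite ltr_norml.
have h1 : \sum_(i <- B) y i <= sup S by apply: ub_le_sup; [exact: hS.2 | exists B].
have h2 := fsum_le y0 AB.
by apply/andP; split; lra.
Qed.

Lemma real_hs (y : I -> R) (M : R) :
  (forall A, \sum_(i <- A) `|y i| <= M) ->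
  exists l, forall e : R, 0 < e -> exists A, forall B, A `<=` B -> `|\sum_(i <- B) y i - l| < e.
Proof.
move=> yM; have [l1 h1] := real_hs_ge0 (fun i => normr_ge0 (y i)) yM.
(* [y] is the difference of the nonnegative families |y| and |y| - y. *)
have [|A|l2 h2] := @real_hs_ge0 (fun i => `|y i| - y i) (M + M).
- by move=> i; rewrite subr_ge0 ler_norm.
- rewrite sumrB; apply: lerD => //; rewrite -sumrN.
  by apply: le_trans (yM A); apply: ler_sum => i _; rewrite -normrN ler_norm.
exists (l1 - l2) => e e0; have e20 : 0 < e / 2 by lra.
have [A1 hA1] := h1 _ e20; have [A2 hA2] := h2 _ e20.
exists (A1 `|` A2) => B; rewrite fsubUset => /andP[/hA1 + /hA2].
by rewrite sumrB !ltr_norml => /andP[a1 a2] /andP[b1 b2]; apply/andP; split; lra.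
Qed.

Lemma Re_sum (J : Type) (s : seq J) (F : J -> R[i]) :
  complex.Re (\sum_(i <- s) F i) = \sum_(i <- s) complex.Re (F i).
Proof.
elim: s => [|j s IH]; rewrite ?big_nil // !big_cons -IH.
by case: (F j) => a b; case: (\sum_(i <- s) _).
Qed.

Lemma Im_sum (J : Type) (s : seq J) (F : J -> R[i]) :
  complex.Im (\sum_(i <- s) F i) = \sum_(i <- s) complex.Im (F i).
Proof.
elim: s => [|j s IH]; rewrite ?big_nil // !big_cons -IH.
by case: (F j) => a b; case: (\sum_(i <- s) _).
Qed.

Lemma bsum_has x : bsum x -> has_sum x (csum x).
Proof.
move=> [M hM].
have [A|a ha] := @real_hs (fun i => complex.Re (x i)) M.
  by apply: le_trans (hM A); apply: ler_sum => i _; exact: nc_Re.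
have [A|b hb] := @real_hs (fun i => complex.Im (x i)) M.
  by apply: le_trans (hM A); apply: ler_sum => i _; exact: nc_Im.
suff h : has_sum x (a +i* b) by rewrite (csumE h).
apply/hsP => e e0; have e20 : 0 < e / 2 by lra.
have [A1 hA1] := ha _ e20; have [A2 hA2] := hb _ e20.
exists (A1 `|` A2) => B; rewrite fsubUset => /andP[/hA1 h1 /hA2 h2].
apply: le_lt_trans (nc_ReIm _) _.
rewrite -Re_sum in h1; rewrite -Im_sum in h2.
move: h1 h2; case: (\sum_(i <- B) x i) => u v /= h1 h2.
by simpc; lra.
Qed.

(** Where [y] is nonnegative, and likewise where it is negative, the sum of absolute values is the
    absolute value of a finite sum; each part contributes one [K]. *)
Lemma abs_bound (y : I -> R) A0 (K : R) :
  (forall A, [disjoint A & A0] -> `|\sum_(i <- A) y i| <= K) ->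
  forall A, [disjoint A & A0] -> \sum_(i <- A) `|y i| <= K + K.
Proof.
move=> h A dA; rewrite (big_fsetID _ (fun i => 0 <= y i)) /=.
have sub (P : pred I) : [disjoint [fset i | i in A & P i] & A0].
  apply/fdisjointP => i; rewrite !inE /= => /andP[iA _].
  by move/fdisjointP: dA => /(_ _ iA).
apply: lerD.
  apply: le_trans (h _ (sub (fun i => 0 <= y i))).
  apply: le_trans (ler_norm _); rewrite big_seq [leRHS]big_seq.
  by apply: ler_sum => i; rewrite !inE /= => /andP[_ /ger0_norm ->].
apply: le_trans (h _ (sub (fun i => ~~ (0 <= y i)))).
rewrite -normrN; apply: le_trans (ler_norm _).
rewrite -sumrN big_seq [leRHS]big_seq.
by apply: ler_sum => i; rewrite !inE /= -ltNge => /andP[_ /ltr0_norm ->].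
Qed.

(** A finite sum off [A0] is the difference of two sums that are within 1 of [l], so it is bounded
    by 2. Then [abs_bound] gives 2 + 2 for the real and for the imaginary parts, whence the constant
    8. *)
Lemma has_bsum x l : has_sum x l -> bsum x.
Proof.
move/hsP => /(_ 1 ltr01) [A0 hA0].
have hA A : [disjoint A & A0] -> nc (\sum_(i <- A) x i) <= 2.
  move=> dA; have h1 := hA0 _ (fsubsetUr A A0); have h2 := hA0 _ (fsubset_refl A0).
  have -> : \sum_(i <- A) x i = (\sum_(i <- A `|` A0) x i - l) - (\sum_(i <- A0) x i - l).
    by rewrite fsum_U //; ring.
  by apply: le_trans (ncB _ _) _; lra.
exists (\sum_(i <- A0) nc (x i) + 8) => A.
rewrite (big_fsetID _ (mem A0)) /=; apply: lerD.
  by apply: fsum_le => [i|]; [exact: nc_ge0 | apply/fsubsetP => i; rewrite !inE => /andP[]].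
set B := [fset _ | _ in _ & _].
have dB : [disjoint B & A0] by apply/fdisjointP => i; rewrite !inE => /andP[].
have hre := @abs_bound (fun i => complex.Re (x i)) A0 2 _ _ dB.
have him := @abs_bound (fun i => complex.Im (x i)) A0 2 _ _ dB.
apply: (@le_trans _ _ (\sum_(i <- B) (`|complex.Re (x i)| + `|complex.Im (x i)|))).
  by apply: ler_sum => i _; exact: nc_ReIm.
rewrite big_split /=; apply: le_trans (lerD (hre _) (him _)) _; last by lra.
- by move=> C /hA; apply: le_trans; rewrite -Re_sum; exact: nc_Re.
- by move=> C /hA; apply: le_trans; rewrite -Im_sum; exact: nc_Im.
Qed.

Lemma eq_has_sum x y l : has_sum x l -> x =1 y -> has_sum y l.
Proof. by move=> h /funext <-. Qed.

Lemma eq_csum x y : x =1 y -> csum x = csum y.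
Proof. by move=> /funext ->. Qed.

Lemma has_sumD x y l m : has_sum x l -> has_sum y m -> has_sum (fun i => x i + y i) (l + m).
Proof.
move=> /hsP hx /hsP hy; apply/hsP => e e0; have e20 : 0 < e / 2 by lra.
have [A1 hA1] := hx _ e20; have [A2 hA2] := hy _ e20.
exists (A1 `|` A2) => B; rewrite fsubUset => /andP[/hA1 h1 /hA2 h2].
rewrite big_split /= opprD addrACA; apply: le_lt_trans (ncD _ _) _; lra.
Qed.

Lemma has_sumZ (a : R[i]) x l : has_sum x l -> has_sum (fun i => a * x i) (a * l).
Proof.
move=> /hsP hx; apply/hsP => e e0.
have a0 : 0 < nc a + 1 by rewrite ltr_wpDl ?nc_ge0.
have [A hA] := hx (e / (nc a + 1)) (divr_gt0 e0 a0).
exists A => B /hA h; rewrite -mulr_sumr -mulrBr ncM.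
apply: le_lt_trans (_ : (nc a + 1) * nc (\sum_(i <- B) x i - l) < e).
  by rewrite ler_wpM2r ?nc_ge0 // lerDl.
by rewrite mulrC -ltr_pdivlMr.
Qed.

Arguments has_sumZ a {x l} _.

Lemma has_sumN x l : has_sum x l -> has_sum (fun i => - x i) (- l).
Proof. by move=> h; rewrite -mulN1r; apply: (eq_has_sum (has_sumZ (-1) h)) => i; rewrite mulN1r. Qed.

Lemma has_sumB x y l m : has_sum x l -> has_sum y m -> has_sum (fun i => x i - y i) (l - m).
Proof. by move=> hx /has_sumN; exact: has_sumD. Qed.

Lemma has_sum0 : has_sum (fun _ : I => 0 : R[i]) 0.
Proof. by apply/hsP => e e0; exists fset0 => B _; rewrite big1_eq subr0 nc0. Qed.

Lemma bsum_le (K : R) x y : bsum y -> (forall i, nc (x i) <= K * nc (y i)) -> bsum x.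
Proof.
move=> [M hM] h; exists (Num.max 0 K * M) => A.
apply: (@le_trans _ _ (Num.max 0 K * \sum_(i <- A) nc (y i))).
  rewrite mulr_sumr; apply: ler_sum => i _; apply: le_trans (h i) _.
  by rewrite ler_wpM2r ?nc_ge0 // le_max lexx orbT.
by rewrite ler_wpM2l // le_max lexx.
Qed.

Lemma bsum_bound x (b : I -> R) M : (forall i, nc (x i) <= b i) ->
  (forall A, \sum_(i <- A) b i <= M) -> bsum x.
Proof. by move=> xb bM; exists M => A; apply: le_trans (bM A); apply: ler_sum. Qed.

Lemma nc_has_sum x l M : has_sum x l -> (forall A, \sum_(i <- A) nc (x i) <= M) -> nc l <= M.
Proof.
move=> /hsP h hM; apply/ler_addgt0Pr => e /h [A /(_ A (fsubset_refl A)) hA].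
have -> : l = \sum_(i <- A) x i - (\sum_(i <- A) x i - l) by ring.
apply: le_trans (ncB _ _) _; apply: lerD; last exact: ltW.
exact: le_trans (nc_sum _ _ _) (hM A).
Qed.

Lemma bsum_tail x (e : R) : bsum x -> 0 < e ->
  exists A0, forall A, [disjoint A & A0] -> \sum_(i <- A) nc (x i) < e.
Proof.
move=> [M hM] e0; have [l hl] := real_hs_ge0 (fun i => nc_ge0 (x i)) hM.
have e20 : 0 < e / 2 by lra.
have [A0 hA0] := hl _ e20; exists A0 => A dA.
have := hA0 _ (fsubsetUr A A0); have := hA0 _ (fsubset_refl A0).
by rewrite fsum_U // !ltr_norml => /andP[a b] /andP[c d]; lra.
Qed.

Lemma tail_dist x l (e : R) A0 : has_sum x l ->
  (forall A, [disjoint A & A0] -> \sum_(i <- A) nc (x i) < e) ->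
  forall B, A0 `<=` B -> nc (\sum_(i <- B) x i - l) <= e.
Proof.
move=> /hsP h t B A0B; apply/ler_addgt0Pr => d /h [A hA].
have /hA h1 := fsubsetUr B A.
have -> : \sum_(i <- B) x i - l = (\sum_(i <- B `|` A) x i - l) - \sum_(i <- (B `|` A) `\` B) x i.
  by rewrite (fsum_split x (fsubsetUl B A)); ring.
apply: le_trans (ncB _ _) _; rewrite addrC; apply: lerD; last exact: ltW.
apply: le_trans (nc_sum _ _ _) (ltW (t _ _)).
by apply/fdisjointP => i; rewrite !inE => /andP[iB _]; apply: contra iB => /(fsubsetP A0B).
Qed.

Lemma bsum_if x (P : pred I) : bsum x -> bsum (fun i => if P i then x i else 0).
Proof.
move=> h; apply: (bsum_le (K := 1) h) => i; rewrite mul1r; case: ifP => // _.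
by rewrite nc0 nc_ge0.
Qed.

Lemma has_sum_single (i0 : I) (a : R[i]) : has_sum (fun i => if i == i0 then a else 0) a.
Proof.
apply/hsP => e e0; exists [fset i0] => B hB.
rewrite (fsum_split _ hB) big_seq_fset1 eqxx big1_fset ?addr0 ?subrr ?nc0 //.
by move=> i; rewrite !inE => /andP[/negPf -> _].
Qed.

End OneFamily.

Arguments has_sumZ {I} a {x l} _.
Arguments has_sum_single {I} i0 a.
Arguments has_sum0 I : clear implicits.

Lemma has_sum_seq (I : choiceType) (J : Type) (s : seq J) (f : J -> I -> R[i]) (y : J -> R[i]) :
  (forall j, has_sum (f j) (y j)) -> has_sum (fun i => \sum_(j <- s) f j i) (\sum_(j <- s) y j).
Proof.
move=> h; elim: s => [|j s IH].
  by rewrite big_nil; apply: (eq_has_sum (has_sum0 _)) => i; rewrite big_nil.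
rewrite big_cons; apply: (eq_has_sum (has_sumD (h j) IH)) => i.
by rewrite big_cons.
Qed.

Arguments has_sum_seq {I J} s {f y} _.

(** Summation by packets, the packets being the fibres of [g]. Off a finite set [A0] the absolute
    sums are small, and as soon as [B] contains the image of [A0] the packets over [B] miss only
    terms off [A0]. *)
Lemma has_sum_group (I J : choiceType) (g : I -> J) (x : I -> R[i]) (y : J -> R[i]) l :
  has_sum x l -> (forall j, has_sum (fun i => if g i == j then x i else 0) (y j)) ->
  has_sum y l.
Proof.
move=> hx hy; apply/hsP => e e0; have e20 : 0 < e / 2 by lra.
have [A0 hA0] := bsum_tail (has_bsum hx) e20.
exists (g @` A0)%fset => B hB.
have hB1 : has_sum (fun i => if g i \in B then x i else 0) (\sum_(j <- B) y j).
  apply: (eq_has_sum (has_sum_seq B hy)) => i; case: ifP => iB.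
    rewrite (big_fsetD1 (g i)) //= eqxx big1_fset ?addr0 // => j.
    by rewrite !inE => /andP[/negPf]; rewrite eq_sym => ->.
  by apply: big1_fset => j jB _; case: eqP => // gij; rewrite gij jB in iB.
have := has_sumB hx hB1; rewrite ncBC => /nc_has_sum h.
apply: le_lt_trans (h (e / 2) _) _ => [A|]; last by lra.
apply: le_trans (ltW (hA0 (A `\` A0)%fset _)); last first.
  by apply/fdisjointP => i; rewrite !inE => /andP[].
rewrite (big_fsetID _ (mem A0)) /= big1_fset ?add0r.
  rewrite -[leRHS](_ : \sum_(i <- [fset i | i in A & i \notin A0]) nc (x i) = _)%fset.
    by apply: ler_sum => i _; case: ifP => _; rewrite ?subr0 // subrr nc0 nc_ge0.
  by apply: eq_fbigl => i; rewrite !inE andbC.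
move=> i; rewrite !inE => /andP[_ iA0] _.
by rewrite (fsubsetP hB) ?subrr ?nc0 //; apply/imfsetP; exists i.
Qed.

Lemma bsum_group (I J : choiceType) (g : I -> J) (x : I -> R[i]) : bsum x ->
  has_sum (fun j => csum (fun i => if g i == j then x i else 0)) (csum x).
Proof.
move=> hx; apply: has_sum_group (bsum_has hx) _ => j.
exact: bsum_has (bsum_if _ hx).
Qed.

Lemma has_sum_inj (I J : choiceType) (h : J -> I) (x : I -> R[i]) l : injective h ->
  (forall i, (forall j, h j != i) -> x i = 0) -> has_sum (fun j => x (h j)) l -> has_sum x l.
Proof.
move=> hi hx hl; apply: (has_sum_group (g := h) hl) => i.
have [[j hj]|nj] := pselect (exists j, h j = i).
  rewrite -hj; apply: (eq_has_sum (has_sum_single j (x (h j)))) => j' /=.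
  by rewrite (inj_eq hi); case: eqP => // ->.
rewrite hx; last by move=> j; apply/eqP => hj; apply: nj; exists j.
apply: (eq_has_sum (has_sum0 _)) => j; case: eqP => // hj.
by case: nj; exists j.
Qed.

Lemma bsum_inj (I J : choiceType) (h : J -> I) (x : I -> R[i]) : injective h ->
  bsum x -> bsum (fun j => x (h j)).
Proof.
move=> hi [M hM]; exists M => A; apply: le_trans (hM (h @` A)%fset).
by rewrite big_imfset //= => a b _ _; exact: hi.
Qed.

Lemma has_sum_inj_rev (I J : choiceType) (h : J -> I) (x : I -> R[i]) l : injective h ->
  (forall i, (forall j, h j != i) -> x i = 0) -> has_sum x l -> has_sum (fun j => x (h j)) l.
Proof.
move=> hi hx hl; have h1 := bsum_has (bsum_inj hi (has_bsum hl)).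
by rewrite (has_sum_unique hl (has_sum_inj hi hx h1)).
Qed.

(** A finite set of pairs lies in the product of its projections, which bounds the absolute sums;
    the value then follows by grouping along the first coordinate. *)
Lemma has_sumM (I J : choiceType) (x : I -> R[i]) (y : J -> R[i]) l m :
  has_sum x l -> has_sum y m -> has_sum (fun p : I * J => x p.1 * y p.2) (l * m).
Proof.
move=> hx hy; have [Mx hMx] := has_bsum hx; have [My hMy] := has_bsum hy.
have Mx0 : 0 <= Mx by have := hMx fset0; rewrite big_nil.
have bxy : bsum (fun p : I * J => x p.1 * y p.2).
  exists (Mx * My) => A.
  pose A1 := (fst @` A)%fset; pose A2 := (snd @` A)%fset.
  apply: (@le_trans _ _ (\sum_(p <- (A1 `*` A2)%fset) nc (x p.1 * y p.2))).
    apply: fsum_le => [p|]; first exact: nc_ge0.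
    apply/fsubsetP => p pA; rewrite in_fsetM; apply/andP; split; apply/imfsetP; by exists p.
  have -> : \sum_(p <- (A1 `*` A2)%fset) nc (x p.1 * y p.2)
     = (\sum_(i <- A1) nc (x i)) * (\sum_(j <- A2) nc (y j)).
    rewrite mulr_suml [LHS](big_imfset2 _ _) /=; last first.
      by move=> [a b] [c d] _ _ [-> ->].
    by apply: eq_bigr => i _; rewrite mulr_sumr; apply: eq_bigr => j _; rewrite ncM.
  apply: ler_pM => //; apply: sumr_ge0 => *; exact: nc_ge0.
have h := bsum_has bxy.
suff -> : l * m = csum (fun p : I * J => x p.1 * y p.2) by [].
suff h2 : has_sum (fun i => x i * m) (csum (fun p : I * J => x p.1 * y p.2)).
  apply: has_sum_unique h2; rewrite mulrC.
  by apply: (eq_has_sum (has_sumZ m hx)) => i; rewrite mulrC.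
apply: (has_sum_group (g := fst) h) => i.
apply: (@has_sum_inj _ _ (fun j => (i, j))).
- by move=> j j' [].
- by move=> [i' j] /= hij; case: eqP => // ii; have := hij j; rewrite ii eqxx.
- by rewrite /= eqxx; exact: has_sumZ.
Qed.

(** Dominated convergence for sums. Off a finite set both tails are bounded by the tail of [b], and
    on the finite set the convergence is termwise. *)
Lemma tannery (I : choiceType) (x_ : nat -> I -> R[i]) (x : I -> R[i]) (b : I -> R) (M : R) :
  (forall A : {fset I}, \sum_(i <- A) b i <= M) ->
  (forall n i, nc (x_ n i) <= b i) -> (forall i, x_ ^~ i @ \oo --> x i) ->
  bsum x /\ (fun n => csum (x_ n)) @ \oo --> csum x.
Proof.
move=> bM xb cx.
have b0 i : 0 <= b i by exact: le_trans (nc_ge0 _) (xb 0%N i).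
have xb' i : nc (x i) <= b i.
  apply/ler_addgt0Pr => e e0; have /nat_ccvgP /(_ e e0) [N /(_ N (leqnn N)) hN] := cx i.
  have -> : x i = x_ N i - (x_ N i - x i) by ring.
  by apply: le_trans (ncB _ _) _; apply: lerD; [exact: xb | exact: ltW].
have bx : bsum x := bsum_bound xb' bM.
split=> //; apply/nat_ccvgP => e e0; have e80 : 0 < e / 8 by lra.
have bb : bsum (fun i => (b i)%:C : R[i]).
  by apply: (bsum_bound _ bM) => i; rewrite nc_real ger0_norm.
have [A0 hA0] := bsum_tail bb e80.
have t (y : I -> R[i]) : (forall i, nc (y i) <= b i) -> nc (\sum_(i <- A0) y i - csum y) <= e / 8.
  move=> yb; apply: (tail_dist (A0 := A0)) => [||]; last exact: fsubset_refl.
    exact: bsum_has (bsum_bound yb bM).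
  move=> A /hA0; apply: le_lt_trans; apply: ler_sum => i _.
  by rewrite nc_real ger0_norm.
have [N hN] : exists N, forall n, (N <= n)%N ->
    nc (\sum_(i <- A0) x_ n i - \sum_(i <- A0) x i) < e / 8.
  have : (fun n => \sum_(i <- A0) x_ n i) @ \oo --> \sum_(i <- A0) x i.
    by apply: cvg_big => [|i _]; [exact: add_continuous | exact: cx].
  by move/nat_ccvgP => /(_ _ e80).
exists N => n /hN h; have h1 := t _ (xb n); have h2 := t _ xb'.
have -> : csum (x_ n) - csum x = - (\sum_(i <- A0) x_ n i - csum (x_ n))
   + (\sum_(i <- A0) x_ n i - \sum_(i <- A0) x i) + (\sum_(i <- A0) x i - csum x) by ring.
apply: le_lt_trans (ncD _ _) _; apply: le_lt_trans (lerD (ncD _ _) (lexx _)) _.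
by rewrite ncN; lra.
Qed.

Lemma fset_nat_bound (A : {fset nat}) : exists n, forall m, (n <= m)%N ->
  forall V : nmodType, forall F : nat -> V,
  exists B : {fset nat}, A `<=` B /\ \sum_(i < m) F i = \sum_(i <- B) F i.
Proof.
exists (\max_(i <- A) i).+1 => m hm V F; exists [fset i in iota 0 m]; split.
  apply/fsubsetP => i iA; rewrite inE /= mem_iota leq0n add0n.
  by apply: leq_trans hm; rewrite ltnS; exact: (leq_bigmax_seq (F := id)).
rewrite -(big_mkord xpredT F); apply: perm_big; apply: uniq_perm.
- by rewrite iota_uniq.
- exact: fset_uniq.
- by move=> i; rewrite inE /= /index_iota subn0.
Qed.

Lemma bsum_nat (x : nat -> R[i]) (M : R) :
  (forall n, \sum_(i < n) nc (x i) <= M) -> bsum x.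
Proof.
move=> h; exists M => A; have [n hn] := fset_nat_bound A.
have [B [AB eB]] := hn n (leqnn n) R (fun i => nc (x i)).
apply: le_trans (h n); rewrite eB; apply: fsum_le => // i; exact: nc_ge0.
Qed.

Lemma has_sum_series (x : nat -> R[i]) l : has_sum x l ->
  (fun n => \sum_(i < n) x i) @ \oo --> l.
Proof.
move=> /hsP h; apply/nat_ccvgP => e /h [A hA].
have [n hn] := fset_nat_bound A; exists n => m nm.
by have [B [AB ->]] := hn m nm _ x; exact: hA.
Qed.

End Sums.

Arguments has_sumZ {R I} a {x l} _.
Arguments has_sum_single {R I} i0 a.
Arguments has_sum0 R I : clear implicits.
Arguments has_sum_seq {R I J} s {f y} _.

(** * The exponential and its Taylor remainder *)

Section Exponential.
Variable R : realType.
Implicit Types (x y z u : R[i]).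

Definition twopii : R[i] := (2 * pi)*i.

Lemma Re_twopiiM z : complex.Re (twopii * z) = - (2 * pi * complex.Im z).
Proof. by case: z => a b; rewrite /twopii; simpc. Qed.

Lemma twopii_neq0 : twopii != 0.
Proof. by rewrite eq_complex /= eqxx /= mulf_neq0 // gt_eqF ?pi_gt0. Qed.

Lemma nc_twopii : nc twopii = 2 * pi.
Proof. by rewrite /twopii /= expr0n /= add0r sqrtr_sqr ger0_norm // mulr_ge0 // pi_ge0. Qed.

Lemma expiD x y : expi (x + y) = expi x * expi y.
Proof.
rewrite /expi -/twopii mulrDr.
move: (twopii * x) (twopii * y) => [a b] [c d] /=.
rewrite expRD cosD sinD; apply/eqP; rewrite eq_complex /=; apply/andP; split; apply/eqP; ring.
Qed.

Lemma expi0 : expi (0 : R[i]) = 1.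
Proof. by rewrite /expi mulr0 /= expR0 cos0 sin0 mul1r. Qed.

Lemma expi_neq0 x : expi x != 0.
Proof.
have : expi x * expi (- x) != 0 by rewrite -expiD subrr expi0 oner_neq0.
by apply: contraNneq => ->; rewrite mul0r.
Qed.

Lemma expiN x : expi (- x) = (expi x)^-1.
Proof.
by apply: (mulfI (expi_neq0 x)); rewrite -expiD subrr expi0 mulfV // expi_neq0.
Qed.

Lemma expiB x y : expi (x - y) = expi x / expi y.
Proof. by rewrite expiD expiN. Qed.

Lemma expiMn n x : expi (n%:R * x) = expi x ^+ n.
Proof.
elim: n => [|n IH]; first by rewrite mul0r expi0 expr0.
by rewrite -natr1 mulrDl mul1r expiD IH exprSr.
Qed.

Lemma expiMz (m : int) x : expi (m%:~R * x) = expi x ^ m.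
Proof.
case: m => n; first by rewrite -pmulrn expiMn.
by rewrite NegzE mulrNz mulNr expiN -pmulrn expiMn.
Qed.

Lemma expi1 : expi (1 : R[i]) = 1.
Proof.
by rewrite /expi mulr1 /= expR0 mul1r mulr_natl cos2pi sin2pi.
Qed.

Lemma expi_int (m : int) : expi (m%:~R : R[i]) = 1.
Proof. by rewrite -[m%:~R]mulr1 expiMz expi1 exp1rz. Qed.

Lemma expi_half : expi (2^-1 : R[i]) = -1.
Proof.
have -> : (2^-1 : R[i]) = (2^-1)%:C by rewrite fmorphV rmorph_nat.
have -> : expi (2^-1)%:C = (expR 0)%:C * (cos pi +i* sin pi) :> R[i].
  rewrite /expi; have -> : (2 * pi)*i * (2^-1)%:C = (pi : R)*i.
    by apply/eqP; rewrite eq_complex /=; apply/andP; split; apply/eqP; field.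
  by [].
by rewrite expR0 cospi sinpi mul1r; apply/eqP; rewrite eq_complex /= oppr0 !eqxx.
Qed.

Lemma expi_halfz (m : int) : expi (m%:~R / 2 : R[i]) = (-1) ^ m.
Proof. by rewrite expiMz expi_half. Qed.

Lemma nc_expi z : nc (expi z) = expR (- (2 * pi * complex.Im z)).
Proof.
rewrite /expi -/twopii ncM nc_real ger0_norm ?expR_ge0 // Re_twopiiM /=.
by rewrite cos2Dsin2 sqrtr1 mulr1.
Qed.

Lemma expi_im (y : R) : expi ('i * y%:C) = (expR (- (2 * pi * y)))%:C.
Proof.
rewrite /expi -/twopii; have -> : twopii * ('i * y%:C) = (- (2 * pi * y))%:C.
  by rewrite /twopii; apply/eqP; rewrite eq_complex /=; apply/andP; split; apply/eqP; ring.
by rewrite /= cos0 sin0 mulr1.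
Qed.

Lemma Re_expi_real (r : R) : complex.Re (expi r%:C) = cos (2 * pi * r).
Proof.
rewrite /expi -/twopii; have -> : twopii * r%:C = (2 * pi * r)*i.
  by rewrite /twopii; simpc.
by rewrite /= expR0 mul1r mul0r subr0.
Qed.

Lemma nc_expi_real (r : R) : nc (expi r%:C) = 1.
Proof. by rewrite nc_expi /= mulr0 oppr0 expR0. Qed.

Lemma expR_sub1_le (a : R) : `|expR a - 1| <= `|a| * expR `|a|.
Proof.
have h := expR_ge1Dx a; have := expR_ge1Dx (- a); rewrite expRN => h2.
have e0 := expR_gt0 a.
have h3 : expR a - 1 <= a * expR a.
  have := ler_wpM2r (ltW e0) h2.
  by rewrite mulVf ?gt_eqF //; lra.
have [a0|a0] := leP 0 a.
  by rewrite (ger0_norm a0) ger0_norm //; lra.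
rewrite (ltr0_norm a0) ltr0_norm; last by rewrite subr_lt0 expR_lt1.
have : - a * 1 <= - a * expR (- a).
  by apply: ler_wpM2l; [rewrite oppr_ge0 ltW | rewrite -[leLHS]expR0 ler_expR oppr_ge0 ltW].
lra.
Qed.

Lemma expR_taylor1 (a : R) : `|expR a - 1 - a| <= a ^+ 2 * expR `|a|.
Proof.
have h := expR_ge1Dx a; have := expR_ge1Dx (- a); rewrite expRN => h2.
have e0 := expR_gt0 a.
have h3 : expR a - 1 <= a * expR a.
  have := ler_wpM2r (ltW e0) h2.
  by rewrite mulVf ?gt_eqF //; lra.
rewrite ger0_norm; last by lra.
apply: (@le_trans _ _ (`|a| * `|expR a - 1|)).
  by apply: (@le_trans _ _ (a * (expR a - 1))); [lra | rewrite -normrM ler_norm].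
rewrite -real_normK ?num_real // expr2 -mulrA.
by rewrite ler_wpM2l //; exact: expR_sub1_le.
Qed.

Lemma sin_le_norm (b : R) : `|sin b| <= `|b|.
Proof.
wlog b0 : b / 0 <= b.
  move=> h; have [/h//|b0] := leP 0 b.
  by rewrite -(normrN b) -(normrN (sin b)) -sinN; apply: h; rewrite oppr_ge0 ltW.
have [c _] := @MVT_segment R sin cos 0 b b0 (fun (t : R) _ => is_derive_sin t)
  (continuous_subspaceT (@continuous_sin R)).
rewrite sin0 !subr0 => ->; rewrite normrM.
by rewrite ler_piMl ?normr_ge0 // cos_max.
Qed.

Lemma cos_sub1_le (b : R) : `|cos b - 1| <= b ^+ 2.
Proof.
have -> : b = (b / 2) *+ 2 by rewrite -mulr_natr divfK.
rewrite cos_mulr2n cos2sin2.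
have -> : (1 - sin (b / 2) ^+ 2) *+ 2 - 1 - 1 = - (2 * sin (b / 2) ^+ 2) by ring.
rewrite normrN normrM normrX (ger0_norm (ler0n _ 2)).
have := sin_le_norm (b / 2); rewrite -(@ler_pXn2r _ 2) ?nnegrE //.
rewrite [X in _ <= X]real_normK ?num_real // -mulr_natr exprMn => h.
by have := sqr_ge0 (b / 2); lra.
Qed.

Lemma sin_subx_le (b : R) : `|sin b - b| <= 2 * b ^+ 2.
Proof.
wlog b0 : b / 0 <= b.
  move=> h; have [/h//|b0] := leP 0 b.
  have := h (- b); rewrite oppr_ge0 sinN sqrrN -opprD normrN; apply; exact: ltW.
have [b1|b1] := leP 1 b.
  apply: le_trans (ler_normB _ _) _; have := sin_le_norm b.
  by rewrite (ger0_norm b0) => h; nra.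
have der (x : R) : x \in `]0, b[ -> is_derive x 1 (sin - id) (cos x - 1).
  by move=> _; apply: is_deriveB.
have [c] := @MVT_segment R (sin - id) (fun t : R => cos t - 1) 0 b b0 der
  (continuous_subspaceT (fun t : R => cvgB (@continuous_sin R t) cvg_id)).
rewrite in_itv /= => /andP[c0 cb] heq.
have -> : sin b - b = (cos c - 1) * (b - 0) by rewrite -heq !fctE sin0 /=; ring.
rewrite subr0 normrM (ger0_norm b0).
have h := cos_sub1_le c.
have : `|cos c - 1| * b <= c ^+ 2 * b by rewrite ler_wpM2r.
by nra.
Qed.

(** The remainder is quadratic with an explicit exponential growth in |u|, valid for all u. It is
    later applied to every monomial of a Fourier series at once, with u unbounded along the
    series. *)
Lemma expi_taylor1 u :
  nc (expi u - 1 - twopii * u) <= 4 * (2 * pi * nc u) ^+ 2 * expR (2 * pi * nc u).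
Proof.
rewrite -nc_twopii -ncM /expi -/twopii; move: (twopii * u) => w {u}.
have [hr hi] := (nc_Re w, nc_Im w).
have sq : nc w ^+ 2 = complex.Re w ^+ 2 + complex.Im w ^+ 2.
  by case: w {hr hi} => a b /=; rewrite sqr_sqrtr // addr_ge0 // sqr_ge0.
have n0 := nc_ge0 w.
move: (nc w) hr hi sq n0 => n; case: w => a b; rewrite [complex.Re _]/= [complex.Im _]/= => hr hi sq n0.
apply: le_trans (nc_ReIm _) _; rewrite /=.
have e1 : expR `|a| <= expR n by rewrite ler_expR.
have e2 : 1 <= expR n by rewrite -[leLHS]expR0 ler_expR.
have ea : expR a <= expR n by rewrite ler_expR; apply: le_trans hr; exact: ler_norm.
have ea0 := expR_gt0 a.
have h1 : `|expR a * cos b - 1 - a| <= (a ^+ 2 + b ^+ 2) * expR n.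
  have -> : expR a * cos b - 1 - a = (expR a - 1 - a) + expR a * (cos b - 1) by ring.
  apply: le_trans (ler_normD _ _) _; rewrite mulrDl; apply: lerD.
    by apply: le_trans (expR_taylor1 a) _; rewrite ler_wpM2l ?sqr_ge0.
  rewrite normrM (ger0_norm (expR_ge0 a)) [leRHS]mulrC.
  by apply: ler_pM => //; exact: cos_sub1_le.
have h2 : `|expR a * sin b - b| <= (`|a| * `|b| + 2 * b ^+ 2) * expR n.
  have -> : expR a * sin b - b = (expR a - 1) * sin b + (sin b - b) by ring.
  apply: le_trans (ler_normD _ _) _; rewrite [leRHS]mulrDl; apply: lerD.
    rewrite normrM mulrAC; apply: ler_pM => //; last exact: sin_le_norm.
    by apply: le_trans (expR_sub1_le a) _; rewrite ler_wpM2l.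
  apply: le_trans (sin_subx_le b) _; rewrite ler_peMr //.
  by rewrite mulr_ge0 // sqr_ge0.
have -> : expR a * cos b - 0 * sin b - 1 - a = expR a * cos b - 1 - a by ring.
have -> : expR a * sin b + 0 * cos b - 0 - b = expR a * sin b - b by ring.
apply: le_trans (lerD h1 h2) _; rewrite -mulrDl ler_wpM2r ?expR_ge0 //.
have a0 := normr_ge0 a; have b0 := normr_ge0 b.
have : `|a| ^+ 2 = a ^+ 2 by rewrite real_normK ?num_real.
have : `|b| ^+ 2 = b ^+ 2 by rewrite real_normK ?num_real.
by nra.
Qed.

End Exponential.

Global Opaque expi.

(** * Fourier series on H x C^n *)

HB.lock Definition mono (R : realType) (n : nat) (p : R[i] * 'cV[R[i]]_n) (i : nat * 'cV[int]_n) : R[i] :=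
  fmono p i.1 i.2.

Section FourierSeries.
Variable R : realType.

Section Basic.
Variable n : nat.
Local Notation pt := (R[i] * 'cV[R[i]]_n)%type.
Local Notation idx := (nat * 'cV[int]_n)%type.
Implicit Types (p h : pt) (f g : pt -> R[i]) (c d : idx -> R[i]).

Definition upper : set pt := [set p | 0 < complex.Im p.1].

Definition lin (p : pt) (i : idx) : R[i] := i.1%:R * p.1 + ((freq R i.2)^T *m p.2) 0 0.

Lemma monoE p i : mono p i = expi (lin p i). Proof. by rewrite mono.unlock. Qed.

Lemma freq_dot (s : 'cV[int]_n) (z : 'cV[R[i]]_n) :
  ((freq R s)^T *m z) 0 0 = \sum_k (s k 0)%:~R / 2 * z k 0.
Proof. by rewrite mxE; apply: eq_bigr => k _; rewrite !mxE [_ / 2]mulrC. Qed.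

Lemma linE p i : lin p i = i.1%:R * p.1 + \sum_k (i.2 k 0)%:~R / 2 * p.2 k 0.
Proof. by rewrite /lin freq_dot. Qed.

Lemma linDl p h i : lin (p + h) i = lin p i + lin h i.
Proof. by rewrite /lin /= mulmxDr mxE; ring. Qed.

Lemma linZl (a : R[i]) p i : lin (a * p.1, a *: p.2) i = a * lin p i.
Proof. by rewrite /lin /= -scalemxAr mxE; ring. Qed.

Lemma monoD p h i : mono (p + h) i = mono p i * mono h i.
Proof. by rewrite !monoE linDl expiD. Qed.

Lemma mono_neq0 p i : mono p i != 0.
Proof. by rewrite monoE; exact: expi_neq0. Qed.

Definition idxD (i j : idx) : idx := ((i.1 + j.1)%N, i.2 + j.2).

Lemma mono_idxD p (i j : idx) : mono p (idxD i j) = mono p i * mono p j.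
Proof.
rewrite !monoE -expiD !linE; congr expi.
rewrite addrACA -big_split; congr (_ + _); first by rewrite natrD mulrDl.
by apply: eq_bigr => k _; rewrite mxE intrD mulrDl mulrDl.
Qed.

Lemma Im_real_mul (r : R) (z : R[i]) : complex.Im (r%:C * z) = r * complex.Im z.
Proof. by case: z => a b /=; rewrite mul0r addr0. Qed.

Lemma Im_lin p i : complex.Im (lin p i) =
  i.1%:R * complex.Im p.1 + \sum_k (i.2 k 0)%:~R / 2 * complex.Im (p.2 k 0).
Proof.
have ImD (x y : R[i]) : complex.Im (x + y) = complex.Im x + complex.Im y by case: x y => ? ? [].
rewrite linE ImD Im_sum; congr (_ + _).
  by rewrite -(rmorph_nat (real_complex R)) Im_real_mul.
apply: eq_bigr => k _.
have -> : ((i.2 k 0)%:~R / 2 : R[i]) = ((i.2 k 0)%:~R / 2)%:C.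
  by rewrite rmorphM fmorphV rmorph_nat rmorph_int.
by rewrite Im_real_mul.
Qed.

Lemma nc_mono p i : nc (mono p i) =
  expR (- (2 * pi * (i.1%:R * complex.Im p.1)) - pi * \sum_k (i.2 k 0)%:~R * complex.Im (p.2 k 0)).
Proof.
rewrite monoE nc_expi Im_lin; congr expR.
rewrite mulrDr opprD; congr (_ + _); congr (- _).
by rewrite !mulr_sumr; apply: eq_bigr => k _; field.
Qed.

(** Each coordinate is replaced by i times its imaginary part. Monomials at [imp p] are the moduli
    of the monomials at [p], so a series with nonnegative coefficients attains its absolute sum at
    [imp p]. *)
Definition imp p : pt := ('i * (complex.Im p.1)%:C, 'i *: \col_k (complex.Im (p.2 k 0))%:C).

Lemma mono_imp p i : mono (imp p) i = (nc (mono p i))%:C.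
Proof.
rewrite !monoE nc_expi -expi_im; congr expi.
rewrite (linZl 'i ((complex.Im p.1)%:C, \col_k (complex.Im (p.2 k 0))%:C)); congr (_ * _).
rewrite Im_lin linE rmorphD rmorphM rmorph_nat rmorph_sum; congr (_ + _).
by apply: eq_bigr => k _; rewrite mxE [RHS]rmorphM fmorph_div rmorph_nat rmorph_int.
Qed.

Definition absconv (U : set pt) c := forall p, U p -> bsum (fun i => c i * mono p i).

Definition fexp (U : set pt) f c := forall p, U p -> has_sum (fun i => c i * mono p i) (f p).

Lemma fexp_conv U f c : fexp U f c -> absconv U c.
Proof. by move=> h p /h /has_bsum. Qed.

Lemma conv_fexp U c : absconv U c -> fexp U (fun p => csum (fun i => c i * mono p i)) c.
Proof. by move=> h p /h /bsum_has. Qed.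

Lemma fexp_eq U f g c : fexp U f c -> (forall p, U p -> f p = g p) -> fexp U g c.
Proof. by move=> h e p Up; rewrite -e //; exact: h. Qed.

Lemma fexpD U f g c d : fexp U f c -> fexp U g d -> fexp U (fun p => f p + g p) (fun i => c i + d i).
Proof.
move=> hf hg p Up; apply: (eq_has_sum (has_sumD (hf _ Up) (hg _ Up))) => i.
by rewrite mulrDl.
Qed.

Lemma fexpZ U (a : R[i]) f c : fexp U f c -> fexp U (fun p => a * f p) (fun i => a * c i).
Proof. by move=> hf p Up; apply: (eq_has_sum (has_sumZ a (hf _ Up))) => i; rewrite mulrA. Qed.

Arguments fexpZ {U} a {f c} _.

Section Generalized.
Variables (I : choiceType) (e : I -> idx).

(** Products, pullbacks and geometric expansions give families in which an exponent occurs many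
    times, even infinitely often; this collects all terms of exponent [j]. *)
Definition gcoef (c : I -> R[i]) : idx -> R[i] := fun j => csum (fun i => if e i == j then c i else 0).

(** The expansion of [f] is there to make the collected coefficients converge: on a fibre of [e] the
    monomial is a nonzero constant and can be divided out. The weight depends on the exponent only,
    so it passes through the grouping. *)
Lemma gexp_weight U f (c : I -> R[i]) (w : idx -> R[i]) (wf : pt -> R[i]) :
  (forall p, U p -> has_sum (fun i => c i * mono p (e i)) (f p)) ->
  (forall p, U p -> has_sum (fun i => w (e i) * c i * mono p (e i)) (wf p)) ->
  fexp U wf (fun j => w j * gcoef c j).
Proof.
move=> h hw p Up; apply: (has_sum_group (g := e) (hw _ Up)) => j.
have hb : bsum (fun i => if e i == j then c i else 0).
  apply: (bsum_le (K := (nc (mono p j))^-1) (has_bsum (h _ Up))) => i.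
  case: eqP => [<-|_]; last by rewrite nc0 mulr_ge0 ?invr_ge0 ?nc_ge0.
  by rewrite ncM mulrCA mulVf ?mulr1 // nc_eq0 mono_neq0.
have := has_sumZ (w j * mono p j) (bsum_has hb); rewrite mulrAC => h1.
by apply: (eq_has_sum h1) => i; case: eqP => [->|_]; rewrite ?mulr0 // mulrAC.
Qed.

Lemma gexp U f (c : I -> R[i]) :
  (forall p, U p -> has_sum (fun i => c i * mono p (e i)) (f p)) -> fexp U f (gcoef c).
Proof.
move=> h; have := @gexp_weight U f c (fun=> 1) f h.
rewrite (_ : (fun j => 1 * gcoef c j) = gcoef c); last by apply/funext => j; rewrite mul1r.
apply=> p Up; apply: (eq_has_sum (h _ Up)) => i; by rewrite mul1r.
Qed.

End Generalized.

Definition mulcoef c d : idx -> R[i] :=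
  gcoef (fun ij : idx * idx => (idxD ij.1 ij.2)) (fun ij => c ij.1 * d ij.2).

Lemma fexpM_gen U f g c d : fexp U f c -> fexp U g d ->
  forall p, U p -> has_sum (fun ij : idx * idx => c ij.1 * d ij.2 *
     mono p (idxD ij.1 ij.2)) (f p * g p).
Proof.
move=> hf hg p Up; apply: (eq_has_sum (has_sumM (hf _ Up) (hg _ Up))) => ij.
by rewrite mono_idxD mulrACA.
Qed.

Lemma fexpM U f g c d : fexp U f c -> fexp U g d -> fexp U (fun p => f p * g p) (mulcoef c d).
Proof. by move=> hf hg; apply: gexp; exact: fexpM_gen. Qed.

Definition wq : idx -> R[i] := fun i => i.1%:R.
Definition wz (k : 'I_n) : idx -> R[i] := fun i => (i.2 k 0)%:~R / 2.

Definition additive_weight (w : idx -> R[i]) := forall i j : idx,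
  w (idxD i j) = w i + w j.

Lemma additive_wq : additive_weight wq.
Proof. by move=> i j; rewrite /wq natrD. Qed.

Lemma additive_wz k : additive_weight (wz k).
Proof. by move=> i j; rewrite /wz /= mxE intrD mulrDl. Qed.

(* For [wq] this is q d/dq, for [wz k] it is (2 pi i)^-1 d/dz_k. *)
Definition isD U (w : idx -> R[i]) f g := exists c, fexp U f c /\ fexp U g (fun i => w i * c i).

Lemma isDD U w f g f' g' : isD U w f f' -> isD U w g g' -> isD U w (fun p => f p + g p) (fun p => f' p + g' p).
Proof.
move=> [c [h1 h2]] [d [h3 h4]]; exists (fun i => c i + d i); split; first exact: fexpD.
have := fexpD h2 h4; rewrite (_ : (fun i => w i * c i + w i * d i) = fun i => w i * (c i + d i)) //.
by apply/funext => i; rewrite mulrDr.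
Qed.

Lemma isDZ U w a f f' : isD U w f f' -> isD U w (fun p => a * f p) (fun p => a * f' p).
Proof.
move=> [c [h1 h2]]; exists (fun i => a * c i); split; first exact: fexpZ.
have := fexpZ a h2; rewrite (_ : (fun i => a * (w i * c i)) = fun i => w i * (a * c i)) //.
by apply/funext => i; rewrite mulrCA.
Qed.

Lemma isDM U w f g f' g' : additive_weight w -> isD U w f f' -> isD U w g g' ->
  isD U w (fun p => f p * g p) (fun p => f' p * g p + f p * g' p).
Proof.
move=> aw [c [h1 h2]] [d [h3 h4]]; exists (mulcoef c d); split; first exact: fexpM.
apply: gexp_weight (fexpM_gen h1 h3) _ => p Up.
have hs := has_sumD (fexpM_gen h2 h3 Up) (fexpM_gen h1 h4 Up).
by apply: (eq_has_sum hs) => ij; rewrite aw; ring.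
Qed.

Definition nrm1 p : R := nc p.1 + \sum_k nc (p.2 k 0).

Definition absS (s : 'cV[int]_n) : R := \sum_k `|(s k 0)%:~R|.

Lemma absS_ge0 s : 0 <= absS s. Proof. exact: sumr_ge0. Qed.

Lemma nc_int (m : int) : nc (m%:~R : R[i]) = `|m%:~R|.
Proof. by rewrite -(rmorph_int (real_complex R)) nc_real. Qed.

Lemma nc_lin_le h i : nc (lin h i) <= (i.1%:R + absS i.2 / 2) * nrm1 h.
Proof.
rewrite linE; apply: le_trans (ncD _ _) _; rewrite ncM nc_nat.
have h0 : 0 <= \sum_k nc (h.2 k 0) by apply: sumr_ge0 => *; exact: nc_ge0.
have h1 := nc_ge0 h.1; have a0 := absS_ge0 i.2; have m0 := ler0n R i.1.
apply: (@le_trans _ _ (i.1%:R * nc h.1 + absS i.2 / 2 * nrm1 h)); last first.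
  by rewrite mulrDl lerD2r ler_wpM2l // lerDl.
rewrite lerD2l; apply: le_trans (nc_sum _ _ _) _.
rewrite /absS !mulr_suml; apply: ler_sum => k _.
rewrite !ncM ncV nc_nat nc_int ler_wpM2l ?divr_ge0 //.
rewrite /nrm1 (bigD1 k) //= addrA addrAC lerDr addr_ge0 //.
by apply: sumr_ge0 => *; exact: nc_ge0.
Qed.

(** Translating z_k by an imaginary amount multiplies the monomial by a real exponential of its
    frequency. Convergence at every z therefore already contains exponential decay in the
    frequency. *)
Lemma conv_shift c (k : 'I_n) (t : R) p : absconv upper c -> upper p ->
  bsum (fun i : idx => (expR (t * (i.2 k 0)%:~R))%:C * (c i * mono p i)).
Proof.
move=> hc Up; pose h : pt := (0, (- (t / pi))*i *: delta_mx k 0).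
have Uph : upper (p + h) by move: Up; rewrite /upper /=; case: (p.1) => a b; rewrite /= addr0.
apply: (bsum_le (K := 1) (hc _ Uph)) => i; rewrite mul1r monoD mulrCA.
rewrite [leLHS]ncM [leRHS]ncM ler_wpM2l ?nc_ge0 // [leLHS]ncM [leRHS]ncM mulrC ler_wpM2l ?nc_ge0 //.
rewrite nc_real ger0_norm ?expR_ge0 //.
rewrite nc_mono /= !mulr0 oppr0 add0r (bigD1 k) //= !mxE !eqxx mulr1 /= big1 => [|j jk].
  rewrite addr0 ler_expR le_eqVlt; apply/orP; left; apply/eqP.
  have pi0 : (pi : R) != 0 by rewrite gt_eqF ?pi_gt0.
  by rewrite !mulrN opprK [RHS]mulrCA [pi * _]mulrC divfK // mulrC.
have -> : ((- (t / pi))*i *: delta_mx k 0 : 'cV[R[i]]_n) j 0 = 0.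
  by rewrite !mxE (negPf jk) andFb mulr0.
by rewrite mulr0.
Qed.

(** exp(t |s_k|) <= exp(t s_k) + exp(- t s_k), applied to one coordinate after the other. *)
Lemma conv_expS c (t : R) : absconv upper c -> absconv upper (fun i => (expR (t * absS i.2))%:C * c i).
Proof.
move=> hc; rewrite /absS.
suff h (r : seq 'I_n) : absconv upper (fun i : idx => (expR (t * \sum_(k <- r) `|(i.2 k 0)%:~R|))%:C * c i).
  have := h (index_enum 'I_n); by [].
elim: r => [|k r IH] p Up.
  apply: (bsum_le (K := 1) (hc _ Up)) => i.
  by rewrite big_nil mulr0 expR0 !mul1r.
have h1 := bsum_has (conv_shift k t IH Up); have h2 := bsum_has (conv_shift k (- t) IH Up).
pose u (i : idx) : R[i] := (expR (t * (i.2 k 0)%:~R) + expR (- t * (i.2 k 0)%:~R))%:C *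
  ((expR (t * \sum_(k <- r) `|(i.2 k 0)%:~R|))%:C * c i * mono p i).
have hu : bsum u.
  apply: has_bsum (eq_has_sum (has_sumD h1 h2) _) => i.
  by rewrite -mulrDl -rmorphD.
apply: (bsum_le (K := 1) hu) => i; rewrite mul1r /u big_cons mulrDr expRD rmorphM /= -!mulrA.
rewrite [leLHS]ncM [leRHS]ncM ler_wpM2r ?nc_ge0 // !nc_real [X in X <= _]ger0_norm ?expR_ge0 //.
rewrite [X in _ <= X]ger0_norm ?addr_ge0 ?expR_ge0 //.
have [m0|m0] := lerP 0 ((i.2 k 0)%:~R : R).
  by rewrite (ger0_norm m0) ler_wpDr ?expR_ge0.
by rewrite (ltr0_norm m0) mulrN -mulNr ler_wpDl ?expR_ge0.
Qed.

(** Halving the imaginary part of tau gains exp(pi Im(tau) m). Together with [conv_expS] this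
    dominates every polynomial weight, which is what makes termwise differentiation possible. *)
Lemma conv_strong c (t : R) p : absconv upper c -> upper p ->
  bsum (fun i : idx => (expR (pi * complex.Im p.1 * i.1%:R + t * absS i.2))%:C * (c i * mono p i)).
Proof.
move=> hc Up; pose h : pt := ((- (complex.Im p.1 / 2))*i, 0).
have Uph : upper (p + h).
  by move: Up; rewrite /upper /h /=; case: (p.1) => a b /= b0; lra.
apply: (bsum_le (K := 1) (conv_expS t hc Uph)) => i.
rewrite mul1r monoD [mono p i * _]mulrC mulrACA.
rewrite [leLHS]ncM [leRHS]ncM ler_wpM2r ?nc_ge0 // ncM !nc_real !ger0_norm ?expR_ge0 //.
rewrite (nc_mono h) /= -expRD ler_expR big1 => [|j _]; last by rewrite mxE /= mulr0.
by rewrite le_eqVlt; apply/orP; left; apply/eqP; field.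
Qed.

Lemma conv_poly c (w : idx -> R[i]) (K : R) : absconv upper c ->
  (forall i, nc (w i) <= K * (i.1%:R + absS i.2)) -> absconv upper (fun i => w i * c i).
Proof.
move=> hc hw p Up; have y0 : 0 < pi * complex.Im p.1 by rewrite mulr_gt0 ?pi_gt0.
set y := pi * _ in y0; have y1 : 0 < Num.min y 1 by rewrite lt_min y0 ltr01.
apply: (bsum_le (K := Num.max 0 K / Num.min y 1) (conv_strong 1 hc Up)) => i.
rewrite -/y -mulrA [leLHS]ncM [X in _ <= _ * X]ncM mulrA ler_wpM2r ?nc_ge0 //.
rewrite nc_real ger0_norm ?expR_ge0 //; apply: le_trans (hw i) _.
have s0 : 0 <= i.1%:R + absS i.2 by rewrite addr_ge0 // absS_ge0.
apply: (@le_trans _ _ (Num.max 0 K * (i.1%:R + absS i.2))).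
  by rewrite ler_wpM2r // le_max lexx orbT.
rewrite -mulrA ler_wpM2l ?le_max ?lexx // mulrC ler_pdivlMr //.
apply: (le_trans _ (expR_ge1Dx _)); apply: ler_wpDl => //.
have m1 : Num.min y 1 <= 1 by rewrite ge_min lexx orbT.
have m2 : Num.min y 1 <= y by rewrite ge_min lexx.
have := absS_ge0 i.2; have := ler0n R i.1; move: (i.1%:R) (absS _) => a b a0 b0.
by rewrite mulrDl; apply: lerD; rewrite mulrC ler_wpM2r.
Qed.

Definition good_weight (w : idx -> R[i]) := exists K : R, forall i, nc (w i) <= K * (i.1%:R + absS i.2).

Lemma good_wq : good_weight wq.
Proof. by exists 1 => i; rewrite /wq nc_nat mul1r lerDl absS_ge0. Qed.

Lemma good_wz k : good_weight (wz k).
Proof.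
exists 1 => i; rewrite /wz ncM nc_int ncV nc_nat mul1r /absS (bigD1 k) //= addrCA.
have := normr_ge0 ((i.2 k 0)%:~R : R); move: `|_| => a a0.
apply: (@le_trans _ _ a); first by lra.
by rewrite lerDl addr_ge0 // sumr_ge0.
Qed.

Lemma isD_ex w f c : good_weight w -> fexp upper f c -> exists g, isD upper w f g /\ fexp upper g (fun i => w i * c i).
Proof.
move=> [K hK] h; have hc := conv_fexp (conv_poly (fexp_conv h) hK).
by eexists; split; last exact: hc; exists c.
Qed.

Lemma expR_sqr_le (a : R) : 0 <= a -> a ^+ 2 <= 2 * expR a.
Proof.
by move=> a0; have := expR_ge1Dxn 1 a0; rewrite (_ : 2`! = 2)%N // => h; lra.
Qed.

(** The remainder of each monomial is estimated by [expi_taylor1], and the resulting family is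
    summable by [conv_strong]. *)
Lemma fexp_taylor f c p : fexp upper f c -> upper p ->
  exists K d : R, 0 < d /\ forall h, nrm1 h <= d -> upper (p + h) /\
   nc (f (p + h) - f p - twopii R * csum (fun i => lin h i * c i * mono p i)) <= K * nrm1 h ^+ 2.
Proof.
move=> hf Up; pose y := complex.Im p.1; pose d := y / 4.
have y0 : 0 < y := Up; have d0 : 0 < d by rewrite divr_gt0.
have [M hM] := conv_strong (pi * y / 2) (fexp_conv hf) Up.
exists (8 / d ^+ 2 * M), d; split=> // h hd.
have h10 : 0 <= nrm1 h by rewrite addr_ge0 ?nc_ge0 // sumr_ge0 // => *; exact: nc_ge0.
have Uph : upper (p + h).
  have : nc h.1 <= d by apply: le_trans hd; rewrite lerDl sumr_ge0 // => *; exact: nc_ge0.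
  have := nc_Im h.1; rewrite /upper /=; have := ler_norm (- complex.Im h.1).
  rewrite normrN; move: y0; rewrite /d /y; case: (p.1) (h.1) => a b [a' b'] /=; lra.
split=> //.
have hl : bsum (fun i => lin h i * c i * mono p i).
  apply: (conv_poly (K := nrm1 h) (fexp_conv hf)) => // i.
  apply: le_trans (nc_lin_le h i) _; rewrite mulrC ler_wpM2l //.
  by have := absS_ge0 i.2; lra.
have hs := has_sumB (has_sumB (hf _ Uph) (hf _ Up)) (has_sumZ (twopii R) (bsum_has hl)).
rewrite mulrAC; apply: (nc_has_sum hs) => A.
apply: le_trans (_ : 8 / d ^+ 2 * nrm1 h ^+ 2 * \sum_(i <- A) nc ((expR (pi * y * i.1%:R + pi * y / 2 * absS i.2))%:C * (c i * mono p i)) <= _); last first.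
  by rewrite ler_wpM2l // mulr_ge0 ?divr_ge0 ?sqr_ge0.
rewrite mulr_sumr; apply: ler_sum => i _.
have -> : c i * mono (p + h) i - c i * mono p i - twopii R * (lin h i * c i * mono p i) =
   (c i * mono p i) * (expi (lin h i) - 1 - twopii R * lin h i).
  by rewrite monoD !(monoE h); ring.
rewrite [leLHS]ncM [leLHS]mulrC [X in _ <= _ * X]ncM.
move: (nc (c i * mono p i)) (nc_ge0 (c i * mono p i)) => X X0.
rewrite [leRHS]mulrA; apply: ler_wpM2r => //.
apply: le_trans (expi_taylor1 _) _.
rewrite nc_real ger0_norm ?expR_ge0 //.
set s := i.1%:R + absS i.2 / 2.
have s0 : 0 <= s by rewrite addr_ge0 // divr_ge0 // absS_ge0.
(* The radius d = y / 4 makes the available weight equal to twice 2 pi s d: one half pays for the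
   exponential in the Taylor remainder, the other for the square, through a^2 <= 2 exp(a). *)
have -> : pi * y * i.1%:R + pi * y / 2 * absS i.2 = 2 * pi * (s * d) + 2 * pi * (s * d).
  by rewrite /s /d; field.
have p0 : 0 <= 2 * pi :> R by rewrite mulr_ge0 // pi_ge0.
have l1 : nc (lin h i) <= s * nrm1 h := nc_lin_le h i.
have l2 : nc (lin h i) <= s * d by apply: le_trans l1 _; rewrite ler_wpM2l.
rewrite expRD [leRHS]mulrA; apply: ler_pM;
  [by rewrite mulr_ge0 ?sqr_ge0 | exact: expR_ge0 | | by rewrite ler_expR ler_wpM2l].
apply: (@le_trans _ _ (4 * ((2 * pi) * (s * nrm1 h)) ^+ 2)).
  have hle : 2 * pi * nc (lin h i) <= 2 * pi * (s * nrm1 h) by rewrite ler_wpM2l.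
  rewrite ler_wpM2l // lerXn2r // nnegrE; first by rewrite mulr_ge0 ?nc_ge0.
  exact: mulr_ge0 p0 (mulr_ge0 s0 h10).
have -> : 4 * (2 * pi * (s * nrm1 h)) ^+ 2 = 4 * (nrm1 h ^+ 2 / d ^+ 2) * (2 * pi * (s * d)) ^+ 2.
  by field; rewrite gt_eqF.
have -> : 8 / d ^+ 2 * nrm1 h ^+ 2 * expR (2 * pi * (s * d)) = 4 * (nrm1 h ^+ 2 / d ^+ 2) * (2 * expR (2 * pi * (s * d))).
  by ring.
apply: ler_wpM2l; first by rewrite mulr_ge0 // divr_ge0 ?sqr_ge0.
by apply: expR_sqr_le; rewrite mulr_ge0 // mulr_ge0 // ltW.
Qed.

End Basic.
End FourierSeries.

(** * Uniqueness of Fourier coefficients, and pullbacks *)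

Section Uniqueness.
Variable R : realType.

(* Halving the angle at most halves the chord, so dyadic angles reduce to the range [1/4, 1/2]. *)
Lemma chord_lb (k : nat) (d : int) (t : R) : t = d%:~R / 2 ^+ k -> `|t| <= 2^-1 ->
  2 * `|t| <= nc (1 - expi t%:C).
Proof.
elim: k d t => [|k IH] d t td t2.
  have d0 : d = 0.
    move: t2; rewrite td expr0 divr1 -intr_norm => t2.
    have : (`|d| < 1) by rewrite -(ltr_int R); lra.
    by lia.
  by rewrite td d0 mul0r normr0 mulr0 nc_ge0.
have [t4|t4] := lerP `|t| (4^-1).
  have h : `|2 * t| <= 2^-1 by rewrite normrM (ger0_norm (ler0n _ 2)); lra.
  have e : 2 * t = d%:~R / 2 ^+ k by rewrite td exprS; field; rewrite expf_neq0.
  have h1 := IH d (2 * t) e h; rewrite normrM (ger0_norm (ler0n _ 2)) in h1.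
  have e2 : 1 - expi (2 * t)%:C = (1 - expi t%:C) * (1 + expi t%:C).
    by rewrite (_ : 2 * t = t + t) ?rmorphD ?expiD; ring.
  rewrite e2 ncM in h1.
  have : nc (1 + expi t%:C) <= 2.
    by apply: le_trans (ncD _ _) _; rewrite nc1 nc_expi_real.
  have := nc_ge0 (1 - expi t%:C); have := normr_ge0 t.
  by move: (nc _) (nc _) h1 => a b; nra.
apply: (@le_trans _ _ 1); first by lra.
apply: le_trans (nc_Re _); apply: le_trans (ler_norm _).
have -> : complex.Re (1 - expi t%:C) = 1 - complex.Re (expi t%:C) by case: (expi _).
rewrite Re_expi_real lerDl oppr_ge0.
have -> : cos (2 * pi * t) = cos (2 * pi * `|t|).
  by case: (ler0P t) => // t0; rewrite mulrN cosN.
rewrite -[2 * pi * _](subrK pi) cosDpi oppr_le0; apply: cos_ge0_pihalf.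
have := pi_gt0 R; move: t4 t2; move: `|t| => u u1 u2 p0.
by apply/andP; split; nra.
Qed.

(** The mean of the character t -> e(d t) over the dyadic grid of mesh 2^-k, a discrete form of its
    integral over a period. It vanishes exactly, not only in the limit, once 2 |d| <= 2^k and d is
    nonzero. *)
Definition davg (k : nat) (d : int) : R[i] :=
  (2 ^+ k)^-1 * \sum_(j < 2 ^ k) expi (d%:~R * (j%:R / 2 ^+ k)).

Lemma nc_davg k d : nc (davg k d) <= 1.
Proof.
rewrite /davg ncM ncV ncX nc_nat ler_pdivrMl ?exprn_gt0 // mulr1.
apply: le_trans (nc_sum _ _ _) _.
apply: le_trans (_ : \sum_(j < 2 ^ k) (1 : R) <= _); last first.
  by rewrite sumr_const card_ord -[_ *+ _]mulr_natr mul1r natrX.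
apply: ler_sum => j _.
have -> : (d%:~R * (j%:R / 2 ^+ k) : R[i]) = (d%:~R * (j%:R / 2 ^+ k))%:C.
  by rewrite rmorphM rmorph_int fmorph_div rmorphXn !rmorph_nat.
by rewrite nc_expi_real.
Qed.

Lemma davg0 k : davg k 0 = 1.
Proof.
rewrite /davg (eq_bigr (fun=> 1)) => [|j _]; last by rewrite mul0r expi0.
by rewrite sumr_const card_ord -[_ *+ _]mulr_natr mul1r natrX mulVf // expf_neq0.
Qed.

Lemma davg_neq0 k d : d != 0 -> (2 * `|d| <= 2 ^ k)%N -> davg k d = 0.
Proof.
move=> d0 dk; rewrite /davg; set w := expi (d%:~R / 2 ^+ k : R[i]).
have -> : \sum_(j < 2 ^ k) expi (d%:~R * (j%:R / 2 ^+ k)) = \sum_(j < 2 ^ k) w ^+ j :> R[i].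
  by apply: eq_bigr => j _; rewrite -expiMn; congr expi; ring.
have N0 : (2 ^+ k : R[i]) != 0 by rewrite expf_neq0.
have h : (1 - w) * \sum_(j < 2 ^ k) w ^+ j = 0.
  rewrite -opprB mulNr -subrX1.
  have -> : w ^+ (2 ^ k) = 1 by rewrite -expiMn natrX mulrC divfK // expi_int.
  by rewrite subrr oppr0.
have w1 : 1 - w != 0.
  rewrite -nc_gt0.
  have wE : w = expi (d%:~R / 2 ^+ k : R)%:C.
    by rewrite /w fmorph_div rmorph_int rmorphXn rmorph_nat.
  have dk' : 2 * `|(d%:~R : R)| <= 2 ^+ k.
    by rewrite -intr_norm -natr_absz -natrX -natrM ler_nat.
  rewrite wE; apply: lt_le_trans (chord_lb (k := k) (d := d) erefl _).
    rewrite mulr_gt0 // normr_gt0 mulf_neq0 ?intr_eq0 // invr_neq0 // expf_neq0 //.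
  rewrite normrM normfV (ger0_norm (exprn_ge0 k (ler0n R 2))) ler_pdivrMr ?exprn_gt0 //; lra.
by move/eqP: h; rewrite mulf_eq0 (negPf w1) /= => /eqP ->; rewrite mulr0.
Qed.

Lemma davg_cvg d : davg ^~ d @ \oo --> ((d == 0)%:R : R[i]).
Proof.
apply/nat_ccvgP => e e0; exists (2 * `|d|)%N => k hk.
have [->|d0] := eqVneq d 0; first by rewrite davg0 subrr nc0.
rewrite davg_neq0 ?subrr ?nc0 //.
by apply: leq_trans hk _; exact: ltnW (ltn_expl _ _).
Qed.

(** Averaging the relation against the character of [k0] over finer and finer dyadic grids isolates
    the terms with [k i = k0]; the limit is exchanged with the sum by [tannery]. *)
Lemma char_group (I : choiceType) (x : I -> R[i]) (k : I -> int) : bsum x ->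
  (forall t : R, has_sum (fun i => x i * expi ((k i)%:~R * t%:C)) 0) ->
  forall k0, csum (fun i => if k i == k0 then x i else 0) = 0.
Proof.
move=> [M hM] h k0.
pose x_ N i := x i * davg N (k i - k0).
have hx N : csum (x_ N) = 0.
  apply: csumE.
  have h1 (j : 'I_(2 ^ N)) := has_sumZ ((2 ^+ N)^-1 * expi (- k0%:~R * (j%:R / 2 ^+ N))) (h (j%:R / 2 ^+ N)).
  have := has_sum_seq (index_enum _) h1; rewrite big1 => [h2|j _]; last by rewrite mulr0.
  apply: (eq_has_sum h2) => i; rewrite /x_ /davg !mulr_sumr; apply: eq_bigr => j _.
  rewrite intrB mulrBl expiB !mulNr expiN.
  have -> : ((j%:R / 2 ^+ N : R)%:C = j%:R / 2 ^+ N :> R[i]).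
    by rewrite fmorph_div rmorphXn !rmorph_nat.
  by ring.
have [|N i|i|_] := @tannery R I x_ (fun i => x i * (k i - k0 == 0)%:R) (fun i => nc (x i)) M.
- exact: hM.
- by rewrite /x_ ncM ler_piMr ?nc_ge0 // nc_davg.
- by apply: cvgMr; exact: davg_cvg.
rewrite (_ : (fun N => csum (x_ N)) = fun=> 0); last by apply/funext.
move=> hc; rewrite -[RHS](ccvg_unique _ hc (cvg_cst _)).
by apply: eq_csum => i; rewrite subr_eq0; case: eqP; rewrite ?mulr1 ?mulr0.
Qed.

(** One character at a time: after each use of [char_group] the restricted family still satisfies
    the relation for all remaining parameters, which is why the induction keeps [t] arbitrary. *)
Lemma chars_group (I : choiceType) (J : finType) (x : I -> R[i]) (k : J -> I -> int) : bsum x ->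
  (forall t : J -> R, has_sum (fun i => x i * expi (\sum_j (k j i)%:~R * (t j)%:C)) 0) ->
  forall k0 : J -> int, csum (fun i => if [forall j, k j i == k0 j] then x i else 0) = 0.
Proof.
move=> bx h k0.
have nce (t : J -> R) (i : I) : nc (expi (\sum_j (k j i)%:~R * (t j)%:C)) = 1.
  have -> : \sum_j (k j i)%:~R * (t j)%:C = (\sum_j (k j i)%:~R * t j)%:C :> R[i].
    by rewrite rmorph_sum; apply: eq_bigr => j _; rewrite rmorphM rmorph_int.
  by rewrite nc_expi_real.
suff H (r : seq J) (t : J -> R) : has_sum (fun i => if all (fun j => k j i == k0 j) r
     then x i * expi (\sum_j (k j i)%:~R * (t j)%:C) else 0) 0.
  rewrite -[RHS](csumE (H (index_enum J) (fun=> 0))); apply: eq_csum => i.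
  rewrite big1 => [|j _]; last by rewrite mulr0.
  rewrite expi0 mulr1; congr (if _ then _ else _).
  apply/forallP/allP => [hj j _|hj j]; [exact: hj | apply: hj; exact: mem_index_enum].
elim: r t => [|j0 r IH] t; first exact: h.
pose y i := if all (fun j => k j i == k0 j) r then x i * expi (\sum_j (k j i)%:~R * (t j)%:C) else 0.
have by_ : bsum y := has_bsum (IH t).
have hy (t' : R) : has_sum (fun i => y i * expi ((k j0 i)%:~R * t'%:C)) 0.
  apply: (eq_has_sum (IH (fun j => t j + (if j == j0 then t' else 0)))) => i.
  rewrite /y; case: ifP => _; last by rewrite mul0r.
  rewrite -mulrA -expiD; congr (_ * expi _).
  rewrite (eq_bigr (fun j => (k j i)%:~R * (t j)%:C + (k j i)%:~R * (if j == j0 then t' else 0)%:C)).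
    rewrite big_split; congr (_ + _); rewrite (bigD1 j0) //= eqxx big1 ?addr0 // => j /negPf ->.
    by rewrite mulr0.
  by move=> j _; rewrite rmorphD mulrDr.
have := char_group by_ hy (k0 j0) => h0.
have := bsum_has (bsum_if (fun i => k j0 i == k0 j0) by_); rewrite h0 => h1.
by apply: (eq_has_sum h1) => i; rewrite /= /y; case: eqP.
Qed.

Section FexpUnique.
Variable n : nat.
Local Notation pt := (R[i] * 'cV[R[i]]_n)%type.
Local Notation idx := (nat * 'cV[int]_n)%type.

(* The half-integral frequencies are made integral by translating z by 2t. *)
Definition realpt (t : 'I_n.+1 -> R) : pt := ((t ord0)%:C, \col_k (2 * t (lift ord0 k))%:C).

Lemma fexp_unique0 (c : idx -> R[i]) (p : pt) :
  (forall t, has_sum (fun i => c i * mono (p + realpt t) i) 0) -> c =1 (fun=> 0).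
Proof.
move=> h j.
pose k (o : 'I_n.+1) (i : idx) : int := if unlift ord0 o is Some a then i.2 a 0 else i.1%:Z.
pose x (i : idx) := c i * mono p i.
have hx t : has_sum (fun i => x i * expi (\sum_o (k o i)%:~R * (t o)%:C)) 0.
  apply: (eq_has_sum (h t)) => i; rewrite monoD mulrA; congr (_ * _).
  rewrite monoE linE; congr expi; rewrite big_ord_recl; congr (_ + _).
    by rewrite /k unlift_none.
  apply: eq_bigr => a _; rewrite /k liftK mxE rmorphM rmorph_nat; by field.
have bx : bsum x.
  apply: (bsum_le (K := 1) (has_bsum (h (fun=> 0)))) => i; rewrite mul1r.
  rewrite (_ : realpt _ = 0) ?addr0 //; congr (_, _).
  by apply/matrixP => a b; rewrite !mxE mulr0.
have := chars_group bx hx (k^~ j).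
have -> : csum (fun i => if [forall o, k o i == k o j] then x i else 0) = x j.
  apply: csumE; apply: (eq_has_sum (has_sum_single j (x j))) => i.
  have [->|ij] := eqVneq i j; first by rewrite (introT forallP) // => o; exact: eqxx.
  case: ifP => // /forallP ho; case/eqP: ij; case: i j ho => [m s] [m' s'] ho.
  congr (_, _).
    by have := ho ord0; rewrite /k unlift_none => /eqP [].
  by apply/colP => a; have := ho (lift ord0 a); rewrite /k liftK => /eqP.
by rewrite /x => /eqP; rewrite mulf_eq0 (negPf (mono_neq0 _ _)) orbF => /eqP.
Qed.

(** [U] only has to contain the real translates of a single point. This allows expansions valid on a
    strip or on a half of the domain to be compared. *)
Lemma fexp_unique (U : set pt) (f : pt -> R[i]) (c d : idx -> R[i]) (p : pt) :
  fexp U f c -> fexp U f d -> (forall t, U (p + realpt t)) -> c = d.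
Proof.
move=> hc hd Up; apply/funext => i; apply/eqP; rewrite -subr_eq0; apply/eqP; move: i.
apply: (@fexp_unique0 _ p) => t.
have := has_sumB (hc _ (Up t)) (hd _ (Up t)); rewrite subrr => h.
by apply: (eq_has_sum h) => i; rewrite mulrBl.
Qed.

Lemma upper_realpt (p : pt) t : upper p -> upper (p + realpt t).
Proof. by rewrite /upper /=; case: (p.1) => a b /=; rewrite addr0. Qed.

Lemma upper_i : upper (('i : R[i]), 0 : 'cV[R[i]]_n).
Proof. by rewrite /upper /= ltr01. Qed.

Lemma fexpH_unique (f : pt -> R[i]) (c d : idx -> R[i]) :
  fexp (@upper R n) f c -> fexp (@upper R n) f d -> c = d.
Proof. by move=> h1 h2; apply: (fexp_unique h1 h2) => t; apply: upper_realpt; exact: upper_i. Qed.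

Lemma isD_unique (w : idx -> R[i]) f g h : isD (@upper R n) w f g -> isD (@upper R n) w f h ->
  forall p, upper p -> g p = h p.
Proof.
move=> [c [fc gc]] [d [fd hd]] p Up; rewrite (fexpH_unique fc fd) in gc.
exact: has_sum_unique (gc _ Up) (hd _ Up).
Qed.

End FexpUnique.

Section Pullback.
Variables (n n' : nat) (L : 'M[int]_(n, n')).
Local Notation pt := (R[i] * 'cV[R[i]]_n)%type.
Local Notation pt' := (R[i] * 'cV[R[i]]_n')%type.
Local Notation idx := (nat * 'cV[int]_n)%type.
Local Notation idx' := (nat * 'cV[int]_n')%type.

Definition pull (p : pt') : pt := (p.1, map_mx intr L *m p.2).

Definition idxpull (i : idx) : idx' := (i.1, L^T *m i.2).

Lemma mono_pull (p : pt') (i : idx) : mono (pull p) i = mono p (idxpull i).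
Proof.
rewrite !monoE /lin; congr (expi (_ + _)).
rewrite mulmxA -(_ : (freq R (L^T *m i.2))^T = (freq R i.2)^T *m map_mx intr L) //.
by rewrite /freq /intv map_mxM -map_trmx !linearZ /= trmx_mul trmxK scalemxAl.
Qed.

Lemma fexp_pull U f c : fexp U f c ->
  fexp [set p | U (pull p)] (fun p => f (pull p)) (gcoef idxpull c).
Proof.
move=> h; apply: gexp => p Up; apply: (eq_has_sum (h _ Up)) => i.
by rewrite mono_pull.
Qed.

Lemma isD_pull U (w : idx -> R[i]) (w' : idx' -> R[i]) (a : R[i]) f g :
  (forall i, w' (idxpull i) = a * w i) -> isD U w f g ->
  isD [set p | U (pull p)] w' (fun p => f (pull p)) (fun p => a * g (pull p)).
Proof.
move=> hw [c [fc gc]]; exists (gcoef idxpull c); split; first exact: fexp_pull.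
apply: gexp_weight => p Up.
  by apply: (eq_has_sum (fc _ Up)) => i; rewrite mono_pull.
by apply: (eq_has_sum (has_sumZ a (gc _ Up))) => i; rewrite mono_pull hw !mulrA.
Qed.

Lemma wq_pull i : wq R (idxpull i) = 1 * wq R i.
Proof. by rewrite mul1r. Qed.

End Pullback.

Lemma wz_pull1 n' (L : 'M[int]_(1, n')) (k : 'I_n') (i : nat * 'cV[int]_1) :
  wz R k (idxpull L i) = (L 0 k)%:~R * wz R 0 i.
Proof. by rewrite /wz /idxpull mxE big_ord1 mxE intrM mulrA. Qed.

End Uniqueness.

(** * Complex derivatives *)

Section ComplexDerivative.
Variable R : realType.
Implicit Types (F G : R[i] -> R[i]) (z u d : R[i]).

(** A derivative with a quadratic remainder. All functions at hand are analytic in the variable, and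
    in this form the sum, product and chain rules are plain estimates. *)
Definition cder F z d := exists K e : R, [/\ 0 <= K, 0 < e &
  forall u, nc u <= e -> nc (F (z + u) - F z - u * d) <= K * nc u ^+ 2].

Lemma cderI F z d (K e : R) : 0 < e ->
  (forall u, nc u <= e -> nc (F (z + u) - F z - u * d) <= K * nc u ^+ 2) -> cder F z d.
Proof.
move=> e0 h; exists (Num.max 0 K), e; split=> //; first by rewrite le_max lexx.
move=> u /h; move=> /le_trans; apply; rewrite ler_wpM2r ?exprn_ge0 ?nc_ge0 //.
by rewrite le_max lexx orbT.
Qed.

Lemma cder_unique F z d d' : cder F z d -> cder F z d' -> d = d'.
Proof.
move=> [K [e [K0 e0 h]]] [K' [e' [K'0 e'0 h']]].
apply/eqP; rewrite -subr_eq0 -nc_eq0; apply/eqP/le_anti; rewrite nc_ge0 andbT.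
apply/ler_addgt0Pr => x x0; rewrite add0r.
pose r := Num.min (Num.min e e') (x / (K + K' + 1)).
have KK : 0 < K + K' + 1 by lra.
have r0 : 0 < r by rewrite !lt_min e0 e'0 divr_gt0.
have nr : nc (r%:C : R[i]) = r by rewrite nc_real gtr0_norm.
have := h r%:C; have := h' r%:C; rewrite nr !ge_min !lexx ?orbT => /(_ isT) h2 /(_ isT) h1.
have : nc (r%:C * (d - d')) <= (K + K') * r ^+ 2.
  have -> : r%:C * (d - d') = (F (z + r%:C) - F z - r%:C * d') - (F (z + r%:C) - F z - r%:C * d) by ring.
  by apply: le_trans (ncB _ _) _; rewrite mulrDl addrC; exact: lerD.
rewrite ncM nr expr2 mulrA [_ * r]mulrC ler_pM2l // => /le_trans; apply.
have : r <= x / (K + K' + 1) by rewrite ge_min lexx orbT.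
by rewrite ler_pdivlMr // => hr; have := ltW r0; nra.
Qed.

Lemma cder_derive1 F z d : cder F z d -> F^`()%classic z = d.
Proof.
move=> [K [e [K0 e0 h]]]; rewrite derive1E; apply: ccvg_lim; apply/ccvgP => x x0.
pose r := Num.min e (x / (K + 1)).
have r0 : 0 < r by rewrite lt_min e0 divr_gt0 // ltr_wpDl.
exists r%:C; first by rewrite /= ltcR.
move=> u /=; rewrite sub0r normrN ncE ltcR => ur u0.
have nu0 : 0 < nc u by rewrite nc_gt0.
have ue : nc u <= e by apply: ltW; apply: lt_le_trans ur _; rewrite ge_min lexx.
have := h u ue.
have -> : F (z + u) - F z - u * d = u * (u^-1 *: (F (u *: 1 + z) - F z) - d).
  rewrite /GRing.scale /= mulr1 [u + z]addrC; field; exact: u0.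
rewrite ncM expr2 mulrA [_ * nc u]mulrC ler_pM2l // => /le_lt_trans; apply.
have : nc u < x / (K + 1) by apply: lt_le_trans ur _; rewrite ge_min lexx orbT.
by rewrite ltr_pdivlMr ?ltr_wpDl // => hu; nra.
Qed.

Lemma cder_ext F G z d : F =1 G -> cder F z d -> cder G z d.
Proof. by move=> /funext ->. Qed.

Lemma cder_eq F z d d' : cder F z d -> d = d' -> cder F z d'.
Proof. by move=> h <-. Qed.

Lemma cder_cst (a : R[i]) z : cder (fun=> a) z 0.
Proof. by apply: (@cderI _ _ _ 0 1) => // u _; rewrite subrr mulr0 subrr nc0 mul0r. Qed.

Lemma cder_id z : cder id z 1.
Proof.
apply: (@cderI _ _ _ 0 1) => // u _; rewrite (_ : _ - _ = 0) ?nc0 ?mul0r //.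
by rewrite mulr1; ring.
Qed.

Lemma cderD F G z d d' : cder F z d -> cder G z d' -> cder (fun z => F z + G z) z (d + d').
Proof.
move=> [K [e [K0 e0 h]]] [K' [e' [K'0 e'0 h']]].
apply: (@cderI _ _ _ (K + K') (Num.min e e')); first by rewrite lt_min e0.
move=> u; rewrite le_min => /andP[/h h1 /h' h2].
have -> : F (z + u) + G (z + u) - (F z + G z) - u * (d + d') =
  (F (z + u) - F z - u * d) + (G (z + u) - G z - u * d') by ring.
by apply: le_trans (ncD _ _) _; rewrite mulrDl lerD.
Qed.

Lemma cderM F G z d d' : cder F z d -> cder G z d' ->
  cder (fun z => F z * G z) z (d * G z + F z * d').
Proof.
move=> [K [e [K0 e0 h]]] [K' [e' [K'0 e'0 h']]].
pose C := K * (nc (G z) + nc d' + K') + K' * (nc (F z) + nc d) + nc d * nc d'.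
apply: (@cderI _ _ _ C (Num.min 1 (Num.min e e'))); first by rewrite !lt_min ltr01 e0.
move=> u; rewrite !le_min => /and3P[u1 /h h1 /h' h2].
have -> : F (z + u) * G (z + u) - F z * G z - u * (d * G z + F z * d') =
  (F (z + u) - F z - u * d) * (G z + u * d' + (G (z + u) - G z - u * d')) +
  ((G (z + u) - G z - u * d') * (F z + u * d) + u * u * (d * d')) by ring.
move: (F (z + u) - _ - _) (G (z + u) - _ - _) h1 h2 => X Y h1 h2.
have n0 := nc_ge0 u; set r := nc u in u1 h1 h2 n0 *.
have Y1 : nc Y <= K'.
  by apply: le_trans h2 _; rewrite ler_piMr // expr_le1.
have A1 : nc (G z + u * d' + Y) <= nc (G z) + nc d' + K'.
  apply: le_trans (ncD _ _) (lerD (le_trans (ncD _ _) _) Y1).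
  by rewrite lerD2l ncM ler_piMl ?nc_ge0.
have A2 : nc (F z + u * d) <= nc (F z) + nc d.
  by apply: le_trans (ncD _ _) _; rewrite lerD2l ncM ler_piMl ?nc_ge0.
have B1 : nc (X * (G z + u * d' + Y)) <= K * (nc (G z) + nc d' + K') * r ^+ 2.
  by rewrite ncM mulrAC; apply: ler_pM => //; exact: nc_ge0.
have B2 : nc (Y * (F z + u * d)) <= K' * (nc (F z) + nc d) * r ^+ 2.
  by rewrite ncM mulrAC; apply: ler_pM => //; exact: nc_ge0.
have B3 : nc (u * u * (d * d')) = nc d * nc d' * r ^+ 2 by rewrite !ncM -/r mulrC expr2.
apply: le_trans (ncD _ _) _; apply: le_trans (lerD (lexx _) (ncD _ _)) _.
by rewrite B3 /C; lra.
Qed.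

Lemma cder_comp F G z d d' : cder G z d' -> cder F (G z) d -> cder (fun z => F (G z)) z (d * d').
Proof.
move=> [K' [e' [K'0 e'0 h']]] [K [e [K0 e0 h]]].
pose L := nc d' + K'.
have L0 : 0 <= L by rewrite addr_ge0 ?nc_ge0.
pose r := Num.min 1 (Num.min e' (e / (L + 1))).
have r0 : 0 < r by rewrite !lt_min ltr01 e'0 divr_gt0 // ltr_wpDl.
apply: (@cderI _ _ _ (K * L ^+ 2 + nc d * K') r) => // u.
rewrite !le_min => /and3P[u1 /h' h2]; rewrite ler_pdivlMr ?ltr_wpDl // => u3.
pose v := G (z + u) - G z.
have n0 := nc_ge0 u.
have vL : nc v <= L * nc u.
  have -> : v = u * d' + (G (z + u) - G z - u * d') by rewrite /v; ring.
  apply: le_trans (ncD _ _) _; rewrite mulrDl ncM [nc d' * _]mulrC lerD2l.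
  apply: le_trans h2 _; rewrite ler_wpM2l // expr2; by rewrite ler_piMl.
have ve : nc v <= e by apply: le_trans vL _; nra.
have := h v ve; rewrite (_ : G z + v = G (z + u)); last by rewrite /v; ring.
move=> h1.
have -> : F (G (z + u)) - F (G z) - u * (d * d') =
  (F (G (z + u)) - F (G z) - v * d) + d * (G (z + u) - G z - u * d') by rewrite /v; ring.
apply: le_trans (ncD _ _) _; rewrite [leRHS]mulrDl; apply: lerD.
  apply: le_trans h1 _; rewrite -mulrA ler_wpM2l // -exprMn.
  by rewrite lerXn2r // nnegrE ?mulr_ge0 ?nc_ge0.
by rewrite ncM -mulrA ler_wpM2l ?nc_ge0.
Qed.

Lemma cder_expi z : cder (@expi R) z (twopii R * expi z).
Proof.
apply: (@cderI _ _ _ (nc (expi z) * (4 * (2 * pi) ^+ 2 * expR (2 * pi))) 1) => // u u1.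
have -> : expi (z + u) - expi z - u * (twopii R * expi z) =
  expi z * (expi u - 1 - twopii R * u) by rewrite expiD; ring.
rewrite [leLHS]ncM -[leRHS]mulrA ler_wpM2l ?nc_ge0 //; apply: le_trans (expi_taylor1 u) _.
rewrite exprMn mulrA mulrAC ler_wpM2r ?exprn_ge0 ?nc_ge0 //.
apply: ler_wpM2l; first by rewrite mulr_ge0 ?sqr_ge0.
by rewrite ler_expR ler_piMr // mulr_ge0 // pi_ge0.
Qed.

Lemma cderZ (a : R[i]) F z d : cder F z d -> cder (fun z => a * F z) z (a * d).
Proof.
by move=> h; have := cderM (cder_cst a z) h; rewrite mul0r add0r.
Qed.

Lemma cder_scale (a z : R[i]) : cder (fun w => a * w) z a.
Proof. by have := cderZ a (cder_id z); rewrite mulr1. Qed.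

End ComplexDerivative.

Lemma differentiable_quad (K : numFieldType) (V W : normedModType K) (f : V -> W)
    (df : {linear V -> W}) (p : V) (C e : K) : continuous df -> 0 < e ->
  (forall h, `|h| <= e -> `|f (p + h) - f p - df h| <= C * `|h| ^+ 2) -> differentiable f p.
Proof.
move=> dfc e0 hC.
have hd : f \o shift p = cst (f p) + df +o_ 0 id.
  apply/eqaddoP => x x0.
  pose r := x / (`|C| + 1).
  have C1 : 0 < `|C| + 1 by rewrite ltr_wpDl.
  have r0 : 0 < r by rewrite divr_gt0.
  near=> h.
  rewrite !fctE /= opprD addrA (_ : h + p = p + h); last by rewrite addrC.
  have he : `|h| < e by near: h; exact: nbhs0_lt.
  have hr : `|h| < r by near: h; exact: nbhs0_lt.
  have h0 := hC h (ltW he).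
  apply: le_trans h0 _; apply: le_trans (real_ler_norm _) _.
    by apply: ger0_real; apply: le_trans (hC h (ltW he)).
  rewrite normrM normrX normr_id expr2 mulrA ler_wpM2r //.
  apply: le_trans (_ : (`|C| + 1) * r <= _); last by rewrite /r mulrC divfK // gt_eqF.
  by apply: ler_pM; rewrite ?normr_ge0 ?lerDl ?ler01 // ltW.
have ddf : 'd f p = df :> (V -> W) by exact: diff_unique.
by apply/diff_locallyP; rewrite ddf; split.
Unshelve. all: by end_near.
Qed.

Section FexpDerivative.
Variable R : realType.

Section Vector.
Variable n : nat.
Local Notation pt := (R[i] * 'cV[R[i]]_n)%type.
Local Notation idx := (nat * 'cV[int]_n)%type.

Lemma coord_norm_le (m : nat) (M : 'cV[R[i]]_m) k : `|M k 0| <= `|M|.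
Proof.
rewrite real_leNgt ?normr_real //; apply/negP => h.
have : ball (0 : 'cV[R[i]]_m) `|M k 0| M by rewrite -ball_normE /= sub0r normrN.
by move=> [_ /(_ k 0)]; rewrite -ball_normE /= mxE sub0r normrN ltxx.
Qed.

Lemma normE_pt (h : pt) : `|h| = (complex.Re `|h|)%:C.
Proof. by rewrite RRe_real // normr_real. Qed.

Lemma nc_fst_le (h : pt) : nc h.1 <= complex.Re `|h|.
Proof.
rewrite -lecR -normE_pt -ncE prod_normE comparable_le_max ?lexx //.
by rewrite real_comparable ?normr_real.
Qed.

Lemma nc_snd_le (h : pt) k : nc (h.2 k 0) <= complex.Re `|h|.
Proof.
rewrite -lecR -normE_pt -ncE; apply: le_trans (coord_norm_le h.2 k) _.
by rewrite prod_normE comparable_le_max ?lexx ?orbT // real_comparable ?normr_real.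
Qed.

Lemma nrm1_le (h : pt) : nrm1 h <= n.+1%:R * complex.Re `|h|.
Proof.
rewrite /nrm1 -natr1 mulrDl mul1r addrC; apply: lerD; last exact: nc_fst_le.
apply: le_trans (ler_sum _ (fun k _ => nc_snd_le h k)) _.
by rewrite sumr_const card_ord -[_ *+ n]mulr_natr mulrC.
Qed.

(** Produces the holomorphy clause of a weak Jacobi form from its expansion. The differential is
    assembled from the termwise derivatives in tau and in each z_k. *)
Lemma fexp_differentiable (f : pt -> R[i]) c p :
  fexp (@upper R n) f c -> upper p -> differentiable f p.
Proof.
move=> hf Up; have [K [e [e0 hK]]] := fexp_taylor hf Up.
have [gq [_ hq]] := isD_ex (good_wq R n) hf.
have /choice [g hg] k : exists g, fexp (@upper R n) g (fun i => wz R k i * c i).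
  by have [g [_ hg]] := isD_ex (good_wz R k) hf; exists g.
pose df (h : pt) : R[i] := twopii R * (gq p * h.1 + \sum_k g k p * h.2 k 0).
have dfE h : twopii R * csum (fun i => lin h i * c i * mono p i) = df h.
  congr (_ * _); apply: csumE.
  have h1 := has_sumZ h.1 (hq _ Up).
  have h2 := has_sum_seq (index_enum _) (fun k => has_sumZ (h.2 k 0) (hg k _ Up)).
  have -> : gq p * h.1 + \sum_k g k p * h.2 k 0 = h.1 * gq p + \sum_k h.2 k 0 * g k p.
    by rewrite mulrC; congr (_ + _); apply: eq_bigr => k _; rewrite mulrC.
  apply: (eq_has_sum (has_sumD h1 h2)) => i.
  rewrite linE !mulrDl !mulr_suml /wq /wz; congr (_ + _); first by ring.
  by apply: eq_bigr => k _; ring.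
have dflin : linear df.
  move=> a x y; rewrite /df /= -[a *: (_ * _)]/(a * (_ * _)).
  have -> : \sum_k g k p * (a *: x.2 + y.2) k 0 = a * (\sum_k g k p * x.2 k 0) + \sum_k g k p * y.2 k 0.
    by rewrite mulr_sumr -big_split; apply: eq_bigr => k _; rewrite !mxE /=; ring.
  by rewrite -[a *: x.1]/(a * x.1); ring.
pose dfl : {linear pt -> R[i]} := HB.pack df (GRing.isLinear.Build _ _ _ _ df dflin).
have bound (h : pt) : `|df h| <= (2 * pi * (nc (gq p) + \sum_k nc (g k p)))%:C * `|h|.
  rewrite ncE normE_pt -rmorphM lecR /df ncM nc_twopii -[leRHS]mulrA; apply: ler_wpM2l.
    by rewrite mulr_ge0 // pi_ge0.
  apply: le_trans (ncD _ _) _; rewrite [leRHS]mulrDl; apply: lerD.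
    by rewrite ncM ler_wpM2l ?nc_ge0 // nc_fst_le.
  apply: le_trans (nc_sum _ _ _) _; rewrite mulr_suml; apply: ler_sum => k _.
  by rewrite ncM ler_wpM2l ?nc_ge0 // nc_snd_le.
apply: (@differentiable_quad _ _ _ _ dfl _ (Num.max 0 K * n.+1%:R ^+ 2)%:C (e / n.+1%:R)%:C).
- apply/linear_bounded_continuous; apply/linear_boundedP; near=> r => h.
  apply: le_trans (bound h) _; rewrite ler_wpM2r //.
  near: r; apply: nbhs_pinfty_ge; apply/complex_realP; by eexists.
- by rewrite ltcR divr_gt0.
- move=> h; rewrite normE_pt lecR ler_pdivlMr // mulrC => hh.
  have := nrm1_le h => h1; have [_] := hK h (le_trans h1 hh).
  rewrite dfE ncE.
  have -> : (Num.max 0 K * n.+1%:R ^+ 2)%:C * (complex.Re `|h|)%:C ^+ 2 =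
      (Num.max 0 K * n.+1%:R ^+ 2 * complex.Re `|h| ^+ 2)%:C by rewrite [RHS]rmorphM rmorphXn.
  move=> h2; rewrite lecR; apply: (le_trans h2).
  have n0 : 0 <= nrm1 h by rewrite addr_ge0 ?nc_ge0 // sumr_ge0 // => *; exact: nc_ge0.
  apply: (@le_trans _ _ (Num.max 0 K * nrm1 h ^+ 2)).
    by rewrite ler_wpM2r ?sqr_ge0 // le_max lexx orbT.
  rewrite -mulrA -exprMn ler_wpM2l ?le_max ?lexx // lerXn2r // nnegrE //.
  exact: le_trans h1.
Unshelve. all: by end_near.
Qed.

End Vector.

Lemma fexp_cder (f g : R[i] * 'cV[R[i]]_1 -> R[i]) (tau z : R[i]) :
  isD (@upper R 1) (wz R 0) f g -> 0 < complex.Im tau ->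
  cder (fun w => f (tau, const_mx w)) z (twopii R * g (tau, const_mx z)).
Proof.
move=> [c [hf hg]] t0; have Up : upper (tau, const_mx z : 'cV[R[i]]_1) by [].
have [K [e [e0 hK]]] := fexp_taylor hf Up.
apply: (@cderI _ _ _ _ K e) => // u ue.
pose h : R[i] * 'cV[R[i]]_1 := (0, const_mx u).
have hn : nrm1 h = nc u by rewrite /nrm1 big_ord1 mxE nc0 add0r.
have := hK h; rewrite hn => /(_ ue) [_].
have -> : (tau, const_mx z) + h = (tau, const_mx (z + u)) :> R[i] * 'cV[R[i]]_1.
  by congr (_, _); [exact: addr0 | apply/matrixP => a b; rewrite !mxE].
have -> : csum (fun i => lin h i * c i * mono (tau, const_mx z) i) = u * g (tau, const_mx z).
  apply: csumE; apply: (eq_has_sum (has_sumZ u (hg _ Up))) => i.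
  by rewrite linE big_ord1 mxE mulr0 add0r /wz; ring.
by rewrite mulrCA.
Qed.

End FexpDerivative.

(** * The Jacobi triple product *)

Section TripleProduct.
Variable R : realType.

Lemma sum_geo_le (r : R) n : 0 <= r -> r < 1 -> \sum_(i < n) r ^+ i <= (1 - r)^-1.
Proof.
move=> r0 r1; have h : 0 < 1 - r by lra.
rewrite -[leRHS]mul1r ler_pdivlMr // mulrC -opprB mulNr -subrX1 opprB.
by rewrite gerBl exprn_ge0.
Qed.

Lemma has_sum_geo (x : R[i]) : nc x < 1 -> has_sum (fun k : nat => x ^+ k) (1 - x)^-1.
Proof.
move=> x1; have b : bsum (fun k : nat => x ^+ k).
  apply: (@bsum_nat _ _ (1 - nc x)^-1) => n.
  under eq_bigr do rewrite ncX.
  by apply: sum_geo_le => //; exact: nc_ge0.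
have h := bsum_has b.
suff -> : (1 - x)^-1 = csum (fun k : nat => x ^+ k) by [].
have x10 : 1 - x != 0.
  by rewrite subr_eq0 eq_sym -(subr_eq0 x) -nc_eq0; apply/eqP => h0; have := nc_lip 1 x; rewrite ncBC h0 nc1; lra.
apply: (mulfI x10); rewrite mulfV //; rewrite mulrBl mul1r; apply/esym.
have hS : has_sum (fun k : nat => if k == 0%N then 0 else x ^+ k) (x * csum (fun k : nat => x ^+ k)).
  apply: (@has_sum_inj _ _ _ S).
  - exact: succn_inj.
  - by case=> [//|k] /(_ k); rewrite eqxx.
  - by apply: (eq_has_sum (has_sumZ x h)) => k /=; rewrite exprS.
have := has_sumB h hS => /(has_sum_unique); apply.
apply: (eq_has_sum (has_sum_single 0%N (1 : R[i]))) => k.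
by case: k => [|k] /=; rewrite ?expr0 ?subr0 ?subrr.
Qed.

Lemma has_sum_finsupp (I : choiceType) (x : I -> R[i]) (A : {fset I}) :
  (forall i, i \notin A -> x i = 0) -> has_sum x (\sum_(i <- A) x i).
Proof.
move=> h; apply/hsP => e e0; exists A => B AB.
rewrite (fsum_split x AB) addrAC subrr add0r big1_fset ?nc0 // => i.
by rewrite inE => /andP[/h].
Qed.

Lemma ratio_bound (u : nat -> R) (K : nat) : (forall l, 0 <= u l) ->
  (forall l, (K <= l)%N -> u l.+1 <= u l / 2) -> exists M, forall n, \sum_(i < n) u i <= M.
Proof.
move=> u0 h; exists (\sum_(i < K) u i + 2 * u K) => n.
have H m : \sum_(i < K + m) u i <= \sum_(i < K) u i + 2 * u K - 2 * u (K + m)%N.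
  elim: m => [|m IH]; first by rewrite addn0; lra.
  rewrite addnS big_ord_recr /=; have := h (K + m)%N (leq_addr _ _).
  by have := u0 (K + m)%N; lra.
apply: (@le_trans _ _ (\sum_(i < K + n) u i)).
  rewrite -(big_mkord xpredT u) -(big_mkord xpredT u) [leRHS](@big_cat_nat _ _ _ n) ?leq_addl //=.
  by rewrite lerDl sumr_ge0.
by apply: le_trans (H n) _; have := u0 (K + n)%N; lra.
Qed.

Lemma pow_small (r s : R) : 0 <= r -> r < 1 -> 0 <= s -> exists K, forall k, (K <= k)%N -> r ^+ k * s <= 2^-1.
Proof.
move=> r0 r1 s0.
have : (fun k => r ^+ k * s) @ \oo --> 0 * s.
  by apply: cvgMl; apply: cvg_expr; rewrite ger0_norm.
rewrite mul0r => /cvgrPdist_lt /(_ 2^-1); rewrite invr_gt0 ltr0n => /(_ isT) [K _ hK].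
exists K => k /hK /=; rewrite sub0r normrN ger0_norm ?mulr_ge0 ?exprn_ge0 //; exact: ltW.
Qed.

(** The summand of theta without the prefactor q^(1/8) zeta^(1/2). *)
Definition thterm (tau z : R[i]) (m : int) : R[i] :=
  expi ((m * (m + 1))%:~R / 2 * tau) * (- expi z) ^ m.

Lemma bsum_int (x : int -> R[i]) : bsum (fun n : nat => x n%:Z) -> bsum (fun n : nat => x (- n.+1%:Z)) -> bsum x.
Proof.
move=> h1 h2.
have b1 : has_sum (fun i : int => if 0 <= i then x i else 0) (csum (fun n : nat => x n%:Z)).
  apply: (@has_sum_inj _ _ _ Posz) => [a b []//|[n|n] h //|]; first by have := h n; rewrite eqxx.
  by apply: (eq_has_sum (bsum_has h1)).
have b2 : has_sum (fun i : int => if 0 <= i then 0 else x i) (csum (fun n : nat => x (- n.+1%:Z))).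
  apply: (@has_sum_inj _ _ _ (fun n : nat => - n.+1%:Z)).
  - by move=> a b /= ab; lia.
  - by move=> i h; case: ifP => // i0; have := h (`|i|.-1)%N; rewrite (_ : - _ = i) ?eqxx //; lia.
  - exact: bsum_has.
by apply: has_bsum (eq_has_sum (has_sumD b1 b2) _) => i /=; case: ifP; rewrite ?addr0 ?add0r.
Qed.

(** The triangular number m (m + 1) / 2 as a natural number. As m (m + 1) is nonnegative for every
    integer, the absolute value changes nothing. *)
Definition tri (m : int) : nat := (`|(m * (m + 1))%R|%N %/ 2)%N.

Lemma triE (m : int) : (2 * tri m)%N%:Z = m * (m + 1).
Proof.
rewrite /tri mulnC divnK.
  by rewrite gez0_abs //; nia.
by rewrite abszM; case: m => n; rewrite dvdn2 oddM; lia.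
Qed.

Lemma tri_neg (n : nat) : tri (- n.+1%:Z) = tri n.
Proof. by have := triE n; have := triE (- n.+1%:Z); lia. Qed.

Lemma tri_succ (n : nat) : tri n.+1 = (tri n + n.+1)%N.
Proof. by have := triE n; have := triE n.+1; lia. Qed.

Lemma thterm_tri tau z m : thterm tau z m = expi tau ^+ tri m * (- expi z) ^ m.
Proof.
have e : (m * (m + 1))%:~R / 2 * tau = (tri m)%:R * tau.
  by rewrite -triE -pmulrn natrM [2 * _]mulrC mulfK.
by rewrite /thterm e expiMn.
Qed.

Lemma nc_expz (x : R[i]) (m : int) : nc (x ^ m) = nc x ^ m.
Proof. by case: m => n; rewrite ?NegzE -?exprnP ?exprnN /= ?ncV ncX. Qed.

Lemma bsum_thterm tau z : 0 < complex.Im tau -> bsum (thterm tau z).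
Proof.
move=> t0; pose r := nc (expi tau).
have r0 : 0 <= r by exact: nc_ge0.
have r1 : r < 1.
  by rewrite /r nc_expi -[ltRHS]expR0 ltr_expR oppr_lt0 mulr_gt0 // mulr_gt0 // pi_gt0.
have half (s : R) : 0 <= s -> exists M, forall n, \sum_(i < n) r ^+ tri i * s ^+ i <= M.
  move=> s0; have [K hK] := pow_small r0 r1 s0.
  apply: (@ratio_bound (fun i : nat => r ^+ tri i * s ^+ i) K) => [l|l Kl]; first by rewrite mulr_ge0 ?exprn_ge0.
  rewrite tri_succ exprD [s ^+ l.+1]exprSr mulrACA ler_wpM2l ?mulr_ge0 ?exprn_ge0 //.
  by apply: hK; exact: leq_trans Kl _.
apply: bsum_int.
- have [M hM] := half (nc (expi z)) (nc_ge0 _); apply: (@bsum_nat _ _ M) => n.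
  by under eq_bigr do rewrite thterm_tri ncM ncX nc_expz ncN -exprnP; exact: hM.
- have i0 : 0 <= (nc (expi z))^-1 by rewrite invr_ge0 nc_ge0.
  have [M hM] := half _ i0.
  apply: (@bsum_nat _ _ ((nc (expi z))^-1 * M)) => n.
  apply: le_trans (ler_wpM2l _ (hM n)); last by rewrite invr_ge0 nc_ge0.
  rewrite mulr_sumr; apply: ler_sum => i _.
  rewrite thterm_tri tri_neg ncM ncX nc_expz ncN -exprnN -exprVn exprS; lra.
Qed.

Section QBinomial.
Variable q : R[i].

(** The Gaussian binomial coefficient, defined by the q-Pascal rule so that no division occurs. *)
Fixpoint qbin (n k : nat) : R[i] := match n, k with
  | _, 0%N => 1
  | 0%N, _.+1 => 0
  | n.+1, k.+1 => qbin n k + q ^+ k.+1 * qbin n k.+1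
  end.

Definition qfact (n : nat) : R[i] := \prod_(j < n) (1 - q ^+ j.+1).

Lemma qbin0 n : qbin n 0 = 1. Proof. by case: n. Qed.

Lemma qbin_small n k : (n < k)%N -> qbin n k = 0.
Proof.
elim: n k => [|n IH] [|k] //= h; rewrite !IH ?mulr0 ?addr0 //; lia.
Qed.

Lemma qfactS n : qfact n.+1 = qfact n * (1 - q ^+ n.+1).
Proof. by rewrite /qfact big_ord_recr. Qed.

Lemma qbin_fact n k : (k <= n)%N -> qbin n k * (qfact k * qfact (n - k)) = qfact n.
Proof.
elim: n k => [|n IH] [|k] kn.
- by rewrite /qfact !big_ord0 !mul1r.
- by [].
- by rewrite qbin0 /qfact big_ord0 subn0 !mul1r.
rewrite subSS [qbin _ _]/= mulrDl {1}qfactS.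
have -> : qbin n k * (qfact k * (1 - q ^+ k.+1) * qfact (n - k)) = qfact n * (1 - q ^+ k.+1).
  by rewrite -(IH k) //; ring.
move: kn; rewrite ltnS leq_eqVlt => /orP[/eqP ->|kn].
  by rewrite qbin_small // mulr0 mul0r addr0 qfactS.
have e : (n - k = (n - k.+1).+1)%N by lia.
have -> : qfact (n - k) = qfact (n - k.+1) * (1 - q ^+ (n - k)) by rewrite {1}e qfactS -e.
have -> : q ^+ k.+1 * qbin n k.+1 * (qfact k.+1 * (qfact (n - k.+1) * (1 - q ^+ (n - k)))) =
  qfact n * (q ^+ k.+1 * (1 - q ^+ (n - k))) by rewrite -(IH k.+1) //; ring.
have -> : q ^+ k.+1 * (1 - q ^+ (n - k)) = q ^+ k.+1 - q ^+ n.+1.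
  by rewrite mulrBr mulr1 -exprD; congr (_ - q ^+ _); lia.
by rewrite qfactS; ring.
Qed.

(** The q-binomial theorem. The factor j = 0 is split off, and the remaining factors are the same
    product at q x. *)
Lemma qbinomial (x : R[i]) n :
  \prod_(j < n) (1 + x * q ^+ j) = \sum_(k < n.+1) q ^+ 'C(k, 2) * qbin n k * x ^+ k.
Proof.
elim: n x => [|n IH] x; first by rewrite big_ord0 big_ord1 qbin0 -[q ^+ _]/(1 : R[i]) -[x ^+ _]/(1 : R[i]) !mulr1.
rewrite big_ord_recl expr0 mulr1.
under eq_bigr => j _ do rewrite lift0 exprS mulrA.
rewrite IH mulrDl mul1r [RHS]big_ord_recl mulr_sumr.
rewrite [X in X + _]big_ord_recl [X in _ + X]big_ord_recr [X in _ = _ + X]big_ord_recr.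
rewrite -!addrA; congr (_ + _); first by rewrite !qbin0.
rewrite addrA -big_split; congr (_ + _).
  apply: eq_bigr => k _; rewrite !lift0 [qbin n.+1 _]/= binS bin1 exprD !exprMn [x ^+ k.+1]exprS [q ^+ k.+1]exprS.
  by rewrite /=; ring.
rewrite !lift0 /= [qbin n n.+1]qbin_small // mulr0 addr0 binS bin1 exprD !exprMn [x ^+ n.+1]exprS.
by ring.
Qed.

End QBinomial.

Lemma has_sum_natfin (x : nat -> R[i]) m : (forall k, (m <= k)%N -> x k = 0) ->
  has_sum x (\sum_(k < m) x k).
Proof.
move=> h; rewrite (_ : \sum_(k < m) x k = \sum_(k <- [fset k in iota 0 m]%fset) x k).
  by apply: has_sum_finsupp => k; rewrite inE /= mem_iota leq0n add0n -leqNgt; exact: h.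
rewrite -(big_mkord xpredT x); apply: perm_big; apply: uniq_perm.
- by rewrite iota_uniq.
- exact: fset_uniq.
- by move=> i; rewrite inE /= /index_iota subn0.
Qed.

Section Products.
Variables (q x : R[i]).
Hypothesis q1 : nc q < 1.

Lemma nc_sub1_ge (y : R[i]) : 1 - nc y <= nc (1 - y).
Proof. by have := nc_lip 1 y; rewrite nc1. Qed.

(** Each factor satisfies 1 / (1 - a r^j) <= 1 + a r^j / (1 - a), which is at most exp(a r^j / (1 -
    a)). *)
Lemma inv_prod_bound (r a : R) N : 0 <= r -> r < 1 -> 0 <= a -> a < 1 ->
  \prod_(j < N) (1 - a * r ^+ j)^-1 <= expR (a / (1 - a) / (1 - r)).
Proof.
move=> r0 r1 a0 a1.
have h (j : nat) : a * r ^+ j <= a by rewrite ler_piMr // exprn_ile1 // ltW.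
have hp (j : nat) : 0 < 1 - a * r ^+ j by have := h j; lra.
apply: (@le_trans _ _ (\prod_(j < N) expR (a / (1 - a) * r ^+ j))).
  apply: ler_prod => j _; rewrite invr_ge0 ltW //=.
  apply: le_trans (expR_ge1Dx _).
  rewrite -[leLHS]mul1r ler_pdivrMr //.
  have rj : 0 <= r ^+ j by exact: exprn_ge0.
  have a1' : 0 < 1 - a by lra.
  have : a / (1 - a) * (1 - a * r ^+ j) >= a.
    by rewrite mulrAC ler_pdivlMr // ler_wpM2l //; have := h j; lra.
  by nra.
rewrite -expR_sum -mulr_sumr ler_expR ler_wpM2l ?divr_ge0 //; first by lra.
exact: sum_geo_le.
Qed.

(** The partial products telescope to 1 minus a series, and its terms are summable because the
    partial products are bounded by exp(M). *)
Lemma prod_cvg (a : nat -> R[i]) (M : R) :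
  (forall n, \sum_(j < n) nc (a j) <= M) ->
  cvg (\prod_(j < n) (1 - a j) @[n --> \oo]).
Proof.
move=> hM; have bnd n : nc (\prod_(j < n) (1 - a j)) <= expR M.
  apply: (@le_trans _ _ (expR (\sum_(j < n) nc (a j)))); last by rewrite ler_expR.
  elim: n => [|n IH]; first by rewrite !big_ord0 expR0 nc1.
  rewrite !big_ord_recr /= ncM expRD; apply: ler_pM; rewrite ?nc_ge0 //.
  apply: le_trans (expR_ge1Dx _); apply: le_trans (ncB _ _) _; by rewrite nc1.
have b : bsum (fun n => (\prod_(j < n) (1 - a j)) * a n).
  apply: (@bsum_nat _ _ (expR M * M)) => n.
  apply: le_trans (ler_wpM2l (expR_ge0 M) (hM n)); rewrite mulr_sumr.
  by apply: ler_sum => j _; rewrite ncM ler_wpM2r ?nc_ge0.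
have := has_sum_series (bsum_has b) => h.
have e n : \prod_(j < n) (1 - a j) = 1 - \sum_(j < n) (\prod_(i < j) (1 - a i)) * a j.
  elim: n => [|n IH]; first by rewrite !big_ord0 subr0.
  by rewrite !big_ord_recr /= [in RHS]opprD addrA -IH; ring.
under eq_fun do rewrite e.
by apply: is_cvgB; [exact: is_cvg_cst | apply/cvg_ex; eexists; exact: h].
Qed.

Lemma qfact_cvg : cvg (qfact q n @[n --> \oo]).
Proof.
apply: (@prod_cvg (fun j => q ^+ j.+1) (nc q / (1 - nc q))) => n.
under eq_bigr do rewrite ncX exprS.
rewrite -mulr_sumr ler_wpM2l ?nc_ge0 //; apply: sum_geo_le => //; exact: nc_ge0.
Qed.

Definition qinf : R[i] := lim (qfact q n @[n --> \oo]).

Lemma qinf_cvg : qfact q n @[n --> \oo] --> qinf.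
Proof. exact: qfact_cvg. Qed.

(** A positive lower bound for all |(q; q)_n|. It keeps the limit away from 0 and bounds the
    Gaussian binomials uniformly in both arguments. *)
Definition qlow : R := expR (- (nc q / (1 - nc q) / (1 - nc q))).

Lemma nc_qfact_ge n : qlow <= nc (qfact q n).
Proof.
rewrite /qlow expRN -[leRHS]invrK lef_pV2 ?posrE ?expR_gt0 ?invr_gt0 //.
  apply: le_trans (inv_prod_bound n (nc_ge0 q) q1 (nc_ge0 q) q1).
  elim: n => [|n IH]; first by rewrite /qfact !big_ord0 nc1 invr1.
  rewrite qfactS big_ord_recr /= ncM invfM; apply: ler_pM; rewrite ?invr_ge0 ?nc_ge0 // lef_pV2 ?posrE.
  - by rewrite -exprS -ncX; exact: nc_sub1_ge.
  - apply: lt_le_trans (nc_sub1_ge _); rewrite subr_gt0 ncX exprn_ilt1 //; exact: nc_ge0.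
  - rewrite subr_gt0 -exprS exprn_ilt1 //; exact: nc_ge0.
rewrite nc_gt0; apply/prodf_neq0 => j _; rewrite -nc_gt0.
apply: lt_le_trans (nc_sub1_ge _); rewrite subr_gt0 ncX exprn_ilt1 //; exact: nc_ge0.
Qed.

Lemma qfact_neq0 n : qfact q n != 0.
Proof. by rewrite -nc_gt0; apply: lt_le_trans (nc_qfact_ge n); exact: expR_gt0. Qed.

Lemma cvg_nc (f : nat -> R[i]) l (M : R) : f @ \oo --> l -> (forall n, M <= nc (f n)) -> M <= nc l.
Proof.
move=> /nat_ccvgP h hM; apply/ler_addgt0Pr => e /h [N /(_ N (leqnn N)) hN].
by have := nc_lip (f N) l; have := hM N; lra.
Qed.

Lemma qinf_neq0 : qinf != 0.
Proof. by rewrite -nc_gt0; apply: lt_le_trans (cvg_nc qinf_cvg nc_qfact_ge); exact: expR_gt0. Qed.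

Lemma nc_qfact_le n : nc (qfact q n) <= expR (nc q / (1 - nc q)).
Proof.
apply: (@le_trans _ _ (expR (\sum_(j < n) nc q * nc q ^+ j))); last first.
  rewrite ler_expR -mulr_sumr ler_wpM2l ?nc_ge0 //; apply: sum_geo_le => //; exact: nc_ge0.
elim: n => [|n IH]; first by rewrite /qfact !big_ord0 expR0 nc1.
rewrite qfactS big_ord_recr /= ncM expRD; apply: ler_pM; rewrite ?nc_ge0 //.
by apply: le_trans (expR_ge1Dx _); apply: le_trans (ncB _ _) _; rewrite nc1 ncX exprS.
Qed.

Lemma nc_qbin_le n k : nc (qbin q n k) <= expR (nc q / (1 - nc q)) / (qlow * qlow).
Proof.
have l0 : 0 < qlow by exact: expR_gt0.
have [kn|kn] := leqP k n; last first.
  by rewrite qbin_small // nc0 divr_ge0 ?expR_ge0 ?mulr_ge0 ?ltW.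
rewrite ler_pdivlMr ?mulr_gt0 //; apply: le_trans (nc_qfact_le n).
rewrite -(qbin_fact q kn) !ncM ler_wpM2l ?nc_ge0 //.
by apply: ler_pM; [exact: ltW | exact: ltW | exact: nc_qfact_ge | exact: nc_qfact_ge].
Qed.

End Products.

Lemma thterm_succ tau z m : thterm tau z (m + 1) = thterm tau z m * - expi (z + (m + 1)%:~R * tau).
Proof.
rewrite /thterm expfzDr ?oppr_eq0 ?expi_neq0 // expr1z expiD.
have -> : ((m + 1) * (m + 1 + 1))%:~R / 2 * tau = (m * (m + 1))%:~R / 2 * tau + (m + 1)%:~R * tau.
  have -> : (m + 1) * (m + 1 + 1) = m * (m + 1) + 2 * (m + 1) by ring.
  by rewrite !(intrD, intrM); field.
by rewrite expiD; ring.
Qed.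

Lemma thterm0 tau z : thterm tau z 0 = 1.
Proof. by rewrite thterm_tri expr0z mulr1 (_ : tri 0 = 0%N) // expr0. Qed.

(** With w(m) = - zeta q^m, multiplying 1 - q^j / zeta by w(-j) gives 1 + w(-j). After
    multiplication by the product [C] of these units, both families of factors form one product of
    2N consecutive factors, to which the q-binomial theorem applies. *)
Lemma finite_triple tau z N :
  \prod_(j < N) ((1 - expi tau ^+ j.+1 * expi z) * (1 - expi tau ^+ j / expi z)) =
  \sum_(k < (N + N).+1) qbin (expi tau) (N + N) k * thterm tau z (k%:Z - N%:Z).
Proof.
pose w (m : int) := - expi (z + m%:~R * tau).
pose C := \prod_(j < N) w (- j%:Z).
have w0 m : w m != 0 by rewrite oppr_eq0 expi_neq0.
have C0 : C != 0 by apply/prodf_neq0.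
have wS m (j : nat) : w m * expi tau ^+ j = w (m + j%:Z).
  by rewrite /w mulNr -expiMn -expiD -addrA -mulrDl intrD -pmulrn.
have hC : C * thterm tau z (- N%:Z) = 1.
  rewrite /C; elim: N {C C0} => [|N IH].
    by rewrite big_ord0 mul1r (_ : - 0%:Z = 0) // thterm0.
  rewrite big_ord_recr /= -mulrA -[RHS]IH; congr (_ * _).
  have := thterm_succ tau z (- N.+1%:Z); rewrite (_ : - N.+1%:Z + 1 = - N%:Z); last by lia.
  by move=> ->; rewrite mulrC.
apply: (mulfI C0).
have -> : C * \prod_(j < N) ((1 - expi tau ^+ j.+1 * expi z) * (1 - expi tau ^+ j / expi z)) =
    \prod_(j < N + N) (1 + w (1 - N%:Z) * expi tau ^+ j).
  rewrite big_split_ord big_split /= mulrCA mulrC; congr (_ * _); last first.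
    apply: eq_bigr => j _; rewrite wS (_ : 1 - N%:Z + (N + j)%N = j.+1); last by lia.
    by rewrite /w -pmulrn expiD expiMn mulrC.
  rewrite /C -big_split [RHS](reindex_inj rev_ord_inj); apply: eq_bigr => j _ /=.
  rewrite wS (_ : 1 - N%:Z + (N - j.+1)%N = - j%:Z); last by have := ltn_ord j; lia.
  have -> : w (- j%:Z) = - (expi z / expi tau ^+ j) by rewrite /w mulrNz mulNr expiB -pmulrn expiMn.
  by field; rewrite expi_neq0 expf_neq0 ?expi_neq0.
rewrite qbinomial mulr_sumr; apply: eq_bigr => k _.
have -> : expi tau ^+ 'C(k, 2) * qbin (expi tau) (N + N) k * w (1 - N%:Z) ^+ k =
  qbin (expi tau) (N + N) k * (expi tau ^+ 'C(k, 2) * w (1 - N%:Z) ^+ k) by ring.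
rewrite [RHS]mulrCA; congr (_ * _); elim: (nat_of_ord k) => [|m IH].
  by rewrite sub0r hC bin0n !expr0 mulr1.
rewrite binS bin1 exprD exprS.
have -> : expi tau ^+ 'C(m, 2) * expi tau ^+ m * (w (1 - N%:Z) * w (1 - N%:Z) ^+ m) =
  (expi tau ^+ 'C(m, 2) * w (1 - N%:Z) ^+ m) * (w (1 - N%:Z) * expi tau ^+ m) by ring.
rewrite IH wS -mulrA.
congr (_ * _); rewrite (_ : m.+1%:Z - N%:Z = m%:Z - N%:Z + 1); last by lia.
rewrite thterm_succ /w (_ : 1 - N%:Z + m%:Z = m%:Z - N%:Z + 1) //.
by lia.
Qed.

Lemma cvg_sub (f : nat -> R[i]) (l : R[i]) (g : nat -> nat) : f @ \oo --> l ->
  (forall B, exists N, forall n, (N <= n)%N -> (B <= g n)%N) -> (f \o g) @ \oo --> l.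
Proof.
move=> /nat_ccvgP h hg; apply/nat_ccvgP => e /h [B hB]; have [N hN] := hg B.
by exists N => n /hN /hB.
Qed.

Lemma nc_expi_lt1 (tau : R[i]) : 0 < complex.Im tau -> nc (expi tau) < 1.
Proof.
by move=> t0; rewrite nc_expi -[ltRHS]expR0 ltr_expR oppr_lt0 mulr_gt0 // mulr_gt0 // pi_gt0.
Qed.

(** The limit of the finite identity: the Gaussian binomial of (2N, N + m) tends to 1 over the Euler
    product for fixed m and is bounded uniformly, so [tannery] applies. *)
Lemma triple_product tau z : 0 < complex.Im tau ->
  \prod_(j < N) ((1 - expi tau ^+ j.+1 * expi z) * (1 - expi tau ^+ j / expi z)) @[N --> \oo]
  --> csum (thterm tau z) / qinf (expi tau).
Proof.
move=> t0; set q := expi tau; have q1 : nc q < 1 := nc_expi_lt1 t0.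
(* The finite sum re-indexed by m = k - N. Below -N the value is set to 0; above N the Gaussian
   binomial vanishes by itself. *)
pose y N (m : int) := if 0 <= m + N%:Z then qbin q (N + N) (absz (m + N%:Z)) * thterm tau z m else 0.
have hy N : csum (y N) = \prod_(j < N) ((1 - q ^+ j.+1 * expi z) * (1 - q ^+ j / expi z)).
  rewrite finite_triple; apply: csumE.
  apply: (@has_sum_inj _ _ _ (fun k : nat => k%:Z - N%:Z)).
  - by move=> a b /= ab; lia.
  - move=> m h; rewrite /y; case: ifP => // m0.
    by have := h (absz (m + N%:Z)); rewrite (_ : _ - _ = m) ?eqxx //=; lia.
  - have yE (k : nat) : y N (k%:Z - N%:Z) = qbin q (N + N) k * thterm tau z (k%:Z - N%:Z).
      by rewrite /y subrK.
    rewrite (_ : \sum_(k < _) _ = \sum_(k < (N + N).+1) y N (k%:Z - N%:Z)); last first.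
      by apply: eq_bigr => k _; rewrite yE.
    apply: (@has_sum_natfin (fun k => y N (k%:Z - N%:Z))) => k hk.
    by rewrite yE qbin_small // mul0r.
have [M hM] := bsum_thterm z t0.
pose K := expR (nc q / (1 - nc q)) / (qlow q * qlow q).
have K0 : 0 <= K by rewrite divr_ge0 ?expR_ge0 ?mulr_ge0 ?expR_ge0.
have [A|N m|m|_] := @tannery R _ y (fun m => (qinf q)^-1 * thterm tau z m) (fun m => K * nc (thterm tau z m)) (K * M).
- by rewrite -mulr_sumr ler_wpM2l.
- rewrite /y; case: ifP => _; last by rewrite nc0 mulr_ge0 ?nc_ge0.
  by rewrite ncM ler_wpM2r ?nc_ge0 // nc_qbin_le.
- have h1 : (fun N => qfact q (N + N) / (qfact q (absz (m + N%:Z)) * qfact q (absz (N%:Z - m))) * thterm tau z m) @ \oo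
      --> qinf q / (qinf q * qinf q) * thterm tau z m.
    have i0 := qinf_neq0 q1.
    apply: cvgMl; apply: cvgM; first by apply: (cvg_sub (g := fun N => (N + N)%N) (qinf_cvg q1)) => B; exists B => n; lia.
    apply: cvgV; first by rewrite mulf_neq0.
    apply: cvgM; [apply: (cvg_sub (g := fun N => (absz (m + N%:Z))) (qinf_cvg q1))|apply: (cvg_sub (g := fun N => (absz (N%:Z - m))) (qinf_cvg q1))];
      by move=> B; exists (B + `|m|)%N => n; lia.
  have -> : (qinf q)^-1 = qinf q / (qinf q * qinf q) by have := qinf_neq0 q1 => i0; field.
  apply: cvg_trans h1; apply: near_eq_cvg; exists `|m|%N => // N /= hN.
  rewrite /y ifT; last by lia.
  congr (_ * _); have hm : (absz (m + N%:Z)%R <= N + N)%N by lia.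
  rewrite -(qbin_fact q hm) (_ : (N + N - absz (m + N%:Z)%R) = absz (N%:Z - m)%R)%N; last by lia.
  by rewrite mulfK // mulf_neq0 // qfact_neq0.
under eq_fun do rewrite hy.
by rewrite (csumE (has_sumZ (qinf q)^-1 (bsum_has (bsum_thterm z t0)))) mulrC.
Qed.

End TripleProduct.

(** * Nonnegative coefficients and inverses of infinite products *)

Section Nonneg.
Variable R : realType.

Lemma ge0_ReIm (x : R[i]) : (0 <= x) = (complex.Im x == 0) && (0 <= complex.Re x).
Proof. by rewrite lecE. Qed.

Lemma nc_ge0E (x : R[i]) : 0 <= x -> (nc x)%:C = x.
Proof. by move=> x0; rewrite -ncE ger0_norm. Qed.

Lemma realcM (a b : R) : (a * b)%:C = a%:C * b%:C. Proof. exact: rmorphM. Qed.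

Lemma realc_sum (I : Type) (s : seq I) (F : I -> R) : (\sum_(i <- s) F i)%:C = \sum_(i <- s) (F i)%:C.
Proof. exact: rmorph_sum. Qed.

Lemma has_sum_ge0 (I : choiceType) (x : I -> R[i]) l : has_sum x l -> (forall i, 0 <= x i) -> 0 <= l.
Proof.
move=> /hsP h x0; rewrite ge0_ReIm.
have key (e : R) : 0 < e -> `|complex.Im l| < e /\ - e < complex.Re l.
  move=> e0; have [A /(_ A (fsubset_refl A)) hA] := h e e0.
  have : 0 <= \sum_(i <- A) x i by rewrite sumr_ge0.
  rewrite ge0_ReIm; move: hA; move: (\sum_(i <- A) x i) => S hA /andP[/eqP i0 r0].
  have hi := le_lt_trans (nc_Im _) hA; have hr := le_lt_trans (nc_Re _) hA.
  move: hi hr; case: S i0 r0 {hA} => a b /= -> a0; case: l {h} => c d /=.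
  by rewrite sub0r normrN => h1; rewrite ltr_norml => /andP[h2 h3]; split => //; lra.
apply/andP; split.
  rewrite -normr_le0; apply/ler_addgt0Pr => e /key [/ltW]; by rewrite add0r.
apply/ler_addgt0Pr => e /key [_]; lra.
Qed.

Lemma has_sum_ge (I : choiceType) (x : I -> R[i]) l (A : {fset I}) : has_sum x l ->
  (forall i, 0 <= x i) -> \sum_(i <- A) x i <= l.
Proof.
move=> h x0; rewrite -subr_ge0.
have h1 : has_sum (fun i => if i \in A then x i else 0) (\sum_(i <- A) x i).
  rewrite big_seq big_mkcond; apply: has_sum_finsupp => i /negPf -> //.
apply: (has_sum_ge0 (has_sumB h h1)) => i.
by case: ifP => _; rewrite ?subrr ?subr0.
Qed.

Lemma has_sum_term (I : choiceType) (x : I -> R[i]) l i0 : has_sum x l ->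
  (forall i, 0 <= x i) -> x i0 <= l.
Proof. by move=> h x0; have := has_sum_ge [fset i0]%fset h x0; rewrite big_seq_fset1. Qed.

Lemma gcoef_has n (I : choiceType) (e : I -> nat * 'cV[int]_n) (c : I -> R[i]) (p : R[i] * 'cV[R[i]]_n) j :
  bsum (fun i => c i * mono p (e i)) ->
  has_sum (fun i => if e i == j then c i else 0) (gcoef e c j).
Proof.
move=> h; apply: bsum_has; apply: (bsum_le (K := (nc (mono p j))^-1) h) => i.
case: eqP => [<-|_]; last by rewrite nc0 mulr_ge0 ?invr_ge0 ?nc_ge0.
by rewrite ncM mulrCA mulVf ?mulr1 // nc_eq0 mono_neq0.
Qed.

End Nonneg.

Arguments gcoef_has {R n I e c p} j _.
Arguments has_sum_term {R I x l} i0 _ _.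
Arguments has_sum_ge {R I x l} A _ _.

Section InverseProduct.
Variables (R : realType) (n : nat).
Local Notation pt := (R[i] * 'cV[R[i]]_n)%type.
Local Notation idx := (nat * 'cV[int]_n)%type.
Variables (e : nat -> idx) (U : set pt).
Hypothesis U_imp : forall p, U p -> U (imp p).
Hypothesis U_small : forall p, U p -> exists a r : R, [/\ 0 <= a, a < 1, 0 <= r, r < 1 &
  forall j, nc (mono p (e j)) <= a * r ^+ j].

Definition invprod N (p : pt) : R[i] := \prod_(j < N) (1 - mono p (e j))^-1.

Definition idxM (k : nat) (i : idx) : idx := ((k * i.1)%N, i.2 *+ k).

Lemma mono_idxM (p : pt) k i : mono p (idxM k i) = mono p i ^+ k.
Proof.
rewrite !monoE -expiMn !linE; congr expi; rewrite mulrDr natrM mulrA mulr_sumr; congr (_ + _).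
apply: eq_bigr => j _; have -> : ((idxM k i).2 j 0)%:~R = k%:R * (i.2 j 0)%:~R :> R[i].
  by rewrite mulmxnE -[_ *+ k]mulr_natr natz intrM -pmulrn mulrC.
by rewrite !mulrA.
Qed.

Lemma nc_mono_lt1 p j : U p -> nc (mono p (e j)) < 1.
Proof.
move=> /U_small [a [r [a0 a1 r0 r1 h]]]; apply: le_lt_trans (h j) _.
by apply: le_lt_trans a1; rewrite ler_piMr // exprn_ile1 // ltW.
Qed.

Definition facoef j : idx -> R[i] := gcoef (fun k : nat => idxM k (e j)) (fun=> 1).

Lemma fac_gen j p : U p -> has_sum (fun k : nat => 1 * mono p (idxM k (e j))) (1 - mono p (e j))^-1.
Proof.
move=> Up; apply: (eq_has_sum (has_sum_geo (nc_mono_lt1 j Up))) => k.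
by rewrite mono_idxM mul1r.
Qed.

Arguments fac_gen j {p} _.

Lemma fac_fexp j : fexp U (fun p => (1 - mono p (e j))^-1) (facoef j).
Proof. by apply: gexp => p Up; exact: fac_gen. Qed.

Arguments fac_fexp j : clear implicits.

Fixpoint ipcoef N : idx -> R[i] := if N is N'.+1 then mulcoef (ipcoef N') (facoef N')
  else fun i => (i == (0%N, 0))%:R.

Lemma mono_idx0 (p : pt) : mono p (0%N, 0) = 1.
Proof.
rewrite monoE linE mul0r add0r big1 ?expi0 // => k _.
by rewrite mxE mul0r mul0r.
Qed.

Lemma ip_fexp N : fexp U (invprod N) (ipcoef N).
Proof.
elim: N => [|N IH] p Up.
  rewrite /invprod big_ord0; apply: (eq_has_sum (has_sum_single (0%N, 0) (1 : R[i]))) => i /=.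
  by have [->|_] := eqVneq i (0%N, 0); rewrite ?mul0r // mono_idx0 mulr1.
rewrite /invprod big_ord_recr; exact: (fexpM IH (fac_fexp N) Up).
Qed.

Arguments ip_fexp N : clear implicits.

Hypothesis U_ne : exists p, U p.

Lemma facoef_ge0 j i : 0 <= facoef j i.
Proof.
have [p Up] := U_ne; apply: (has_sum_ge0 (gcoef_has _ (has_bsum (fac_gen j Up)))) => k.
by case: ifP => _; rewrite ?ler01.
Qed.

Lemma facoef_ge1 j : 1 <= facoef j (0%N, 0).
Proof.
have [p Up] := U_ne; have h := has_sum_term 0%N (gcoef_has (0%N, 0) (has_bsum (fac_gen j Up))).
apply: le_trans (h _) => [|k]; last by case: ifP => _; rewrite ?ler01.
by rewrite {1}/idxM mul0n mulr0n eqxx.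
Qed.

Lemma ipcoef_ge0 N i : 0 <= ipcoef N i.
Proof.
elim: N i => [|N IH] i; first by rewrite /= ler0n.
have [p Up] := U_ne; have h := fexpM_gen (ip_fexp N) (fac_fexp N) Up.
apply: (has_sum_ge0 (gcoef_has i (has_bsum h))) => ij.
by case: ifP => _ //; rewrite mulr_ge0 // facoef_ge0.
Qed.

Lemma ipcoef_le N i : ipcoef N i <= ipcoef N.+1 i.
Proof.
have [p Up] := U_ne; have h := fexpM_gen (ip_fexp N) (fac_fexp N) Up.
have h1 := has_sum_term (i, (0%N, 0)) (gcoef_has i (has_bsum h)).
apply: le_trans (h1 _) => [|ij]; last first.
  by case: ifP => _ //; rewrite mulr_ge0 ?ipcoef_ge0 // facoef_ge0.
rewrite {1}/idxD addn0 addr0 -surjective_pairing eqxx.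
by rewrite ler_peMr ?ipcoef_ge0 // facoef_ge1.
Qed.

(** At [imp p] the series of the partial product has nonnegative terms, and their sum is the partial
    product itself, which [inv_prod_bound] bounds independently of N. *)
Lemma ip_bound p : U p -> exists B : R, forall N (A : {fset idx}),
  \sum_(i <- A) nc (ipcoef N i * mono p i) <= B.
Proof.
move=> Up; have [a [r [a0 a1 r0 r1 h]]] := U_small Up.
exists (expR (a / (1 - a) / (1 - r))) => N A.
have hs := ip_fexp N _ (U_imp Up).
have t0 i : 0 <= ipcoef N i * mono (imp p) i.
  by rewrite mulr_ge0 ?ipcoef_ge0 // mono_imp lecR nc_ge0.
have := has_sum_ge A hs t0.
have -> : \sum_(i <- A) ipcoef N i * mono (imp p) i = (\sum_(i <- A) nc (ipcoef N i * mono p i))%:C.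
  rewrite realc_sum; apply: eq_bigr => i _; rewrite mono_imp ncM realcM; congr (_ * _).
  by rewrite nc_ge0E // ipcoef_ge0.
rewrite lecE => /andP[_ /=] /le_trans; apply.
apply: le_trans (ler_norm _) _; apply: le_trans (nc_Re _) _.
apply: le_trans (inv_prod_bound N r0 r1 a0 a1).
rewrite /invprod; elim: N {hs t0} => [|N IH]; first by rewrite !big_ord0 nc1.
rewrite !big_ord_recr /= ncM; apply: ler_pM; rewrite ?nc_ge0 // ncV lef_pV2 ?posrE.
- apply: le_trans (nc_sub1_ge _); rewrite lerD2l lerN2 mono_imp nc_real ger0_norm ?nc_ge0 //.
- apply: lt_le_trans (nc_sub1_ge _); rewrite subr_gt0; exact: nc_mono_lt1 (U_imp Up).
- rewrite subr_gt0; apply: le_lt_trans a1; by rewrite ler_piMr // exprn_ile1 // ltW.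
Qed.

(** Every factor is a geometric series with nonnegative coefficients and constant term at least 1,
    so the coefficients of the partial products increase with N. They are bounded by [ip_bound],
    hence converge, and the limit dominates all stages, as [tannery] requires. *)
Lemma ip_limit : exists c : idx -> R[i], [/\ forall i, (fun N => ipcoef N i) @ \oo --> c i,
   forall N i, nc (ipcoef N i) <= nc (c i), absconv U c &
   forall p, U p -> (fun N => invprod N p) @ \oo --> csum (fun i => c i * mono p i)].
Proof.
pose a N i := complex.Re (ipcoef N i).
have aE N i : ipcoef N i = (a N i)%:C by rewrite RRe_real // ger0_real // ipcoef_ge0.
have a0 N i : 0 <= a N i by have := ipcoef_ge0 N i; rewrite aE ler0c.
have ale i : {homo (fun N => a N i) : N M / (N <= M)%N >-> N <= M}.
  apply: homo_leq => [//|x y z xy yz|N]; first exact: le_trans xy yz.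
  by have := ipcoef_le N i; rewrite !aE lecR.
have acvg i : cvgn (fun N => a N i).
  apply: nondecreasing_is_cvgn; first exact: ale.
  have [p Up] := U_ne; have [B hB] := ip_bound Up.
  exists (B / nc (mono p i)) => _ [N _ <-]; rewrite ler_pdivlMr ?nc_gt0 ?mono_neq0 //.
  have := hB N [fset i]%fset; rewrite big_seq_fset1 ncM aE nc_real ger0_norm //.
pose c i : R[i] := (limn (fun N => a N i))%:C.
have c0 i : 0 <= c i by rewrite ler0c; apply: limr_ge => //; exact: nearW.
have cc i : (fun N => ipcoef N i) @ \oo --> c i.
  apply/nat_ccvgP => x x0; have /cvgrPdist_lt /(_ x x0) [N _ hN] := acvg i.
  by exists N => k /hN /=; rewrite aE -rmorphB nc_real distrC.
have cle N i : nc (ipcoef N i) <= nc (c i).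
  rewrite aE !nc_real ger0_norm // ger0_norm; last first.
    by apply: limr_ge => //; apply: nearW.
  by apply: nondecreasing_cvgn_le => //; exact: ale.
have cb p : U p -> exists B : R, forall A : {fset idx}, \sum_(i <- A) nc (c i) * nc (mono p i) <= B.
  move=> Up; have [B hB] := ip_bound Up; exists B => A.
  have : (fun N => \sum_(i <- A) ipcoef N i * (nc (mono p i))%:C) @ \oo --> \sum_(i <- A) c i * (nc (mono p i))%:C.
    by apply: cvg_big => [|i _]; [exact: add_continuous | apply: cvgMl; exact: cc].
  have -> : \sum_(i <- A) c i * (nc (mono p i))%:C = (\sum_(i <- A) nc (c i) * nc (mono p i))%:C.
    rewrite realc_sum; apply: eq_bigr => i _; by rewrite realcM [in RHS]nc_ge0E.
  move=> /nat_ccvgP h; apply/ler_addgt0Pr => x /h [N /(_ N (leqnn N))].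
  have -> : \sum_(i <- A) ipcoef N i * (nc (mono p i))%:C = (\sum_(i <- A) nc (ipcoef N i * mono p i))%:C.
    by rewrite realc_sum; apply: eq_bigr => i _; rewrite ncM realcM [in RHS]nc_ge0E // ipcoef_ge0.
  rewrite -rmorphB nc_real ltr_norml => /andP[h1 _].
  by have := hB N A; lra.
exists c; split=> // [p Up|p Up].
  by have [B hB] := cb _ Up; exists B => A; under eq_bigr do rewrite ncM.
have [B hB] := cb _ Up.
have [||_] := @tannery R _ (fun N i => ipcoef N i * mono p i) (fun i => c i * mono p i) _ _ hB.
- by move=> N i; rewrite ncM ler_wpM2r ?nc_ge0.
- by move=> i; apply: cvgMl; exact: cc.
apply: cvg_trans; apply: near_eq_cvg; apply: nearW => N.
by rewrite (csumE (ip_fexp N _ Up)).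
Qed.

End InverseProduct.

Arguments ip_fexp {R n e U} U_small N : rename.
Arguments fac_fexp {R n e U} U_small j : rename.

Global Opaque has_sum csum.

(** * The inverse Euler product and its logarithmic derivative *)

Section EulerInverse.
Variable R : realType.
Local Notation pt := (R[i] * 'cV[R[i]]_1)%type.
Local Notation idx := (nat * 'cV[int]_1)%type.
Implicit Types (p : pt).

Lemma mono_q n (p : R[i] * 'cV[R[i]]_n) m : mono p (m, 0) = expi p.1 ^+ m.
Proof.
rewrite monoE linE big1 ?addr0 ?expiMn // => k _.
by rewrite mxE mul0r mul0r.
Qed.

Lemma nc_le_mul3 (a b b' c : R[i]) : nc b <= nc b' -> nc (a * b * c) <= nc (a * b' * c).
Proof. by move=> h; rewrite !ncM ler_wpM2r ?nc_ge0 // ler_wpM2l ?nc_ge0. Qed.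

Definition eul (j : nat) : idx := (j.+1, 0).

Lemma upper_imp n (p : R[i] * 'cV[R[i]]_n) : upper p -> upper (imp p).
Proof. by rewrite /upper /= mul0r mul1r add0r. Qed.

Lemma eul_small p : upper p -> exists a r : R, [/\ 0 <= a, a < 1, 0 <= r, r < 1 &
  forall j, nc (mono p (eul j)) <= a * r ^+ j].
Proof.
move=> Up; have q1 := nc_expi_lt1 Up; have q0 := nc_ge0 (expi p.1).
exists (nc (expi p.1)), (nc (expi p.1)); split=> // j.
by rewrite mono_q ncX exprS.
Qed.

Lemma upper_ne n : exists p : R[i] * 'cV[R[i]]_n, upper p.
Proof. by exists ('i, 0); exact: upper_i. Qed.

Definition tinv p : R[i] := (qinf (expi p.1))^-1.

Lemma invprod_eul N p : invprod eul N p = (qfact (expi p.1) N)^-1.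
Proof.
rewrite /invprod /qfact; elim: N => [|N IH]; first by rewrite !big_ord0 invr1.
by rewrite !big_ord_recr /= invfM IH mono_q.
Qed.

Lemma eul_limit : exists c : idx -> R[i], [/\ fexp (@upper R 1) tinv c,
  forall i, (fun N => ipcoef R eul N i) @ \oo --> c i &
  forall N i, nc (ipcoef R eul N i) <= nc (c i)].
Proof.
have [c [h1 h2 h3 h4]] := ip_limit (fun p => @upper_imp 1 p) eul_small (upper_ne 1).
exists c; split; [move=> p Up|exact: h1|exact: h2]; have := bsum_has (h3 _ Up).
have -> : csum (fun i => c i * mono p i) = tinv p; last by [].
apply: ccvg_unique (h4 _ Up) _.
under eq_fun do rewrite invprod_eul.
have q1 := nc_expi_lt1 Up.
by apply: cvgV; [exact: qinf_neq0 | exact: qinf_cvg].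
Qed.

Lemma isD_cst n U (w : nat * 'cV[int]_n -> R[i]) (a : R[i]) : w (0%N, 0) = 0 -> isD U w (fun _ : R[i] * 'cV[R[i]]_n => a) (fun=> 0).
Proof.
move=> w0; exists (fun i => if i == (0%N, 0) then a else 0); split=> p _.
  apply: (eq_has_sum (has_sum_single (0%N, 0) a)) => i.
  by case: eqP => [->|_]; rewrite ?mul0r // mono_q expr0 mulr1.
apply: (eq_has_sum (has_sum0 R _)) => i.
by case: eqP => [->|_]; rewrite ?w0 ?mulr0 ?mul0r.
Qed.

Lemma isD_mono n U (w : nat * 'cV[int]_n -> R[i]) j : isD U w (fun p : R[i] * 'cV[R[i]]_n => mono p j) (fun p : R[i] * 'cV[R[i]]_n => w j * mono p j).
Proof.
exists (fun i => (i == j)%:R); split=> p _.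
  apply: (eq_has_sum (has_sum_single j (mono p j))) => i.
  by case: eqP => [->|_]; rewrite ?mul1r ?mul0r.
apply: (eq_has_sum (has_sum_single j (w j * mono p j))) => i.
by case: eqP => [->|_]; rewrite ?mulr1 ?mulr0 ?mul0r.
Qed.

Lemma isD_eq n U (w : nat * 'cV[int]_n -> R[i]) f g f' g' : isD U w f g -> (forall p : R[i] * 'cV[R[i]]_n, U p -> f p = f' p) ->
  (forall p : R[i] * 'cV[R[i]]_n, U p -> g p = g' p) -> isD U w f' g'.
Proof.
move=> [c [h1 h2]] e1 e2; exists c; split; [exact: fexp_eq h1 e1 | exact: fexp_eq h2 e2].
Qed.

(** A derivative exists by [isD_ex]; its value is read off by differentiating the identity (1 -
    x)^-1 (1 - x) = 1 and comparing through [isD_unique]. *)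
Lemma isD_fac j : isD (@upper R 1) (wq R (n:=1)) (fun p => (1 - mono p (eul j))^-1)
  (fun p => (1 - mono p (eul j))^-1 * (j.+1%:R * mono p (eul j) / (1 - mono p (eul j)))).
Proof.
have [g [hg _]] := isD_ex (good_wq R 1) (fac_fexp eul_small j).
have h1 : isD (@upper R 1) (wq R (n:=1)) (fun p => 1 - mono p (eul j)) (fun p => 0 - j.+1%:R * mono p (eul j)).
  have := isDD (isD_cst (@upper R 1) 1 (erefl : wq R (0%N, 0) = 0))
    (isDZ (-1) (isD_mono (@upper R 1) (wq R (n:=1)) (eul j))).
  by move/isD_eq; apply=> p _; rewrite mulN1r.
have neq p : upper p -> 1 - mono p (eul j) != 0.
  move=> Up; rewrite -nc_gt0; apply: lt_le_trans (nc_sub1_ge _).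
  by rewrite subr_gt0; exact: nc_mono_lt1 eul_small _ _ Up.
have := isDM (@additive_wq R 1) hg h1 => h2.
have h3 : isD (@upper R 1) (wq R (n:=1)) (fun p => (1 - mono p (eul j))^-1 * (1 - mono p (eul j))) (fun=> 0).
  apply: (isD_eq (isD_cst (@upper R 1) 1 (erefl : wq R (0%N, 0) = 0))) => // p Up.
  by rewrite mulVf // neq.
have e := isD_unique h2 h3.
apply: (isD_eq hg) => // p Up; have := e p Up; have := neq p Up.
move: (g p) (mono p _) => G M M0 /eqP; rewrite addr_eq0 sub0r mulrN opprK => /eqP eG.
by apply: (mulIf M0); rewrite eG; field.
Qed.

Definition sigN N p : R[i] := \sum_(j < N) j.+1%:R * mono p (eul j) / (1 - mono p (eul j)).

Lemma isD_invprod N : isD (@upper R 1) (wq R (n:=1)) (invprod eul N) (fun p => invprod eul N p * sigN N p).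
Proof.
elim: N => [|N IH].
  apply: (isD_eq (isD_cst (@upper R 1) 1 (erefl : wq R (0%N, 0) = 0))) => p _.
    by rewrite /invprod big_ord0.
  by rewrite /sigN big_ord0 mulr0.
apply: (isD_eq (isDM (@additive_wq R 1) IH (isD_fac N))) => p _.
  by rewrite /invprod big_ord_recr.
by rewrite /invprod /sigN !big_ord_recr /=; ring.
Qed.

Definition sig (tau : R[i]) : R[i] := csum (fun m : nat => (sigma1 m.+1)%:R * expi tau ^+ m.+1).

Lemma nat_expR_le (t : R) (m : nat) : 0 < t -> m%:R <= t^-1 * expR (t * m%:R).
Proof.
move=> t0; rewrite ler_pdivlMl //; apply: le_trans (expR_ge1Dx _).
by rewrite lerDr.
Qed.

(** With s = |q|^(1/2) and n the exponent, the term is at most n s^(2n), which is at most a constant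
    times s^n because n <= exp(a n) / a; finally s^n is bounded by a product of two geometric
    terms. *)
Lemma sig_family (tau : R[i]) : 0 < complex.Im tau ->
  bsum (fun jk : nat * nat => jk.1.+1%:R * expi tau ^+ (jk.1.+1 * jk.2.+1)).
Proof.
move=> t0; pose a := pi * complex.Im tau.
have a0 : 0 < a by rewrite mulr_gt0 ?pi_gt0.
have t20 : 0 < complex.Im (tau / 2).
  have -> : tau / 2 = 2^-1%:C * tau by rewrite mulrC fmorphV rmorph_nat.
  by rewrite Im_real_mul mulr_gt0.
have s1 := nc_expi_lt1 t20; have s0 := nc_ge0 (expi (tau / 2)).
have b := has_bsum (has_sumM (has_sum_geo s1) (has_sum_geo s1)).
apply: (bsum_le (K := a^-1) b) => -[j k] /=; set m := (j.+1 * k.+1)%N.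
have qE : expi tau = expi (tau / 2) ^+ 2 by rewrite -expiMn mulrC divfK.
rewrite ncM nc_nat qE -exprM ncX.
have sE : nc (expi (tau / 2)) = expR (- a).
  rewrite nc_expi /a (_ : tau / 2 = 2^-1%:C * tau); last by rewrite mulrC fmorphV rmorph_nat.
  by rewrite Im_real_mul; congr expR; field.
apply: (@le_trans _ _ (m%:R * nc (expi (tau / 2)) ^+ (2 * m))).
  by rewrite ler_wpM2r ?exprn_ge0 // ler_nat leq_pmulr.
have h : m%:R * nc (expi (tau / 2)) ^+ (2 * m) <= a^-1 * nc (expi (tau / 2)) ^+ m.
  rewrite mul2n -addnn exprD mulrA ler_wpM2r ?exprn_ge0 //.
  apply: le_trans (ler_wpM2r _ (nat_expR_le m a0)) _; first exact: exprn_ge0.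
  by rewrite sE -expRM_natl -mulrA -expRD mulrN [a * _]mulrC subrr expR0 mulr1.
apply: le_trans h _; rewrite ler_wpM2l ?invr_ge0 //; [exact: ltW|rewrite -exprD ncX].
by apply: ler_wiXn2l => //; [exact: ltW | rewrite /m mulSn mulnS; lia].
Qed.

(** Two groupings of the double series of j q^(jk): by the product jk it gives the divisor sums, by
    j the Lambert series. *)
Lemma sig_has (tau : R[i]) : 0 < complex.Im tau ->
  has_sum (fun m : nat => (sigma1 m.+1)%:R * expi tau ^+ m.+1) (sig tau) /\
  has_sum (fun j : nat => j.+1%:R * expi tau ^+ j.+1 / (1 - expi tau ^+ j.+1)) (sig tau).
Proof.
move=> t0; have h := bsum_has (sig_family t0).
have h1 : has_sum (fun m : nat => (sigma1 m.+1)%:R * expi tau ^+ m.+1)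
   (csum (fun jk : nat * nat => jk.1.+1%:R * expi tau ^+ (jk.1.+1 * jk.2.+1))).
  apply: (has_sum_group (g := fun jk : nat * nat => (jk.1.+1 * jk.2.+1).-1) h) => m.
  pose A := [fset (d.-1, (m.+1 %/ d).-1) | d in divisors m.+1]%fset.
  pose F (jk : nat * nat) : R[i] := if (jk.1.+1 * jk.2.+1).-1 == m then jk.1.+1%:R * expi tau ^+ (jk.1.+1 * jk.2.+1) else 0.
  have hA jk : jk \notin A -> F jk = 0.
    case: jk => j k; rewrite /F [_.1]/= [_.2]/=; case: eqP => // e /negP [].
    have e' : (j.+1 * k.+1 = m.+1)%N by rewrite -e prednK ?muln_gt0.
    apply/imfsetP; exists j.+1; first by rewrite /= -dvdn_divisors // -e' dvdn_mulr.
    by rewrite -e' mulKn.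
  change (has_sum F ((sigma1 m.+1)%:R * expi tau ^+ m.+1)).
  have -> : (sigma1 m.+1)%:R * expi tau ^+ m.+1 = \sum_(i <- A) F i; last exact: has_sum_finsupp hA.
  rewrite big_imfset /=; last first.
    move=> d d' hd hd' [e _].
    have pd x : x \in divisors m.+1 -> (0 < x)%N.
      by rewrite -dvdn_divisors // => /dvdn_gt0; apply.
    by have := pd _ hd; have := pd _ hd'; lia.
  rewrite (undup_id (divisors_uniq _)).
  rewrite /sigma1 natr_sum mulr_suml big_seq [RHS]big_seq; apply: eq_bigr => d.
  rewrite -dvdn_divisors // => dm.
  have d0 : (0 < d)%N by exact: dvdn_gt0 dm.
  have k0 : (0 < m.+1 %/ d)%N by rewrite divn_gt0 // dvdn_leq.
  by rewrite /F !prednK // [(d * _)%N]mulnC divnK // eqxx.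
split; first by rewrite /sig (csumE h1).
rewrite /sig (csumE h1); apply: (has_sum_group (g := fst) h) => j.
have q1 : nc (expi tau ^+ j.+1) < 1 by rewrite ncX exprn_ilt1 ?nc_ge0 // nc_expi_lt1.
apply: (@has_sum_inj _ _ _ (fun k => (j, k))) => [k k' []//|[j' k] hk /=|].
  by case: eqP => // e; have := hk k; rewrite e eqxx.
have := has_sumZ (j.+1%:R * expi tau ^+ j.+1) (has_sum_geo q1) => hs.
by apply: (eq_has_sum hs) => k /=; rewrite eqxx -exprM -mulrA -exprD mulnS.
Qed.

Lemma E2_sig (tau : R[i]) : 0 < complex.Im tau -> E2 tau = 1 - 24 * sig tau.
Proof.
move=> t0; rewrite /E2; congr (1 - 24 * _); apply: ccvg_lim.
have [h _] := sig_has t0; have h1 := has_sum_series h.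
have h2 := @cvg_sub R _ _ predn h1.
apply: cvg_trans (h2 _) => [|n]; last by exists n.+1 => k; lia.
apply: near_eq_cvg; exists 1%N => // N /= N1.
by rewrite -(big_mkord xpredT (fun m => (sigma1 m.+1)%:R * expi tau ^+ m.+1)) -(big_add1 _ _ _ N xpredT (fun m => (sigma1 m)%:R * expi tau ^+ m)).
Qed.

(** The partial products are differentiated factor by factor. Their coefficients are dominated by
    those of the limit, so [tannery] carries the derivative to the infinite product. *)
Lemma isD_tinv : isD (@upper R 1) (wq R (n:=1)) tinv (fun p => tinv p * sig p.1).
Proof.
have [c [hc cc cle]] := eul_limit; exists c; split; [exact: hc | move=> p Up].
have [K hK] := good_wq R 1.
have b := conv_poly (fexp_conv hc) hK Up; have [M hM] := b.
have := bsum_has b.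
have -> : csum (fun i => wq R i * c i * mono p i) = tinv p * sig p.1; last by [].
have [||_ ht] := @tannery R _ (fun N i => wq R i * ipcoef R eul N i * mono p i) (fun i => wq R i * c i * mono p i) _ _ hM.
- move=> N i; exact: nc_le_mul3 (cle N i).
- by move=> i; apply: cvgMl; apply: cvgMr; exact: cc.
apply: ccvg_unique ht _.
have e N : csum (fun i => wq R i * ipcoef R eul N i * mono p i) = invprod eul N p * sigN N p.
  have [d [hd hd']] := isD_invprod N.
  by rewrite (fexpH_unique (ip_fexp eul_small N) hd); exact: csumE (hd' _ Up).
under eq_fun do rewrite e; apply: cvgM.
  under eq_fun do rewrite invprod_eul.
  have q1 := nc_expi_lt1 Up.
  by apply: cvgV; [exact: qinf_neq0 | exact: qinf_cvg].
have [_ h] := sig_has Up; have := has_sum_series h.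
by apply: cvg_trans; apply: near_eq_cvg; apply: nearW => N; apply: eq_bigr => j _; rewrite mono_q.
Qed.

End EulerInverse.

(** * The form theta / eta^3 *)

Lemma thtermE (R : realType) (tau z : R[i]) m :
  thterm tau z m = expi ((m * (m + 1))%:~R / 2 * tau) * (- expi z) ^ m.
Proof. by []. Qed.

Lemma tinvE (R : realType) (p : R[i] * 'cV[R[i]]_1) : tinv p = (qinf (expi p.1))^-1. Proof. by []. Qed.

Global Opaque thterm qinf E2 tinv sig mulc addc oppc invc.

Section SeqLimits.
Variable R : realType.
Implicit Types (f g : nat -> R[i]) (a b c : R[i]).

Lemma seqM f g a b : f @ \oo --> a -> g @ \oo --> b -> (fun n => f n * g n) @ \oo --> a * b.
Proof. by move=> hf hg; apply: cvgM; [exact: hf | exact: hg]. Qed.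

Lemma seqZ c f a : f @ \oo --> a -> (fun n => c * f n) @ \oo --> c * a.
Proof. by move=> hf; apply: cvgM; [exact: cvg_cst | exact: hf]. Qed.

Lemma seq_eq f g a : f @ \oo --> a -> f =1 g -> g @ \oo --> a.
Proof. by move=> h /funext <-. Qed.

End SeqLimits.

Section FourierClass.
Variables (R : realType) (n : nat).
Local Notation pt := (R[i] * 'cV[R[i]]_n)%type.
Local Notation idx := (nat * 'cV[int]_n)%type.
Implicit Types (f g : pt -> R[i]) (w : idx -> R[i]).

Definition isF f := exists c, fexp (@upper R n) f c.

Lemma onHE f p : upper p -> onH f p = f p.
Proof. by rewrite /onH /upper /= => ->. Qed.

Lemma fexpP f c : fourier_expansion f c <-> fexp (@upper R n) f c.
Proof. by rewrite /fourier_expansion /fexp mono.unlock. Qed.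

Lemma fourier_coefE f c : fexp (@upper R n) f c -> fourier_coef f = c.
Proof.
move=> h; rewrite /fourier_coef; case: xgetP => [d _ /fexpP hd|/(_ c)]; last by case; apply/fexpP.
exact: fexpH_unique hd h.
Qed.

Lemma isF_eq f g : isF f -> (forall p, upper p -> f p = g p) -> isF g.
Proof. by move=> [c h] e; exists c; exact: fexp_eq h e. Qed.

Lemma isF_onH f : isF f -> isF (onH f).
Proof. by move=> h; apply: isF_eq h _ => p Up; rewrite onHE. Qed.

Lemma isF_D f g : isF f -> isF g -> isF (fun p => f p + g p).
Proof. by move=> [c hc] [d hd]; eexists; exact: fexpD hc hd. Qed.

Lemma isF_Z a f : isF f -> isF (fun p => a * f p).
Proof. by move=> [c hc]; eexists; exact: fexpZ hc. Qed.

Lemma isF_M f g : isF f -> isF g -> isF (fun p => f p * g p).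
Proof. by move=> [c hc] [d hd]; eexists; exact: fexpM hc hd. Qed.

Lemma isF_cst a : isF (fun=> a).
Proof. by have [c [h _]] := isD_cst (@upper R n) a (erefl : (fun=> 0 : R[i]) (0%N, 0) = 0); exists c. Qed.

Lemma isF_isDl w f g : isD (@upper R n) w f g -> isF f.
Proof. by move=> [c [h _]]; exists c. Qed.

Lemma isF_isDr w f g : isD (@upper R n) w f g -> isF g.
Proof. by move=> [c [_ h]]; eexists; exact: h. Qed.

Definition Dop_def w f : pt -> R[i] := onH (fun p => csum (fun i => w i * fourier_coef f i * mono p i)).

Lemma isD_comm w w' f g h k : isD (@upper R n) w f g -> isD (@upper R n) w' f h ->
  isD (@upper R n) w' g k -> isD (@upper R n) w h k.
Proof.
move=> [c [fc gc]] [d [fd hd]] [e [ge ke]].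
have cd := fexpH_unique fc fd; have ed := fexpH_unique gc ge.
exists (fun i => w' i * d i); split; first exact: hd.
move: ke; rewrite -ed -cd.
suff -> : (fun i => w' i * (w i * c i)) = fun i => w i * (w' i * c i) by [].
by apply/funext => i; rewrite mulrCA.
Qed.

(** A relation among weights that holds on all exponents of a family becomes a differential equation
    for its sum; the heat equation of theta is obtained in this way. *)
Lemma gcoef_supp (I : choiceType) (e : I -> idx) (c : I -> R[i]) w j :
  (forall i, w (e i) = 0) -> w j * gcoef e c j = 0.
Proof.
move=> hw; case: (pselect (exists i, e i = j)) => [[i <-]|ne]; first by rewrite hw mul0r.
rewrite /gcoef (@csumE _ _ _ 0) ?mulr0 //; apply: (eq_has_sum (has_sum0 R _)) => i.
by case: eqP => // ei; case: ne; exists i.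
Qed.

End FourierClass.

Lemma isF_pull (R : realType) n n' (L : 'M[int]_(n, n')) (f : R[i] * 'cV[R[i]]_n -> R[i]) :
  isF f -> isF (fun p => f (pull L p)).
Proof. by move=> [c hc]; eexists; exact: fexp_pull hc. Qed.

HB.lock Definition thsum (R : realType) (tau z : R[i]) : R[i] := csum (thterm tau z).
HB.lock Definition Dop (R : realType) (n : nat) (w : nat * 'cV[int]_n -> R[i]) (f : R[i] * 'cV[R[i]]_n -> R[i]) :
  R[i] * 'cV[R[i]]_n -> R[i] := Dop_def w f.

Section DopTheory.
Variables (R : realType) (n : nat).
Local Notation pt := (R[i] * 'cV[R[i]]_n)%type.
Local Notation idx := (nat * 'cV[int]_n)%type.
Implicit Types (f g : pt -> R[i]) (w : idx -> R[i]).

Lemma isD_Dop w f g p : isD (@upper R n) w f g -> upper p -> Dop w f p = g p.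
Proof.
move=> [c [h1 h2]] Up; rewrite Dop.unlock /Dop_def onHE // (fourier_coefE h1).
exact: csumE (h2 _ Up).
Qed.

Lemma DopP w f : good_weight w -> isF f -> isD (@upper R n) w f (Dop w f).
Proof.
move=> gw [c h]; have [g [hg _]] := isD_ex gw h.
by apply: (isD_eq hg) => // p Up; rewrite (isD_Dop hg).
Qed.

End DopTheory.

Section Phi.
Variable R : realType.
Local Notation pt := (R[i] * 'cV[R[i]]_1)%type.
Local Notation idx := (nat * 'cV[int]_1)%type.
Local Notation up := (@upper R 1).
Local Notation wz0 := (@wz R 1 0).
Implicit Types (p : pt) (tau z : R[i]).

Definition pt1 (tau z : R[i]) : pt := (tau, const_mx z).

Lemma pt1E p : p = pt1 p.1 (p.2 0 0).
Proof.
case: p => t v; congr (_, _); apply/matrixP => i j; rewrite !ord1 mxE //.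
Qed.

(** Theta without the factor q^(1/8), so that the powers of q are integral. *)
Definition thhat p : R[i] := expi (p.2 0 0 / 2) * thsum p.1 (p.2 0 0).

Definition thidx (m : int) : idx := (tri m, const_mx (2 * m + 1)).

Lemma th_gen p : up p -> has_sum (fun m => (-1) ^ m * mono p (thidx m)) (thhat p).
Proof.
move=> Up; have h := has_sumZ (expi (p.2 0 0 / 2)) (bsum_has (@bsum_thterm _ _ (p.2 0 0) Up)).
rewrite /thhat thsum.unlock.
apply: (eq_has_sum h) => m.
rewrite thterm_tri monoE linE big_ord1 mxE expiD expiMn -[- expi _]mulN1r expfzMl -expiMz.
have -> : expi ((2 * m + 1)%:~R / 2 * p.2 0 0) = expi (p.2 0 0 / 2) * expi (m%:~R * p.2 0 0).
  by rewrite -expiD; congr expi; rewrite intrD intrM; field.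
by rewrite [_.1]/=; ring.
Qed.

Lemma th_fexp : fexp up thhat (gcoef thidx (fun m => (-1) ^ m)).
Proof. by apply: gexp; exact: th_gen. Qed.

Lemma isF_th : isF thhat. Proof. by eexists; exact: th_fexp. Qed.

(** The heat equation on exponents: m (m + 1) / 2 = ((2m + 1) / 2)^2 / 2 - 1/8, where 1/8 is the
    power of q that was dropped. *)
Lemma th_heat j : wq R j * gcoef thidx (fun m => (-1) ^ m) j =
  (2^-1 * (wz0 j * wz0 j) - 8^-1) * gcoef thidx (fun m => (-1 : R[i]) ^ m) j.
Proof.
apply/eqP; rewrite -subr_eq0 -mulrBl; apply/eqP.
apply: (@gcoef_supp R 1 _ thidx _ (fun j => wq R j - (2^-1 * (wz0 j * wz0 j) - 8^-1))) => m.
rewrite /wq /wz /= mxE.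
have -> : (tri m)%:R = (m * (m + 1))%:~R / 2 :> R[i].
  by rewrite -triE -pmulrn natrM mulrC mulKf // pnatr_eq0.
by rewrite !intrD !intrM intrD; field.
Qed.

Definition cst_z (f : pt -> R[i]) := forall p z, f p = f (pt1 p.1 z).

Lemma isD_cst_z f : isF f -> cst_z f -> isD up wz0 f (fun=> 0).
Proof.
move=> hf cf; have h := DopP (good_wz R 0) hf; apply: (isD_eq h) => // p Up.
have := fexp_cder (p.2 0 0) h Up => h1.
have h2 : cder (fun w => f (p.1, const_mx w)) (p.2 0 0) 0.
  by apply: cder_ext (cder_cst (f p) _) => z; exact: cf.
have /eqP := cder_unique h1 h2; rewrite mulf_eq0 (negPf (twopii_neq0 R)) /= => /eqP.
by rewrite -[X in _ X = 0 -> _]/(pt1 p.1 (p.2 0 0)) -pt1E.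
Qed.

Lemma isF_tinv : isF (@tinv R). Proof. exact: isF_isDl (@isD_tinv R). Qed.

Lemma isF_E2 : isF (fun p : pt => E2 p.1).
Proof.
have hs : isF (fun p : pt => sig p.1).
  exists (gcoef (fun m : nat => (m.+1, 0 : 'cV[int]_1)) (fun m => (sigma1 m.+1)%:R)).
  by apply: gexp => p Up; have [h _] := sig_has Up; apply: (eq_has_sum h) => m; rewrite mono_q.
apply: isF_eq (isF_D (isF_cst (R:=R) 1 1) (isF_Z (-24) hs)) _ => p Up.
by rewrite E2_sig // mulNr.
Qed.

End Phi.

(* [phi] is theta / eta^3, in which the fractional power of q cancels. *)
HB.lock Definition phi (R : realType) : R[i] * 'cV[R[i]]_1 -> R[i] := onH (fun p => thhat p * tinv p ^+ 3).
Arguments phi {R}.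
HB.lock Definition phk (R : realType) (k : nat) : R[i] * 'cV[R[i]]_1 -> R[i] := iter k (Dop (@wz R 1 0)) phi.
Arguments phk {R}.
HB.lock Definition ph (R : realType) (k : nat) (tau z : R[i]) : R[i] := phk k (pt1 tau z).
HB.lock Definition sz (R : realType) (z : R[i]) : R[i] := expi (z / 2) - expi (- (z / 2)).

Lemma expNz (R : realType) (z : R[i]) (m : int) : (- expi z) ^ m = (-1) ^ m * expi (m%:~R * z).
Proof. by rewrite expiMz -[- expi z]mulN1r expfzMl. Qed.

Section PhiTheory.
Variable R : realType.
Local Notation thhat := (@thhat R).
Local Notation pt := (R[i] * 'cV[R[i]]_1)%type.
Local Notation idx := (nat * 'cV[int]_1)%type.
Local Notation up := (@upper R 1).
Local Notation wz0 := (@wz R 1 0).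
Local Notation phi := (@phi R).
Local Notation phk := (@phk R).
Implicit Types (p : pt) (tau z : R[i]).

Lemma phk0 : phk 0 = phi. Proof. by rewrite phk.unlock. Qed.
Lemma phkS k : phk k.+1 = Dop wz0 (phk k). Proof. by rewrite phk.unlock. Qed.

Lemma phiE p : up p -> phi p = thhat p * tinv p ^+ 3. Proof. by move=> Up; rewrite phi.unlock onHE. Qed.

Lemma isF_phi : isF phi.
Proof.
rewrite phi.unlock; apply: isF_onH; apply: isF_M (@isF_th R) _.
by apply: isF_M (@isF_tinv R) _; apply: isF_M (@isF_tinv R) (@isF_tinv R).
Qed.

Lemma isF_phk k : isF (phk k).
Proof.
elim: k => [|k IH]; first by rewrite phk0; exact: isF_phi.
rewrite phkS; exact: isF_isDr (DopP (good_wz R 0) IH).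
Qed.

Lemma isD_phk k : isD up wz0 (phk k) (phk k.+1).
Proof. rewrite phkS; exact: DopP (good_wz R 0) (isF_phk k). Qed.

Lemma isD_cube w f g : additive_weight w -> isD up w f g -> isD up w (fun p => f p ^+ 3) (fun p => 3 * (f p ^+ 2 * g p)).
Proof.
move=> aw h; apply: (isD_eq (isDM aw h (isDM aw h h))) => p Up; by ring.
Qed.

Lemma isD_tinvz : isD up wz0 (@tinv R) (fun=> 0).
Proof. by apply: isD_cst_z (@isF_tinv R) _. Qed.

Lemma phk_th k p : up p -> phk k p = iter k (Dop wz0) thhat p * tinv p ^+ 3.
Proof.
elim: k p => [|k IH] p Up; first by rewrite phk0; exact: phiE.
have Fk : isF (iter k (Dop wz0) thhat).
  elim: k {IH} => [|k IH]; first exact: (@isF_th R).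
  exact: isF_isDr (DopP (good_wz R 0) IH).
have h := isDM (@additive_wz R 1 0) (DopP (good_wz R 0) Fk) (isD_cube (@additive_wz R 1 0) isD_tinvz).
have h' : isD up wz0 (phk k) (fun p => Dop wz0 (iter k (Dop wz0) thhat) p * tinv p ^+ 3).
  by apply: (isD_eq h) => q Uq; [rewrite IH | rewrite !mulr0 addr0].
by rewrite phkS (isD_Dop h').
Qed.

(** Differentiating the cube of the inverse Euler product adds 3 [sig] = (1 - E2) / 8, and its
    constant 1/8 cancels the -1/8 of [th_heat]. *)
Lemma phi_heat : isD up (wq R (n := 1)) phi (fun p => 2^-1 * phk 2 p - E2 p.1 / 8 * phi p).
Proof.
have hq : isD up (wq R (n := 1)) thhat (fun p => 2^-1 * Dop wz0 (Dop wz0 thhat) p - 8^-1 * thhat p).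
  exists (gcoef thidx (fun m => (-1) ^ m)); split; first exact: (@th_fexp R).
  have [c1 [h1 h1']] := DopP (good_wz R 0) (@isF_th R).
  have [c2 [h2 h2']] := DopP (good_wz R 0) (isF_isDr (DopP (good_wz R 0) (@isF_th R))).
  have e1 := fexpH_unique h1 (@th_fexp R); have e2 := fexpH_unique h2 h1'.
  have := fexpD (fexpZ (a:=2^-1) h2') (fexpZ (a:=- 8^-1) (@th_fexp R)); rewrite e2 e1.
  rewrite (_ : (fun i => 2^-1 * _ + _) = fun i => wq R i * gcoef thidx (fun m => (-1) ^ m) i); last first.
    by apply/funext => i; rewrite th_heat; ring.
  by move/fexp_eq; apply=> p _; rewrite mulNr.
have h := isDM (@additive_wq R 1) hq (isD_cube (@additive_wq R 1) (@isD_tinv R)).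
apply: (isD_eq h) => p Up; first by rewrite phiE.
by rewrite (phk_th 2) // phiE // E2_sig // /=; field.
Qed.

Lemma phi_heat1 : isD up (wq R (n := 1)) (phk 1) (fun p => 2^-1 * phk 3 p - E2 p.1 / 8 * phk 1 p).
Proof.
have h0 : isD up wz0 phi (phk 1) by rewrite -phk0; exact: isD_phk.
apply: (isD_comm phi_heat h0).
have hE : isD up wz0 (fun p => E2 p.1) (fun=> 0) by apply: isD_cst_z (@isF_E2 R) _.
have h := isDD (isDZ 2^-1 (isD_phk 2)) (isDZ (- 8^-1) (isDM (@additive_wz R 1 0) hE h0)).
by apply: (isD_eq h) => p Up; rewrite ?mul0r ?add0r; ring.
Qed.

Lemma ph_cder k tau z : 0 < complex.Im tau -> cder (ph k tau) z (twopii R * ph k.+1 tau z).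
Proof. by move=> t0; rewrite ph.unlock; exact: fexp_cder (isD_phk k) t0. Qed.

Lemma phE tau z : 0 < complex.Im tau -> ph 0 tau z =
  expi (z / 2) * thsum tau z / qinf (expi tau) ^+ 3.
Proof. by move=> t0; rewrite ph.unlock phk0 phiE // /thhat tinvE /= mxE exprVn. Qed.

Lemma ph_prod tau z : 0 < complex.Im tau ->
  sz z * \prod_(j < N) ((1 - expi tau ^+ j.+1 * expi z) * (1 - expi tau ^+ j.+1 / expi z)) @[N --> \oo]
   --> qinf (expi tau) ^+ 2 * ph 0 tau z.
Proof.
move=> t0; have q1 := nc_expi_lt1 t0; have q0 := qinf_neq0 q1.
have h := triple_product (z:=z) t0; rewrite -[csum _]/(csum (thterm tau z)) in h.
have hS : thsum tau z = csum (thterm tau z) by rewrite thsum.unlock.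
(* In the triple product the factors in 1 / zeta start at j = 0. That first factor joins expi(z / 2)
   to form [sz z]; the factor j = N missing at the other end tends to 1. *)
have h1 : 1 - expi tau ^+ N / expi z @[N --> \oo] --> (1 : R[i]).
  rewrite -[X in _ --> X]subr0; apply: cvgB; first exact: cvg_cst.
  rewrite -[X in _ --> X](mul0r (expi z)^-1); apply: cvgMl.
  apply/nat_ccvgP => e e0; have /cvgrPdist_lt /(_ e e0) [N _ hN] : (fun N => nc (expi tau) ^+ N) @ \oo --> (0 : R).
    by apply: cvg_expr; rewrite ger0_norm ?nc_ge0.
  exists N => k /hN /=; rewrite sub0r normrN subr0 ncX ger0_norm ?exprn_ge0 ?nc_ge0 //.
have h2 := seqZ (c:=expi (z / 2)) (seqM h h1).
have -> : qinf (expi tau) ^+ 2 * ph 0 tau z = expi (z / 2) * (csum (thterm tau z) / qinf (expi tau) * 1).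
  by rewrite phE // hS; field; rewrite q0.
apply: (seq_eq h2) => N; symmetry.
rewrite !big_split /=; have -> : sz z = expi (z / 2) * (1 - 1 / expi z).
  rewrite sz.unlock mulrBr mulr1; congr (_ - _); rewrite mul1r -expiN -expiD; congr expi; by field.
have e : (1 - 1 / expi z) * \prod_(j < N) (1 - expi tau ^+ j.+1 / expi z) =
    \prod_(j < N) (1 - expi tau ^+ j / expi z) * (1 - expi tau ^+ N / expi z).
  elim: N => [|N IH]; first by rewrite !big_ord0 expr0; ring.
  by rewrite !big_ord_recr /= mulrA IH.
transitivity (expi (z / 2) * \prod_(j < N) (1 - expi tau ^+ j.+1 * expi z) *
  ((1 - 1 / expi z) * \prod_(j < N) (1 - expi tau ^+ j.+1 / expi z))); [by ring | by rewrite e; ring].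
Qed.

Lemma sz_odd z : sz (- z) = - sz z.
Proof. by rewrite sz.unlock mulNr opprK opprB. Qed.

Lemma ph_odd tau z : 0 < complex.Im tau -> ph 0 tau (- z) = - ph 0 tau z.
Proof.
move=> t0; have q0 := qinf_neq0 (nc_expi_lt1 t0).
have h1 := ph_prod (z:=- z) t0; have h2 := seqZ (c:=-1) (ph_prod (z:=z) t0).
have : qinf (expi tau) ^+ 2 * ph 0 tau (- z) = -1 * (qinf (expi tau) ^+ 2 * ph 0 tau z).
  apply: ccvg_unique h1 _; apply: (seq_eq h2) => N; symmetry.
  rewrite /= sz_odd mulN1r mulNr; congr (- (_ * _)); apply: eq_bigr => j _.
  by rewrite expiN invrK mulrC.
by rewrite mulN1r -mulrN => /mulfI; apply; rewrite expf_neq0.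
Qed.

Lemma ph_add1 tau z : 0 < complex.Im tau -> ph 0 tau (z + 1) = - ph 0 tau z.
Proof.
move=> t0; rewrite !(phE _ t0) mulrDl expiD mul1r expi_half mulrN1 !mulNr; congr (- (_ * _ / _)).
rewrite thsum.unlock; apply: eq_csum => m; by rewrite !thtermE expiD expi1 mulr1.
Qed.

Lemma ph_addtau tau z : 0 < complex.Im tau -> ph 0 tau (z + tau) = - (expi (- (tau / 2) - z) * ph 0 tau z).
Proof.
move=> t0; rewrite !phE //; have h := bsum_has (@bsum_thterm _ _ z t0).
have -> : thsum tau (z + tau) = - (expi (- tau - z) * thsum tau z).
  rewrite thsum.unlock; apply: csumE; rewrite -mulNr.
  have h1 := has_sumZ (- expi (- tau - z)) h.
  have h2 : has_sum (fun m : int => - expi (- tau - z) * thterm tau z (m + 1)) (- expi (- tau - z) * csum (thterm tau z)).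
    apply: (@has_sum_inj_rev _ _ _ (fun m : int => m + 1) _ _ _ _ h1) => [m m' /addIr //|m hm].
    by have := hm (m - 1); rewrite subrK eqxx.
  apply: (eq_has_sum h2) => m.
  rewrite thterm_succ mulrN mulNr mulrN opprK !thtermE !expNz.
  have e : expi (- tau - z) * expi (m%:~R * z) * expi (z + (m + 1)%:~R * tau) = expi (m%:~R * (z + tau)).
    by rewrite -!expiD; congr expi; rewrite intrD; ring.
  by rewrite -e; ring.
have e : expi ((z + tau) / 2) * expi (- tau - z) = expi (- (tau / 2) - z) * expi (z / 2).
  by rewrite -!expiD; congr expi; field.
transitivity (- (expi ((z + tau) / 2) * expi (- tau - z)) * (thsum tau z / qinf (expi tau) ^+ 3)).
  by ring.
by rewrite e; ring.
Qed.

End PhiTheory.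

Lemma int_step (P : int -> Prop) : P 0 -> (forall l, P l -> P (l + 1)) -> (forall l, P l -> P (l - 1)) ->
  forall l, P l.
Proof.
move=> h0 h1 h2; elim/int_rect => [//|k /h1|k /h2]; first by rewrite -addn1 PoszD.
by rewrite -addn1 PoszD opprD.
Qed.

(** * Lattice translations, behaviour at the origin, and zeros of phi *)

Section PhiElliptic.
Variable R : realType.
Implicit Types (tau z : R[i]).

Lemma ImD (x y : R[i]) : complex.Im (x + y) = complex.Im x + complex.Im y. Proof. by case: x y => ? ? []. Qed.
Lemma ImN (x : R[i]) : complex.Im (- x) = - complex.Im x. Proof. by case: x. Qed.

Lemma ph_addl tau (l : int) z : 0 < complex.Im tau ->
  ph 0 tau (z + l%:~R * tau) = (-1) ^ l * expi (- (l%:~R ^+ 2 / 2 * tau) - l%:~R * z) * ph 0 tau z.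
Proof.
move=> t0; elim/int_step: l z => [z|l IH z|l IH z].
- by rewrite (_ : 0%:~R = 0) // !mul0r addr0 expr0n !mul0r subr0 oppr0 expi0 expr0z !mul1r.
- have -> : z + (l + 1)%:~R * tau = (z + l%:~R * tau) + tau by rewrite intrD; ring.
  rewrite ph_addtau // IH expfzDr ?oppr_eq0 ?oner_eq0 // expr1z.
  have e : expi (- (tau / 2) - (z + l%:~R * tau)) * expi (- (l%:~R ^+ 2 / 2 * tau) - l%:~R * z) =
    expi (- ((l + 1)%:~R ^+ 2 / 2 * tau) - (l + 1)%:~R * z).
    by rewrite -expiD; congr expi; rewrite intrD; field.
  by rewrite -e; ring.
- have := ph_addtau (z + (l - 1)%:~R * tau) t0.
  have -> : z + (l - 1)%:~R * tau + tau = z + l%:~R * tau by rewrite intrD rmorphN1; ring.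
  rewrite IH => h.
  have e : expi (- (tau / 2) - (z + (l - 1)%:~R * tau)) * expi (- ((l - 1)%:~R ^+ 2 / 2 * tau) - (l - 1)%:~R * z) =
     expi (- (l%:~R ^+ 2 / 2 * tau) - l%:~R * z).
    by rewrite -expiD; congr expi; rewrite intrD rmorphN1; field.
  apply: (mulfI (expi_neq0 (- (tau / 2) - (z + (l - 1)%:~R * tau)))).
  apply: oppr_inj; rewrite -h -e expfzDr ?oppr_eq0 ?oner_eq0 // (_ : (-1) ^ (-1) = -1 :> R[i]); last first.
    by rewrite exprN1 invrN1.
  by ring.
Qed.

Lemma ph_addm tau (m : int) z : 0 < complex.Im tau -> ph 0 tau (z + m%:~R) = (-1) ^ m * ph 0 tau z.
Proof.
move=> t0; elim/int_step: m z => [z|m IH z|m IH z].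
- by rewrite addr0 expr0z mul1r.
- by rewrite intrD addrA ph_add1 // IH expfzDr ?oppr_eq0 ?oner_eq0 // expr1z; ring.
- have := ph_add1 (z + (m - 1)%:~R) t0; rewrite intrD rmorphN1 -addrA subrK IH => h.
  apply: oppr_inj; rewrite -h expfzDr ?oppr_eq0 ?oner_eq0 // (_ : (-1) ^ (-1) = -1 :> R[i]); last first.
    by rewrite exprN1 invrN1.
  by ring.
Qed.

Lemma ph_lattice tau (l m : int) z : 0 < complex.Im tau ->
  ph 0 tau (z + tau * l%:~R + m%:~R) = (-1) ^ (l + m) * expi (- (l%:~R ^+ 2 / 2 * tau) - l%:~R * z) * ph 0 tau z.
Proof.
move=> t0; rewrite ph_addm // [tau * _]mulrC ph_addl // expfzDr ?oppr_eq0 ?oner_eq0 //.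
by ring.
Qed.

Lemma ph_0 tau : 0 < complex.Im tau -> ph 0 tau 0 = 0.
Proof.
move=> t0; have := ph_odd 0 t0; rewrite oppr0 => /eqP; rewrite -addr_eq0 -mulr2n mulrn_eq0 /=.
by move/eqP.
Qed.

Lemma nc_lim_le (f : nat -> R[i]) (l : R[i]) (M : R) : f @ \oo --> l -> (forall n, nc (f n) <= M) -> nc l <= M.
Proof.
move=> /nat_ccvgP h hM; apply/ler_addgt0Pr => e /h [N /(_ N (leqnn N)) hN].
have := nc_lip l (f N); rewrite ncBC => h1; have := hM N; lra.
Qed.

Lemma nc_prod_sub1 (b : nat -> R[i]) N : nc (\prod_(j < N) (1 - b j) - 1) <= expR (\sum_(j < N) nc (b j)) - 1.
Proof.
elim: N => [|N IH]; first by rewrite !big_ord0 subrr nc0 expR0 subrr.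
rewrite !big_ord_recr /= expRD; move: IH; set P := \prod_(j < N) _; set S := \sum_(j < N) _ => IH.
have -> : P * (1 - b N) - 1 = (P - 1) * (1 - b N) - b N by ring.
apply: le_trans (ncB _ _) _; rewrite ncM.
have h1 : nc (1 - b N) <= 1 + nc (b N) by apply: le_trans (ncB _ _) _; rewrite nc1.
have h2 := expR_ge1Dx (nc (b N)); have h3 := nc_ge0 (P - 1); have h4 := nc_ge0 (b N); have h5 := nc_ge0 (1 - b N).
have h6 : 0 < expR S := expR_gt0 S.
apply: (@le_trans _ _ ((expR S - 1) * (1 + nc (b N)) + nc (b N))).
  by rewrite lerD2r; apply: ler_pM.
by nra.
Qed.

Lemma sz_sqr z : sz z ^+ 2 = expi z + (expi z)^-1 - 2.
Proof.
rewrite sz.unlock; have e1 : expi z = expi (z / 2) ^+ 2 by rewrite -expiMn; congr expi; field.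
have e2 : expi (- (z / 2)) = (expi (z / 2))^-1 by rewrite expiN.
by rewrite e2 e1; have := expi_neq0 (z / 2); move: (expi _) => x x0; field.
Qed.

(** Pairing factors gives (1 - x zeta)(1 - x / zeta) = (1 - x)^2 (1 - s^2 x / (1 - x)^2) with s =
    [sz z]. So [phi] is s times a product in s^2; it differs from [sz] by a term of third order at
    the origin and has the same derivative there. *)
Lemma ph_near_sz tau : 0 < complex.Im tau -> exists K : R, 0 <= K /\
  forall z, nc (ph 0 tau z - sz z) <= nc (sz z) * (expR (nc (sz z) ^+ 2 * K) - 1).
Proof.
move=> t0; set q := expi tau; have q1 : nc q < 1 := nc_expi_lt1 t0; have q0 := nc_ge0 q.
pose u j := q ^+ j.+1 / (1 - q ^+ j.+1) ^+ 2.
have d0 : 0 < 1 - nc q by lra.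
have hq j : 1 - nc q <= nc (1 - q ^+ j.+1).
  apply: le_trans (nc_sub1_ge _); rewrite lerD2l lerN2 ncX exprS ler_piMr // exprn_ile1 //; exact: ltW.
have hd j : 1 - q ^+ j.+1 != 0 by rewrite -nc_gt0; exact: lt_le_trans (hq j).
have hu j : nc (u j) <= nc q / (1 - nc q) ^+ 2 * nc q ^+ j.
  rewrite /u ncM ncV !ncX exprS mulrAC ler_wpM2r ?exprn_ge0 // ler_wpM2l // lef_pV2 ?posrE ?exprn_gt0 //.
    by rewrite lerXn2r ?nnegrE ?nc_ge0 // ltW.
  by apply: lt_le_trans (hq j).
exists (nc q / (1 - nc q) ^+ 2 / (1 - nc q)); split.
  by rewrite mulr_ge0 ?divr_ge0 ?invr_ge0 ?exprn_ge0 // ltW.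
move=> z; set K := _ / _ / _; set s := sz z.
have hN N : nc (s * \prod_(j < N) (1 - s ^+ 2 * u j) - s) <= nc s * (expR (nc s ^+ 2 * K) - 1).
  have -> : s * \prod_(j < N) (1 - s ^+ 2 * u j) - s = s * (\prod_(j < N) (1 - s ^+ 2 * u j) - 1) by ring.
  rewrite ncM ler_wpM2l ?nc_ge0 //.
  apply: le_trans (nc_prod_sub1 (fun j => s ^+ 2 * u j) N) _; rewrite lerD2r ler_expR.
  under eq_bigr do rewrite ncM ncX; rewrite -mulr_sumr ler_wpM2l ?exprn_ge0 ?nc_ge0 //.
  apply: (@le_trans _ _ (\sum_(j < N) nc q / (1 - nc q) ^+ 2 * nc q ^+ j)); first by apply: ler_sum => j _; exact: hu.
  rewrite -mulr_sumr ler_wpM2l ?divr_ge0 ?exprn_ge0 //; first exact: ltW.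
  exact: sum_geo_le.
have Q0 := qinf_neq0 q1.
have hl : (fun N => s * \prod_(j < N) (1 - s ^+ 2 * u j) - s) @ \oo --> ph 0 tau z - s.
  apply: cvgB; last exact: cvg_cst.
  have h1 := ph_prod (z := z) t0; have h2 : (fun N => (qfact q N ^+ 2)^-1) @ \oo --> (qinf q ^+ 2)^-1.
    by apply: cvgV; [rewrite expf_neq0 | apply: (seqM (qinf_cvg q1) (qinf_cvg q1))].
  rewrite -[X in _ --> X](mulKf (expf_neq0 2 Q0)); apply: (seq_eq (seqM h2 h1)) => N; rewrite -/q -/s.
  have -> : \prod_(j < N) ((1 - q ^+ j.+1 * expi z) * (1 - q ^+ j.+1 / expi z)) =
     qfact q N ^+ 2 * \prod_(j < N) (1 - s ^+ 2 * u j).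
    rewrite /qfact -prodrXl -big_split /=; apply: eq_bigr => j _.
    rewrite /u sz_sqr; have := hd j; have := expi_neq0 z; move: (q ^+ _) (expi z) => x y y0 x0.
    by field; rewrite y0 x0.
  have := qfact_neq0 q1 N; move: (qfact q N) (\prod_(j < N) _) => a b a0.
  by field.
exact: nc_lim_le hl hN.
Qed.

Lemma cder_sz : cder (@sz R) 0 (twopii R).
Proof.
have h a : cder (fun z => expi (a * z)) 0 (twopii R * expi (a * 0) * a).
  by apply: (@cder_comp _ (@expi R) (fun z => a * z)); [exact: cder_scale | exact: cder_expi].
have := cderD (h 2^-1) (cderZ (-1) (h (- 2^-1))) => h1.
apply: cder_eq (cder_ext _ h1) _; last by rewrite !mulr0 expi0; field.
by move=> z; rewrite sz.unlock mulN1r mulNr ![_ / 2]mulrC.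
Qed.

Lemma sz0 : sz (0 : R[i]) = 0.
Proof. by rewrite sz.unlock mul0r oppr0 subrr. Qed.

Lemma cder_ph0 tau : 0 < complex.Im tau -> cder (ph 0 tau) 0 (twopii R).
Proof.
move=> t0; have [K [K0 hK]] := ph_near_sz t0.
have [K1 [e [K10 e0 h1]]] := cder_sz.
pose C := nc (twopii R) + K1 * e.
have C0 : 0 <= C by rewrite addr_ge0 ?nc_ge0 // mulr_ge0 // ltW.
pose T := (C * e) ^+ 2 * K.
have T0 : 0 <= T by rewrite mulr_ge0 ?sqr_ge0.
apply: (@cderI _ _ _ _ (K1 + C * (C ^+ 2 * K * expR T) * e) e) => // u ue.
have u0 := nc_ge0 u.
rewrite ph_0 // subr0 add0r.
have := h1 u ue; rewrite add0r sz0 subr0 => h2.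
have su : nc (sz u) <= C * nc u.
  have := nc_lip (sz u) (u * twopii R); rewrite ncM => h3.
  have h4 : K1 * nc u ^+ 2 <= K1 * e * nc u by rewrite -mulrA ler_wpM2l // expr2 ler_wpM2r.
  by rewrite /C mulrDl; lra.
have s0 := nc_ge0 (sz u).
have hx : expR (nc (sz u) ^+ 2 * K) - 1 <= C ^+ 2 * K * expR T * nc u ^+ 2.
  set x := _ ^+ 2 * K; have x0 : 0 <= x by rewrite mulr_ge0 ?sqr_ge0.
  have sq : nc (sz u) ^+ 2 <= (C * nc u) ^+ 2 by rewrite lerXn2r ?nnegrE // mulr_ge0.
  have xT : x <= T.
    rewrite ler_wpM2r //; apply: le_trans sq _; rewrite lerXn2r ?nnegrE ?mulr_ge0 //; first exact: ltW.
    by rewrite ler_wpM2l.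
  have x1 : x <= C ^+ 2 * K * nc u ^+ 2 by rewrite mulrAC -exprMn ler_wpM2r.
  have := expR_sub1_le x; rewrite ger0_norm ?(ger0_norm x0) => [h|]; last first.
    by rewrite subr_ge0 -[leLHS]expR0 ler_expR.
  apply: le_trans h _; rewrite [leRHS]mulrAC; apply: ler_pM => //; rewrite ?expR_ge0 ?ler_expR //.
have -> : ph 0 tau u - u * twopii R = (sz u - u * twopii R) + (ph 0 tau u - sz u) by ring.
apply: le_trans (ncD _ _) _; rewrite [leRHS]mulrDl; apply: lerD => //.
apply: le_trans (hK u) _.
have y0 : 0 <= C ^+ 2 * K * expR T by rewrite !mulr_ge0 ?expR_ge0 ?sqr_ge0.
apply: (@le_trans _ _ (C * nc u * (C ^+ 2 * K * expR T * nc u ^+ 2))).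
  apply: ler_pM => //; rewrite subr_ge0 -[leLHS]expR0 ler_expR mulr_ge0 ?sqr_ge0 //.
have : nc u * (C * (C ^+ 2 * K * expR T) * nc u ^+ 2) <= e * (C * (C ^+ 2 * K * expR T) * nc u ^+ 2).
  by rewrite ler_wpM2r // mulr_ge0 ?sqr_ge0 // mulr_ge0.
by move: (C ^+ 2 * K * expR T) => X; nra.
Qed.

Lemma ph1_0 tau : 0 < complex.Im tau -> ph 1 tau 0 = 1.
Proof.
move=> t0; have := cder_unique (ph_cder 0 0 t0) (cder_ph0 t0).
by rewrite -[RHS]mulr1 => /(mulfI (twopii_neq0 R)).
Qed.

(** The heat equation for the first derivative of [phi] is restricted to z = 0, as a pullback to
    functions of tau alone. There the first derivative is the constant 1, so 0 = phi'''(0) / 2 - E2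
    / 8. *)
Lemma ph3_0 tau : 0 < complex.Im tau -> ph 3 tau 0 = E2 tau / 4.
Proof.
move=> t0; pose L : 'M[int]_(1, 0) := 0.
have h := isD_pull (L := L) (@wq_pull R 1 0 L) (@phi_heat1 R).
have h1 := isD_cst (@upper R 0) 1 (erefl : wq R (0%N, 0) = 0).
have e (p : R[i] * 'cV[R[i]]_0) : pull L p = pt1 p.1 0.
  by congr (_, _); apply/matrixP => i j; rewrite !mxE big_ord0.
have h2 : isD (@upper R 0) (wq R (n := 0)) (fun=> 1)
    (fun p => 1 * (2^-1 * phk 3 (pull L p) - E2 (pull L p).1 / 8 * phk 1 (pull L p))).
  apply: (isD_eq h) => // p Up; have := ph1_0 Up; by rewrite ph.unlock e.
have := isD_unique h2 h1 (p := (tau, 0)) t0; rewrite mul1r !e /=.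
have := ph1_0 t0; rewrite ph.unlock => ->; rewrite mulr1 => /eqP; rewrite subr_eq0 => /eqP h3.
by apply: (mulfI (_ : 2^-1 != 0)); [rewrite invr_eq0 pnatr_eq0 | rewrite h3; field].
Qed.

Lemma prod_lower (x : nat -> R[i]) (a r : R) N : 0 <= r -> r < 1 -> 0 <= a -> a < 1 ->
  (forall j, nc (x j) <= a * r ^+ j) -> expR (- (a / (1 - a) / (1 - r))) <= nc (\prod_(j < N) (1 - x j)).
Proof.
move=> r0 r1 a0 a1 hx.
have hp j : 0 < 1 - a * r ^+ j.
  by rewrite subr_gt0; apply: le_lt_trans a1; rewrite ler_piMr // exprn_ile1 // ltW.
have h := inv_prod_bound N r0 r1 a0 a1.
have P0 M : 0 < \prod_(j < M) (1 - a * r ^+ j).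
  by apply: prodr_gt0 => j _; exact: hp.
apply: (@le_trans _ _ (\prod_(j < N) (1 - a * r ^+ j))).
  rewrite expRN -lef_pV2 ?posrE ?invrK ?invr_gt0 ?expR_gt0 //.
  apply: le_trans h; elim: N {P0} => [|N IH]; first by rewrite !big_ord0 invr1.
  rewrite !big_ord_recr /= invfM; apply: ler_pM => //; rewrite ?invr_ge0 ?ltW //.
  by apply: prodr_gt0 => j _.
elim: N {h} => [|N IH]; first by rewrite !big_ord0 nc1.
rewrite !big_ord_recr /= ncM; apply: ler_pM; [exact: ltW (P0 N) | exact: ltW (hp N) | exact: IH | ].
apply: le_trans (nc_sub1_ge _); rewrite lerD2l lerN2; exact: hx.
Qed.

(** In this range both |q zeta| and |q / zeta| are below 1, so the product stays away from 0, and
    [sz z] vanishes only for real z. Off the rows of zeros this is all that the cancellation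
    arguments need. *)
Lemma ph_neq0 tau z : 0 < complex.Im tau -> complex.Im z != 0 -> `|complex.Im z| < complex.Im tau ->
  ph 0 tau z != 0.
Proof.
move=> t0 z0; rewrite ltr_norml => /andP[zl zr].
have a1 : nc (expi (tau + z)) < 1 by apply: nc_expi_lt1; rewrite ImD; lra.
have b1 : nc (expi (tau - z)) < 1 by apply: nc_expi_lt1; rewrite ImD ImN; lra.
have q1 := nc_expi_lt1 t0; have q0 := nc_ge0 (expi tau).
have s0 : 0 < nc (sz z).
  rewrite nc_gt0 sz.unlock subr_eq0; apply/negP => /eqP /(congr1 (@ComplexField.Normc.normc R)).
  rewrite !nc_expi => /expR_inj /eqP; rewrite eqr_opp => /eqP /mulfI; rewrite mulf_neq0 ?gt_eqF ?pi_gt0 // => /(_ isT).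
  have -> : z / 2 = 2^-1%:C * z by rewrite mulrC fmorphV rmorph_nat.
  by rewrite -mulrN !Im_real_mul ImN => /mulfI; rewrite invr_eq0 pnatr_eq0 /= => /(_ isT); move/eqP: z0; lra.
have h := ph_prod (z := z) t0.
have h1 N : nc (sz z) * (expR (- (nc (expi (tau + z)) / (1 - nc (expi (tau + z))) / (1 - nc (expi tau)))) *
    expR (- (nc (expi (tau - z)) / (1 - nc (expi (tau - z))) / (1 - nc (expi tau))))) <=
    nc (sz z * \prod_(j < N) ((1 - expi tau ^+ j.+1 * expi z) * (1 - expi tau ^+ j.+1 / expi z))).
  rewrite ncM; apply: ler_wpM2l; [exact: nc_ge0 | rewrite big_split /=].
  rewrite (ncM (\prod_(j < N) (1 - expi tau ^+ j.+1 * expi z))).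
  apply: ler_pM; [exact: expR_ge0 | exact: expR_ge0 | |].
    apply: (prod_lower (x := fun j => expi tau ^+ j.+1 * expi z)) => // [|j]; first exact: nc_ge0.
    by rewrite expiD exprS mulrAC (ncM (expi tau * expi z)) ncX.
  apply: (prod_lower (x := fun j => expi tau ^+ j.+1 / expi z)) => // [|j]; first exact: nc_ge0.
  by rewrite expiB exprS mulrAC (ncM (expi tau / expi z)) ncX.
have := cvg_nc h h1; rewrite -nc_gt0 ncM => h2.
have : 0 < nc (qinf (expi tau) ^+ 2) * nc (ph 0 tau z) by apply: lt_le_trans h2; rewrite !mulr_gt0 ?expR_gt0.
by rewrite pmulr_rgt0 // nc_gt0 expf_neq0 // qinf_neq0.
Qed.

Lemma etaE tau : 0 < complex.Im tau -> dedekind_eta tau = expi (tau / 24) * qinf (expi tau).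
Proof.
move=> t0; have q1 := nc_expi_lt1 t0; rewrite /dedekind_eta; congr (_ * _).
apply: ccvg_lim; have h := @cvg_sub R _ _ predn (qinf_cvg q1).
have := h _ => h2; apply: (seq_eq (h2 _)) => [B|N]; first by exists B.+1 => k; lia.
by rewrite /= /qfact -(big_mkord xpredT (fun j => 1 - expi tau ^+ j.+1)) -(big_add1 _ _ _ N xpredT (fun m => 1 - expi tau ^+ m)).
Qed.

Lemma thetaE tau z : 0 < complex.Im tau -> theta tau z = dedekind_eta tau ^+ 3 * ph 0 tau z.
Proof.
move=> t0; have q1 := nc_expi_lt1 t0; have Q0 := qinf_neq0 q1.
rewrite etaE // phE // /theta thsum.unlock exprMn -expiMn.
have -> : 3 * (tau / 24) = tau / 8 by field.
have -> : csum (fun m : int => expi ((m * (m + 1))%:~R / 2 * tau) * (- expi z) ^ m) = csum (thterm tau z).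
  by apply: eq_csum => m; rewrite thtermE.
by move: (csum _) (expi _) (expi _) (qinf _) Q0 => S a b Q Q0; field.
Qed.

Lemma eta_neq0 tau : 0 < complex.Im tau -> dedekind_eta tau != 0.
Proof. by move=> t0; rewrite etaE // mulf_neq0 ?expi_neq0 // qinf_neq0 // nc_expi_lt1. Qed.

Lemma dthetaE tau z : 0 < complex.Im tau -> dtheta tau z = dedekind_eta tau ^+ 3 * (twopii R * ph 1 tau z).
Proof.
move=> t0; apply: cder_derive1; apply: cder_ext (cderZ (dedekind_eta tau ^+ 3) (ph_cder 0 z t0)) => w.
by rewrite thetaE.
Qed.

End PhiElliptic.

HB.lock Definition ee (R : realType) (z : R[i]) : R[i] := expi z.

Section SealedExponential.
Variable R : realType.
Implicit Types (x y z : R[i]).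

Lemma expi_ee z : expi z = ee z. Proof. by rewrite ee.unlock. Qed.
Lemma eeD x y : ee (x + y) = ee x * ee y. Proof. by rewrite ee.unlock expiD. Qed.
Lemma ee0 : ee (0 : R[i]) = 1. Proof. by rewrite ee.unlock expi0. Qed.
Lemma ee_neq0 x : ee x != 0. Proof. by rewrite ee.unlock expi_neq0. Qed.
Lemma eeN x : ee (- x) = (ee x)^-1. Proof. by rewrite ee.unlock expiN. Qed.
Lemma ee_int (m : int) : ee (m%:~R : R[i]) = 1. Proof. by rewrite ee.unlock expi_int. Qed.
Lemma ee_half (m : int) : ee (m%:~R / 2 : R[i]) = (-1) ^ m. Proof. by rewrite ee.unlock expi_halfz. Qed.
Lemma eeMn n x : ee (n%:R * x) = ee x ^+ n. Proof. by rewrite ee.unlock expiMn. Qed.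
Lemma eeMz (m : int) x : ee (m%:~R * x) = ee x ^ m. Proof. by rewrite ee.unlock expiMz. Qed.
Lemma nc_ee z : nc (ee z) = expR (- (2 * pi * complex.Im z)). Proof. by rewrite ee.unlock nc_expi. Qed.
Lemma cder_ee z : cder (@ee R) z (twopii R * ee z). Proof. by rewrite ee.unlock; exact: cder_expi. Qed.
Lemma ee_taylor u : nc (ee u - 1 - twopii R * u) <= 4 * (2 * pi * nc u) ^+ 2 * expR (2 * pi * nc u).
Proof. by rewrite ee.unlock; exact: expi_taylor1. Qed.

Lemma ph_ee tau (l m : int) z : 0 < complex.Im tau ->
  ph 0 tau (z + tau * l%:~R + m%:~R) = (-1) ^ (l + m) * ee (- (l%:~R ^+ 2 / 2 * tau) - l%:~R * z) * ph 0 tau z.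
Proof. by rewrite ee.unlock; exact: ph_lattice. Qed.

End SealedExponential.

(** A second-order Taylor bound with one constant for all base points and increments in a disc. The
    averages over grids need this uniformity in the base point. *)
Definition lt2 (R : realType) (h h' : R[i] -> R[i]) := forall B : R, exists K : R, 0 <= K /\
  forall z, nc z <= B -> [/\ nc (h z) <= K, nc (h' z) <= K &
    forall u, nc u <= B -> nc (h (z + u) - h z - u * h' z) <= K * nc u ^+ 2].

Section LT2.
Variable R : realType.
Implicit Types (h g : R[i] -> R[i]) (z u a : R[i]).

Lemma lt2_cst a : lt2 (fun=> a) (fun=> 0).
Proof.
move=> B; exists (nc a); split; first exact: nc_ge0.
move=> z _; split; rewrite ?nc0 ?nc_ge0 // => u _.
by rewrite subrr mulr0 subr0 nc0 mulr_ge0 ?sqr_ge0 ?nc_ge0.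
Qed.

Lemma lt2_id : lt2 (fun z : R[i] => z) (fun=> 1).
Proof.
move=> B; exists (Num.max 1 `|B|); split; first by rewrite le_max ler01.
move=> z zB; split; first by rewrite le_max (le_trans zB (ler_norm B)) orbT.
  by rewrite nc1 le_max lexx.
move=> u _; rewrite mulr1 [z + u]addrC addrK subrr nc0 mulr_ge0 ?sqr_ge0 // le_max ler01 //.
Qed.

Lemma lt2D h h' g g' : lt2 h h' -> lt2 g g' -> lt2 (fun z => h z + g z) (fun z => h' z + g' z).
Proof.
move=> hh hg B; have [K [K0 hK]] := hh B; have [L [L0 hL]] := hg B.
exists (K + L); split; first exact: addr_ge0.
move=> z zB; have [a1 a2 a3] := hK z zB; have [b1 b2 b3] := hL z zB.
split; [exact: le_trans (ncD _ _) (lerD a1 b1) | exact: le_trans (ncD _ _) (lerD a2 b2) |].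
move=> u uB; have := lerD (a3 u uB) (b3 u uB); rewrite -mulrDl; apply: le_trans.
apply: le_trans (ncD _ _); rewrite le_eqVlt; apply/orP; left; apply/eqP; congr nc; ring.
Qed.

Lemma lt2M h h' g g' : lt2 h h' -> lt2 g g' ->
  lt2 (fun z => h z * g z) (fun z => h' z * g z + h z * g' z).
Proof.
move=> hh hg B0; pose B := `|B0|; have B00 : 0 <= B := normr_ge0 _.
have [K [K0 hK]] := hh B; have [L [L0 hL]] := hg (B + B).
exists (K * L * (3 + B)); have KL : 0 <= K * L by exact: mulr_ge0.
split; first by rewrite mulr_ge0 // addr_ge0.
move=> z zB0; have zB : nc z <= B := le_trans zB0 (ler_norm _).
have zBB : nc z <= B + B by rewrite ler_wpDr.
have [a1 a2 a3] := hK z zB; have [b1 b2 b3] := hL z zBB.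
have m1 x y : nc x <= K -> nc y <= L -> nc (x * y) <= K * L.
  by move=> ? ?; rewrite ncM; apply: ler_pM; rewrite ?nc_ge0.
split; first by apply: le_trans (m1 _ _ a1 b1) _; rewrite ler_peMr //; lra.
  apply: le_trans (ncD _ _) _; have := m1 _ _ a1 b2; have := m1 _ _ a2 b1; nra.
move=> u uB0; have uB : nc u <= B := le_trans uB0 (ler_norm _).
have uBB : nc u <= B + B by rewrite ler_wpDr.
have [c1 _ _] := hL (z + u) (le_trans (ncD _ _) (lerD zB uB)).
have E1 := a3 u uB; have E2 := b3 u uBB.
set e1 := h (z + u) - h z - u * h' z in E1; set e2 := g (z + u) - g z - u * g' z in E2.
have -> : h (z + u) * g (z + u) - h z * g z - u * (h' z * g z + h z * g' z) =
  e1 * g (z + u) + ((h z + u * h' z) * e2 + u ^+ 2 * (h' z * g' z)) by rewrite /e1 /e2; ring.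
apply: le_trans (ncD _ _) _; have -> : K * L * (3 + B) * nc u ^+ 2 = K * L * nc u ^+ 2 + (K * (1 + B) * (L * nc u ^+ 2) + K * L * nc u ^+ 2).
  by ring.
apply: lerD.
  by rewrite ncM mulrAC; apply: ler_pM; rewrite ?nc_ge0.
apply: le_trans (ncD _ _) _; apply: lerD.
  rewrite ncM; apply: ler_pM; rewrite ?nc_ge0 //; apply: le_trans (ncD _ _) _.
  rewrite mulrDr mulr1; apply: lerD => //; rewrite ncM mulrC; apply: ler_pM; rewrite ?nc_ge0 //.
by rewrite ncM ncX mulrC ler_wpM2r ?sqr_ge0 //; exact: m1.
Qed.

Lemma lt2_comp h h' g g' : lt2 h h' -> lt2 g g' -> lt2 (fun z => h (g z)) (fun z => h' (g z) * g' z).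
Proof.
move=> hh hg B0; pose B := `|B0|; have B00 : 0 <= B := normr_ge0 _.
have [L [L0 hL]] := hg B; pose V := B * L + L * B ^+ 2.
have V0 : 0 <= V by rewrite addr_ge0 ?mulr_ge0 ?sqr_ge0.
have [K [K0 hK]] := hh (L + V).
have P0 : 0 <= K * (L + L * B) ^+ 2 by rewrite mulr_ge0 ?sqr_ge0.
have KL : 0 <= K * L by exact: mulr_ge0.
exists (K * (L + L * B) ^+ 2 + K * L + K); split; first by lra.
move=> z zB0; have zB : nc z <= B := le_trans zB0 (ler_norm _).
have [b1 b2 b3] := hL z zB.
have LV : L <= L + V by lra.
have [a1 a2 a3] := hK (g z) (le_trans b1 LV).
split; [lra | |].
  rewrite ncM; apply: (@le_trans _ _ (K * L)); last by lra.
  by apply: ler_pM; rewrite ?nc_ge0.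
move=> u uB0; have uB : nc u <= B := le_trans uB0 (ler_norm _); have u0 := nc_ge0 u.
have := b3 u uB; set e := _ - u * g' z => he; pose v := u * g' z + e.
have gv : g (z + u) = g z + v by rewrite /v /e; ring.
have v1 : nc v <= (L + L * B) * nc u.
  apply: le_trans (ncD _ _) _; rewrite ncM mulrDl; apply: lerD; first by rewrite mulrC ler_wpM2r.
  apply: le_trans he _; rewrite expr2 mulrA ler_wpM2r // ler_wpM2l //.
have vV : nc v <= L + V.
  apply: le_trans v1 _; have : (L + L * B) * nc u <= (L + L * B) * B by rewrite ler_wpM2l // addr_ge0 ?mulr_ge0.
  have VE : V = (L + L * B) * B by rewrite /V; ring.
  by rewrite -VE; move: L0; lra.
have := a3 v vV; rewrite -gv => ha.
have -> : h (g (z + u)) - h (g z) - u * (h' (g z) * g' z) =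
   (h (g (z + u)) - h (g z) - v * h' (g z)) + e * h' (g z) by rewrite /v; ring.
apply: le_trans (ncD _ _) _; rewrite [leRHS]mulrDl; apply: ler_wpDr; first by rewrite mulr_ge0 ?sqr_ge0.
rewrite [leRHS]mulrDl; apply: lerD.
  apply: le_trans ha _; rewrite -mulrA -exprMn ler_wpM2l // lerXn2r ?nnegrE ?nc_ge0 //.
  by rewrite mulr_ge0 // addr_ge0 ?mulr_ge0.
by rewrite ncM mulrC -mulrA; apply: ler_pM; rewrite ?nc_ge0.
Qed.

Lemma lt2_ee : lt2 (@ee R) (fun z => twopii R * ee z).
Proof.
move=> B0; pose B := `|B0|; have B00 : 0 <= B := normr_ge0 _.
have p0 : 0 < pi :> R := pi_gt0 R; have p1 := ltW p0; have p2 : 0 <= 2 * pi :> R by rewrite mulr_ge0.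
pose E := expR (2 * pi * B); have E0 : 0 < E := expR_gt0 _.
exists (E + 2 * pi * E + E * (4 * (2 * pi) ^+ 2 * E)); split.
  by rewrite !addr_ge0 ?mulr_ge0 ?sqr_ge0 // ltW.
move=> z zB0; have zB : nc z <= B := le_trans zB0 (ler_norm _).
have hE : nc (ee z) <= E.
  rewrite nc_ee ler_expR -mulrN ler_wpM2l //; apply: le_trans (ler_norm _) _.
  by rewrite normrN; exact: le_trans (nc_Im _) zB.
have x0 : 0 <= E * (4 * (2 * pi) ^+ 2 * E) by rewrite !mulr_ge0 ?sqr_ge0 // ltW.
have x1 : 0 <= 2 * pi * E by rewrite !mulr_ge0 // ltW.
split; first by lra.
  rewrite ncM nc_twopii; have : 2 * pi * nc (ee z) <= 2 * pi * E by rewrite ler_wpM2l.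
  by lra.
move=> u uB0; have uB : nc u <= B := le_trans uB0 (ler_norm _); have u0 := nc_ge0 u.
have -> : ee (z + u) - ee z - u * (twopii R * ee z) = ee z * (ee u - 1 - twopii R * u) by rewrite eeD; ring.
rewrite ncM; apply: (@le_trans _ _ (E * (4 * (2 * pi) ^+ 2 * E) * nc u ^+ 2)); last first.
  by rewrite ler_wpM2r ?sqr_ge0 //; lra.
rewrite -mulrA; apply: ler_pM; rewrite ?nc_ge0 //; apply: le_trans (ee_taylor u) _.
rewrite exprMn mulrA [leRHS]mulrAC ler_wpM2l ?mulr_ge0 ?sqr_ge0 //.
by rewrite ler_expR ler_wpM2l.
Qed.

Lemma fexp_lt2 (f g : R[i] * 'cV[R[i]]_1 -> R[i]) tau : isD (@upper R 1) (@wz R 1 0) f g ->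
  0 < complex.Im tau -> lt2 (fun z => f (pt1 tau z)) (fun z => twopii R * g (pt1 tau z)).
Proof.
move=> [c [hf hg]] t0 B0; pose B := `|B0|; have B00 : 0 <= B := normr_ge0 _.
have p0 : 0 < pi :> R := pi_gt0 R; have p1 := ltW p0; have p2 : 0 <= 2 * pi :> R by rewrite mulr_ge0.
have Up z : upper (pt1 tau z) by [].
(* The needed weights: pi B for the monomial at z, a further 1 for the frequency factor of the
   derivative, and in the Taylor remainder pi B for z, pi B for u and pi for the squared
   frequency. *)
pose t := pi * B + pi * B + 1 + pi; have pB : 0 <= pi * B by rewrite mulr_ge0.
have [M hM] := conv_expS t (fexp_conv hf) (Up 0).
have M0 : 0 <= M by have := hM fset0; rewrite big_seq_fset0.
pose x (i : nat * 'cV[int]_1) := (expR (t * absS R i.2))%:C * c i * mono (pt1 tau 0) i.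
have monoz z (i : nat * 'cV[int]_1) : mono (pt1 tau z) i = mono (pt1 tau 0) i * expi (wz R 0 i * z).
  by rewrite !monoE !linE !big_ord1 !mxE mulr0 addr0 expiD.
have absE (i : nat * 'cV[int]_1) : absS R i.2 = `|(i.2 0 0)%:~R| by rewrite /absS big_ord1.
have wn (i : nat * 'cV[int]_1) : nc (wz R 0 i) = absS R i.2 / 2 by rewrite /wz ncM nc_int ncV nc_nat absE.
have ncex z (i : nat * 'cV[int]_1) : nc z <= B -> nc (expi (wz R 0 i * z)) <= expR (pi * B * absS R i.2).
  move=> zB; rewrite nc_expi ler_expR -mulrN; apply: (@le_trans _ _ (2 * pi * nc (wz R 0 i * z))).
    rewrite ler_wpM2l //; apply: le_trans (ler_norm _) _; rewrite normrN; exact: nc_Im.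
  rewrite ncM wn; have -> : 2 * pi * (absS R i.2 / 2 * nc z) = pi * nc z * absS R i.2 by field.
  by rewrite ler_wpM2r ?absS_ge0 // ler_wpM2l.
have xE i : nc (x i) = expR (t * absS R i.2) * nc (c i * mono (pt1 tau 0) i).
  by rewrite /x -mulrA ncM nc_real ger0_norm ?expR_ge0.
have bnd z : nc z <= B -> forall A : {fset _}, \sum_(i <- A) nc (c i * mono (pt1 tau z) i) <= M.
  move=> zB A; apply: le_trans (hM A); apply: ler_sum => i _; rewrite -/(x i) xE monoz mulrA ncM mulrC.
  rewrite ler_wpM2r ?nc_ge0 //; apply: le_trans (ncex z i zB) _; rewrite ler_expR ler_wpM2r ?absS_ge0 //.
  by rewrite /t; move: pB; move: (pi * B) => y y0; lra.
have bnd1 z : nc z <= B -> forall A : {fset _}, \sum_(i <- A) nc (wz R 0 i * c i * mono (pt1 tau z) i) <= M.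
  move=> zB A; apply: le_trans (hM A); apply: ler_sum => i _; rewrite -/(x i) xE monoz -mulrA ncM mulrA ncM.
  rewrite [X in _ * X]mulrC mulrA ler_wpM2r ?nc_ge0 //.
  apply: (@le_trans _ _ (expR (absS R i.2) * expR (pi * B * absS R i.2))).
    apply: ler_pM; rewrite ?nc_ge0 // ?ncex //; rewrite wn; have := expR_ge1Dx (absS R i.2); have := absS_ge0 R i.2; lra.
  rewrite -expRD ler_expR -[X in X + _]mul1r -mulrDl ler_wpM2r ?absS_ge0 //.
  by rewrite /t; move: pB; move: (pi * B) => y y0; lra.
exists (M + 2 * pi * M + 32 * M); split; first by rewrite !addr_ge0 ?mulr_ge0.
have y0 : 0 <= 2 * pi * M by rewrite !mulr_ge0 // ltW.
move=> z zB0; have zB : nc z <= B := le_trans zB0 (ler_norm _).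
split.
- by apply: le_trans (nc_has_sum (hf _ (Up z)) (bnd z zB)) _; lra.
- have := nc_has_sum (hg _ (Up z)) (bnd1 z zB); rewrite ncM nc_twopii => h.
  have : 2 * pi * nc (g (pt1 tau z)) <= 2 * pi * M by rewrite ler_wpM2l.
  by lra.
move=> u uB0; have uB : nc u <= B := le_trans uB0 (ler_norm _); have u0 := nc_ge0 u.
have hs := has_sumB (has_sumB (hf _ (Up (z + u))) (hf _ (Up z))) (has_sumZ (u * twopii R) (hg _ (Up z))).
rewrite mulrA; apply: (@le_trans _ _ (32 * nc u ^+ 2 * M)); last first.
  by rewrite [leRHS]mulrC -mulrA mulrCA ler_wpM2l ?sqr_ge0 //; lra.
apply: (nc_has_sum hs) => A.
apply: le_trans (ler_wpM2l (_ : 0 <= 32 * nc u ^+ 2) (hM A)); last by rewrite mulr_ge0 ?sqr_ge0.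
rewrite mulr_sumr; apply: ler_sum => i _; rewrite -/(x i) xE.
have -> : c i * mono (pt1 tau (z + u)) i - c i * mono (pt1 tau z) i - u * twopii R * (wz R 0 i * c i * mono (pt1 tau z) i) =
  c i * mono (pt1 tau 0) i * (expi (wz R 0 i * z) * (expi (wz R 0 i * u) - 1 - twopii R * (wz R 0 i * u))).
  rewrite (monoz (z + u)) (monoz z) [_ * (z + u)]mulrDr expiD.
  by ring.
rewrite (ncM (c i * mono (pt1 tau 0) i)) [leRHS]mulrA [leRHS]mulrC; apply: ler_wpM2l; first exact: nc_ge0.
rewrite (ncM (expi (wz R 0 i * z))).
have a0 := absS_ge0 R i.2; have := expi_taylor1 (wz R 0 i * u).
have -> : 2 * pi * nc (wz R 0 i * u) = pi * nc u * absS R i.2 by rewrite ncM wn; field.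
move=> h; apply: le_trans (ler_pM (nc_ge0 _) (nc_ge0 _) (ncex z i zB) h) _.
have h2 : (pi * nc u * absS R i.2) ^+ 2 <= 2 * nc u ^+ 2 * expR (pi * absS R i.2).
  have := expR_sqr_le (_ : 0 <= pi * absS R i.2); rewrite mulr_ge0 // => /(_ isT) h2.
  have -> : (pi * nc u * absS R i.2) ^+ 2 = nc u ^+ 2 * (pi * absS R i.2) ^+ 2 by ring.
  have -> : 2 * nc u ^+ 2 * expR (pi * absS R i.2) = nc u ^+ 2 * (2 * expR (pi * absS R i.2)) by ring.
  by rewrite ler_wpM2l ?sqr_ge0.
have h3 : expR (pi * nc u * absS R i.2) <= expR (pi * B * absS R i.2).
  by rewrite ler_expR ler_wpM2r // ler_wpM2l.
apply: (@le_trans _ _ (expR (pi * B * absS R i.2) * (4 * (2 * nc u ^+ 2 * expR (pi * absS R i.2)) * expR (pi * B * absS R i.2)))).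
  rewrite ler_wpM2l ?expR_ge0 //; apply: ler_pM; rewrite ?mulr_ge0 ?sqr_ge0 ?expR_ge0 //.
  by rewrite ler_wpM2l.
have -> : expR (pi * B * absS R i.2) * (4 * (2 * nc u ^+ 2 * expR (pi * absS R i.2)) * expR (pi * B * absS R i.2)) =
  8 * nc u ^+ 2 * expR (pi * B * absS R i.2 + pi * absS R i.2 + pi * B * absS R i.2) by rewrite !expRD; ring.
apply: ler_pM; rewrite ?mulr_ge0 ?sqr_ge0 ?expR_ge0 //.
  by rewrite ler_wpM2r ?sqr_ge0 // ler_nat.
have -> : pi * B * absS R i.2 + pi * absS R i.2 + pi * B * absS R i.2 = (pi * B + pi + pi * B) * absS R i.2 by ring.
by rewrite ler_expR ler_wpM2r // /t; move: (pi * B) => y; lra.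
Qed.

Lemma lt2_ph k tau : 0 < complex.Im tau -> lt2 (ph k tau) (fun z => twopii R * ph k.+1 tau z).
Proof. by move=> t0; have := fexp_lt2 (@isD_phk R k) t0; rewrite ph.unlock. Qed.

End LT2.

(** * Uniqueness of theta functions *)

Lemma seqD (R : realType) (f g : nat -> R[i]) (a b : R[i]) : f @ \oo --> a -> g @ \oo --> b ->
  (fun n => f n + g n) @ \oo --> a + b.
Proof. by move=> hf hg; apply: cvgD; [exact: hf | exact: hg]. Qed.

Section ThetaUniqueness.
Variable R : realType.
Implicit Types (f g h : R[i] -> R[i]) (s u z : R[i]).

(** A Riemann sum over one period; for periodic f its limit stands for the zeroth Fourier
    coefficient. *)
Definition navg (k : nat) f s : R[i] := (2 ^+ k)^-1 * \sum_(j < 2 ^ k) f (s + j%:R / 2 ^+ k).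

Lemma two_neq0 k : (2 ^+ k : R[i]) != 0. Proof. by rewrite expf_neq0 // pnatr_eq0. Qed.

Lemma nc_two k : nc ((2 ^+ k)^-1 : R[i]) = (2 ^+ k)^-1.
Proof. by rewrite ncV ncX nc_nat. Qed.

Lemma two_gt0 k : 0 < (2 ^+ k : R). Proof. by rewrite exprn_gt0. Qed.

Lemma nc_grid k j : (j <= 2 ^ k)%N -> nc (j%:R / 2 ^+ k : R[i]) <= 1.
Proof.
by move=> h; rewrite ncM nc_nat nc_two ler_pdivrMr ?two_gt0 // mul1r -natrX ler_nat.
Qed.

Lemma nc_avg_le k (F : nat -> R[i]) (K : R) : (forall j, (j < 2 ^ k)%N -> nc (F j) <= K) ->
  nc ((2 ^+ k)^-1 * \sum_(j < 2 ^ k) F j) <= K.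
Proof.
move=> h; rewrite ncM nc_two ler_pdivrMl ?two_gt0 //; apply: le_trans (nc_sum _ _ _) _.
apply: (@le_trans _ _ (\sum_(j < 2 ^ k) K)); first by apply: ler_sum => j _; exact: h.
by rewrite sumr_const card_ord -[_ *+ _]mulr_natl natrX.
Qed.

Lemma sum_shift_period (V : zmodType) (F : nat -> V) N : F N = F 0%N -> \sum_(j < N) F j.+1 = \sum_(j < N) F j.
Proof.
move=> h; apply: (addrI (F 0%N)); transitivity (\sum_(j < N.+1) F j); first by rewrite big_ord_recl.
by rewrite big_ord_recr /= h addrC.
Qed.

(** A single shift by d costs O(|d| / 2^k + |d|^2), because the mean of the derivative over the grid
    is O(2^-k). Cutting u into 2^k equal steps makes both terms add up to O(|u| / 2^k). *)
Lemma navg_shift f f' (B : R) : lt2 f f' -> (forall z, f (z + 1) = f z) -> exists K : R, 0 <= K /\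
  forall k s u, nc s <= B -> nc u <= B -> nc (navg k f (s + u) - navg k f s) <= K * nc u / 2 ^+ k.
Proof.
move=> hf per; pose B1 := `|B| + `|B| + 1.
have B0 : 0 <= `|B| := normr_ge0 _; have [K [K0 hK]] := hf B1.
exists (K * (1 + `|B|)); split; first by rewrite mulr_ge0 // addr_ge0.
move=> k s u sB0 uB0; have sB : nc s <= `|B| := le_trans sB0 (ler_norm _).
have uB : nc u <= `|B| := le_trans uB0 (ler_norm _).
have N0 := two_gt0 k; have u0 := nc_ge0 u.
have N1 : 1 <= 2 ^+ k :> R by rewrite -natrX ler1n expn_gt0.
have iN0 : 0 < (2 ^+ k : R)^-1 by rewrite invr_gt0.
have iN1 : (2 ^+ k : R)^-1 <= 1 by rewrite invf_le1.
have step x d : nc x <= `|B| + `|B| -> nc d <= `|B| ->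
    nc (navg k f (x + d) - navg k f x) <= K * (nc d / 2 ^+ k + nc d ^+ 2).
  move=> xB dB; have xj j : (j < 2 ^ k)%N -> nc (x + j%:R / 2 ^+ k) <= B1.
    by move=> jk; apply: le_trans (ncD _ _) _; apply: lerD => //; apply: nc_grid; exact: ltnW.
  pose a' := (2 ^+ k)^-1 * \sum_(j < 2 ^ k) f' (x + j%:R / 2 ^+ k).
  have ha : nc a' <= K / 2 ^+ k.
    (* By periodicity the increments along the grid cancel, so the mean of f' is -2^k times the mean
       of the Taylor remainders, each of size O(4^-k). *)
    have tel : \sum_(j < 2 ^ k) (f (x + j%:R / 2 ^+ k + (2 ^+ k)^-1) - f (x + j%:R / 2 ^+ k)) = 0.
      rewrite big_split /= -(@sum_shift_period _ (fun j : nat => - f (x + j%:R / 2 ^+ k))); last first.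
        by rewrite natrX divff ?two_neq0 // per mul0r addr0.
      rewrite -big_split big1 // => j _ /=.
      by rewrite (_ : x + j%:R / 2 ^+ k + (2 ^+ k)^-1 = x + j.+1%:R / 2 ^+ k) ?subrr // -natr1; ring.
    have -> : a' = (2 ^+ k)^-1 * \sum_(j < 2 ^ k)
       - (2 ^+ k * (f (x + j%:R / 2 ^+ k + (2 ^+ k)^-1) - f (x + j%:R / 2 ^+ k) - (2 ^+ k)^-1 * f' (x + j%:R / 2 ^+ k))).
      rewrite /a'; congr (_ * _); rewrite sumrN -mulr_sumr big_split /= tel add0r mulr_sumr -sumrN.
      by apply: eq_bigr => j _; rewrite mulrN opprK mulrA mulfV ?two_neq0 // mul1r.
    apply: (@nc_avg_le k (fun j => - (2 ^+ k * (f (x + j%:R / 2 ^+ k + (2 ^+ k)^-1) - f (x + j%:R / 2 ^+ k) - (2 ^+ k)^-1 * f' (x + j%:R / 2 ^+ k))))).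
    move=> j jk; have [_ _ h3] := hK _ (xj j jk).
    have i1 : nc ((2 ^+ k)^-1 : R[i]) <= B1 by rewrite nc_two /B1; lra.
    have := h3 _ i1; rewrite nc_two => h4; rewrite ncN ncM ncX nc_nat.
    apply: le_trans (ler_wpM2l (ltW N0) h4) _; rewrite le_eqVlt; apply/orP; left; apply/eqP; field.
    by rewrite gt_eqF.
  have -> : navg k f (x + d) - navg k f x = d * a' + (2 ^+ k)^-1 * \sum_(j < 2 ^ k)
      (f (x + j%:R / 2 ^+ k + d) - f (x + j%:R / 2 ^+ k) - d * f' (x + j%:R / 2 ^+ k)).
    rewrite /navg /a' mulrCA -mulrDr -mulrBr; congr (_ * _).
    rewrite mulr_sumr -sumrB -big_split; apply: eq_bigr => j _ /=.
    rewrite (_ : x + d + j%:R / 2 ^+ k = x + j%:R / 2 ^+ k + d); last by rewrite addrAC.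
    by move: (f _) (f _) (f' _) => p q r; ring.
  apply: le_trans (ncD _ _) _; rewrite mulrDr; apply: lerD.
    rewrite ncM mulrCA ler_wpM2l ?nc_ge0 //.
  apply: (@nc_avg_le k (fun j => f (x + j%:R / 2 ^+ k + d) - f (x + j%:R / 2 ^+ k) - d * f' (x + j%:R / 2 ^+ k))).
  move=> j jk; have [_ _ h3] := hK _ (xj j jk); apply: h3; rewrite /B1; lra.
pose d := u / 2 ^+ k; have nd : nc d = nc u / 2 ^+ k by rewrite ncM nc_two.
have dB : nc d <= `|B| by rewrite nd; apply: le_trans uB; rewrite ler_piMr.
have it i : (i <= 2 ^ k)%N -> nc (navg k f (s + i%:R * d) - navg k f s) <= i%:R * (K * (nc d / 2 ^+ k + nc d ^+ 2)).
  elim: i => [|i IH] ik; first by rewrite !mul0r addr0 subrr nc0.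
  have -> : navg k f (s + i.+1%:R * d) - navg k f s =
    (navg k f (s + i%:R * d + d) - navg k f (s + i%:R * d)) + (navg k f (s + i%:R * d) - navg k f s).
    by rewrite addrA subrK -addrA -natr1 mulrDl mul1r.
  apply: le_trans (ncD _ _) _; rewrite -natr1 mulrDl mul1r addrC; apply: lerD; first exact: IH (ltnW ik).
  apply: step => //; apply: le_trans (ncD _ _) _; apply: lerD => //.
  rewrite ncM nc_nat nd mulrCA; apply: le_trans uB; rewrite ler_piMr // ler_pdivrMr // mul1r -natrX ler_nat.
  exact: ltnW.
have := it _ (leqnn _); rewrite natrX /d mulrCA mulfV ?two_neq0 // mulr1 => h.
apply: le_trans h _; rewrite -/d nd natrX.
have -> : 2 ^+ k * (K * (nc u / 2 ^+ k / 2 ^+ k + (nc u / 2 ^+ k) ^+ 2)) = K * (1 + nc u) * nc u / 2 ^+ k.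
  by field; rewrite gt_eqF.
rewrite ler_wpM2r ?(ltW iN0) // ler_wpM2r // ler_wpM2l //; lra.
Qed.

Lemma sum_pairs (F : nat -> R[i]) m : \sum_(j < 2 * m) F j = \sum_(j < m) (F (2 * j)%N + F (2 * j).+1).
Proof.
elim: m => [|m IH]; first by rewrite muln0 !big_ord0.
by rewrite mulnS add2n !big_ord_recr /= IH addrA.
Qed.

(** Doubling the grid adds a copy of the old grid shifted by half its mesh, so by [navg_shift]
    consecutive averages differ by a geometrically small amount. *)
Lemma navg_cvg f f' : lt2 f f' -> (forall z, f (z + 1) = f z) -> exists l, navg ^~ f ^~ 0 @ \oo --> (l : R[i]).
Proof.
move=> hf per; have [K [K0 hK]] := @navg_shift f f' 1 hf per.
pose a k := navg k f 0.
have half k : a k.+1 - a k = 2^-1 * (navg k f (0 + (2 ^+ k.+1)^-1) - navg k f 0).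
  rewrite /a /navg expnS (sum_pairs (fun j => f (0 + j%:R / 2 ^+ k.+1))).
  have e1 (j : nat) : 0 + (2 * j)%N%:R / 2 ^+ k.+1 = 0 + j%:R / 2 ^+ k :> R[i].
    by rewrite natrM exprS; field; rewrite two_neq0.
  have e2 (j : nat) : 0 + (2 * j).+1%:R / 2 ^+ k.+1 = 0 + (2 ^+ k.+1)^-1 + j%:R / 2 ^+ k :> R[i].
    by rewrite -natr1 natrM exprS; field; rewrite two_neq0.
  under eq_bigr do rewrite e1 e2.
  rewrite big_split /= exprS invfM; move: (\sum_(i < _) _) (\sum_(i < _) _) => x y; field.
  by rewrite two_neq0.
have b : bsum (fun k => a k.+1 - a k).
  apply: (@bsum_nat _ _ (K * (1 - 2^-1)^-1)) => n.
  apply: (@le_trans _ _ (\sum_(i < n) K * 2^-1 ^+ i)); last first.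
    by rewrite -mulr_sumr ler_wpM2l // sum_geo_le //; lra.
  apply: ler_sum => i _; rewrite half ncM ncV nc_nat.
  have i1 (m : nat) : ((2 ^+ m)^-1 : R) <= 1 by rewrite invf_le1 ?two_gt0 // -natrX ler1n expn_gt0.
  have := hK i 0 (2 ^+ i.+1)^-1; rewrite nc0 nc_two => /(_ ler01 (i1 _)) h.
  have h2 := i1 i.+1; have h3 : 0 < (2 ^+ i : R)^-1 by rewrite invr_gt0 two_gt0.
  have h4 : 0 < (2 ^+ i.+1 : R)^-1 by rewrite invr_gt0 two_gt0.
  rewrite exprVn; apply: (@le_trans _ _ (2^-1 * (K * (2 ^+ i.+1)^-1 / 2 ^+ i))); first by rewrite ler_wpM2l.
  rewrite !mulrA ler_wpM2r ?(ltW h3) //.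
  have : K * (2 ^+ i.+1)^-1 <= K by rewrite ler_piMr.
  have : 0 <= K * (2 ^+ i.+1)^-1 by rewrite mulr_ge0 // ltW.
  by lra.
have := has_sum_series (bsum_has b); set L := csum _ => h.
exists (L + a 0%N); apply: (seq_eq (seqD h (cvg_cst (a 0%N)))) => n.
rewrite -(big_mkord xpredT (fun k => a k.+1 - a k)) telescope_sumr //.
by rewrite subrK.
Qed.

Section Coefficients.
Variables (g g' : R[i] -> R[i]) (hg : lt2 g g') (per : forall z, g (z + 1) = g z).

(** A Riemann sum for the r-th Fourier coefficient of g, with base point s and without the phase of
    s. *)
Definition bco (s : R[i]) k (r : int) : R[i] :=
  (2 ^+ k)^-1 * \sum_(j < 2 ^ k) g (s + j%:R / 2 ^+ k) * ee (- (r%:~R * (j%:R / 2 ^+ k))).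

(** Summation by parts, twice: (1 - w)^2 times the coefficient is a mean of second differences of g,
    of size O(4^-k), while |1 - w| is at least 2 |r| / 2^k by [chord_lb]. This gives decay like 1 /
    r^2, uniformly in k. *)
Lemma bco_bound s : exists K : R, 0 <= K /\ forall k (r : int), (2 * `|r| <= 2 ^ k)%N ->
  nc (bco s k r) <= K / (1 + r%:~R ^+ 2).
Proof.
have [K [K0 hK]] := hg (nc s + 3); exists (2 * K + 2 * K); split; first by lra.
move=> k r rk; have N0 := two_gt0 k.
pose d : R[i] := (2 ^+ k)^-1; have nd : nc d = (2 ^+ k)^-1 := nc_two k.
have d1 : nc d <= 1 by rewrite nd invf_le1 // -natrX ler1n expn_gt0.
have s0 := nc_ge0 s.
have gj j : (j <= (2 ^ k).+1)%N -> nc (s + j%:R * d) <= nc s + 3.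
  move=> jk; apply: le_trans (ncD _ _) _; rewrite lerD2l ncM nc_nat nd ler_pdivrMr //.
  rewrite -natrX -natrM ler_nat; have : (0 < 2 ^ k)%N by rewrite expn_gt0.
  by move: jk; move: (2 ^ k)%N => N; lia.
pose w := ee (r%:~R * d); pose F (j : nat) := g (s + j%:R * d) * ee (- (r%:~R * (j%:R * d))).
have NE : 2 ^+ k * d = 1 by rewrite mulfV ?two_neq0.
have gper j : g (s + (j + 2 ^ k)%N%:R * d) = g (s + j%:R * d).
  by rewrite natrD natrX mulrDl NE addrA per.
have eper j : ee (- (r%:~R * ((j + 2 ^ k)%N%:R * d))) = ee (- (r%:~R * (j%:R * d))).
  rewrite natrD natrX mulrDl NE mulrDr mulr1 opprD eeD -[- r%:~R]mulN1r -(rmorphN1 intr) -intrM ee_int mulr1 //.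
have Fper j : F (j + 2 ^ k)%N = F j by rewrite /F gper eper.
pose S := \sum_(j < 2 ^ k) F j.
have S1 : \sum_(j < 2 ^ k) F j.+1 = S by apply: sum_shift_period; rewrite -[(2 ^ k)%N]add0n Fper.
have S2 : \sum_(j < 2 ^ k) F j.+2 = S.
  by rewrite -S1; apply: (@sum_shift_period _ (fun j => F j.+1)); rewrite -[(2 ^ k).+1]add1n Fper.
have FS j : w * F j.+1 = g (s + j.+1%:R * d) * ee (- (r%:~R * (j%:R * d))).
  rewrite /F mulrCA /w -eeD; congr (_ * ee _); rewrite -natr1; ring.
have FSS j : w ^+ 2 * F j.+2 = g (s + j.+2%:R * d) * ee (- (r%:~R * (j%:R * d))).
  rewrite expr2 -mulrA FS mulrCA /w -eeD; congr (_ * ee _); rewrite -natr1; ring.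
pose D j := g (s + j.+2%:R * d) - 2 * g (s + j.+1%:R * d) + g (s + j%:R * d).
have key : (1 - w) ^+ 2 * bco s k r = (2 ^+ k)^-1 * \sum_(j < 2 ^ k) D j * ee (- (r%:~R * (j%:R * d))).
  have -> : bco s k r = (2 ^+ k)^-1 * S by [].
  have -> : (1 - w) ^+ 2 * ((2 ^+ k)^-1 * S) = (2 ^+ k)^-1 * (w ^+ 2 * S - 2 * (w * S) + S) by ring.
  congr (_ * _); rewrite -{1}S2 -{1}S1 /S !mulr_sumr -sumrB -big_split; apply: eq_bigr => j _ /=.
  by rewrite FSS FS /D /F; ring.
have hD j : (j < 2 ^ k)%N -> nc (D j * ee (- (r%:~R * (j%:R * d)))) <= 2 * K * nc d ^+ 2.
  move=> jk; rewrite ncM.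
  have -> : nc (ee (- (r%:~R * (j%:R * d)))) = 1.
    have -> : - (r%:~R * (j%:R * d)) = (- (r%:~R * (j%:R / 2 ^+ k)))%:C.
      by rewrite rmorphN rmorphM rmorph_int fmorph_div rmorph_nat rmorphXn rmorph_nat.
    by rewrite -expi_ee nc_expi_real.
  rewrite mulr1; have [_ _ h3] := hK _ (gj j.+1 (ltnW jk)).
  have dB : nc d <= nc s + 3 by lra.
  have := h3 d dB; have := h3 (- d); rewrite ncN => /(_ dB) h4 h5.
  have -> : D j = (g (s + j.+1%:R * d + d) - g (s + j.+1%:R * d) - d * g' (s + j.+1%:R * d)) +
     (g (s + j.+1%:R * d - d) - g (s + j.+1%:R * d) - - d * g' (s + j.+1%:R * d)).
    rewrite /D (_ : s + j.+1%:R * d + d = s + j.+2%:R * d); last by rewrite -(natr1 j.+1); ring.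
    rewrite (_ : s + j.+1%:R * d - d = s + j%:R * d); last by rewrite -(natr1 j); ring.
    by ring.
  apply: le_trans (ncD _ _) _; have := lerD h5 h4; rewrite -mulrDl -mulr2n -[_ *+ 2]mulr_natl //.
have h1 : nc (1 - w) ^+ 2 * nc (bco s k r) <= 2 * K * nc d ^+ 2.
  by rewrite -ncX -ncM key; apply: (@nc_avg_le k (fun j => D j * ee (- (r%:~R * (j%:R * d))))).
have b0 := nc_ge0 (bco s k r).
have [r0|r0] := eqVneq r 0.
  rewrite r0 /= expr0n /= addr0 divr1; apply: (@le_trans _ _ K); last by lra.
  apply: (@nc_avg_le k (fun j => g (s + j%:R / 2 ^+ k) * ee (- (0%:~R * (j%:R / 2 ^+ k))))) => j jk.
  rewrite mul0r oppr0 ee0 mulr1; have [-> //] := hK _ (gj j (leqW (ltnW jk))).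
have r1 : 1 <= (r%:~R : R) ^+ 2.
  by rewrite -rmorphXn /= ler1z -gtz0_ge1 exprn_even_gt0.
have hw : 2 * (`|r%:~R| / 2 ^+ k) <= nc (1 - w).
  pose t : R := r%:~R / 2 ^+ k.
  have tn : `|t| = `|r%:~R| / 2 ^+ k by rewrite /t normrM normfV (ger0_norm (ltW N0)).
  have t2 : `|t| <= 2^-1.
    rewrite tn ler_pdivrMr // mulrC ler_pdivlMr // mulrC -intr_norm -natr_absz -natrX -natrM ler_nat //.
  rewrite -tn; apply: le_trans (chord_lb (k := k) (d := r) erefl t2) _.
  by rewrite /w -expi_ee /d /t fmorph_div rmorph_int rmorphXn rmorph_nat.
have h2 : (2 * (`|r%:~R| / 2 ^+ k)) ^+ 2 * nc (bco s k r) <= 2 * K * nc d ^+ 2.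
  apply: le_trans h1; rewrite ler_wpM2r // lerXn2r ?nnegrE ?nc_ge0 // mulr_ge0 // divr_ge0 // ltW //.
have h3 : 4 * r%:~R ^+ 2 * nc (bco s k r) <= 2 * K.
  move: h2; rewrite nd exprMn exprMn exprVn real_normK ?num_real // => h2.
  rewrite -(ler_pM2r (_ : 0 < (2 ^+ k : R) ^- 2)); last by rewrite invr_gt0 exprn_gt0.
  by apply: le_trans h2; rewrite le_eqVlt; apply/orP; left; apply/eqP; ring.
rewrite ler_pdivlMr; last by lra.
by move: r1 h3 b0; move: (_ ^+ 2) (nc _) => x y; nra.
Qed.

Lemma davg_period k (j : nat) : (j < 2 ^ k)%N -> davg R k (- j%:Z) = (j == 0%N)%:R.
Proof.
move=> jk; have [->|j0] := eqVneq j 0%N; first by rewrite oppr0 davg0.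
have [h|h] := leqP (2 * j) (2 ^ k).
  by apply: davg_neq0; [rewrite oppr_eq0 | rewrite abszN absz_nat].
have -> : davg R k (- j%:Z) = davg R k ((2 ^ k)%N%:Z - j%:Z).
  rewrite /davg; congr (_ * _); apply: eq_bigr => i _; rewrite !expi_ee.
  have -> : ((2 ^ k)%N%:Z - j%:Z)%:~R * (i%:R / 2 ^+ k) = i%:Z%:~R + (- j%:Z)%:~R * (i%:R / 2 ^+ k) :> R[i].
    by rewrite intrD -!pmulrn natrX; field; rewrite two_neq0.
  by rewrite eeD ee_int mul1r.
by apply: davg_neq0; lia.
Qed.

(** Finite Fourier inversion on 2^(k+1) points. The frequencies run over the window [-2^k, 2^k), on
    which [bco_bound] applies. *)
Lemma bco_inversion s k : \sum_(i < 2 ^ k.+1) bco s k.+1 (i%:Z - (2 ^ k)%N%:Z) = g s.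
Proof.
rewrite /bco -mulr_sumr exchange_big /=.
have e (j : 'I_(2 ^ k.+1)) : \sum_(i < 2 ^ k.+1) g (s + j%:R / 2 ^+ k.+1) * ee (- ((i%:Z - (2 ^ k)%N%:Z)%:~R * (j%:R / 2 ^+ k.+1))) =
   (if j == 0 :> nat then 2 ^+ k.+1 * g s else 0).
  rewrite -mulr_sumr.
  have -> : \sum_(i < 2 ^ k.+1) ee (- ((i%:Z - (2 ^ k)%N%:Z)%:~R * (j%:R / 2 ^+ k.+1))) =
     ee ((2 ^ k)%N%:R * (j%:R / 2 ^+ k.+1)) * (2 ^+ k.+1 * davg R k.+1 (- j%:Z)).
    rewrite /davg mulVKf ?two_neq0 // mulr_sumr; apply: eq_bigr => i _.
    rewrite expi_ee -eeD; congr ee; rewrite intrD !rmorphN -!pmulrn /=; ring.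
  rewrite davg_period //; case: eqP => [->|_]; last by rewrite !mulr0.
  by rewrite mul0r mulr0 ee0 addr0 mul1r mulr1 mulrC.
rewrite (eq_bigr _ (fun j _ => e j)).
have N0 : (0 < 2 ^ k.+1)%N by rewrite expn_gt0.
rewrite (bigD1 (Ordinal N0)) //= big1 => [|j]; last by rewrite -val_eqE /= => /negPf ->.
by rewrite addr0 mulKf // two_neq0.
Qed.

Lemma bsum_inv_sq (K : R) : 0 <= K -> exists M : R, forall A : {fset int},
  \sum_(r <- A) K / (1 + r%:~R ^+ 2) <= M.
Proof.
move=> K0; pose y (r : int) : R[i] := (K / (1 + r%:~R ^+ 2))%:C.
have p0 (x : R) : 0 < 1 + x ^+ 2 by rewrite ltr_wpDr // sqr_ge0.
have yE r : nc (y r) = K / (1 + r%:~R ^+ 2) by rewrite nc_real ger0_norm // divr_ge0 // ltW.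
have b : bsum (fun n : nat => y n%:Z).
  apply: (@bsum_nat _ _ (4 * K)) => n.
  apply: (@le_trans _ _ (\sum_(i < n) 4 * K * (i.+1%:R^-1 - i.+2%:R^-1))).
    apply: ler_sum => i _; rewrite yE -pmulrn.
    have e1 : (i.+1%:R : R) = i%:R + 1 by rewrite natr1.
    have e2 : (i.+2%:R : R) = i%:R + 1 + 1 by rewrite !natr1.
    rewrite e1 e2; have := ler0n R i; move: (i%:R) => x x0; rewrite ler_pdivrMr //.
    have -> : 4 * K * ((x + 1)^-1 - (x + 1 + 1)^-1) = 4 * K / ((x + 1) * (x + 1 + 1)).
      by field; apply/andP; split; rewrite gt_eqF //; lra.
    rewrite mulrAC ler_pdivlMr; last by rewrite mulr_gt0 //; lra.
    by rewrite [4 * K]mulrC -[leRHS]mulrA ler_wpM2l //; nra.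
  rewrite -mulr_sumr.
  have -> : \sum_(i < n) (i.+1%:R^-1 - i.+2%:R^-1) = 1 - n.+1%:R^-1 :> R.
    elim: n => [|n IH]; first by rewrite big_ord0 invr1 subrr.
    by rewrite big_ord_recr /= IH addrA subrK.
  have n0 : 0 <= (n.+1%:R : R)^-1 by rewrite invr_ge0.
  by rewrite -[leRHS]mulr1 ler_wpM2l //; lra.
have [M hM] : bsum y.
  apply: bsum_int => //; apply: (bsum_le (K := 1) b) => n; rewrite mul1r !yE ler_wpM2l // lef_pV2 ?posrE //.
  rewrite lerD2l rmorphN sqrrN -!pmulrn lerXn2r ?nnegrE // ler_nat //.
by exists M => A; apply: le_trans (hM A); rewrite le_eqVlt; apply/orP; left; apply/eqP; apply: eq_bigr => r _; rewrite yE.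
Qed.

(** For each k the finite inversion formula writes g(s) as a sum dominated by the summable family of
    [bco_bound]; as its terms tend to 0, so does the sum. *)
Lemma bco_zero s : (forall r : int, bco s ^~ r @ \oo --> (0 : R[i])) -> g s = 0.
Proof.
move=> h; have [K [K0 hK]] := bco_bound s; have [M hM] := bsum_inv_sq K0.
pose x k (r : int) := if (- (2 ^ k)%N%:Z <= r) && (r < (2 ^ k)%N%:Z) then bco s k.+1 r else 0.
have hx k : has_sum (x k) (g s).
  apply: (@has_sum_inj R _ _ (fun i : nat => i%:Z - (2 ^ k)%N%:Z)) => [i j /addIr [] //|r hr|].
    rewrite /x; case: ifP => // /andP[r1 r2]; have := hr (absz (r + (2 ^ k)%N%:Z)).
    by rewrite gez0_abs ?addrK ?eqxx //; lia.
  rewrite -(bco_inversion s k).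
  have -> : \sum_(i < 2 ^ k.+1) bco s k.+1 (i%:Z - (2 ^ k)%N%:Z) = \sum_(i < 2 ^ k.+1) x k (i%:Z - (2 ^ k)%N%:Z).
    apply: eq_bigr => i _; rewrite /x ifT //; have := ltn_ord i.
    by move: (nat_of_ord i) => {}i; rewrite expnS; move: (2 ^ k)%N => N; lia.
  apply: (@has_sum_natfin R (fun i : nat => x k (i%:Z - (2 ^ k)%N%:Z))) => i; rewrite expnS /x => hi.
  by rewrite ifF //; move: hi; move: (2 ^ k)%N => N; lia.
have [||_] := @tannery R _ x (fun=> 0) _ _ hM.
- move=> k r; rewrite /x; case: ifP => [/andP[r1 r2]|_].
    by apply: hK; rewrite expnS; move: r1 r2; move: (2 ^ k)%N => N; lia.
  by rewrite nc0 divr_ge0 // addr_ge0 // sqr_ge0.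
- move=> r; have h1 := @cvg_sub R _ _ succn (h r).
  have h2 : (bco s ^~ r \o succn) @ \oo --> (0 : R[i]) by apply: h1 => B; exists B => k; lia.
  move/nat_ccvgP: h2 => h2; apply/nat_ccvgP => e e0; have [N hN] := h2 e e0.
  exists N => k Nk; rewrite /x; case: ifP => _; last by rewrite subrr nc0.
  exact: hN.
rewrite (_ : (fun k => csum (x k)) = fun=> g s); last by apply/funext => k; exact: csumE (hx k).
rewrite (csumE (has_sum0 R _)) => h1; exact: ccvg_unique (cvg_cst _) h1.
Qed.

End Coefficients.

Section Quasi.
Variable tau : R[i].

(** The functional equations of a theta function of degree one for the lattice Z + tau Z, satisfied
    by ee(z / 2) times [phi]. *)
Definition quasi (g g' : R[i] -> R[i]) := [/\ lt2 g g', forall z, g (z + 1) = g z &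
  forall z, g (z + tau) = - (ee (- z) * g z)].

Definition tw (r : int) g z := g z * ee (- (r%:~R * z)).

Lemma lt2_tw (r : int) g g' : lt2 g g' -> exists f', lt2 (tw r g) f'.
Proof.
move=> hg; have h := lt2M hg (lt2_comp (@lt2_ee R) (lt2M (lt2_cst (- r%:~R)) (@lt2_id R))).
eexists; rewrite /tw; have -> : (fun z => g z * ee (- (r%:~R * z))) = (fun z => g z * ee (- r%:~R * z)).
  by apply/funext => z; rewrite mulNr.
exact: h.
Qed.

Lemma tw_per (r : int) g : (forall z, g (z + 1) = g z) -> forall z, tw r g (z + 1) = tw r g z.
Proof.
move=> per z; rewrite /tw per mulrDr mulr1 opprD eeD -[- r%:~R]mulN1r -(rmorphN1 intr) -intrM ee_int mulr1 //.
Qed.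

Lemma navg_shift0 (r : int) g g' s : quasi g g' -> navg ^~ (tw r g) ^~ 0 @ \oo --> (0 : R[i]) <->
  navg ^~ (tw r g) ^~ s @ \oo --> (0 : R[i]).
Proof.
move=> [hg per _]; have [f' hf] := lt2_tw r hg.
have [K [K0 hK]] := @navg_shift _ _ (nc s) hf (tw_per r per).
have d e : 0 < e -> exists N, forall k, (N <= k)%N -> nc (navg k (tw r g) s - navg k (tw r g) 0) < e.
  move=> e0; have [N _ hN] : \forall k \near \oo, (K * nc s) * 2^-1 ^+ k < e.
    have : (fun k => (K * nc s) * 2^-1 ^+ k) @ \oo --> ((K * nc s) * 0 : R).
      by apply: cvgM; [exact: cvg_cst | apply: cvg_expr; rewrite ger0_norm ?invr_ge0 //; lra].
    rewrite mulr0 => /cvgrPdist_lt /(_ e e0); apply: filterS => k; rewrite sub0r normrN ger0_norm //.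
    by rewrite !mulr_ge0 ?nc_ge0 ?exprn_ge0 ?invr_ge0.
  exists N => k /hN h; have := hK k 0 s; rewrite nc0 add0r => /(_ (nc_ge0 _) (lexx _)) /le_lt_trans; apply.
  by move: h; rewrite /= exprVn.
split=> /nat_ccvgP h; apply/nat_ccvgP => e e0; have e2 : 0 < e / 2 by lra.
  have [N1 h1] := h _ e2; have [N2 h2] := d _ e2; exists (maxn N1 N2) => k; rewrite geq_max => /andP[k1 k2].
  have -> : navg k (tw r g) s - 0 = (navg k (tw r g) s - navg k (tw r g) 0) + (navg k (tw r g) 0 - 0) by ring.
  by apply: le_lt_trans (ncD _ _) _; have := h1 _ k1; have := h2 _ k2; lra.
have [N1 h1] := h _ e2; have [N2 h2] := d _ e2; exists (maxn N1 N2) => k; rewrite geq_max => /andP[k1 k2].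
have -> : navg k (tw r g) 0 - 0 = (navg k (tw r g) s - 0) - (navg k (tw r g) s - navg k (tw r g) 0) by ring.
by apply: le_lt_trans (ncB _ _) _; have := h1 _ k1; have := h2 _ k2; lra.
Qed.

Lemma tw_tau (r : int) g g' z : quasi g g' -> tw r g (z + tau) = - ee (- (r%:~R * tau)) * tw (r + 1) g z.
Proof.
move=> [_ _ q]; rewrite /tw q.
have -> : ee (- (r%:~R * (z + tau))) = ee (- (r%:~R * tau)) * ee (- (r%:~R * z)) by rewrite -eeD; congr ee; ring.
have -> : ee (- ((r + 1)%:~R * z)) = ee (- z) * ee (- (r%:~R * z)) by rewrite -eeD; congr ee; rewrite intrD; ring.
by ring.
Qed.

Lemma navg_tau (r : int) g g' k : quasi g g' ->
  navg k (tw r g) tau = - ee (- (r%:~R * tau)) * navg k (tw (r + 1) g) 0.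
Proof.
move=> hq; rewrite /navg mulrCA; congr (_ * _); rewrite mulr_sumr; apply: eq_bigr => j _.
by rewrite addrC (tw_tau _ _ hq) add0r.
Qed.

(** The law under z + tau relates the r-th and the (r + 1)-st Fourier coefficients by a nonzero
    factor, and by [navg_shift0] the base point does not affect vanishing. If the zeroth coefficient
    is 0, all of them are. *)
Lemma quasi_zero g g' : quasi g g' -> navg ^~ g ^~ 0 @ \oo --> (0 : R[i]) -> forall s, g s = 0.
Proof.
move=> hq h0 s; have [hg per q] := hq.
have tw0 : tw 0 g = g by apply/funext => z; rewrite /tw mul0r oppr0 ee0 mulr1.
have P r : navg ^~ (tw r g) ^~ 0 @ \oo --> (0 : R[i]).
  elim/int_step: r => [|r IH|r IH]; first by rewrite tw0.
    have := (navg_shift0 r tau hq).1 IH => h.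
    have := seqZ (c := - ee (r%:~R * tau)) h; rewrite mulr0 => h1.
    apply: (seq_eq h1) => k; rewrite (navg_tau _ _ hq) eeN mulrA mulrNN mulfV ?ee_neq0 // mul1r //.
  apply: (navg_shift0 (r - 1) tau hq).2; have := seqZ (c := - ee (- ((r - 1)%:~R * tau))) IH; rewrite mulr0 => h1.
  by apply: (seq_eq h1) => k; rewrite (navg_tau _ _ hq) subrK.
apply: (bco_zero hg per) => r; have := (navg_shift0 r s hq).1 (P r) => h.
have := seqZ (c := ee (r%:~R * s)) h; rewrite mulr0 => h1; apply: (seq_eq h1) => k.
rewrite /navg /bco mulrCA; congr (_ * _); rewrite mulr_sumr; apply: eq_bigr => j _; rewrite /tw mulrCA; congr (_ * _).
by rewrite -eeD; congr ee; ring.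
Qed.

(** With a and b the zeroth coefficients of g and h, the function a h - b g has zeroth coefficient
    0, hence vanishes; a is nonzero because g is. *)
Lemma quasi_unique g g' h h' : quasi g g' -> quasi h h' -> (exists s, g s != 0) -> exists c, forall z, h z = c * g z.
Proof.
move=> hg hh [s gs]; have [g1 g2 g3] := hg; have [h1 h2 h3] := hh.
have [a ha] := navg_cvg g1 g2; have [b hb] := navg_cvg h1 h2.
have a0 : a != 0.
  apply/eqP => a0; rewrite a0 in ha; by have := quasi_zero hg ha s; move/eqP: gs.
pose f z := a * h z + (- b) * g z.
have hf : quasi f (fun z => (0 * h z + a * h' z) + (0 * g z + (- b) * g' z)).
  split; first exact: lt2D (lt2M (lt2_cst a) h1) (lt2M (lt2_cst (- b)) g1).
    by move=> z; rewrite /f g2 h2.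
  by move=> z; rewrite /f g3 h3; ring.
have f0 : navg ^~ f ^~ 0 @ \oo --> (0 : R[i]).
  have := seqD (seqZ (c := a) hb) (seqZ (c := - b) ha); rewrite (_ : a * b + - b * a = 0); last by ring.
  move=> hh2; apply: (seq_eq hh2) => k; rewrite /navg /f big_split /= -!mulr_sumr.
  by move: (\sum_(i < _) _) (\sum_(i < _) _) => x y; ring.
exists (b / a) => z; have := quasi_zero hf f0 z; rewrite /f => /eqP; rewrite addr_eq0 mulNr opprK => /eqP e.
by apply: (mulfI a0); rewrite e; field.
Qed.

End Quasi.

End ThetaUniqueness.

(** * Modular transformation of theta *)

Section PhiModular.
Variable R : realType.
Implicit Types (tau z : R[i]).

Lemma ReD (x y : R[i]) : complex.Re (x + y) = complex.Re x + complex.Re y. Proof. by case: x y => ? ? []. Qed.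
Lemma ReN (x : R[i]) : complex.Re (- x) = - complex.Re x. Proof. by case: x. Qed.
Lemma ReM (x y : R[i]) : complex.Re (x * y) = complex.Re x * complex.Re y - complex.Im x * complex.Im y.
Proof. by case: x y => ? ? []. Qed.
Lemma ImM (x y : R[i]) : complex.Im (x * y) = complex.Re x * complex.Im y + complex.Im x * complex.Re y.
Proof. by case: x y => ? ? []. Qed.

Lemma Im_moebius (a b c d tau : R[i]) : complex.Im a = 0 -> complex.Im b = 0 -> complex.Im c = 0 -> complex.Im d = 0 ->
  a * d - b * c = 1 -> 0 < complex.Im tau ->
  c * tau + d != 0 /\ 0 < complex.Im ((a * tau + b) / (c * tau + d)).
Proof.
move=> a0 b0 c0 d0 det t0.
have := congr1 (@complex.Re R) det; rewrite ReD ReN !ReM a0 b0 !mul0r !subr0 (_ : complex.Re 1 = 1) // => e3.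
have j0 : c * tau + d != 0.
  apply/eqP => j0; have := congr1 (@complex.Im R) j0; have := congr1 (@complex.Re R) j0.
  rewrite ReD ImD ReM ImM c0 d0 !mul0r subr0 !addr0 => e2 e1.
  have c00 : complex.Re c = 0 by move/eqP: e1; rewrite mulf_eq0 (gt_eqF t0) orbF => /eqP.
  move: e2 e3; rewrite c00 mul0r add0r => e2; rewrite e2 !mulr0 subr0 => /eqP.
  by rewrite eq_sym oner_eq0.
split=> //; set w := _ / _.
have : w * (c * tau + d) = a * tau + b by rewrite /w divfK.
move: w => w e; have := congr1 (@complex.Im R) e; have := congr1 (@complex.Re R) e.
rewrite !(ReD, ImD, ReM, ImM) a0 b0 c0 d0 !mul0r !subr0 !addr0.
move: (complex.Re a) (complex.Re b) (complex.Re c) (complex.Re d) (complex.Re tau) (complex.Im tau) (complex.Re w) (complex.Im w) t0 e3.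
move=> A B C D x y u v y0 e3 e2 e1.
(* The usual identity Im(w) |c tau + d|^2 = Im(tau), from the real and imaginary parts of w (c tau +
   d) = a tau + b and the determinant. *)
have key : v * ((C * x + D) ^+ 2 + (C * y) ^+ 2) = y.
  rewrite -[RHS]mulr1 -e3; have := congr1 (fun t => (C * x + D) * t) e1; have := congr1 (fun t => (C * y) * t) e2.
  by move=> /= h1 h2; lra.
have n0 : 0 <= (C * x + D) ^+ 2 + (C * y) ^+ 2 by rewrite addr_ge0 ?sqr_ge0.
by rewrite ltNge; apply/negP => v0; have := mulr_le0_ge0 v0 n0; rewrite key; lra.
Qed.

Lemma Im_int (m : int) : complex.Im (m%:~R : R[i]) = 0.
Proof. by rewrite -(rmorph_int (real_complex R)). Qed.

Lemma sl2_upper (a b c d : int) tau : a * d - b * c = 1 -> 0 < complex.Im tau ->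
  c%:~R * tau + d%:~R != 0 /\ 0 < complex.Im ((a%:~R * tau + b%:~R) / (c%:~R * tau + d%:~R)).
Proof.
move=> det t0; apply: Im_moebius => //; rewrite ?Im_int // -!intrM -rmorphB det //.
Qed.

Lemma S_upper tau : 0 < complex.Im tau -> tau != 0 /\ 0 < complex.Im (- tau^-1).
Proof.
move=> t0; have := @sl2_upper 0 (-1) 1 0 tau; rewrite !mul0r sub0r mulN1r opprK => /(_ erefl t0).
by rewrite rmorphN1 addr0 mul1r add0r mulN1r.
Qed.

Lemma ph_T tau z : 0 < complex.Im tau -> ph 0 (tau + 1) z = ph 0 tau z.
Proof.
move=> t0; have [c hc] := @isF_phi R; rewrite ph.unlock phk0.
have U1 : upper (pt1 (tau + 1) z) by rewrite /upper /= ImD (_ : complex.Im 1 = 0) // addr0.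
have h1 := hc _ U1; have h2 := hc (pt1 tau z) t0.
apply: has_sum_unique h1 _; apply: (eq_has_sum h2) => i; congr (_ * _); symmetry.
rewrite !monoE !expi_ee; have -> : lin (pt1 (tau + 1) z) i = (i.1 : int)%:~R + lin (pt1 tau z) i.
  by rewrite !linE /= -pmulrn; move: (\sum_k _) => S; ring.
by rewrite [LHS]eeD ee_int mul1r.
Qed.

Lemma ph_nz tau : 0 < complex.Im tau -> exists z, ph 0 tau z != 0.
Proof.
move=> t0; exists (2^-1%:C * tau); apply: ph_neq0 => //; rewrite Im_real_mul.
  by rewrite mulf_neq0 ?invr_eq0 ?pnatr_eq0 // gt_eqF.
rewrite ger0_norm; first by lra.
by lra.
Qed.

(** After multiplication by suitable exponentials both sides satisfy the equations of [quasi] for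
    the lattice of tau, so they are proportional. Comparing derivatives at 0, where phi' = 1 for
    every tau, identifies the constant as 1 / tau. *)
Lemma ph_S tau z : 0 < complex.Im tau ->
  ph 0 (- tau^-1) (z / tau) = tau^-1 * ee (z ^+ 2 / 2 / tau) * ph 0 tau z.
Proof.
move=> t0; have [tau0 t1] := S_upper t0.
pose G z := ee (2^-1 * z) * ph 0 tau z.
have l2h (a : R[i]) : exists h', lt2 (fun z => ee (a * z)) h'.
  by eexists; exact: lt2_comp (@lt2_ee R) (lt2M (lt2_cst a) (@lt2_id R)).
have [h1 l1] := l2h 2^-1.
have qG : quasi tau G (fun z => h1 z * ph 0 tau z + ee (2^-1 * z) * (twopii R * ph 1 tau z)).
  split; first exact: lt2M l1 (lt2_ph 0 t0).
    move=> w; rewrite /G ph_add1 // mulrDr mulr1 eeD.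
    have -> : ee (2^-1 : R[i]) = -1 by have := ee_half R 1; rewrite mul1r expr1z.
    by ring.
  move=> w; rewrite /G ph_addtau // expi_ee.
  have e : ee (2^-1 * (w + tau)) * ee (- (tau / 2) - w) = ee (- w) * ee (2^-1 * w).
    by rewrite -!eeD; congr ee; field.
  transitivity (- (ee (2^-1 * (w + tau)) * ee (- (tau / 2) - w)) * ph 0 tau w); first by ring.
  by rewrite e; ring.
(* The Gaussian turns the two multipliers of phi(-1/tau, w/tau) into those of [quasi]: under w + 1
   the lattice vector -(-1/tau) is crossed, under w + tau the period 1. *)
pose E w := ee (2^-1 * w) * ee (- (2 * tau)^-1 * (w * w)).
pose H w := E w * ph 0 (- tau^-1) (tau^-1 * w).
have [h2 l2] : exists h', lt2 E h'.
  by eexists; exact: lt2M l1 (lt2_comp (@lt2_ee R) (lt2M (lt2_cst _) (lt2M (@lt2_id R) (@lt2_id R)))).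
have l3 := lt2_comp (lt2_ph 0 t1) (lt2M (lt2_cst tau^-1) (@lt2_id R)).
have qH : quasi tau H (fun z => h2 z * ph 0 (- tau^-1) (tau^-1 * z) + E z * (twopii R * ph 1 (- tau^-1) (tau^-1 * z) * (0 * z + tau^-1 * 1))).
  split; first exact: lt2M l2 l3.
    move=> w; rewrite /H.
    have -> : tau^-1 * (w + 1) = tau^-1 * w + (- tau^-1) * (-1)%:~R + 0%:~R by rewrite rmorphN1; ring.
    rewrite ph_ee // addr0 (_ : (-1) ^ (-1) = -1 :> R[i]); last by rewrite exprN1 invrN1.
    have e : E (w + 1) * ee (- ((-1)%:~R ^+ 2 / 2 * - tau^-1) - (-1)%:~R * (tau^-1 * w)) = - E w.
      rewrite /E -!eeD.
      have -> : 2^-1 * (w + 1) + - (2 * tau)^-1 * ((w + 1) * (w + 1)) + (- ((-1)%:~R ^+ 2 / 2 * - tau^-1) - (-1)%:~R * (tau^-1 * w)) =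
         1%:~R / 2 + (2^-1 * w + - (2 * tau)^-1 * (w * w)) by rewrite rmorphN1; field.
      by rewrite [LHS]eeD ee_half expr1z mulN1r.
    transitivity (- (E (w + 1) * ee (- ((-1)%:~R ^+ 2 / 2 * - tau^-1) - (-1)%:~R * (tau^-1 * w))) * ph 0 (- tau^-1) (tau^-1 * w)); first by ring.
    by rewrite e; ring.
  move=> w; rewrite /H.
  have -> : tau^-1 * (w + tau) = tau^-1 * w + 1 by rewrite mulrDr mulVf.
  rewrite ph_add1 //.
  have e : E (w + tau) = ee (- w) * E w.
    by rewrite /E -!eeD; congr ee; field.
  by rewrite e; ring.
have [s0 ns] := ph_nz t0.
have [|c hc] := quasi_unique qG qH; first by exists s0; rewrite mulf_neq0 ?ee_neq0.
have law w : ph 0 (- tau^-1) (tau^-1 * w) = c * (ee ((2 * tau)^-1 * (w * w)) * ph 0 tau w).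
  have := hc w; rewrite /H /G /E => h.
  apply: (mulfI (ee_neq0 (2^-1 * w))); apply: (mulfI (ee_neq0 (- (2 * tau)^-1 * (w * w)))).
  transitivity (ee (2^-1 * w) * ee (- (2 * tau)^-1 * (w * w)) * ph 0 (- tau^-1) (tau^-1 * w)); first by ring.
  rewrite h mulNr eeN; have := ee_neq0 ((2 * tau)^-1 * (w * w)); move: (ee _) (ee _) (ph _ _ _) => x y p x0.
  by field.
have cE : c = tau^-1.
  have d1 : cder (fun w => ph 0 (- tau^-1) (tau^-1 * w)) 0 (twopii R * ph 1 (- tau^-1) (tau^-1 * 0) * tau^-1).
    exact: cder_comp (cder_scale tau^-1 0) (ph_cder 0 (tau^-1 * 0) t1).
  have d2 := cderZ c (cderM (cder_comp (cderM (cder_cst (2 * tau)^-1 0) (cderM (cder_id 0) (cder_id 0))) (cder_ee _)) (ph_cder 0 0 t0)).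
  have := cder_unique (cder_ext law d1) d2.
  rewrite ph_0 // !(mulr0, mul0r, addr0, add0r) !ph1_0 // ee0 !(mulr0, mul0r, addr0, add0r, mul1r, mulr1) => e.
  by apply: (mulfI (twopii_neq0 R)); rewrite e mulrC.
rewrite [z / tau]mulrC law cE mulrA; congr (_ * ee _ * _); by field.
Qed.

Definition ph_law (a b c d : int) := forall tau z, 0 < complex.Im tau ->
  ph 0 ((a%:~R * tau + b%:~R) / (c%:~R * tau + d%:~R)) (z / (c%:~R * tau + d%:~R)) =
  (c%:~R * tau + d%:~R)^-1 * ee (c%:~R * (z ^+ 2 / 2) / (c%:~R * tau + d%:~R)) * ph 0 tau z.

Lemma ph_Tn (n : int) tau z : 0 < complex.Im tau -> ph 0 (tau + n%:~R) z = ph 0 tau z.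
Proof.
move=> t0; have U (m : int) : 0 < complex.Im (tau + m%:~R) by rewrite ImD Im_int addr0.
elim/int_step: n => [|n IH|n IH]; first by rewrite addr0.
  by rewrite intrD addrA ph_T.
by rewrite -[LHS]ph_T // intrD rmorphN1 addrA subrK.
Qed.

(** Euclidean division on the bottom row (c, d), by induction on |c|. When c = 0 the matrix is a
    translation up to sign, and the sign is the oddness of [phi]. *)
Lemma ph_modular (a b c d : int) : a * d - b * c = 1 -> ph_law a b c d.
Proof.
move: {2}(absz c) (leqnn (absz c)) => m; elim: m a b c d => [|m IH] a b c d cm det tau z t0.
  have c0 : c = 0 by lia.
  have : (a == d) && ((d == 1) || (d == -1)).
    move: det; rewrite c0 mulr0 subr0 => ad; move/eqP: (congr1 absz ad); rewrite abszM muln_eq1 => /andP[/eqP a1 /eqP d1].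
    have [a1'|a1'] : a = 1 \/ a = -1 by lia.
      by move: ad; rewrite a1' mul1r => ->.
    by move: ad; rewrite a1' mulN1r; lia.
  move=> /andP[/eqP -> /orP[/eqP ->|/eqP ->]]; rewrite c0 !mul0r add0r.
    by rewrite invr1 !mulr1 !mul1r ee0 mul1r ph_Tn.
  rewrite rmorphN1 invrN1 ee0 mulr1 !mulrN1 !mulN1r opprD opprK -rmorphN ph_Tn // ph_odd //.
have [c0|c0] := eqVneq c 0; first by apply: IH => //; rewrite c0.
(* The matrix is (-b', a; -d', c) times S times the translation by n, and the first factor has lower
   left entry of absolute value d' < |c|. *)
pose n := (d %/ c)%Z; pose d' := (d %% c)%Z; pose b' := b - n * a.
have dE : d = n * c + d' by exact: divz_eq.
have d'c : (absz d' < absz c)%N by have := modz_ge0 d c0; have := ltz_mod d c0; rewrite -/d'; lia.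
have law : ph_law (- b') a (- d') c by apply: IH; [lia | rewrite /b'; move: det; rewrite dE; lia].
have t1 : 0 < complex.Im (tau + n%:~R) by rewrite ImD Im_int addr0.
have [tn0 t2] := S_upper t1; have [j0 _] := sl2_upper det t0.
have := law (- (tau + n%:~R)^-1) (z / (tau + n%:~R)) t2.
set jj := (- d')%:~R * _ + c%:~R.
have jE : jj = (c%:~R * tau + d%:~R) / (tau + n%:~R).
  by rewrite /jj dE intrD intrM rmorphN /=; field.
have jj0 : jj != 0 by rewrite jE mulf_neq0 // invr_eq0.
rewrite ph_S // ph_Tn //.
have -> : ((- b')%:~R * - (tau + n%:~R)^-1 + a%:~R) / jj = (a%:~R * tau + b%:~R) / (c%:~R * tau + d%:~R).
  rewrite jE /b' rmorphN rmorphB /= intrM; field; by rewrite tn0 j0.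
have -> : z / (tau + n%:~R) / jj = z / (c%:~R * tau + d%:~R) by rewrite jE; field; rewrite tn0 j0.
move=> ->.
have e : ee ((- d')%:~R * ((z / (tau + n%:~R)) ^+ 2 / 2) / jj) * ee (z ^+ 2 / 2 / (tau + n%:~R)) =
   ee (c%:~R * (z ^+ 2 / 2) / (c%:~R * tau + d%:~R)).
  rewrite -eeD; congr ee; rewrite jE.
  have dd : d'%:~R = (c%:~R * tau + d%:~R) - c%:~R * (tau + n%:~R) :> R[i].
    have dR : d%:~R = n%:~R * c%:~R + d'%:~R :> R[i] by rewrite -intrM -intrD -dE.
    by rewrite dR; ring.
  rewrite mulrNz dd; move: j0 tn0; move: (c%:~R * tau + d%:~R) (tau + n%:~R) => x y x0 y0.
  by field; rewrite x0 y0.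
rewrite -e; move: (ee _) (ee _) => x y; rewrite jE; field; by rewrite tn0 j0.
Qed.

End PhiModular.

(** * Division by theta *)

Section DyadicCharacters.
Variable R : realType.

Lemma eq_leR (x y : R) : x = y -> x <= y. Proof. by move->. Qed.

Lemma nc_cancel (x y : R[i]) : y != 0 -> nc x <= (nc y)^-1 * nc (x * y).
Proof. by move=> y0; rewrite ncM mulrCA mulVf ?mulr1 // nc_eq0. Qed.

Lemma nc_interp (d m m1 m2 : R[i]) : nc m <= nc m1 + nc m2 -> nc (d * m) <= nc (d * m1) + nc (d * m2).
Proof. by move=> h; rewrite !ncM -mulrDr ler_wpM2l ?nc_ge0. Qed.

Lemma Im_iM (x : R) : complex.Im ('i%C * x%:C) = x.
Proof. by rewrite ImM /= mulr0 mul1r add0r. Qed.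

(** The grid sum depends only on d modulo 2^a, which makes it the exact indicator of divisibility by
    2^a. *)
Lemma davg_dvd a (d : int) : davg R a d = (((2 ^ a)%N%:Z %| d)%Z)%:R.
Proof.
have V0 : (2 ^ a)%N%:Z != 0 by rewrite eqz_nat -lt0n expn_gt0.
have per (e t : int) : davg R a (e + t * (2 ^ a)%N%:Z) = davg R a e.
  rewrite /davg; congr (_ * _); apply: eq_bigr => i _; rewrite !expi_ee.
  have -> : (e + t * (2 ^ a)%N%:Z)%:~R * (i%:R / 2 ^+ a) = (t * i%:Z)%:~R + e%:~R * (i%:R / 2 ^+ a) :> R[i].
    by rewrite intrD !intrM -!pmulrn natrX; field; rewrite two_neq0.
  by rewrite eeD ee_int mul1r.
pose r := ((- d) %% (2 ^ a)%N%:Z)%Z; have r0 : 0 <= r by exact: modz_ge0.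
have rV : r < (2 ^ a)%N%:Z by have := ltz_mod (- d) V0; rewrite ger0_norm.
have e : d = - r + (- ((- d) %/ (2 ^ a)%N%:Z)%Z) * (2 ^ a)%N%:Z.
  have h := divz_eq (- d) (2 ^ a)%N%:Z; rewrite -/r in h.
  by rewrite mulNr -opprD addrC -h opprK.
have rE : r = (absz r)%:Z by rewrite gez0_abs.
rewrite {1}e per rE davg_period; last by lia.
have -> : ((2 ^ a)%N%:Z %| d)%Z = ((2 ^ a)%N%:Z %| - d)%Z by rewrite !dvdzE abszN.
have -> // : (absz r == 0)%N = ((2 ^ a)%N%:Z %| - d)%Z.
by apply/eqP/dvdz_mod0P; rewrite -/r; lia.
Qed.

End DyadicCharacters.

Lemma mulr_exp1z (F : fieldType) (x y : F) (m : int) : x = 1 -> y * x ^ m = y.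
Proof. by move=> ->; rewrite exp1rz mulr1. Qed.

Section DivideFactor.
Variables (R : realType) (n : nat).
Local Notation pt := (R[i] * 'cV[R[i]]_n)%type.
Local Notation idx := (nat * 'cV[int]_n)%type.
Local Notation up := (@upper R n).
Variables (f : pt -> R[i]) (c : idx -> R[i]) (hf : fexp up f c).
Variables (N : nat) (v : 'cV[int]_n) (k0 : 'I_n) (a : nat) (hv : v k0 0 = (2 ^ a)%N%:Z).
Local Notation V := ((2 ^ a)%N%:Z).
Let rho : idx := (N, v).
Hypothesis f0 : forall p, up p -> mono p rho = 1 -> f p = 0.

(** Coordinates for exponents modulo the orbit i + Z rho: [kap] is the position along the orbit,
    while [kk] together with the residue of the k0-coordinate modulo 2^a tells the orbits apart. *)
Let kap (i : idx) : int := divz (i.2 k0 0) V.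
Let kk (o : 'I_n.+1) (i : idx) : int :=
  if unlift ord0 o is Some j then (if j == k0 then 0 else i.2 j 0 - kap i * v j 0) else i.1%:Z - kap i * N%:Z.
Let rel (i j : idx) : bool := [forall o, kk o i == kk o j] && (modz (i.2 k0 0) V == modz (j.2 k0 0) V).

Let V0 : V != 0. Proof. by rewrite eqz_nat -lt0n expn_gt0. Qed.
Let VR0 : (2 ^+ a : R) != 0. Proof. by rewrite expf_neq0 // pnatr_eq0. Qed.

Let rel_eq i j : rel i j -> i.1%:Z = j.1%:Z + (kap i - kap j) * N%:Z /\
  forall b, i.2 b 0 = j.2 b 0 + (kap i - kap j) * v b 0.
Proof.
move=> /andP[/forallP h /eqP hr]; split.
  by have := h ord0; rewrite /kk unlift_none => /eqP; lia.
move=> b; have [->|bk] := eqVneq b k0.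
  by rewrite hv (divz_eq (i.2 k0 0) V) hr {2}(divz_eq (j.2 k0 0) V) -/(kap i) -/(kap j); ring.
have := h (lift ord0 b); rewrite /kk liftK (negPf bk) => /eqP e.
by move: e; rewrite mulrBl; lia.
Qed.

Let rel_lin (p : pt) i j : rel i j -> lin p i = lin p j + (kap i - kap j)%:~R * lin p rho.
Proof.
move=> /rel_eq [e1 e2]; rewrite !linE mulrDr addrACA; congr (_ + _).
  by rewrite -[i.1%:R]/(i.1%:Z%:~R) e1 intrD intrM -pmulrn mulrDl mulrA.
rewrite mulr_sumr -big_split; apply: eq_bigr => b _; rewrite e2 intrD intrM /=; ring.
Qed.

(** Moving z_k0 by multiples of 2 / 2^a keeps the monomial [rho] equal to 1, so f still vanishes,
    and averaging selects one residue class of the k0-coordinate. The dyadic averages are the reason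
    for asking that this coordinate of [v] be a power of two. *)
Lemma residue_zero (r : int) q : up q -> mono q rho = 1 ->
  has_sum (fun i : idx => if modz (i.2 k0 0) V == modz r V then c i * mono q i else 0) 0.
Proof.
move=> Uq q1; pose h (j : nat) : pt := (0, (2 * (j%:R / 2 ^+ a)) *: delta_mx k0 0).
have hl (j : nat) (i : idx) : lin (h j) i = (i.2 k0 0)%:~R * (j%:R / 2 ^+ a).
  rewrite linE mulr0 add0r (bigD1 k0) //= !mxE !eqxx mulr1 big1 => [|b bk].
    by rewrite addr0; field; rewrite two_neq0.
  by rewrite !mxE (negPf bk) /= !mulr0.
have Uh j : up (q + h j) by rewrite /upper /= addr0.
have h1 (j : 'I_(2 ^ a)) : has_sum (fun i => c i * mono (q + h j) i) 0.
  rewrite -(f0 (Uh j)); first exact: hf.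
  rewrite monoD q1 mul1r monoE hl hv expi_ee.
  have -> : V%:~R * (j%:R / 2 ^+ a) = (j%:Z)%:~R :> R[i] by rewrite -!pmulrn natrX; field; rewrite two_neq0.
  exact: ee_int.
have h2 (j : 'I_(2 ^ a)) := has_sumZ ((2 ^+ a)^-1 * ee (- (r%:~R * (j%:R / 2 ^+ a)))) (h1 j).
have := has_sum_seq (index_enum _) h2; rewrite big1 => [h3|j _]; last by rewrite mulr0.
apply: (eq_has_sum h3) => i.
transitivity (c i * mono q i * davg R a (i.2 k0 0 - r)).
  rewrite /davg !mulr_sumr; apply: eq_bigr => j _; rewrite monoD (monoE (h j)) hl !expi_ee.
  have -> : ee ((i.2 k0 0 - r)%:~R * (j%:R / 2 ^+ a)) = ee (- (r%:~R * (j%:R / 2 ^+ a))) * ee ((i.2 k0 0)%:~R * (j%:R / 2 ^+ a)) :> R[i].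
    by rewrite -eeD; congr ee; rewrite intrD rmorphN; ring.
  by ring.
rewrite davg_dvd -eqz_mod_dvd.
by case: eqP; rewrite ?mulr1 ?mulr0.
Qed.

Let base : pt := ('i%C, (- (2 * N%:R / 2 ^+ a) * 'i%C) *: delta_mx k0 0).

Let base_rho : mono base rho = 1.
Proof.
rewrite monoE linE (bigD1 k0) //= !mxE !eqxx mulr1 hv big1 => [|b bk]; last by rewrite !mxE (negPf bk) /= !mulr0.
rewrite addr0 expi_ee -[RHS]ee0; congr ee; rewrite -!pmulrn natrX; field; by rewrite two_neq0.
Qed.

Let base_up : up base. Proof. by rewrite /upper /= ltr01. Qed.

(** On the hypersurface where the monomial [rho] is 1, the monomials of one orbit coincide, and real
    translations along the hypersurface separate the orbits. So vanishing there says that each orbit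
    of coefficients sums to zero. *)
Lemma orbit_zero j : has_sum (fun i => if rel i j then c i else 0) 0.
Proof.
pose x (i : idx) := if modz (i.2 k0 0) V == modz (j.2 k0 0) V then c i * mono base i else 0.
have bx : bsum x := has_bsum (residue_zero (j.2 k0 0) base_up base_rho).
have hx (t : 'I_n.+1 -> R) : has_sum (fun i => x i * expi (\sum_o (kk o i)%:~R * (t o)%:C)) 0.
  pose W : R := N%:R * t ord0 + \sum_(b | b != k0) (v b 0)%:~R * t (lift ord0 b).
  (* A real translation inside the hypersurface: the k0-coordinate compensates the phase [W] that
     the other coordinates give to [rho]. *)
  pose h : pt := ((t ord0)%:C, \col_b (if b == k0 then - (2 / 2 ^+ a * W) else 2 * t (lift ord0 b))%:C).
  have hl (i : idx) : lin h i = i.1%:R * (t ord0)%:C + \sum_(b | b != k0) (i.2 b 0)%:~R * (t (lift ord0 b))%:C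
       - (i.2 k0 0)%:~R / 2 ^+ a * W%:C.
    rewrite linE (bigD1 k0) //= mxE eqxx -addrA; congr (_ + _); rewrite addrC; congr (_ + _).
      apply: eq_bigr => b bk; rewrite mxE (negPf bk) rmorphM rmorph_nat; by field.
    rewrite rmorphN !rmorphM fmorphV rmorphXn rmorph_nat; field; by rewrite two_neq0.
  have WE : W%:C = N%:R * (t ord0)%:C + \sum_(b | b != k0) (v b 0)%:~R * (t (lift ord0 b))%:C.
    rewrite rmorphD rmorphM rmorph_nat rmorph_sum; congr (_ + _).
    by apply: eq_bigr => b _; rewrite rmorphM rmorph_int.
  have Uh : up (base + h).
    by change (0 < complex.Im ('i%C + (t ord0)%:C)); rewrite ImD /= addr0 ltr01.
  have r1 : mono (base + h) rho = 1.
    rewrite monoD base_rho mul1r monoE hl /= hv expi_ee -[RHS]ee0; congr ee; rewrite -WE -!pmulrn natrX.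
    by rewrite divff ?two_neq0 // mul1r subrr.
  have h1 := has_sumZ (ee ((modz (j.2 k0 0) V)%:~R / 2 ^+ a * W%:C)) (residue_zero (j.2 k0 0) Uh r1).
  rewrite mulr0 in h1; apply: (eq_has_sum h1) => i; rewrite /x; case: eqP => [e|_]; last by rewrite mulr0 mul0r.
  suff -> : \sum_o (kk o i)%:~R * (t o)%:C = (modz (j.2 k0 0) V)%:~R / 2 ^+ a * W%:C + lin h i.
    rewrite monoD (monoE h) !expi_ee (eeD ((modz (j.2 k0 0) V)%:~R / 2 ^+ a * W%:C) (lin h i)).
    by move: (mono base i) (ee _) (ee _) => B x1 x2; ring.
  rewrite hl.
  rewrite big_ord_recl {1}/kk unlift_none.
  have -> : \sum_(b < n) (kk (lift ord0 b) i)%:~R * (t (lift ord0 b))%:C =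
     \sum_(b | b != k0) (i.2 b 0)%:~R * (t (lift ord0 b))%:C - (kap i)%:~R * \sum_(b | b != k0) (v b 0)%:~R * (t (lift ord0 b))%:C.
    rewrite (bigD1 k0) //= /kk liftK eqxx mul0r add0r mulr_sumr -sumrB; apply: eq_bigr => b bk.
    by rewrite liftK (negPf bk) intrB intrM; ring.
  have -> : (i.2 k0 0)%:~R = (kap i)%:~R * 2 ^+ a + (modz (j.2 k0 0) V)%:~R :> R[i].
    by rewrite {1}(divz_eq (i.2 k0 0) V) e intrD intrM -pmulrn natrX.
  rewrite intrB intrM -!pmulrn WE; move: (\sum_(b | _) _) (\sum_(b | _) _) => S1 S2; field.
  by rewrite two_neq0.
have := chars_group bx hx (kk ^~ j) => h0.
have := bsum_has (bsum_if (fun i => [forall o, kk o i == kk o j]) bx); rewrite h0 => h1.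
have := has_sumZ (mono base j)^-1 h1; rewrite mulr0 => h2.
apply: (eq_has_sum h2) => i; rewrite /x /rel.
case: ifP => ho; last by rewrite mulr0.
case: ifP => hr; last by rewrite mulr0.
have hij : rel i j by rewrite /rel ho hr.
have e : mono base i = mono base j.
  rewrite !monoE (rel_lin base hij) !expi_ee eeD eeMz.
  have er : ee (lin base rho) = 1 by move: base_rho; rewrite monoE expi_ee.
    exact: mulr_exp1z er.
by rewrite e mulrCA mulVf ?mulr1 // mono_neq0.
Qed.

(** The coefficients along the orbit of [j], continued by 0 where the power of q would be
    negative. *)
Let sh (j : idx) (k : int) : R[i] :=
  if 0 <= j.1%:Z + k * N%:Z then c (absz (j.1%:Z + k * N%:Z), j.2 + k *: v) else 0.

Let sh_sum j : has_sum (sh j) 0.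
Proof.
apply: (has_sum_group (g := fun i : idx => kap i - kap j) (orbit_zero j)) => k.
have kapS (i : idx) : i.2 = j.2 + k *: v -> kap i = kap j + k.
  move=> e; rewrite /kap e !mxE hv divzDr ?dvdz_mull // mulzK //.
rewrite /sh; case: ifP => hk.
  pose i1 : idx := (absz (j.1%:Z + k * N%:Z), j.2 + k *: v).
  have k1 : kap i1 = kap j + k by apply: kapS.
  have r1 : rel i1 j.
    rewrite /rel; apply/andP; split.
      apply/forallP => o; rewrite /kk k1; case: (unlift ord0 o) => [b|].
        by case: ifP => // _; rewrite /= !mxE; apply/eqP; ring.
      by rewrite /= gez0_abs //; apply/eqP; ring.
    by apply/eqP; rewrite /= !mxE hv addrC modzMDl.
  apply: (eq_has_sum (has_sum_single i1 (c i1))) => i.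
  have [->|ne] := eqVneq i i1; first by rewrite r1 k1 [kap j + k]addrC addrK eqxx.
  case: eqP => // e; case: ifP => // /rel_eq [e1 e2]; case/eqP: ne; case: i e e1 e2 => m s e e1 e2.
  congr (_, _); first by move: e1; rewrite e /=; lia.
  by apply/colP => b; have := e2 b; rewrite e !mxE.
apply: (eq_has_sum (has_sum0 R _)) => i; case: eqP => // e; case: ifP => // /rel_eq [e1 _].
by move: hk; rewrite -e; lia.
Qed.

Lemma has_sum_int_split (y : int -> R[i]) (A B l : R[i]) : has_sum y l ->
  has_sum (fun k : nat => y k.+1%:Z) A -> has_sum (fun k : nat => y (- k%:Z)) B -> l = A + B.
Proof.
move=> hy hA hB.
have h1 : has_sum (fun k : int => if 0 < k then y k else 0) A.
  apply: (@has_sum_inj R _ _ (fun k : nat => k.+1%:Z)) => [k k' [] //|k hk|].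
    by case: ifP => // k1; have := hk (absz k).-1; rewrite prednK ?absz_gt0 ?gtz0_abs ?eqxx //; lia.
  by apply: (eq_has_sum hA) => k.
have h2 : has_sum (fun k : int => if 0 < k then 0 else y k) B.
  apply: (@has_sum_inj R _ _ (fun k : nat => - k%:Z)) => [k k' /oppr_inj [] //|k hk|].
    by case: ifP => // k1; have := hk (absz k); rewrite (_ : - (absz k)%:Z = k) ?eqxx //; lia.
  by apply: (eq_has_sum hB) => k; rewrite ifF //; lia.
apply: has_sum_unique hy _; apply: (eq_has_sum (has_sumD h1 h2)) => k.
by case: ifP => _; rewrite ?addr0 ?add0r.
Qed.

Let e (ik : idx * nat) : idx := idxD ik.1 (idxM ik.2 rho).
(** With x the monomial [rho], these are the coefficients of f / (1 - x) expanded in powers of x,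
    valid for |x| < 1. The family [dp] below is, up to sign, the expansion in powers of 1/x for |x|
    > 1. *)
Let dm : idx -> R[i] := gcoef e (fun ik => c ik.1).
Let dp (j : idx) : R[i] := csum (fun k : nat => c (idxD j (idxM k.+1 rho))).

Let Ul : set pt := [set p | up p /\ nc (mono p rho) < 1].

Let gen_l p : Ul p -> has_sum (fun ik => c ik.1 * mono p (e ik)) (f p / (1 - mono p rho)).
Proof.
move=> [Up p1]; apply: (eq_has_sum (has_sumM (hf Up) (has_sum_geo p1))) => ik.
by rewrite /e mono_idxD mono_idxM mulrA.
Qed.

Let fexp_l : fexp Ul (fun p => f p / (1 - mono p rho)) dm.
Proof. by apply: gexp => p; exact: gen_l. Qed.

Let ptl : pt := ('i%C * 1%:C, ('i%C * 1%:C) *: delta_mx k0 0).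

Let nc_rho_real (p : pt) t : nc (mono (p + realpt t) rho) = nc (mono p rho).
Proof.
rewrite monoD ncM (nc_mono (realpt t)) /= mulr0 mulr0 oppr0 big1 => [|b _]; last by rewrite mxE /= mulr0.
by rewrite mulr0 subr0 expR0 mulr1.
Qed.

Let nc_rho_pure (x : R) (u : R) : 0 <= x -> 0 < u -> nc (mono ('i%C * x%:C, ('i%C * u%:C) *: delta_mx k0 0 : 'cV[R[i]]_n) rho) < 1.
Proof.
move=> x0 u0; rewrite nc_mono /= (bigD1 k0) //= big1 => [|b bk]; last by rewrite !mxE (negPf bk) /= !mulr0.
rewrite !mxE !eqxx mulr1 hv !Im_iM addr0 -[ltRHS]expR0 ltr_expR.
have v0 : 0 < (V%:~R : R) by rewrite ltr0z ltz_nat expn_gt0.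
have p0 := pi_gt0 R.
have h1 : 0 <= 2 * pi * (N%:R * x) by rewrite !mulr_ge0 // ltW.
have h2 : 0 < pi * (V%:~R * u) by rewrite !mulr_gt0.
by lra.
Qed.

Let ptl_l t : Ul (ptl + realpt t).
Proof.
split; last by rewrite nc_rho_real; exact: nc_rho_pure.
by apply: upper_realpt; rewrite /upper /= Im_iM.
Qed.

(** [dm j] sums the orbit of [j] from [j] backwards and [dp j] sums it strictly forwards; together
    they give the full orbit sum, which is 0. Hence both sides of the hypersurface share one
    expansion. *)
Let dm_dp j : dm j = - dp j.
Proof.
have bl := has_bsum (gen_l (ptl_l (fun=> 0))).
have hd := gcoef_has j bl; rewrite -/dm in hd.
have h1 : has_sum (fun k : nat => sh j (- k%:Z)) (dm j).
  apply: (has_sum_group (g := snd) hd) => k; rewrite /sh; case: ifP => hk.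
    pose i1 : idx := (absz (j.1%:Z + - k%:Z * N%:Z), j.2 + - k%:Z *: v).
    apply: (eq_has_sum (has_sum_single (i1, k) (c i1))) => -[i k'] /=.
    have [[-> ->]|ne] := eqVneq (i, k') (i1, k).
      rewrite eqxx ifT //; apply/eqP; rewrite /e /idxD /idxM /rho /=; case: j @i1 hk {hd} => m s /= hk.
      congr (_, _); first by have := gez0_abs hk; lia.
      by apply/colP => b; rewrite !mxE mulmxnE /=; ring.
    case: eqP => // kk'; case: eqP => // ej; case/eqP: ne; rewrite kk'; congr (_, _).
    move: ej; rewrite /e /idxD /idxM /rho /i1 kk' /= => <- /=; case: i => m s; congr (_, _) => /=; first by lia.
    by apply/colP => b; rewrite !mxE mulmxnE /=; ring.
  apply: (eq_has_sum (has_sum0 R _)) => -[i k'] /=; case: eqP => // ->; case: eqP => // ej.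
  by move: hk; rewrite -ej /e /idxD /idxM /=; lia.
have h2 : has_sum (fun k : nat => sh j k.+1%:Z) (dp j).
  have b2 : bsum (fun k : nat => sh j k.+1%:Z).
    by apply: (@bsum_inj R _ _ (fun k : nat => k.+1%:Z) _ _ (has_bsum (sh_sum j))) => k k' [].
  have := bsum_has b2; rewrite (_ : csum (fun k : nat => sh j k.+1%:Z) = dp j) //.
  suff e1 (k : nat) : sh j k.+1%:Z = c (idxD j (idxM k.+1 rho)) by apply: eq_csum => k; exact: e1.
  have e1 : absz (j.1%:Z + k.+1%:Z * N%:Z) = (j.1 + k.+1 * N)%N by rewrite -PoszM -PoszD.
  transitivity (c (absz (j.1%:Z + k.+1%:Z * N%:Z), j.2 + k.+1%:Z *: v)); first by [].
  have -> : k.+1%:Z *: v = v *+ k.+1 by rewrite -scaler_nat natz.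
  by rewrite e1.
by have := has_sum_int_split (sh_sum j) h2 h1 => /eqP; rewrite eq_sym addrC addr_eq0 => /eqP.
Qed.

Let bsum_g p : up p -> 1 < nc (mono p rho) -> bsum (fun j => dm j * mono p j).
Proof.
move=> Up p1; set q := mono p rho in p1.
have q0 : q != 0 by exact: mono_neq0.
have s1 : nc q^-1 < 1 by rewrite ncV invf_lt1 // (lt_trans ltr01).
have b1 := has_bsum (has_sumM (hf Up) (has_sum_geo s1)).
pose h (jk : idx * nat) : idx * nat := (idxD jk.1 (idxM jk.2.+1 rho), jk.2).
have hi : injective h.
  move=> [j k] [j' k'] [] /= e1 e2 ek; rewrite ek in e1 e2 *; congr (_, _); case: j j' e1 e2 => m s [m' s'] /= e1 e2.
  by congr (_, _); [lia | apply: addIr e2].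
have b2 := @bsum_group R _ _ fst _ (bsum_inj hi b1).
apply: (bsum_le (K := nc q^-1 ^+ 0) (has_bsum b2)) => j; rewrite expr0 mul1r dm_dp mulNr ncN.
suff -> : csum (fun i : idx * nat => if i.1 == j then c (h i).1 * mono p (h i).1 * q^-1 ^+ (h i).2 else 0) = q * (dp j * mono p j).
  by rewrite ncM ler_peMl ?nc_ge0 // ltW.
have b3 : bsum (fun k : nat => c (idxD j (idxM k.+1 rho))).
  have b4 := @bsum_inj R _ _ (fun k : nat => (j, k)) _ (fun k k' => (fun e => congr1 snd e)) (bsum_inj hi b1).
  apply: (bsum_le (K := (nc (q * mono p j))^-1) b4) => k; rewrite /= mono_idxD mono_idxM -/q exprS.
  have -> : c (idxD j (idxM k.+1 rho)) * (mono p j * (q * q ^+ k)) * q^-1 ^+ k = c (idxD j (idxM k.+1 rho)) * (q * mono p j).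
    by rewrite exprVn; field; rewrite expf_neq0.
  exact: nc_cancel (mulf_neq0 q0 (mono_neq0 p j)).
apply: csumE; apply: (@has_sum_inj R _ _ (fun k : nat => (j, k))) => [k k' [] //|[j' k] hk /=|].
  by case: eqP => // ej; have := hk k; rewrite ej eqxx.
have h1 := has_sumZ (q * mono p j) (bsum_has b3).
have mk k : mono p (idxD j (idxM k.+1 rho)) = mono p j * q ^+ k.+1 by rewrite mono_idxD mono_idxM.
have -> : q * (dp j * mono p j) = q * mono p j * dp j by move: (dp j) (mono p j) => *; ring.
apply: (eq_has_sum h1) => k; rewrite [_.1]/= eqxx [(h _).2]/= [(h _).1]/= mk exprS exprVn.
by move: (c _) (mono p j) => *; field; rewrite expf_neq0.
Qed.

(** An arbitrary point is interpolated between two points obtained by imaginary shifts of z_k0 by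
    [eps] and -[eps], one on each side of the hypersurface. The moduli of a monomial there are
    multiplied by exp(-y) and exp(y), whose sum is at least 1. *)
Let absconv_dm : absconv up dm.
Proof.
move=> p Up; pose X := complex.Im (lin p rho); pose eps : R := 2 / 2 ^+ a * (`|X| + 1).
pose h (s : R) : pt := (0, ('i%C * s%:C) *: delta_mx k0 0).
have hn (s : R) (i : idx) : nc (mono (p + h s) i) = nc (mono p i) * expR (- (pi * ((i.2 k0 0)%:~R * s))).
  rewrite monoD ncM (nc_mono (h s)) /= mulr0 mulr0 oppr0 add0r (bigD1 k0) //= big1 => [|b bk]; last first.
    by rewrite !mxE (negPf bk) /= !mulr0.
  by rewrite !mxE !eqxx mulr1 Im_iM addr0.
have Uh s : up (p + h s) by rewrite /upper /= addr0.
have p0 := pi_gt0 R; have v0 : 0 < (2 ^+ a : R) by rewrite exprn_gt0.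
have rn (s : R) : nc (mono (p + h s) rho) = expR (- (2 * pi * X) - pi * (2 ^+ a * s)).
  by rewrite hn monoE nc_expi -/X -expRD hv -pmulrn natrX.
have ve : 2 ^+ a * eps = 2 * (`|X| + 1) by rewrite /eps; field; rewrite VR0.
have Xn := ler_norm X; have Xn' := ler_norm (- X); rewrite normrN in Xn'.
have b1 : bsum (fun i => dm i * mono (p + h eps) i).
  apply: (fexp_conv fexp_l); split=> //; rewrite rn ve -[ltRHS]expR0 ltr_expR.
  have : pi * (- (2 * X)) < pi * (2 * (`|X| + 1)) by rewrite ltr_pM2l //; lra.
  by lra.
have b2 : bsum (fun i => dm i * mono (p + h (- eps)) i).
  apply: bsum_g => //; rewrite rn mulrN ve -[ltLHS]expR0 ltr_expR.
  have : pi * (2 * X) < pi * (2 * (`|X| + 1)) by rewrite ltr_pM2l //; lra.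
  by lra.
have [M1 h1] := b1; have [M2 h2] := b2; exists (M1 + M2) => A; apply: le_trans (lerD (h1 A) (h2 A)).
rewrite -big_split; apply: ler_sum => i _; apply: nc_interp.
apply: le_trans (eq_leR (congr2 +%R (esym (hn eps i)) (esym (hn (- eps) i)))).
rewrite -mulrDr; apply: ler_peMr; first exact: nc_ge0.
rewrite mulrN mulrN opprK; move: (pi * _) => y.
have [y0|y0] := lerP 0 y.
  by apply: le_trans (_ : 1 <= expR y) _; [rewrite -[leLHS]expR0 ler_expR | rewrite lerDr expR_ge0].
by apply: le_trans (_ : 1 <= expR (- y)) _; [rewrite -[leLHS]expR0 ler_expR oppr_ge0 ltW | rewrite lerDl expR_ge0].
Qed.

(** On |x| < 1 the series G is f / (1 - x). Thus (1 - x) G and f have the same coefficients there,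
    and since both expansions converge everywhere the identity extends. *)
Lemma divide_factor : exists g, isF g /\ forall p, up p -> f p = (1 - mono p rho) * g p.
Proof.
have hG := conv_fexp absconv_dm; set G := fun p => _ in hG; exists G; split; first by exists dm.
have [c1 [h1 _]] : isD up (fun=> 0) (fun p => 1 - mono p rho) (fun p => 0 + (-1) * (0 * mono p rho)).
  have := isDD (isD_cst up 1 (erefl : (fun=> 0 : R[i]) (0%N, 0 : 'cV[int]_n) = 0)) (isDZ (-1) (isD_mono up (fun=> 0) rho)).
  by move/isD_eq; apply=> p _; rewrite ?mulN1r.
have h2 := fexpM h1 hG.
have sub p : Ul p -> up p by case.
have h3 : fexp Ul f (mulcoef c1 dm).
  move=> p Ulp; have := h2 p (sub p Ulp).
  have -> : G p = f p / (1 - mono p rho) by apply: csumE; exact: fexp_l.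
  rewrite mulrCA mulfV ?mulr1 // -nc_gt0; apply: lt_le_trans (nc_sub1_ge _).
  by rewrite subr_gt0; case: Ulp.
have h4 : fexp Ul f c by move=> p Ulp; exact: hf (sub p Ulp).
have cc := fexp_unique h4 h3 ptl_l.
by move=> p Up; apply: has_sum_unique (hf Up) _; rewrite cc; exact: h2.
Qed.

End DivideFactor.

(** * Division by phi along a linear form *)

Section DividePhi.
Variables (R : realType) (n : nat).
Local Notation pt := (R[i] * 'cV[R[i]]_n)%type.
Local Notation idx := (nat * 'cV[int]_n)%type.
Local Notation up := (@upper R n).

(** The modulus forces x to be real; for its fractional part t, cos(2 pi t) = 1 gives sin(pi t) = 0
    and so t = 0. *)
Lemma ee_eq1 (x : R[i]) : ee x = 1 -> exists m : int, x = m%:~R.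
Proof.
move=> x1; have : nc (ee x) = 1 by rewrite x1 nc1.
rewrite nc_ee -[RHS]expR0 => /expR_inj /eqP; rewrite oppr_eq0 mulf_eq0 mulf_eq0 pnatr_eq0 (gt_eqF (pi_gt0 R)) /= => /eqP xi.
pose m := Num.floor (complex.Re x); pose t := complex.Re x - m%:~R.
have xE : x = (t + m%:~R)%:C by rewrite /t subrK; case: x xi {x1 m t} => a b /= ->.
have t0 : 0 <= t by rewrite subr_ge0 ge_floor.
have t1 : t < 1 by rewrite ltrBlDr addrC -[X in _ + X]/(1%:~R) -intrD floorD1_gt.
exists m; rewrite xE; move: x1; rewrite xE rmorphD rmorph_int eeD ee_int mulr1 -expi_ee => h.
have := congr1 (@complex.Re R) h; rewrite Re_expi_real => h1.
have h2 : cos (2 * pi * t) = 1 - sin (pi * t) ^+ 2 *+ 2.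
  have -> : 2 * pi * t = (pi * t) *+ 2 by ring.
  by rewrite cos_mulr2n -[cos _ ^+ 2](addrK (sin (pi * t) ^+ 2)) cos2Dsin2 mulrnBl mulr2n addrAC addrK.
move: h1; rewrite h2 => /eqP; rewrite [X in _ == X](_ : _ = 1) // -subr_eq0 addrAC subrr add0r oppr_eq0 mulrn_eq0 /=.
rewrite expf_eq0 /= => /eqP s0.
have [t00|t00] := eqVneq t 0; first by rewrite t00 add0r.
have : 0 < sin (pi * t).
  apply: sin_gt0_pi; rewrite gtr_pMr ?pi_gt0 // t1 andbT mulr_gt0 ?pi_gt0 //.
  by rewrite lt_neqAle eq_sym t00.
by rewrite s0 ltxx.
Qed.

Lemma divide_factor_neg (f : pt -> R[i]) (N : nat) (v : 'cV[int]_n) k0 a : v k0 0 = - (2 ^ a)%N%:Z -> isF f ->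
  (forall p, up p -> mono p (N, v) = 1 -> f p = 0) ->
  exists g, isF g /\ forall p, up p -> f p = (1 - mono p (N, v)) * g p.
Proof.
move=> hv hf f0; pose L : 'M[int]_n := - 1%:M.
have LL (p : pt) : pull L (pull L p) = p.
  rewrite /pull; case: p => t z; congr (_, _).
  by rewrite mulmxA -map_mxM /L mulNmx mulmxN opprK mul1mx map_mx1 mul1mx.
have mL p (u : 'cV[int]_n) : mono (pull L p) (N, u) = mono p (N, - u).
  by rewrite mono_pull /idxpull /L linearN /= trmx1 mulNmx mul1mx.
have [c hc] := isF_pull L hf.
have [||g [hg eg]] := divide_factor hc (N := N) (v := - v) (k0 := k0) (a := a).
- by rewrite mxE hv opprK.
- by move=> p Up p1; apply: f0 => //; rewrite mL.
exists (fun p => g (pull L p)); split; first exact: isF_pull hg.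
move=> p Up; have := eg (pull L p) Up; rewrite LL => ->.
by rewrite mL opprK.
Qed.

Variables (L : 'cV[int]_n) (k0 : 'I_n) (b : nat).
Hypothesis hL : L k0 0 = (2 ^ b)%N%:Z.

Definition Lz (p : pt) : R[i] := \sum_k (L k 0)%:~R * p.2 k 0.

Let v : 'cV[int]_n := 2 *: L.
(** The exponent of the factor whose zeros are the points with Lz in t tau + Z. The sign of [v]
    depends on t so that the power of q is nonnegative. *)
Let rt (t : int) : idx := (absz t, if t <= 0 then v else - v).

Lemma lin_v p m : lin p (m, v) = m%:R * p.1 + Lz p.
Proof.
rewrite linE; congr (_ + _); apply: eq_bigr => k _; rewrite /= mxE intrM; by field.
Qed.

Lemma lin_Nv p m : lin p (m, - v) = m%:R * p.1 - Lz p.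
Proof.
rewrite linE -sumrN; congr (_ + _); apply: eq_bigr => k _; rewrite /= !mxE mulrNz intrM; by field.
Qed.

Lemma mono_v p m : mono p (m, v) = expi p.1 ^+ m * ee (Lz p).
Proof. by rewrite monoE lin_v expi_ee eeD eeMn expi_ee. Qed.

Lemma mono_Nv p m : mono p (m, - v) = expi p.1 ^+ m / ee (Lz p).
Proof. by rewrite monoE lin_Nv expi_ee eeD eeMn expi_ee eeN. Qed.

Let rt_sep p t : up p -> mono p (rt t) = 1 -> complex.Im (Lz p) = t%:~R * complex.Im p.1 /\
  exists m : int, Lz p = t%:~R * p.1 + m%:~R.
Proof.
move=> Up; rewrite monoE expi_ee => /ee_eq1 [m hm].
have [m' e] : exists m' : int, Lz p = t%:~R * p.1 + m'%:~R.
  move: hm; rewrite /rt; case: ifP => t0; rewrite ?lin_v ?lin_Nv => e.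
    exists m; have -> : t%:~R = - (absz t)%:R :> R[i] by rewrite -[(absz t)%:R]/((absz t)%:Z%:~R) lez0_abs // mulrNz opprK.
    by rewrite mulNr -e; ring.
  exists (- m); have -> : t%:~R = (absz t)%:R :> R[i] by rewrite -{1}(gez0_abs (_ : 0 <= t)) //; lia.
  by rewrite rmorphN /= -e; ring.
split; last by exists m'.
by rewrite e ImD Im_int addr0 ImM Im_int mul0r addr0 -(rmorph_int (real_complex R)).
Qed.

Let v_k0 : v k0 0 = (2 ^ b.+1)%N%:Z.
Proof. by rewrite mxE hL expnS PoszM. Qed.

Variables (f : pt -> R[i]) (hf : isF f).
Hypothesis f0 : forall p (l m : int), up p -> Lz p = l%:~R * p.1 + m%:~R -> f p = 0.

(** The zeros of the factor t lie at height Im(Lz) = t Im(tau), so the zero sets of distinct factors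
    are disjoint and dividing by one factor leaves the vanishing on the others intact. *)
Let divide_list (s : seq int) : uniq s -> exists g, isF g /\ forall p, up p -> f p = \prod_(t <- s) (1 - mono p (rt t)) * g p.
Proof.
elim: s => [|t s IH] /=; first by exists f; split=> // p _; rewrite big_nil mul1r.
move=> /andP[ts us]; have [g [hg eg]] := IH us.
have g0 p : up p -> mono p (rt t) = 1 -> g p = 0.
  move=> Up p1; have [i1 [m e1]] := rt_sep Up p1; have := eg p Up; rewrite (f0 Up e1) => /esym /eqP.
  rewrite mulf_eq0 => /orP[|/eqP //]; rewrite prodf_seq_eq0 => /hasP [t' t's /andP[_]].
  rewrite subr_eq0 eq_sym => /eqP /(rt_sep Up) [i2 _]; move: i2; rewrite i1 => /mulIf; rewrite gt_eqF // => /(_ isT) /intr_inj e.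
  by move: ts; rewrite e t's.
have [h [hh eh]] : exists h, isF h /\ forall p, up p -> g p = (1 - mono p (rt t)) * h p.
  move: g0; rewrite /rt; case: ifP => t0 g0.
    by have [c hc] := hg; exact: (divide_factor hc (k0 := k0) (a := b.+1) v_k0 g0).
  by apply: (@divide_factor_neg g _ _ k0 b.+1) => //; rewrite mxE v_k0.
exists h; split=> // p Up; rewrite big_cons eg // eh //; move: (\prod_(j <- s) _) (1 - _) (h p) => x y z; ring.
Qed.

Let fac (j : nat) (p : pt) : R[i] := (1 - expi p.1 ^+ j.+1 * ee (Lz p)) * (1 - expi p.1 ^+ j.+1 / ee (Lz p)).

Let divide_T (T : nat) : exists g, isF g /\ forall p, up p -> f p = (1 - ee (Lz p)) * \prod_(j < T) fac j p * g p.
Proof.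
pose sT := fix sT T : seq int := if T is T'.+1 then [:: - T%:Z, T%:Z & sT T'] else [:: 0].
have mem t T' : t \in sT T' -> (absz t <= T')%N.
  elim: T' => [|T' IH] /=; first by rewrite inE => /eqP ->.
  by rewrite !inE => /or3P[/eqP ->|/eqP ->|/IH]; lia.
have us : uniq (sT T).
  elim: T => [|T IH] //=; rewrite inE IH andbT negb_or -andbA; apply/and3P; split; first by lia.
    by apply/negP => /mem; lia.
  by apply/negP => /mem; lia.
have [g [hg eg]] := divide_list us; exists g; split=> // p Up; rewrite eg //; congr (_ * _).
elim: T {us g hg eg} => [|T IH] /=.
  by rewrite big_seq1 big_ord0 mulr1 /rt lexx absz0 mono_v expr0 mul1r.
have r1 : rt (- T.+1%:Z) = (T.+1, v) by [].
have r2 : rt T.+1%:Z = (T.+1, - v) by [].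
rewrite !big_cons IH big_ord_recr /= r1 r2 mono_v mono_Nv.
rewrite [fac T p]/fac; set x := \prod_(i < T) _; move: x (ee _) (expi _ ^+ _) => x y q; ring.
Qed.

(** Here all factors of index beyond T can be inverted by geometric series; the set contains the
    region |Im(Lz)| < (T + 1) Im(tau). *)
Let UT (T : nat) : set pt := [set p | up p /\ (nc (mono p (T.+1, v)) < 1 /\ nc (mono p (T.+1, - v)) < 1)].

Let nc_imp (p : pt) i : nc (mono (imp p) i) = nc (mono p i).
Proof. by rewrite mono_imp nc_real ger0_norm // nc_ge0. Qed.

Let UT_imp T p : UT T p -> UT T (imp p).
Proof. by move=> [Up [h1 h2]]; split; [exact: upper_imp | rewrite !nc_imp]. Qed.

Let UT_small T (w : 'cV[int]_n) : (w = v \/ w = - v) -> forall p, UT T p -> exists a r : R, [/\ 0 <= a, a < 1, 0 <= r, r < 1 &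
  forall j, nc (mono p ((T.+1 + j)%N, w)) <= a * r ^+ j].
Proof.
move=> hw p [Up [h1 h2]]; exists (nc (mono p (T.+1, w))), (nc (expi p.1)); split.
- exact: nc_ge0.
- by case: hw => ->.
- exact: nc_ge0.
- exact: nc_expi_lt1.
move=> j; have -> : ((T.+1 + j)%N, w) = idxD (T.+1, w) (j, 0) by rewrite /idxD /= addr0.
by rewrite mono_idxD mono_q ncM ncX.
Qed.

Let strip : set pt := [set p | up p /\ 0 < complex.Im (Lz p) < complex.Im p.1].

Let nc_mv p m : nc (mono p (m, v)) = expR (- (2 * pi * (m%:R * complex.Im p.1 + complex.Im (Lz p)))).
Proof. by rewrite monoE lin_v nc_expi ImD ImM -(rmorph_nat (real_complex R)) /= mul0r addr0. Qed.

Let nc_mNv p m : nc (mono p (m, - v)) = expR (- (2 * pi * (m%:R * complex.Im p.1 - complex.Im (Lz p)))).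
Proof. by rewrite monoE lin_Nv nc_expi ImD ImN ImM -(rmorph_nat (real_complex R)) /= mul0r addr0. Qed.

Let UT_iff T p : up p -> `|complex.Im (Lz p)| < T.+1%:R * complex.Im p.1 -> UT T p.
Proof.
move=> Up; rewrite ltr_norml => /andP[h1 h2]; split=> //; rewrite nc_mv nc_mNv -[X in _ < X]expR0 !ltr_expR !oppr_lt0.
have p0 : 0 < 2 * pi :> R by rewrite mulr_gt0 ?pi_gt0.
by split; [rewrite pmulr_rgt0 //; lra | rewrite -[X in _ < X]expR0 ltr_expR oppr_lt0 pmulr_rgt0 //; lra].
Qed.

Let strip_UT T p : strip p -> UT T p.
Proof.
move=> [Up /andP[h1 h2]]; apply: UT_iff => //; rewrite gtr0_norm //; apply: lt_le_trans h2 _.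
by rewrite ler_peMl ?ler1n // ltW.
Qed.

Let pt0 : pt := ('i%C, ('i%C * (2 ^+ b.+1)^-1%:C) *: delta_mx k0 0).

Let Im_real (x : R) : complex.Im x%:C = 0. Proof. by []. Qed.

Let strip_pt0 t : strip (pt0 + realpt t).
Proof.
have ImLz : complex.Im (Lz (pt0 + realpt t)) = 2^-1.
  rewrite /Lz Im_sum (bigD1 k0) //= big1 => [|k kk].
    rewrite !mxE !eqxx mulr1 ImM ImD Im_iM /= addr0 Im_int mul0r addr0 hL -(rmorph_int (real_complex R)) /= addr0.
    by rewrite -pmulrn natrX exprS; field; rewrite expf_neq0.
  by rewrite !mxE (negPf kk) /= mulr0 add0r ImM Im_int mul0r addr0 Im_real mulr0.
have h1 : complex.Im (pt0 + realpt t).1 = 1.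
  by change (complex.Im ('i%C + (t ord0)%:C) = 1); rewrite ImD /= addr0.
split; first by rewrite /upper /= h1 ltr01.
by rewrite ImLz h1; apply/andP; split; lra.
Qed.

(** As phi'(0) = 1, the z-derivative of [thhat] at 0 is the cube of the Euler product. Multiplying
    it by the inverse Euler product gives the square together with an expansion. *)
Lemma isF_qinf2 : isF (fun p : pt => qinf (expi p.1) ^+ 2).
Proof.
pose Z : 'M[int]_(1, n) := 0.
have e (p : pt) : pull Z p = pt1 p.1 0.
  congr (_, _); apply/matrixP => i j; rewrite !mxE big1 // => k _; by rewrite !mxE mul0r.
have h1 := isF_pull Z (isF_isDr (DopP (@good_wz R 1 0) (@isF_th R))).
have h2 := isF_pull Z (@isF_tinv R).
apply: (isF_eq (isF_M h1 h2)) => p Up; rewrite e.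
have t0 : 0 < complex.Im p.1 := Up.
have := ph1_0 t0; rewrite ph.unlock (@phk_th R 1) //= tinvE /=.
have := qinf_neq0 (nc_expi_lt1 t0); move: (qinf _) (Dop _ _ _) => q d q0 h.
have -> : d = q ^+ 3 by rewrite -[RHS]mul1r -h; field.
by field.
Qed.

(** The first T pairs of factors, and the factor 1 - ee(Lz), are divided out of f; the remaining
    factors are inverted by [ip_limit], and the square of the Euler product comes from the
    normalisation in [ph_prod]. *)
Let GT (T : nat) : exists G d, fexp (UT T) G d /\ forall p, UT T p -> f p = ph 0 p.1 (Lz p) * G p.
Proof.
have [g [[cg hg] eg]] := divide_T T.
have ne : exists p, UT T p by exists (pt0 + realpt (fun=> 0)); apply: strip_UT; exact: strip_pt0.
have [c1 [_ _ a1 l1]] := ip_limit (e := fun j => ((T.+1 + j)%N, v)) (@UT_imp T) (UT_small (or_introl erefl)) ne.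
have [c2 [_ _ a2 l2]] := ip_limit (e := fun j => ((T.+1 + j)%N, - v)) (@UT_imp T) (UT_small (or_intror erefl)) ne.
have [c3 h3] := isF_qinf2.
have [c4 [h4 _]] := isDZ (-1) (isD_mono up (fun=> 0) (0%N, L)).
have sub p : UT T p -> up p by case.
have w1 := conv_fexp a1; have w2 := conv_fexp a2; set Q1 := fun p => _ in w1; set Q2 := fun p => _ in w2.
have res (h : pt -> R[i]) d : fexp up h d -> fexp (UT T) h d by move=> hh p Tp; exact: hh (sub p Tp).
exists (fun p => (-1 * mono p (0%N, L)) * (qinf (expi p.1) ^+ 2 * (Q1 p * (Q2 p * g p)))); eexists; split.
  exact: fexpM (res _ _ h4) (fexpM (res _ _ h3) (fexpM w1 (fexpM w2 (res _ _ hg)))).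
move=> p Tp; have Up := sub p Tp; rewrite eg //.
have key : sz (Lz p) * \prod_(j < T) fac j p = qinf (expi p.1) ^+ 2 * ph 0 p.1 (Lz p) * (Q1 p * Q2 p).
  have hp := ph_prod (z := Lz p) Up.
  have hB B : exists N, forall m, (N <= m)%N -> (B <= T + m)%N by exists B => m; lia.
  have h := seqM (cvg_sub hp hB) (seqM (l1 p Tp) (l2 p Tp)).
  have cl (F : nat -> R[i]) (y l : R[i]) : F @ \oo --> l -> (forall M, F M = y) -> y = l.
    by move=> hF eF; move: hF; rewrite (_ : F = fun=> y); [move=> h1; exact: ccvg_unique (cvg_cst _) h1 | apply/funext].
  apply: (cl _ _ _ h) => M /=; symmetry; rewrite (expi_ee (Lz p)) big_split_ord /= -!mulrA; congr (_ * _).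
  rewrite [X in X * _](_ : _ = \prod_(j < T) fac j p) //.
  rewrite -[LHS]mulr1; congr (_ * _); symmetry.
  rewrite /invprod -!big_split big1 // => j _ /=; rewrite mono_v mono_Nv addSn.
  have n1 (x : R[i]) : nc x < 1 -> 1 - x != 0.
    by move=> x1; rewrite -nc_gt0; apply: lt_le_trans (nc_sub1_ge _); rewrite subr_gt0.
  have [a' [r [a0 a1' r0 r1 hr]]] := UT_small (or_introl erefl) Tp.
  have [a'' [r' [a0' a1'' r0' r1' hr']]] := UT_small (or_intror erefl) Tp.
  have m1 : 1 - expi p.1 ^+ (T + j).+1 * ee (Lz p) != 0.
    apply: n1; have := hr j; rewrite mono_v addSn => /le_lt_trans; apply; apply: le_lt_trans a1'.
    by rewrite ler_piMr // exprn_ile1 // ltW.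
  have m2 : 1 - expi p.1 ^+ (T + j).+1 / ee (Lz p) != 0.
    apply: n1; have := hr' j; rewrite mono_Nv addSn => /le_lt_trans; apply; apply: le_lt_trans a1''.
    by rewrite ler_piMr // exprn_ile1 // ltW.
  move: (1 - _) (1 - _) m1 m2 => x y x0 y0; field; by rewrite x0 y0.
have e1 : mono p (0%N, L) = ee (Lz p / 2).
  rewrite monoE expi_ee linE mul0r add0r; congr ee; rewrite /Lz mulr_suml; apply: eq_bigr => k _; ring.
have e2 : 1 - ee (Lz p) = - ee (Lz p / 2) * sz (Lz p).
  rewrite sz.unlock !expi_ee eeN; have -> : ee (Lz p) = ee (Lz p / 2) ^+ 2 by rewrite -eeMn; congr ee; field.
  by have := ee_neq0 (Lz p / 2); move: (ee _) => x x0; field.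
rewrite e1 e2; transitivity (- ee (Lz p / 2) * (sz (Lz p) * \prod_(j < T) fac j p) * g p); first by ring.
by rewrite key; ring.
Qed.

(** The quotients for the various T agree with f / phi on the strip 0 < Im(Lz) < Im(tau), where phi
    has no zeros. By uniqueness they have one and the same coefficient family, which therefore
    converges on every region and hence everywhere. *)
Theorem divide_phi : exists g, isF g /\ forall p, up p -> f p = ph 0 p.1 (Lz p) * g p.
Proof.
have [G0 [d [h0 e0]]] := GT 0.
have fs T G dT : fexp (UT T) G dT -> (forall p, UT T p -> f p = ph 0 p.1 (Lz p) * G p) ->
    fexp strip (fun p => f p / ph 0 p.1 (Lz p)) dT.
  move=> hG eG p sp; have Tp := strip_UT T sp; rewrite eG // mulrC mulKf; first exact: hG.
  case: sp => Up /andP[i1 i2]; apply: ph_neq0 => //; first by rewrite gt_eqF.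
  by rewrite gtr0_norm.
have all p : up p -> exists2 y, has_sum (fun i => d i * mono p i) y & f p = ph 0 p.1 (Lz p) * y.
  move=> Up; have t0 : 0 < complex.Im p.1 := Up.
  pose T := Num.truncn (`|complex.Im (Lz p)| / complex.Im p.1).
  have Tp : UT T p.
    apply: UT_iff => //; rewrite -ltr_pdivrMr //.
    by have /andP[] := truncn_itv (divr_ge0 (normr_ge0 (complex.Im (Lz p))) (ltW t0)).
  have [G [dT [hG eG]]] := GT T; exists (G p); last exact: eG.
  by rewrite (fexp_unique (fs _ _ _ h0 e0) (fs _ _ _ hG eG) strip_pt0); exact: hG.
exists (fun p => csum (fun i => d i * mono p i)); split.
  by exists d => p Up; have [y hy _] := all p Up; rewrite (csumE hy).
by move=> p Up; have [y hy ->] := all p Up; rewrite (csumE hy).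
Qed.

End DividePhi.

(** * Weak Jacobi forms *)

Lemma addr_rot (V : zmodType) (a b c d : V) : a + b + c + d = a + d + b + c.
Proof. by rewrite addrAC [a + b + d]addrAC. Qed.

Section Shuffles.
Variable F : comRingType.

Lemma mulr_shuffle (a b c d x y : F) : a * b * x * (c * d * y) = a * c * (b * d) * (x * y).
Proof. by ring. Qed.

Lemma quot_shuffle (x1 x2 x3 x4 x5 x6 x7 : F) : x1 * x3 * x5 * x6 = x2 * x1 * (x4 * x3) * (x5 * x7) ->
  x1 * x3 * (x5 * (x6 + -1 * (x2 * x4 * x7))) = 0.
Proof.
move=> e; transitivity (x1 * x3 * x5 * x6 - x2 * x1 * (x4 * x3) * (x5 * x7)); first by ring.
by rewrite e subrr.
Qed.

End Shuffles.

Section Jac.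
Variables (R : realType) (n : nat).
Local Notation pt := (R[i] * 'cV[R[i]]_n)%type.
Local Notation up := (@upper R n).
Implicit Types (f g h : pt -> R[i]) (M : 'M[int]_n) (k : int).

(** Equivalent to [weak_jacobi] by [jacP], with the expansion as the working datum. Arbitrary
    integer matrices are allowed on purpose: the descent passes through a negative and an indefinite
    index, where the forms turn out to vanish. *)
Record jac k M f : Prop := Jac {
  jac_onH : onH f = f ;
  jac_F : isF f ;
  jac_mod : forall (a b c d : int) tau (z : 'cV[R[i]]_n), a * d - b * c = 1 -> 0 < complex.Im tau ->
    f ((a%:~R * tau + b%:~R) / (c%:~R * tau + d%:~R), (c%:~R * tau + d%:~R)^-1 *: z) =
      (c%:~R * tau + d%:~R) ^ k * ee (c%:~R * quad (intm R M) z / (c%:~R * tau + d%:~R)) * f (tau, z) ;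
  jac_ell : forall (l m : 'cV[int]_n) tau (z : 'cV[R[i]]_n), 0 < complex.Im tau ->
    f (tau, z + tau *: intv R l + intv R m) =
      (-1) ^ ((l^T *m M *m l) 0 0 + (m^T *m M *m m) 0 0) *
      ee (- (tau * quad (intm R M) (intv R l)) - bil (intm R M) (intv R l) z) * f (tau, z)
}.

Lemma jacP k M f : weak_jacobi k M f <-> jac k M f.
Proof.
split=> [[h1 h2 h3 h4 [c /fexpP h5]]|[h1 [c h2] h3 h4]].
  split=> //; first by exists c.
    by move=> *; rewrite -expi_ee; exact: h3.
  by move=> *; rewrite -expi_ee; exact: h4.
split=> //; last by exists c; apply/fexpP.
- by move=> p Up; exact: fexp_differentiable h2 Up.
- by move=> a b c' d tau z det t0 /=; rewrite expi_ee; exact: h3.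
- by move=> l m tau z t0; rewrite expi_ee; exact: h4.
Qed.

Lemma quadD M M' (z : 'cV[R[i]]_n) : quad (intm R (M + M')) z = quad (intm R M) z + quad (intm R M') z.
Proof. by rewrite /quad /bil /intm map_mxD mulmxDr mulmxDl mxE mulrDr. Qed.

Lemma bilD M M' (x y : 'cV[R[i]]_n) : bil (intm R (M + M')) x y = bil (intm R M) x y + bil (intm R M') x y.
Proof. by rewrite /bil /intm map_mxD mulmxDr mulmxDl mxE. Qed.

Lemma onH_M f g : onH f = f -> onH (fun p => f p * g p) = fun p => f p * g p.
Proof. by move=> hf; apply/funext => p; rewrite /onH; case: ifP => // h; rewrite -hf /onH h mul0r. Qed.

Lemma onH_D f g : onH f = f -> onH g = g -> onH (fun p => f p + g p) = fun p => f p + g p.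
Proof. by move=> hf hg; apply/funext => p; rewrite /onH; case: ifP => // h; rewrite -hf -hg /onH h addr0. Qed.

Lemma onH_onH f : onH (onH f) = onH f.
Proof. by apply/funext => p; rewrite /onH; case: (0 < complex.Im p.1). Qed.

Lemma intmx_D M M' (l : 'cV[int]_n) : (l^T *m (M + M') *m l) 0 0 = (l^T *m M *m l) 0 0 + (l^T *m M' *m l) 0 0.
Proof. by rewrite mulmxDr mulmxDl mxE. Qed.

Lemma m1_neq0 : (-1 : R[i]) != 0. Proof. by rewrite oppr_eq0 oner_eq0. Qed.

Lemma jacM k k' M M' f g : jac k M f -> jac k' M' g -> jac (k + k') (M + M') (fun p => f p * g p).
Proof.
move=> [f1 f2 f3 f4] [g1 g2 g3 g4]; split; [exact: onH_M | exact: isF_M | |].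
  move=> a b c d tau z det t0; have [j0 _] := sl2_upper det t0; rewrite f3 // g3 // quadD expfzDr //.
  rewrite mulrDr mulrDl eeD; exact: mulr_shuffle.
move=> l m tau z t0; rewrite f4 // g4 // quadD bilD !intmx_D addrACA [in RHS]expfzDr ?m1_neq0 //.
have -> : - (tau * (quad (intm R M) (intv R l) + quad (intm R M') (intv R l))) -
   (bil (intm R M) (intv R l) z + bil (intm R M') (intv R l) z) =
   (- (tau * quad (intm R M) (intv R l)) - bil (intm R M) (intv R l) z) +
   (- (tau * quad (intm R M') (intv R l)) - bil (intm R M') (intv R l) z).
  by rewrite mulrDr !opprD addrACA.
rewrite [in RHS]eeD; exact: mulr_shuffle.
Qed.

Lemma jacD k M f g : jac k M f -> jac k M g -> jac k M (fun p => f p + g p).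
Proof.
move=> [f1 f2 f3 f4] [g1 g2 g3 g4]; split; [exact: onH_D | exact: isF_D | |].
  by move=> a b c d tau z det t0; rewrite f3 // g3 // mulrDr.
by move=> l m tau z t0; rewrite f4 // g4 // mulrDr.
Qed.

Lemma jacZ k M x f : jac k M f -> jac k M (fun p => x * f p).
Proof.
move=> [f1 f2 f3 f4]; split; [ | exact: isF_Z | |].
- by apply/funext => p; rewrite /onH; case: ifP => // h; rewrite -f1 /onH h mulr0.
- by move=> a b c d tau z det t0; rewrite f3 // mulrCA.
by move=> l m tau z t0; rewrite f4 // mulrCA.
Qed.

Lemma jac0 k M : jac k M (fun=> 0).
Proof.
split; [by apply/funext => p; rewrite /onH; case: ifP | exact: isF_cst | |].
- by move=> *; rewrite mulr0.
- by move=> *; rewrite mulr0.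
Qed.

End Jac.

Lemma bil_pull (R : realType) n n' (M : 'M[int]_n) (L : 'M[int]_(n, n')) (x y : 'cV[R[i]]_n') :
  bil (intm R M) (map_mx intr L *m x) (map_mx intr L *m y) = bil (intm R (L^T *m M *m L)) x y.
Proof. by rewrite /bil /intm !map_mxM -map_trmx trmx_mul !mulmxA. Qed.

Lemma jac_pull (R : realType) n n' (L : 'M[int]_(n, n')) k M (f : R[i] * 'cV[R[i]]_n -> R[i]) :
  jac k M f -> jac k (L^T *m M *m L) (fun p => f (pull L p)).
Proof.
move=> [f1 f2 f3 f4]; split; [ | exact: isF_pull | |].
- by apply/funext => p; rewrite /onH; case: ifP => // h; rewrite -f1 /onH h.
- move=> a b c d tau z det t0; rewrite /pull /= -scalemxAr f3 //.
  by rewrite /quad bil_pull.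
move=> l m tau z t0; rewrite /pull /= !mulmxDr -scalemxAr.
have e (u : 'cV[int]_n') : map_mx intr L *m intv R u = intv R (L *m u) by rewrite /intv map_mxM.
rewrite !e f4 // /quad -!e !bil_pull; congr (_ ^ (_ + _) * _ * _).
- by rewrite trmx_mul !mulmxA.
- by rewrite trmx_mul !mulmxA.
Qed.

(** * Cancelling phi by continuity *)

Section Cancel.
Variable R : realType.

Lemma cder_vanish (F : R[i] -> R[i]) d (e0 : R) : cder F 0 d -> 0 < e0 ->
  (forall e : R, 0 < e -> e < e0 -> F ('i%C * e%:C) = 0) -> F 0 = 0.
Proof.
move=> [K [e1 [K0 e10 h]]] e00 hF; apply/eqP; rewrite -nc_eq0 eq_le nc_ge0 andbT.
have ni (e : R) : 0 <= e -> nc ('i%C * e%:C) = e.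
  by move=> e0'; rewrite ncM nc_real ger0_norm // (_ : nc 'i%C = 1) ?mul1r // /= expr0n expr1n add0r sqrtr1.
apply/ler_addgt0Pr => e2 e20; rewrite add0r.
pose e := Num.min (Num.min (e0 / 2) e1) (Num.min 1 (e2 / (nc d + K + 1))).
have q0 : 0 < nc d + K + 1 by have := nc_ge0 d; lra.
have ep : 0 < e by rewrite !lt_min divr_gt0 //= e10 ltr01 divr_gt0.
have ee0 : e < e0.
  by apply: le_lt_trans (_ : e0 / 2 < e0); [rewrite !ge_min lexx | lra].
have ee1 : e <= e1 by rewrite !ge_min lexx orbT.
have e1' : e <= 1 by rewrite !ge_min lexx !orbT.
have ee2 : e * (nc d + K + 1) <= e2 by rewrite -ler_pdivlMr // !ge_min lexx !orbT.
have := h ('i%C * e%:C); rewrite ni ?(ltW ep) // add0r (hF _ ep ee0) sub0r => /(_ ee1) h1.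
have h2 : nc (F 0) <= K * e ^+ 2 + e * nc d.
  have -> : F 0 = - (- F 0 - 'i%C * e%:C * d) - 'i%C * e%:C * d by ring.
  by apply: le_trans (ncB _ _) _; rewrite ncN ncM ni ?(ltW ep) // lerD2r.
apply: le_trans h2 _; apply: le_trans ee2.
have : K * e ^+ 2 <= K * e by rewrite ler_wpM2l // expr2 ler_piMr // ltW.
by lra.
Qed.

(** A small step from [w0] in the direction i leads strictly between two consecutive rows of zeros
    of [phi], even if [w0] lies on a row. There F must vanish, and F(0) = 0 follows by
    continuity. *)
Lemma ph_cancel (tau w0 : R[i]) (a : R) (F : R[i] -> R[i]) d : 0 < complex.Im tau -> 0 < a -> cder F 0 d ->
  (forall u, ph 0 tau (w0 + a%:C * u) * F u = 0) -> F 0 = 0.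
Proof.
move=> t0 a0 hF hz; set T := complex.Im tau in t0; pose W := complex.Im w0.
pose l := Num.floor (W / T).
have l1 : l%:~R * T <= W by rewrite -ler_pdivlMr // ge_floor.
have l2 : W < (l%:~R + 1) * T by rewrite -ltr_pdivrMr // -[X in _ + X]/(1%:~R) -intrD floorD1_gt.
apply: (cder_vanish (e0 := ((l%:~R + 1) * T - W) / a) hF); first by rewrite divr_gt0 // subr_gt0.
move=> e e0 e1; have := hz ('i%C * e%:C) => /eqP; rewrite mulf_eq0 => /orP[|/eqP //].
have ae : a * e < (l%:~R + 1) * T - W by rewrite mulrC -ltr_pdivlMr.
have ae0 : 0 < a * e by rewrite mulr_gt0.
pose w := w0 + a%:C * ('i%C * e%:C) - l%:~R * tau.
have wI : complex.Im w = W + a * e - l%:~R * T.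
  rewrite /w !ImD ImN ImM [complex.Im (l%:~R * tau)]ImM Im_int mul0r addr0 Im_iM /= mul0r addr0.
  by rewrite -(rmorph_int (real_complex R)).
have := @ph_neq0 R tau w t0; rewrite wI gt_eqF; last by lra.
rewrite gtr0_norm; last by lra.
have hlt : W + a * e - l%:~R * T < T by lra.
move=> /(_ isT hlt) hn.
have -> : w0 + a%:C * ('i%C * e%:C) = w + tau * l%:~R + 0%:~R by rewrite /w; ring.
rewrite ph_ee // mulf_eq0 mulf_eq0 (negPf (ee_neq0 _)) orbF expfz_eq0 (negPf (m1_neq0 R)) andbF /=.
by rewrite (negPf hn).
Qed.

Variable n : nat.
Local Notation pt := (R[i] * 'cV[R[i]]_n)%type.
Local Notation up := (@upper R n).

Lemma isF_line (g : pt -> R[i]) tau (z v : 'cV[R[i]]_n) : isF g -> 0 < complex.Im tau ->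
  exists d, cder (fun u => g (tau, z + u *: v)) 0 d.
Proof.
move=> [c hc] t0; have Up : up (tau, z) by [].
have [K [e [e0 hK]]] := fexp_taylor hc Up.
pose N : R := \sum_k nc (v k 0) + 1.
have S0 : 0 <= \sum_k nc (v k 0) by apply: sumr_ge0 => k _; exact: nc_ge0.
have N0 : 0 < N by rewrite /N; lra.
exists (twopii R * csum (fun i => lin (0, v) i * c i * mono (tau, z) i)).
apply: (@cderI _ _ _ _ (Num.max 0 K * N ^+ 2) (e / N)); first exact: divr_gt0.
move=> u ue; pose h : pt := (0, u *: v).
have hn : nrm1 h = nc u * \sum_k nc (v k 0).
  by rewrite /nrm1 nc0 add0r mulr_sumr; apply: eq_bigr => k _; rewrite !mxE ncM.
have hN : nrm1 h <= nc u * N by rewrite hn ler_wpM2l ?nc_ge0 // lerDl.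
have he : nrm1 h <= e by apply: le_trans hN _; rewrite -ler_pdivlMr.
have [_] := hK h he.
have -> : (tau, z) + h = (tau, z + (0 + u) *: v) by rewrite add0r; congr (_, _); exact: addr0.
have -> : csum (fun i => lin h i * c i * mono (tau, z) i) = u * csum (fun i => lin (0, v) i * c i * mono (tau, z) i).
  have b : bsum (fun i => lin (0, v) i * c i * mono (tau, z) i).
    apply: (conv_poly (K := nrm1 ((0, v) : pt)) (fexp_conv hc)) => // i.
    apply: le_trans (nc_lin_le (0, v) i) _; rewrite mulrC ler_wpM2l //.
      by rewrite addr_ge0 ?nc_ge0 // sumr_ge0 // => *; exact: nc_ge0.
    by have := absS_ge0 R i.2; lra.
  apply: csumE; apply: (eq_has_sum (has_sumZ u (bsum_has b))) => i.
  have -> : lin h i = u * lin (0, v) i by rewrite -linZl mulr0.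
  by rewrite !mulrA.
rewrite mulrCA scale0r addr0 => h1; apply: le_trans h1 _.
apply: (@le_trans _ _ (Num.max 0 K * nrm1 h ^+ 2)).
  by rewrite ler_wpM2r ?sqr_ge0 // le_max lexx orbT.
rewrite -mulrA ler_wpM2l ?le_max ?lexx // -exprMn [N * _]mulrC lerXn2r ?nnegrE //.
  by rewrite hn mulr_ge0 ?nc_ge0.
by rewrite mulr_ge0 ?nc_ge0 // ltW.
Qed.

Lemma bilxD (A : 'M[R[i]]_n) x y z : bil A x (y + z) = bil A x y + bil A x z.
Proof. by rewrite /bil mulmxDr mxE. Qed.

Lemma bilDx (A : 'M[R[i]]_n) x y z : bil A (y + z) x = bil A y x + bil A z x.
Proof. by rewrite /bil [(y + z)^T]linearD /= !mulmxDl mxE. Qed.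

Lemma bilxZ (A : 'M[R[i]]_n) x a z : bil A x (a *: z) = a * bil A x z.
Proof. by rewrite /bil -scalemxAr mxE. Qed.

Lemma bilZx (A : 'M[R[i]]_n) x a z : bil A (a *: z) x = a * bil A z x.
Proof. by rewrite /bil [(a *: z)^T]linearZ /= -!scalemxAl mxE. Qed.

Lemma cder_quad (A : 'M[R[i]]_n) (z v : 'cV[R[i]]_n) : exists d, cder (fun u => quad A (z + u *: v)) 0 d.
Proof.
have e u : quad A (z + u *: v) = quad A z + (u * (2^-1 * (bil A z v + bil A v z)) + u * u * quad A v).
  rewrite /quad bilxD !bilDx !bilxZ !bilZx.
  by move: (bil A z z) (bil A z v) (bil A v z) (bil A v v) => *; ring.
have := cderD (cder_cst (quad A z) 0) (cderD (cderM (cder_id 0) (cder_cst (2^-1 * (bil A z v + bil A v z)) 0))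
   (cderM (cderM (cder_id 0) (cder_id 0)) (cder_cst (quad A v) 0))) => h.
by eexists; apply: cder_ext h => u; rewrite e.
Qed.

Lemma cder_bil (A : 'M[R[i]]_n) (x z v : 'cV[R[i]]_n) : exists d, cder (fun u => bil A x (z + u *: v)) 0 d.
Proof.
have e u : bil A x (z + u *: v) = bil A x z + u * bil A x v by rewrite bilxD bilxZ.
have := cderD (cder_cst (bil A x z) 0) (cderM (cder_id 0) (cder_cst (bil A x v) 0)) => h.
by eexists; apply: cder_ext h => u; rewrite e.
Qed.

Variables (L : 'cV[int]_n) (k0 : 'I_n) (b : nat).
Hypothesis hL : L k0 0 = (2 ^ b)%N%:Z.

Let ev : 'cV[R[i]]_n := delta_mx k0 0.

Lemma Lz_line tau (z : 'cV[R[i]]_n) u : Lz L (tau, z + u *: ev) = Lz L (tau, z) + (2 ^+ b)%:C * u.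
Proof.
rewrite /Lz /= (eq_bigr (fun k => (L k 0)%:~R * z k 0 + (L k 0)%:~R * (u * ev k 0))) => [|k _]; last by rewrite !mxE mulrDr.
rewrite big_split /=; congr (_ + _); rewrite (bigD1 k0) //= big1 => [|k kk]; last by rewrite mxE (negPf kk) /= !mulr0.
by rewrite mxE !eqxx mulr1 addr0 hL rmorphXn rmorph_nat -pmulrn natrX.
Qed.

Lemma Lz_scale tau tau' x (z : 'cV[R[i]]_n) : Lz L (tau, x *: z) = x * Lz L (tau', z).
Proof. by rewrite /Lz mulr_sumr; apply: eq_bigr => k _; rewrite /= mxE mulrCA. Qed.

(* The quotient of two forms satisfies its transformation laws off the zeros of the denominator, hence everywhere by continuity. *)
Lemma jac_quot k k' M M' (f g : pt -> R[i]) :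
  jac (k + k') (M + M') f -> jac k' M' (onH (fun p : pt => ph 0 p.1 (Lz L p))) -> isF g -> onH g = g ->
  (forall p, up p -> f p = ph 0 p.1 (Lz L p) * g p) -> jac k M g.
Proof.
move=> [_ _ f3 f4] [_ _ h3 h4] gF g1 e; split=> //.
  move=> a b' c d tau z det t0; have [j0 t1] := sl2_upper det t0; set j := _ + _ in j0 t1 *; set tau' := _ / j in t1 *.
  pose A u := c%:~R * quad (intm R M) (z + u *: ev) / j.
  have [d1 c1] := isF_line (j^-1 *: z) (j^-1 *: ev) gF t1.
  have [d2 c2] := isF_line z ev gF t0.
  have [d3 c3] := cder_quad (intm R M) z ev.
  pose F u := g (tau', j^-1 *: z + u *: (j^-1 *: ev)) + -1 * (j ^ k * ee (c%:~R * quad (intm R M) (z + u *: ev) * j^-1) * g (tau, z + u *: ev)).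
  have [dF cF] : exists d, cder F 0 d.
    have c4 := cderM (cderM (cder_cst c%:~R 0) c3) (cder_cst j^-1 0).
    have c5 := cderM (cder_cst (j ^ k) 0) (cder_comp c4 (cder_ee _)).
    by eexists; exact: cderD c1 (cderZ (-1) (cderM c5 c2)).
  suff hc : F 0 = 0.
    by move: hc; rewrite /F !scale0r !addr0 mulN1r => /eqP; rewrite subr_eq0 => /eqP.
  apply: (@ph_cancel tau (Lz L (tau, z)) (2 ^+ b) F dF t0 (exprn_gt0 _ _) cF) => // u.
  have Up1 : up (tau', j^-1 *: (z + u *: ev)) by []. have Up2 : up (tau, z + u *: ev) by [].
  have := f3 a b' c d tau (z + u *: ev) det t0; have := h3 a b' c d tau (z + u *: ev) det t0.
  rewrite -/j -/tau' (e _ Up1) (e _ Up2) !onHE //= quadD expfzDr // mulrDr mulrDl eeD => -> e1.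
  have zz : j^-1 *: (z + u *: ev) = j^-1 *: z + u *: (j^-1 *: ev) by rewrite scalerDr !scalerA [j^-1 * u]mulrC.
  rewrite zz in e1; rewrite -Lz_line /F.
  have n1 : j ^ k' * ee (c%:~R * quad (intm R M') (z + u *: ev) / j) != 0 by rewrite mulf_neq0 ?ee_neq0 // expfz_neq0.
  by apply: (mulfI n1); rewrite mulr0; exact: quot_shuffle e1.
move=> l m tau z t0; pose z1 u := z + u *: ev + tau *: intv R l + intv R m.
have [d1 c1] := isF_line (z + tau *: intv R l + intv R m) ev gF t0.
have [d2 c2] := isF_line z ev gF t0.
have [d3 c3] := cder_bil (intm R M) (intv R l) z ev.
pose S : R[i] := (-1) ^ ((l^T *m M *m l) 0 0 + (m^T *m M *m m) 0 0).
pose B := - (tau * quad (intm R M) (intv R l)).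
pose F u := g (tau, z + tau *: intv R l + intv R m + u *: ev) + -1 * (S * ee (B + -1 * bil (intm R M) (intv R l) (z + u *: ev)) * g (tau, z + u *: ev)).
have [dF cF] : exists d, cder F 0 d.
  have c4 := cderD (cder_cst B 0) (cderZ (-1) c3).
  have c5 := cderM (cder_cst S 0) (cder_comp c4 (cder_ee _)).
  by eexists; exact: cderD c1 (cderZ (-1) (cderM c5 c2)).
suff hc : F 0 = 0.
  by move: hc; rewrite /F !scale0r !addr0 !mulN1r => /eqP; rewrite subr_eq0 => /eqP.
apply: (@ph_cancel tau (Lz L (tau, z)) (2 ^+ b) F dF t0 (exprn_gt0 _ _) cF) => // u.
have zE : z + tau *: intv R l + intv R m + u *: ev = z + u *: ev + tau *: intv R l + intv R m by exact: addr_rot.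
have Up1 : up (tau, z + u *: ev + tau *: intv R l + intv R m) by []. have Up2 : up (tau, z + u *: ev) by [].
have := f4 l m tau (z + u *: ev) t0; have := h4 l m tau (z + u *: ev) t0.
rewrite (e _ Up1) (e _ Up2) !onHE // quadD bilD !intmx_D addrACA => e1 e2.
move: ((l^T *m M' *m l) 0 0 + (m^T *m M' *m m) 0 0) e1 e2 => sM' e1 e2.
rewrite expfzDr ?m1_neq0 // -/S in e2.
rewrite -Lz_line /F zE; move: e2; rewrite e1.
set b1 := bil (intm R M) _ _; set b2 := bil (intm R M') _ _; set q1 := quad (intm R M) _; set q2 := quad (intm R M') _.
have -> : - (tau * (q1 + q2)) - (b1 + b2) = (- (tau * q1) - b1) + (- (tau * q2) - b2) by rewrite mulrDr !opprD addrACA.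
rewrite (eeD (- (tau * q1) - b1)) (mulN1r b1) => e2.
have n1 : (-1) ^ sM' * ee (- (tau * q2) - b2) != 0 by rewrite mulf_neq0 ?ee_neq0 // expfz_neq0 // m1_neq0.
by apply: (mulfI n1); rewrite mulr0; exact: quot_shuffle e2.
Qed.

End Cancel.

(** * The two generators *)

Section Gauss.
Variable R : realType.
Local Notation kap := (twopii R).
Implicit Types (g h A : R[i] -> R[i]) (j u v t beta : R[i]).

Lemma cder_gaussian beta t : cder (fun t => ee (beta / 2 * (t * t))) t (kap * (beta * t * ee (beta / 2 * (t * t)))).
Proof.
apply: cder_eq (cder_comp (cderZ (beta / 2) (cderM (cder_id t) (cder_id t))) (cder_ee _)) _.
by move: (ee _) kap => x k; field.
Qed.

Lemma gauss_step g g' A A' j v beta : j != 0 ->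
  (forall t, cder g t (kap * g' t)) -> (forall t, cder A t (kap * A' t)) ->
  (forall t, g (j^-1 * t) = v * (ee (beta / 2 * (t * t)) * A t)) ->
  forall t, g' (j^-1 * t) = j * v * (ee (beta / 2 * (t * t)) * (A' t + beta * t * A t)).
Proof.
move=> j0 hg hA e t.
have h1 := cder_ext e (cder_comp (cder_scale j^-1 t) (hg (j^-1 * t))).
have h2 := cder_unique h1 (cderZ v (cderM (cder_gaussian beta t) (hA t))).
apply: (mulfI (twopii_neq0 R)); apply: (mulIf (invr_neq0 j0)); rewrite h2.
by move: (ee _) (A t) (A' t) kap => x y y' k; field.
Qed.

(** In units of 2 pi i the Gaussian ee(beta t^2 / 2) has vanishing odd derivatives at 0 and second
    derivative beta / (2 pi i). So the first derivative at 0 is covariant, and the third picks up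
    three times beta / (2 pi i) times the first. *)
Lemma gauss (g0 g1 g2 g3 h0 h1 h2 h3 : R[i] -> R[i]) j u beta : j != 0 ->
  (forall t, cder g0 t (kap * g1 t)) -> (forall t, cder g1 t (kap * g2 t)) -> (forall t, cder g2 t (kap * g3 t)) ->
  (forall t, cder h0 t (kap * h1 t)) -> (forall t, cder h1 t (kap * h2 t)) -> (forall t, cder h2 t (kap * h3 t)) ->
  (forall t, g0 (j^-1 * t) = u * (ee (beta / 2 * (t * t)) * h0 t)) ->
  g1 0 = j * u * h1 0 /\ g3 0 = j ^+ 3 * u * (h3 0 + 3 * beta / kap * h1 0).
Proof.
move=> j0 cg0 cg1 cg2 c0 c1 c2 e0.
have k0 := twopii_neq0 R.
have e1 := gauss_step j0 cg0 c0 e0.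
pose A1 t := h2 t + (beta / kap * h0 t + beta * t * h1 t).
have cA1 t : cder (fun t => h1 t + beta * t * h0 t) t (kap * A1 t).
  apply: cder_eq (cderD (c1 t) (cderM (cder_scale beta t) (c0 t))) _; rewrite /A1.
  by move: (h0 t) (h1 t) (h2 t) k0; move: kap => k x0 x1 x2 k0; field.
have e2 := gauss_step j0 cg1 cA1 e1.
pose A2 t := h3 t + (beta / kap * h1 t + (beta / kap * h1 t + beta * t * h2 t)) +
   (beta / kap * (h1 t + beta * t * h0 t) + beta * t * A1 t).
have cA2 t : cder (fun t => A1 t + beta * t * (h1 t + beta * t * h0 t)) t (kap * A2 t).
  have cA t' : cder A1 t' (kap * (h3 t' + (beta / kap * h1 t' + (beta / kap * h1 t' + beta * t' * h2 t')))).
    apply: cder_eq (cderD (c2 t') (cderD (cderZ (beta / kap) (c0 t')) (cderM (cder_scale beta t') (c1 t')))) _.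
    by move: (h1 t') (h2 t') (h3 t') k0; move: kap => k x1 x2 x3 k0; field.
  apply: cder_eq (cderD (cA t) (cderM (cder_scale beta t) (cA1 t))) _; rewrite /A2.
  by move: (A1 t) (h0 t) (h1 t) (h2 t) (h3 t) k0; move: kap => k y x0 x1 x2 x3 k0; field.
have e3 := gauss_step j0 cg2 cA2 e2.
have := e1 0; have := e3 0; rewrite !mulr0 !mul0r ee0 !mul1r => -> ->; rewrite !addr0.
split=> //; rewrite /A2 /A1 !mulr0 !mul0r !addr0.
by move: (h1 0) (h3 0) k0; move: kap => k x1 x3 k0; field.
Qed.

(** [gauss] applied to the modular law of [phi] in z, with phi'(0) = 1 and phi'''(0) = E2 / 4; the
    anomaly 12 is 4 times 3. *)
Lemma E2_modular (a b c d : int) tau : a * d - b * c = 1 -> 0 < complex.Im tau ->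
  E2 ((a%:~R * tau + b%:~R) / (c%:~R * tau + d%:~R)) =
  (c%:~R * tau + d%:~R) ^+ 2 * (E2 tau + 12 * (c%:~R / (c%:~R * tau + d%:~R)) / kap).
Proof.
move=> det t0; have [j0 t1] := sl2_upper det t0.
have law := ph_modular det (tau := tau).
move: law j0 t1; set j := c%:~R * tau + d%:~R; set tau' := _ / j => law j0 t1.
have [] := @gauss (ph 0 tau') (ph 1 tau') (ph 2 tau') (ph 3 tau') (ph 0 tau) (ph 1 tau) (ph 2 tau) (ph 3 tau)
  j j^-1 (c%:~R / j) j0 (fun t => ph_cder 0 t t1) (fun t => ph_cder 1 t t1) (fun t => ph_cder 2 t t1)
  (fun t => ph_cder 0 t t0) (fun t => ph_cder 1 t t0) (fun t => ph_cder 2 t t0).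
  move=> t; rewrite [j^-1 * t]mulrC law // -mulrA; congr (_ * (ee _ * _)).
  have fl (x y : R[i]) : y != 0 -> x * (t ^+ 2 / 2) / y = x / y / 2 * (t * t) by move=> y0; field.
  exact: fl.
rewrite !ph3_0 // !ph1_0 // => _ e3.
have -> : E2 tau' = 4 * (E2 tau' / 4) by rewrite mulrC divfK // pnatr_eq0.
have fl (k j' c' x : R[i]) : k != 0 -> j' != 0 -> 4 * (j' ^+ 3 * j'^-1 * (x / 4 + 3 * (c' / j') / k * 1)) = j' ^+ 2 * (x + 12 * (c' / j') / k).
  by move=> k0' j0'; field; rewrite k0' j0'.
by rewrite e3; apply: fl => //; exact: twopii_neq0.
Qed.

End Gauss.

Section SignLemmas.
Variable R : realType.

Lemma sgn_cases (m : int) : (-1 : R[i]) ^ m = 1 \/ (-1 : R[i]) ^ m = -1.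
Proof.
elim/int_step: m => [|l|l]; first by left; rewrite expr0z.
  by rewrite expfzDr ?m1_neq0 // expr1z => -[->|->]; [right; rewrite mul1r | left; rewrite mulrNN mulr1].
by rewrite expfzDr ?m1_neq0 // exprN1 invrN1 => -[->|->]; [right; rewrite mul1r | left; rewrite mulrNN mulr1].
Qed.

Lemma sgn_sq (m : int) : (-1 : R[i]) ^ (m * m) = (-1) ^ m.
Proof. by rewrite -exprz_exp; have [e|e] := sgn_cases m; rewrite ?e ?exp1rz. Qed.

Lemma sgn_even (m : int) : (-1 : R[i]) ^ (2 * m) = 1.
Proof. by rewrite -exprz_exp -[(-1) ^ 2]/((-1) ^+ 2) sqrrN expr1n exp1rz. Qed.

End SignLemmas.

Section LinearForms.
Variables (R : realType) (n : nat) (L : 'cV[int]_n).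
Local Notation pt := (R[i] * 'cV[R[i]]_n)%type.
Local Notation up := (@upper R n).

Definition phL : pt -> R[i] := onH (fun p : pt => ph 0 p.1 (Lz L p)).

Definition dotz (l : 'cV[int]_n) : int := (L^T *m l) 0 0.

Lemma Lz_dot tau (z : 'cV[R[i]]_n) : Lz L (tau, z) = ((intv R L)^T *m z) 0 0.
Proof. by rewrite mxE /Lz; apply: eq_bigr => k _; rewrite !mxE. Qed.

Lemma Lz_int tau (l : 'cV[int]_n) : Lz L (tau, intv R l) = (dotz l)%:~R.
Proof.
rewrite /Lz /dotz mxE (rmorph_sum (intmul 1)); apply: eq_bigr => k _.
by rewrite /= !mxE rmorphM.
Qed.

Lemma Lz_shift tau (z : 'cV[R[i]]_n) (l m : 'cV[int]_n) :
  Lz L (tau, z + tau *: intv R l + intv R m) = Lz L (tau, z) + tau * (dotz l)%:~R + (dotz m)%:~R.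
Proof.
rewrite -(Lz_int tau l) -(Lz_int tau m) /Lz mulr_sumr -!big_split /=; apply: eq_bigr => k _; rewrite !mxE.
by move: (z k 0) ((l k 0)%:~R : R[i]) ((m k 0)%:~R : R[i]) ((L k 0)%:~R : R[i]) => *; ring.
Qed.

Lemma bil_LL tau (x y : 'cV[R[i]]_n) : bil (intm R (L *m L^T)) x y = Lz L (tau, x) * Lz L (tau, y).
Proof.
rewrite /bil /intm map_mxM -map_trmx !mulmxA -mulmxA mxE big_ord1 !Lz_dot.
by rewrite -{1}[x^T *m _]trmxK trmx_mul trmxK [in X in X * _]mxE.
Qed.

Lemma int_LL (l : 'cV[int]_n) : (l^T *m (L *m L^T) *m l) 0 0 = dotz l * dotz l.
Proof.
rewrite !mulmxA -mulmxA mxE big_ord1 /dotz.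
by rewrite -{1}[l^T *m _]trmxK trmx_mul trmxK [in X in X * _]mxE.
Qed.

Lemma phk_pull k (p : pt) : phk k (pull L^T p) = ph k p.1 (Lz L p).
Proof.
rewrite ph.unlock; congr (phk k (_, _)); apply/matrixP => i j; rewrite !ord1 !mxE /Lz.
by apply: eq_bigr => k' _; rewrite !mxE.
Qed.

Lemma isF_phz k : isF (fun p : pt => ph k p.1 (Lz L p)).
Proof. by apply: isF_eq (isF_pull L^T (isF_phk R k)) _ => p _; exact: phk_pull. Qed.

Lemma jac_phL : jac (-1) (L *m L^T) phL.
Proof.
split; [exact: onH_onH | exact: isF_onH (isF_phz 0) | |].
  move=> a b c d tau z det t0; have [j0 t1] := sl2_upper det t0.
  rewrite /phL !onHE //= (Lz_scale L _ tau) [_^-1 * Lz _ _]mulrC (ph_modular det) // exprN1.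
  by rewrite /quad (bil_LL tau) [2^-1 * _]mulrC expr2.
move=> l m tau z t0; rewrite /phL !onHE //= Lz_shift ph_ee // !int_LL.
have -> : (-1 : R[i]) ^ (dotz l * dotz l + dotz m * dotz m) = (-1) ^ (dotz l + dotz m).
  by rewrite !expfzDr ?m1_neq0 // !sgn_sq.
congr (_ * ee (_ - _) * _); last by rewrite (bil_LL tau) Lz_int.
by rewrite /quad (bil_LL tau) Lz_int; move: ((dotz l)%:~R : R[i]) => x; field.
Qed.

End LinearForms.

Section Nabla.
Variable R : realType.
Local Notation kap := (twopii R).

(* [nabla k] is the k-th power of the derivation D1 + D2 - D3 applied to a product of three factors. *)
Definition nabla (k : nat) (a b c : nat -> R[i]) : R[i] :=
  match k with
  | 0%N => a 0%N * b 0%N * c 0%N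
  | 1%N => a 1%N * b 0%N * c 0%N + a 0%N * b 1%N * c 0%N + -1 * (a 0%N * b 0%N * c 1%N)
  | 2%N => a 2%N * b 0%N * c 0%N + a 0%N * b 2%N * c 0%N + a 0%N * b 0%N * c 2%N
         + 2 * (a 1%N * b 1%N * c 0%N) + -2 * (a 1%N * b 0%N * c 1%N) + -2 * (a 0%N * b 1%N * c 1%N)
  | _ => a 3%N * b 0%N * c 0%N + a 0%N * b 3%N * c 0%N + -1 * (a 0%N * b 0%N * c 3%N)
         + 3 * (a 2%N * b 1%N * c 0%N) + 3 * (a 1%N * b 2%N * c 0%N) + -3 * (a 2%N * b 0%N * c 1%N) + -3 * (a 0%N * b 2%N * c 1%N)
         + 3 * (a 1%N * b 0%N * c 2%N) + 3 * (a 0%N * b 1%N * c 2%N) + -6 * (a 1%N * b 1%N * c 1%N)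
  end.

Lemma nabla_cder k (a b c : nat -> R[i] -> R[i]) t : (k < 3)%N ->
  (forall i t, cder (a i) t (kap * a i.+1 t)) -> (forall i t, cder (b i) t (kap * b i.+1 t)) ->
  (forall i t, cder (c i) t (- (kap * c i.+1 t))) ->
  cder (fun t => nabla k (a ^~ t) (b ^~ t) (c ^~ t)) t (kap * nabla k.+1 (a ^~ t) (b ^~ t) (c ^~ t)).
Proof.
move=> k3 ca cb cc.
have T i j l : cder (fun t => a i t * b j t * c l t) t
   (kap * (a i.+1 t * b j t * c l t + a i t * b j.+1 t * c l t + -1 * (a i t * b j t * c l.+1 t))).
  by apply: cder_eq (cderM (cderM (ca i t) (cb j t)) (cc l t)) _; ring.
case: k k3 => [|[|[|//]]] _ /=.
- exact: T.
- by apply: cder_eq (cderD (cderD (T _ _ _) (T _ _ _)) (cderZ _ (T _ _ _))) _; ring.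
- by apply: cder_eq (cderD (cderD (cderD (cderD (cderD (T _ _ _) (T _ _ _)) (T _ _ _))
    (cderZ _ (T _ _ _))) (cderZ _ (T _ _ _))) (cderZ _ (T _ _ _))) _; ring.
Qed.

Definition nab k (tau z w t : R[i]) :=
  nabla k (fun i => ph i tau (z + t)) (fun i => ph i tau (w + t)) (fun i => ph i tau (z + w - t)).

Arguments nab : simpl never.

Lemma nab_cder k tau z w t : (k < 3)%N -> 0 < complex.Im tau ->
  cder (nab k tau z w) t (kap * nab k.+1 tau z w t).
Proof.
move=> k3 t0; apply: (@nabla_cder k (fun i t => ph i tau (z + t)) (fun i t => ph i tau (w + t)) (fun i t => ph i tau (z + w - t))) => // i t'.
- apply: cder_eq (cder_comp (cderD (cder_cst z t') (cder_id t')) (ph_cder i _ t0)) _.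
  by rewrite add0r mulr1.
- apply: cder_eq (cder_comp (cderD (cder_cst w t') (cder_id t')) (ph_cder i _ t0)) _.
  by rewrite add0r mulr1.
have e x : z + w + -1 * x = z + w - x by rewrite mulN1r.
have := cder_comp (cderD (cder_cst (z + w) t') (cder_scale (-1) t')) (ph_cder i _ t0).
rewrite e => h; apply: (cder_eq (d := kap * ph i.+1 tau (z + w - t') * (0 + -1))); last by rewrite add0r mulrN1.
by apply: cder_ext h => x; rewrite e.
Qed.

Lemma nab_gauss tau tau' z w z' w' j u beta : 0 < complex.Im tau -> 0 < complex.Im tau' -> j != 0 ->
  (forall t, nab 0 tau' z' w' (j^-1 * t) = u * (ee (beta / 2 * (t * t)) * nab 0 tau z w t)) ->
  nab 1 tau' z' w' 0 = j * u * nab 1 tau z w 0 /\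
  nab 3 tau' z' w' 0 = j ^+ 3 * u * (nab 3 tau z w 0 + 3 * beta / kap * nab 1 tau z w 0).
Proof.
move=> t0 t1 j0; apply: (gauss (g2 := nab 2 tau' z' w') (h2 := nab 2 tau z w)) => // t; exact: nab_cder.
Qed.

End Nabla.

Section Sym2.
Variable R : realType.
Implicit Types (a b c : int) (x y z : 'cV[R[i]]_2).

Lemma lift01 : lift ord0 ord0 = 1 :> 'I_2. Proof. exact: val_inj. Qed.

Lemma bil_sym2 a b c x y : bil (intm R (sym2 a b c)) x y =
  a%:~R * (x 0 0 * y 0 0) + b%:~R * (x 0 0 * y 1 0 + x 1 0 * y 0 0) + c%:~R * (x 1 0 * y 1 0).
Proof.
rewrite /bil !mxE big_ord_recl big_ord1 !mxE !big_ord_recl !big_ord0 !mxE lift01 /=.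
by move: (a%:~R : R[i]) (b%:~R : R[i]) (c%:~R : R[i]) => *; ring.
Qed.

Lemma quad_sym2 a b c z : quad (intm R (sym2 a b c)) z =
  2^-1 * (a%:~R * (z 0 0 * z 0 0) + 2 * b%:~R * (z 0 0 * z 1 0) + c%:~R * (z 1 0 * z 1 0)).
Proof. by rewrite /quad bil_sym2; congr (_ * _); move: (a%:~R : R[i]) (b%:~R : R[i]) (c%:~R : R[i]) => *; ring. Qed.

Lemma int_sym2 a b c (l : 'cV[int]_2) : (l^T *m sym2 a b c *m l) 0 0 =
  a * (l 0 0 * l 0 0) + 2 * b * (l 0 0 * l 1 0) + c * (l 1 0 * l 1 0).
Proof.
rewrite !mxE big_ord_recl big_ord1 !mxE !big_ord_recl !big_ord0 !mxE lift01 /=.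
by move: (l 0 0) (l 1 0) => *; ring.
Qed.

End Sym2.

Definition ez : 'cV[int]_2 := \col_i (i == 0)%:Z.
Definition ew : 'cV[int]_2 := \col_i (i == 1)%:Z.
Definition ezw : 'cV[int]_2 := \col_i 1.

Lemma LzE (R : realType) (p : R[i] * 'cV[R[i]]_2) :
  [/\ Lz ez p = p.2 0 0, Lz ew p = p.2 1 0 & Lz ezw p = p.2 0 0 + p.2 1 0].
Proof.
split; rewrite /Lz big_ord_recl big_ord1 lift01 !mxE /=.
- by rewrite mul1r mul0r addr0.
- by rewrite mul1r mul0r add0r.
- by rewrite !mul1r.
Qed.

Lemma mulr_shuffle3 (F : comRingType) (j e1 e2 e3 p1 p2 p3 e E : F) : e1 * e2 * e3 = e * E ->
  (j * e1 * p1) * (j * e2 * p2) * (j * e3 * p3) = j ^+ 3 * e * (E * (p1 * p2 * p3)).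
Proof.
move=> h; transitivity (j ^+ 3 * (e1 * e2 * e3) * (p1 * p2 * p3)); first by ring.
by rewrite h; ring.
Qed.

Section XY.
Variable R : realType.
Local Notation kap := (twopii R).
Local Notation pt := (R[i] * 'cV[R[i]]_2)%type.
Local Notation up := (@upper R 2).
Implicit Types (p : pt).

Definition Xf : pt -> R[i] := onH (fun p => nab 1 p.1 (p.2 0 0) (p.2 1 0) 0).

(** The two coefficients cancel the modular anomalies: that of [nab 3] is 9 c / (c tau + d) and that
    of E2 is 12 c / (c tau + d), each over 2 pi i, and -2 * 9 + (3/2) * 12 = 0. *)
Definition Yf : pt -> R[i] := onH (fun p =>
  -2 * nab 3 p.1 (p.2 0 0) (p.2 1 0) 0 + 3 / 2 * E2 p.1 * nab 1 p.1 (p.2 0 0) (p.2 1 0) 0).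

Lemma XfE tau z : 0 < complex.Im tau -> Xf (tau, z) = nab 1 tau (z 0 0) (z 1 0) 0.
Proof. by move=> t0; rewrite /Xf onHE. Qed.

Lemma YfE tau z : 0 < complex.Im tau -> Yf (tau, z) = -2 * nab 3 tau (z 0 0) (z 1 0) 0 + 3 / 2 * E2 tau * nab 1 tau (z 0 0) (z 1 0) 0.
Proof. by move=> t0; rewrite /Yf onHE. Qed.

(** Half the sum of the three squares is z^2 + z w + w^2 + 3 t^2 / 2, so the Gaussian parameter for
    [gauss] is 3 c / (c tau + d). *)
Lemma nab_modular (a b c d : int) (tau z w t : R[i]) : a * d - b * c = 1 -> 0 < complex.Im tau ->
  nab 0 ((a%:~R * tau + b%:~R) / (c%:~R * tau + d%:~R)) ((c%:~R * tau + d%:~R)^-1 * z) ((c%:~R * tau + d%:~R)^-1 * w)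
    ((c%:~R * tau + d%:~R)^-1 * t) =
  (c%:~R * tau + d%:~R)^-1 ^+ 3 * ee (c%:~R * (z * z + z * w + w * w) / (c%:~R * tau + d%:~R)) *
  (ee (3 * (c%:~R / (c%:~R * tau + d%:~R)) / 2 * (t * t)) * nab 0 tau z w t).
Proof.
move=> det t0; have [j0 t1] := sl2_upper det t0; have law := ph_modular det (tau := tau).
move: law j0 t1; set j := c%:~R * tau + d%:~R; set tau' := _ / j => law j0 t1.
have e1 x y : j^-1 * x + j^-1 * y = (x + y) / j by rewrite -mulrDr mulrC.
have e2 x y : j^-1 * x - j^-1 * y = (x - y) / j by rewrite -mulrBr mulrC.
have e3 : j^-1 * z + j^-1 * w - j^-1 * t = (z + w - t) / j by rewrite -mulrDr e2.
rewrite /nab /= e3 !e1 !law //.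
apply: mulr_shuffle3; rewrite -!eeD; congr ee.
have fl (x y : R[i]) : y != 0 -> x * ((z + t) ^+ 2 / 2) / y + x * ((w + t) ^+ 2 / 2) / y + x * ((z + w - t) ^+ 2 / 2) / y =
  x * (z * z + z * w + w * w) / y + 3 * (x / y) / 2 * (t * t) by move=> y0; field.
exact: fl.
Qed.

Lemma nab_elliptic (l0 l1 m0 m1 : int) (tau z w t : R[i]) : 0 < complex.Im tau ->
  nab 0 tau (z + tau * l0%:~R + m0%:~R) (w + tau * l1%:~R + m1%:~R) t =
  ee (- (tau * (l0%:~R * l0%:~R + l0%:~R * l1%:~R + l1%:~R * l1%:~R)) -
      (2 * (l0%:~R * z) + (l0%:~R * w + l1%:~R * z) + 2 * (l1%:~R * w))) * nab 0 tau z w t.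
Proof.
move=> t0; rewrite /nab /=.
have -> : z + tau * l0%:~R + m0%:~R + t = (z + t) + tau * l0%:~R + m0%:~R by ring.
have -> : w + tau * l1%:~R + m1%:~R + t = (w + t) + tau * l1%:~R + m1%:~R by ring.
have -> : z + tau * l0%:~R + m0%:~R + (w + tau * l1%:~R + m1%:~R) - t = (z + w - t) + tau * (l0 + l1)%:~R + (m0 + m1)%:~R.
  by rewrite !intrD; ring.
rewrite !ph_ee //.
set s := ee (_ - (2 * _ + _ + _)).
have es : ee (- (l0%:~R ^+ 2 / 2 * tau) - l0%:~R * (z + t)) * ee (- (l1%:~R ^+ 2 / 2 * tau) - l1%:~R * (w + t)) *
   ee (- ((l0 + l1)%:~R ^+ 2 / 2 * tau) - (l0 + l1)%:~R * (z + w - t)) = s.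
  by rewrite -!eeD /s; congr ee; rewrite intrD; move: (l0%:~R : R[i]) (l1%:~R : R[i]) => x y; field.
have e1 : (-1 : R[i]) ^ (l0 + m0) * (-1) ^ (l1 + m1) * (-1) ^ (l0 + l1 + (m0 + m1)) = 1.
  by rewrite -!expfzDr ?m1_neq0 // (_ : _ + _ = 2 * (l0 + l1 + m0 + m1)) ?sgn_even //; ring.
have fl (s1 s2 s3 x1 x2 x3 p1 p2 p3 y : R[i]) : s1 * s2 * s3 = 1 -> x1 * x2 * x3 = y ->
   s1 * x1 * p1 * (s2 * x2 * p2) * (s3 * x3 * p3) = y * (p1 * p2 * p3).
  move=> h1 h2; transitivity (s1 * s2 * s3 * (x1 * x2 * x3) * (p1 * p2 * p3)); first by ring.
  by rewrite h1 h2 mul1r.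
exact: fl e1 es.
Qed.

Lemma isF_nab_factors k : [/\ isF (fun p => ph k p.1 (p.2 0 0)), isF (fun p => ph k p.1 (p.2 1 0)) &
  isF (fun p => ph k p.1 (p.2 0 0 + p.2 1 0))].
Proof.
by split; [apply: isF_eq (isF_phz R ez k) _ | apply: isF_eq (isF_phz R ew k) _ | apply: isF_eq (isF_phz R ezw k) _] => p _;
  have [e1 e2 e3] := LzE p; rewrite ?e1 ?e2 ?e3.
Qed.

Lemma isF_nab k : isF (fun p => nab k p.1 (p.2 0 0) (p.2 1 0) 0).
Proof.
have T i j l : isF (fun p => ph i p.1 (p.2 0 0) * ph j p.1 (p.2 1 0) * ph l p.1 (p.2 0 0 + p.2 1 0)).
  have [h _ _] := isF_nab_factors i; have [_ h' _] := isF_nab_factors j; have [_ _ h''] := isF_nab_factors l.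
  exact: isF_M (isF_M h h') h''.
suff : isF (fun p => nabla k (fun i => ph i p.1 (p.2 0 0)) (fun i => ph i p.1 (p.2 1 0)) (fun i => ph i p.1 (p.2 0 0 + p.2 1 0))).
  by move=> h; apply: isF_eq h _ => p _; rewrite /nab !addr0 subr0.
case: k => [|[|[|k]]] /=.
- exact: T.
- exact: isF_D (isF_D (T _ _ _) (T _ _ _)) (isF_Z _ (T _ _ _)).
- exact: isF_D (isF_D (isF_D (isF_D (isF_D (T _ _ _) (T _ _ _)) (T _ _ _))
    (isF_Z _ (T _ _ _))) (isF_Z _ (T _ _ _))) (isF_Z _ (T _ _ _)).
- exact: isF_D (isF_D (isF_D (isF_D (isF_D (isF_D (isF_D (isF_D (isF_D (T _ _ _) (T _ _ _)) (isF_Z _ (T _ _ _)))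
    (isF_Z _ (T _ _ _))) (isF_Z _ (T _ _ _))) (isF_Z _ (T _ _ _))) (isF_Z _ (T _ _ _))) (isF_Z _ (T _ _ _)))
    (isF_Z _ (T _ _ _))) (isF_Z _ (T _ _ _)).
Qed.

Lemma isF_E2_2 : isF (fun p : pt => E2 p.1).
Proof. exact: (isF_pull (0 : 'M[int]_(1, 2)) (@isF_E2 R)). Qed.

Lemma quad_A (z : 'cV[R[i]]_2) : quad (intm R indexA) z = z 0 0 * z 0 0 + z 0 0 * z 1 0 + z 1 0 * z 1 0.
Proof. by rewrite quad_sym2; move: (z 0 0) (z 1 0) => x y; field. Qed.

Lemma bil_A (x y : 'cV[R[i]]_2) : bil (intm R indexA) x y =
  2 * (x 0 0 * y 0 0) + (x 0 0 * y 1 0 + x 1 0 * y 0 0) + 2 * (x 1 0 * y 1 0).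
Proof. by rewrite bil_sym2 mul1r. Qed.

Lemma sgn_A (l m : 'cV[int]_2) : (-1 : R[i]) ^ ((l^T *m indexA *m l) 0 0 + (m^T *m indexA *m m) 0 0) = 1.
Proof.
rewrite !int_sym2 (_ : _ + _ = 2 * ((l 0 0 * l 0 0) + (l 0 0 * l 1 0) + (l 1 0 * l 1 0) +
  ((m 0 0 * m 0 0) + (m 0 0 * m 1 0) + (m 1 0 * m 1 0)))) ?sgn_even //.
by move: (l 0 0) (l 1 0) (m 0 0) (m 1 0) => *; ring.
Qed.

Lemma nab_laws_mod (a b c d : int) tau (z : 'cV[R[i]]_2) : a * d - b * c = 1 -> 0 < complex.Im tau ->
  let j := c%:~R * tau + d%:~R in
  nab 1 ((a%:~R * tau + b%:~R) / j) ((j^-1 *: z) 0 0) ((j^-1 *: z) 1 0) 0 =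
    j^-1 ^+ 2 * ee (c%:~R * quad (intm R indexA) z / j) * nab 1 tau (z 0 0) (z 1 0) 0 /\
  nab 3 ((a%:~R * tau + b%:~R) / j) ((j^-1 *: z) 0 0) ((j^-1 *: z) 1 0) 0 =
    ee (c%:~R * quad (intm R indexA) z / j) * (nab 3 tau (z 0 0) (z 1 0) 0 + 9 * (c%:~R / j) / kap * nab 1 tau (z 0 0) (z 1 0) 0).
Proof.
move=> det t0 j; have [j0 t1] := sl2_upper det t0; rewrite !mxE quad_A.
have [] := nab_gauss t0 t1 j0 (fun t => nab_modular (z 0 0) (z 1 0) t det t0).
move=> -> ->; split.
  have fl (e x y : R[i]) : y != 0 -> y * (y^-1 ^+ 3 * e) * x = y^-1 ^+ 2 * e * x by move=> y0; field.
  exact: fl.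
have fl (k y x c' x3 x1 : R[i]) : k != 0 -> y != 0 ->
   y ^+ 3 * (y^-1 ^+ 3 * x) * (x3 + 3 * (3 * (c' / y)) / k * x1) = x * (x3 + 9 * (c' / y) / k * x1).
  by move=> k0 y0; field; rewrite k0 y0.
by apply: fl => //; exact: twopii_neq0.
Qed.

Lemma nab_laws_ell (l m : 'cV[int]_2) tau (z : 'cV[R[i]]_2) : 0 < complex.Im tau ->
  let z' := z + tau *: intv R l + intv R m in
  let u := ee (- (tau * quad (intm R indexA) (intv R l)) - bil (intm R indexA) (intv R l) z) in
  nab 1 tau (z' 0 0) (z' 1 0) 0 = u * nab 1 tau (z 0 0) (z 1 0) 0 /\
  nab 3 tau (z' 0 0) (z' 1 0) 0 = u * nab 3 tau (z 0 0) (z 1 0) 0.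
Proof.
move=> t0 z' u; have uE : u = ee (- (tau * ((l 0 0)%:~R * (l 0 0)%:~R + (l 0 0)%:~R * (l 1 0)%:~R + (l 1 0)%:~R * (l 1 0)%:~R)) -
      (2 * ((l 0 0)%:~R * z 0 0) + ((l 0 0)%:~R * z 1 0 + (l 1 0)%:~R * z 0 0) + 2 * ((l 1 0)%:~R * z 1 0))).
  by rewrite /u quad_A bil_A !mxE.
have h t : nab 0 tau (z' 0 0) (z' 1 0) (1^-1 * t) = u * (ee (0 / 2 * (t * t)) * nab 0 tau (z 0 0) (z 1 0) t).
  by rewrite invr1 mul1r !mul0r ee0 mul1r uE -(@nab_elliptic _ _ (m 0 0) (m 1 0)) // /z' !mxE.
have [-> ->] := nab_gauss t0 t0 (oner_neq0 _) h; move: (nab 3 _ _ _ _) (nab 1 _ _ _ _) => x y; split.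
  by rewrite mul1r.
by rewrite mulr0 !mul0r addr0 expr1n mul1r.
Qed.

Lemma jac_X : jac (-2) indexA Xf.
Proof.
split; [exact: onH_onH | exact: isF_onH (isF_nab 1) | |].
  move=> a b c d tau z det t0; have [j0 t1] := sl2_upper det t0; have [e _] := nab_laws_mod z det t0.
  by rewrite !XfE // e exprVn -exprnN.
move=> l m tau z t0; have [e _] := nab_laws_ell l m z t0.
by rewrite !XfE // e sgn_A mul1r.
Qed.

Lemma jac_Y : jac 0 indexA Yf.
Proof.
split; [exact: onH_onH | | |].
- apply: isF_onH; apply: isF_D (isF_Z _ (isF_nab 3)) (isF_M (isF_Z _ isF_E2_2) (isF_nab 1)).
- move=> a b c d tau z det t0; have [j0 t1] := sl2_upper det t0; have [e e'] := nab_laws_mod z det t0.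
  rewrite !YfE // e e' E2_modular // expr0z mul1r.
  have fl (k y x c' x3 x1 x0 : R[i]) : k != 0 -> y != 0 ->
     -2 * (x * (x3 + 9 * (c' / y) / k * x1)) + 3 / 2 * (y ^+ 2 * (x0 + 12 * (c' / y) / k)) * (y^-1 ^+ 2 * x * x1) =
     x * (-2 * x3 + 3 / 2 * x0 * x1).
    by move=> k0 y0; field; rewrite k0 y0.
  by apply: fl => //; exact: twopii_neq0.
move=> l m tau z t0; have [e e'] := nab_laws_ell l m z t0.
by rewrite !YfE // e e' sgn_A mul1r; move: (ee _) (nab 3 _ _ _ _) (nab 1 _ _ _ _) => *; ring.
Qed.

End XY.

(** * The Serre derivative and the identification of the generators *)

Section Derivations.
Variable R : realType.

Lemma isD_coef n (w : nat * 'cV[int]_n -> R[i]) f g c : fexp (@upper R n) f c -> isD (@upper R n) w f g ->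
  fexp (@upper R n) g (fun i => w i * c i).
Proof. by move=> hc [d [hd hg]]; rewrite (fexpH_unique hc hd). Qed.

Lemma isD_phz n (L : 'cV[int]_n) k k' : isD (@upper R n) (wz R k') (fun p => ph k p.1 (Lz L p))
  (fun p => (L k' 0)%:~R * ph k.+1 p.1 (Lz L p)).
Proof.
have h := isD_pull (wz_pull1 R L^T k') (isD_phk R k).
by apply: (isD_eq h) => p _; rewrite phk_pull // mxE.
Qed.

Lemma isD_phq n (L : 'cV[int]_n) k : (k < 2)%N -> isD (@upper R n) (@wq R n) (fun p => ph k p.1 (Lz L p))
  (fun p => 2^-1 * ph k.+2 p.1 (Lz L p) - E2 p.1 / 8 * ph k p.1 (Lz L p)).
Proof.
case: k => [|[|//]] _.
  have h := isD_pull (wq_pull R L^T) (phi_heat R).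
  by apply: (isD_eq h) => p _; rewrite -?phk0 !phk_pull // mul1r.
have h := isD_pull (wq_pull R L^T) (phi_heat1 R).
by apply: (isD_eq h) => p _; rewrite !phk_pull // mul1r.
Qed.

End Derivations.

Section Serre.
Variable R : realType.
Local Notation kap := (twopii R).
Local Notation pt := (R[i] * 'cV[R[i]]_2)%type.
Local Notation idx := (nat * 'cV[int]_2)%type.
Local Notation up := (@upper R 2).
Local Notation wz0 := (@wz R 2 0).
Local Notation wz1 := (@wz R 2 1).
Local Notation wq2 := (@wq R 2).
Implicit Types (p : pt).

Let T i j l p := ph i p.1 (Lz ez p) * ph j p.1 (Lz ew p) * ph l p.1 (Lz ezw p).

Let D0 i j l : isD up wz0 (T i j l) (fun p => T i.+1 j l p + T i j l.+1 p).
Proof.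
have h := isDM (additive_wz R 0) (isDM (additive_wz R 0) (isD_phz R ez i 0) (isD_phz R ew j 0)) (isD_phz R ezw l 0).
apply: (isD_eq h) => // p _; rewrite /T !mxE /=.
by move: (ph _ _ _) (ph _ _ _) (ph _ _ _) (ph _ _ _) (ph _ _ _) (ph _ _ _) => *; ring.
Qed.

Let D1 i j l : isD up wz1 (T i j l) (fun p => T i j.+1 l p + T i j l.+1 p).
Proof.
have h := isDM (additive_wz R 1) (isDM (additive_wz R 1) (isD_phz R ez i 1) (isD_phz R ew j 1)) (isD_phz R ezw l 1).
apply: (isD_eq h) => // p _; rewrite /T !mxE /=.
by move: (ph _ _ _) (ph _ _ _) (ph _ _ _) (ph _ _ _) (ph _ _ _) (ph _ _ _) => *; ring.
Qed.

Let Dq i j l : (i < 2)%N -> (j < 2)%N -> (l < 2)%N ->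
  isD up wq2 (T i j l) (fun p => 2^-1 * (T i.+2 j l p + T i j.+2 l p + T i j l.+2 p) - 3 / 8 * E2 p.1 * T i j l p).
Proof.
move=> i2 j2 l2.
have h := isDM (@additive_wq R 2) (isDM (@additive_wq R 2) (isD_phq R ez i2) (isD_phq R ew j2)) (isD_phq R ezw l2).
apply: (isD_eq h) => // p _; rewrite /T.
by move: (ph _ _ _) (ph _ _ _) (ph _ _ _) (ph _ _ _) (ph _ _ _) (ph _ _ _) (E2 _) => *; field.
Qed.

Let X p := T 1 0 0 p + T 0 1 0 p + -1 * T 0 0 1 p.

Lemma nabE k (tau z w : R[i]) : nab k tau z w 0 = nabla k (fun i => ph i tau z) (fun i => ph i tau w) (fun i => ph i tau (z + w)).
Proof. by rewrite /nab !addr0 subr0. Qed.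

Lemma Xf_T p : up p -> Xf p = X p.
Proof. by move=> Up; have [e1 e2 e3] := LzE p; rewrite /Xf onHE // nabE /X /T e1 e2 e3. Qed.

(** The weight m - r^T A^-1 r / 2 of the Serre derivative, written in the derivations that act on
    expansions: here r^T A^-1 r / 2 = (r0^2 - r0 r1 + r1^2) / 3. *)
Let w2 i : R[i] := wq2 i - 3^-1 * (wz0 i * wz0 i - wz1 i * wz0 i + wz1 i * wz1 i).

(** The Serre weight applied to X, written in products of derivatives of [phi]: the q-derivatives
    have been replaced through the heat equation, d/dz acts on the first and third factors, d/dw on
    the second and third. *)
Let HX p := 2^-1 * (T 3 0 0 p + T 1 2 0 p + T 1 0 2 p) - 3 / 8 * E2 p.1 * T 1 0 0 p +
  (2^-1 * (T 2 1 0 p + T 0 3 0 p + T 0 1 2 p) - 3 / 8 * E2 p.1 * T 0 1 0 p) +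
  -1 * (2^-1 * (T 2 0 1 p + T 0 2 1 p + T 0 0 3 p) - 3 / 8 * E2 p.1 * T 0 0 1 p) +
  - 3^-1 * ((T 3 0 0 p + T 2 0 1 p + (T 2 0 1 p + T 1 0 2 p) + (T 2 1 0 p + T 1 1 1 p + (T 1 1 1 p + T 0 1 2 p))
             + -1 * (T 2 0 1 p + T 1 0 2 p + (T 1 0 2 p + T 0 0 3 p))) +
            -1 * (T 2 1 0 p + T 2 0 1 p + (T 1 1 1 p + T 1 0 2 p) + (T 1 2 0 p + T 1 1 1 p + (T 0 2 1 p + T 0 1 2 p))
             + -1 * (T 1 1 1 p + T 1 0 2 p + (T 0 1 2 p + T 0 0 3 p))) +
            (T 1 2 0 p + T 1 1 1 p + (T 1 1 1 p + T 1 0 2 p) + (T 0 3 0 p + T 0 2 1 p + (T 0 2 1 p + T 0 1 2 p))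
             + -1 * (T 0 2 1 p + T 0 1 2 p + (T 0 1 2 p + T 0 0 3 p)))).

Let HX_fexp c : fexp up X c -> fexp up HX (fun i => w2 i * c i).
Proof.
move=> hc.
have hq := isD_coef hc (isDD (isDD (@Dq 1 0 0 isT isT isT) (@Dq 0 1 0 isT isT isT)) (isDZ (-1) (@Dq 0 0 1 isT isT isT))).
have h0 := isD_coef hc (isDD (isDD (D0 1 0 0) (D0 0 1 0)) (isDZ (-1) (D0 0 0 1))).
have h1 := isD_coef hc (isDD (isDD (D1 1 0 0) (D1 0 1 0)) (isDZ (-1) (D1 0 0 1))).
have h00 := isD_coef h0 (isDD (isDD (isDD (D0 2 0 0) (D0 1 0 1)) (isDD (D0 1 1 0) (D0 0 1 1))) (isDZ (-1) (isDD (D0 1 0 1) (D0 0 0 2)))).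
have h01 := isD_coef h0 (isDD (isDD (isDD (D1 2 0 0) (D1 1 0 1)) (isDD (D1 1 1 0) (D1 0 1 1))) (isDZ (-1) (isDD (D1 1 0 1) (D1 0 0 2)))).
have h11 := isD_coef h1 (isDD (isDD (isDD (D1 1 1 0) (D1 1 0 1)) (isDD (D1 0 2 0) (D1 0 1 1))) (isDZ (-1) (isDD (D1 0 1 1) (D1 0 0 2)))).
have h01' := fexpZ (a := -1) h01; have h2 := fexpD (fexpD h00 h01') h11; have h3 := fexpZ (a := - 3^-1) h2.
have h := fexpD hq h3.
rewrite (_ : (fun i => w2 i * c i) = fun i => wq2 i * c i + - 3^-1 * (wz0 i * (wz0 i * c i) + -1 * (wz1 i * (wz0 i * c i)) + wz1 i * (wz1 i * c i))).
  by apply: (fexp_eq h).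
by apply/funext => i; rewrite /w2; move: (wq2 i) (wz0 i) (wz1 i) (c i) => *; ring.
Qed.

Lemma invA : invmx (intm R indexA) = 3^-1 *: intm R (sym2 2 (-1) 2).
Proof.
have e : indexA *m sym2 2 (-1) 2 = 3%:M.
  apply/matrixP => i j; rewrite !mxE !big_ord_recl big_ord0 !mxE.
  by case: i => [[|[|//]] ?]; case: j => [[|[|//]] ?].
have e1 : intm R indexA *m (3^-1 *: intm R (sym2 2 (-1) 2)) = 1%:M.
  rewrite -scalemxAr /intm -map_mxM e; apply/matrixP => i j; rewrite !mxE.
  by case: eqP => _; rewrite ?mulr0n ?mulr1n ?rmorph0 ?mulr0 // mulVf // pnatr_eq0.
have [u _] := mulmx1_unit e1.
by rewrite -[RHS]mul1mx -(mulVmx u) -mulmxA e1 mulmx1.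
Qed.

Lemma serre_weight (i : idx) : i.1%:R - quad (invmx (intm R indexA)) (freq R i.2) = w2 i.
Proof.
rewrite invA /w2 /wq /wz; congr (_ - _).
have -> (a : R[i]) (M : 'M[R[i]]_2) x : quad (a *: M) x = a * quad M x.
  by rewrite /quad /bil -scalemxAr -scalemxAl mxE mulrCA.
by rewrite quad_sym2 /freq !mxE; move: ((i.2 0 0)%:~R : R[i]) ((i.2 1 0)%:~R : R[i]) => x y; field.
Qed.

Lemma Phi_m2_X : @Phi_m2 R = fun p => kap * Xf p.
Proof.
apply/funext => p; rewrite /Phi_m2 /Xf /onH; case: ifP => [t0|_]; last by rewrite mulr0.
rewrite nabE /= !thetaE // !dthetaE //; have := eta_neq0 t0.
move: (dedekind_eta _) (ph 0 _ _) (ph 0 _ _) (ph 0 _ _) (ph 1 _ _) (ph 1 _ _) (ph 1 _ _) kap => e a0 b0 c0 a1 b1 c1 k e0.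
by field.
Qed.

(** The derivatives in [HX] collapse to [nab 3] / 6, whence the coefficient -12 / 6 = -2. The E2
    terms are -3/8, one -1/8 per factor, and +1/4 from k/12 - n/24 = -1/4; the factor -12 makes them
    3/2. *)
Lemma Phi_0_Y : @Phi_0 R = fun p => kap * Yf p.
Proof.
apply/funext => p; rewrite /Phi_0 /serre /Yf /onH; case: ifP => [t0|_]; last by rewrite !mulr0.
have Up : up p by [].
have [c hc] : isF X by apply: isF_eq (jac_F (jac_X R)) Xf_T.
have hP : fexp up (@Phi_m2 R) (fun i => kap * c i).
  by rewrite Phi_m2_X; apply: fexp_eq (fexpZ (a := kap) hc) _ => q Uq; rewrite Xf_T.
rewrite (fourier_coefE hP).
have hs := fexpZ (a := kap) (HX_fexp hc).
have -> : csum (fun i : idx => kap * c i * (i.1%:R - quad (invmx (intm R indexA)) (freq R i.2)) * fmono p i.1 i.2) = kap * HX p.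
  apply: csumE; apply: (eq_has_sum (hs p Up)) => i; rewrite serre_weight mono.unlock.
  by congr (_ * _); rewrite -mulrA [c i * _]mulrC.
rewrite Phi_m2_X Xf_T // !nabE /HX /X /T; have [-> -> ->] := LzE p; rewrite /=.
move: (ph 0 _ _) (ph 0 _ _) (ph 0 _ _) (ph 1 _ _) (ph 1 _ _) (ph 1 _ _) (ph 2 _ _) (ph 2 _ _) (ph 2 _ _)
  (ph 3 _ _) (ph 3 _ _) (ph 3 _ _) (E2 _) kap => *.
by field.
Qed.

End Serre.

(** * Forms in one variable *)

Section Division.
Variables (R : realType) (n : nat) (L : 'cV[int]_n) (k0 : 'I_n) (b : nat).
Hypothesis hL : L k0 0 = (2 ^ b)%N%:Z.
Local Notation pt := (R[i] * 'cV[R[i]]_n)%type.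
Local Notation up := (@upper R n).
Implicit Types (f g : pt -> R[i]).

Lemma phLE (p : pt) : up p -> phL L p = ph 0 p.1 (Lz L p).
Proof. by move=> Up; rewrite /phL onHE. Qed.

Lemma phL_cancel f : isF f -> (forall p, up p -> ph 0 p.1 (Lz L p) * f p = 0) -> forall p, up p -> f p = 0.
Proof.
move=> hf h [tau z] t0.
have [d hd] := isF_line z (delta_mx k0 0) hf t0.
have hh u : ph 0 tau (Lz L (tau, z) + (2 ^+ b)%:C * u) * f (tau, z + u *: delta_mx k0 0) = 0.
  by rewrite -(Lz_line hL); exact: (h (tau, z + u *: delta_mx k0 0) t0).
have b0 : 0 < 2 ^+ b :> R by rewrite exprn_gt0.
by have := ph_cancel t0 b0 hd hh; rewrite scale0r addr0.
Qed.

Lemma jac_divide k M f : jac (k - 1) (M + L *m L^T) f ->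
  (forall p (l m : int), up p -> Lz L p = l%:~R * p.1 + m%:~R -> f p = 0) ->
  exists g, jac k M g /\ forall p, up p -> f p = ph 0 p.1 (Lz L p) * g p.
Proof.
move=> hf f0; have [g [gF e]] := divide_phi hL (jac_F hf) f0.
exists (onH g); split; last by move=> p Up; rewrite onHE // e.
apply: (jac_quot hL hf (jac_phL R L) (isF_onH gF) (onH_onH g)) => p Up.
by rewrite onHE // e.
Qed.

(** Translation by lattice multiples of [e] moves any point with Lz = l tau + m to one with Lz = 0,
    and the elliptic law transports the vanishing. *)
Lemma jac_divide0 k M f (e : 'cV[int]_n) : dotz L e = 1 -> jac (k - 1) (M + L *m L^T) f ->
  (forall p, up p -> Lz L p = 0 -> f p = 0) ->
  exists g, jac k M g /\ forall p, up p -> f p = ph 0 p.1 (Lz L p) * g p.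
Proof.
move=> Le hf f0; apply: (jac_divide hf) => -[tau z] l m t0 /= hz.
pose z' := z - tau *: intv R (l *: e) - intv R (m *: e).
have zE : z = z' + tau *: intv R (l *: e) + intv R (m *: e) by rewrite /z' addrAC subrK subrK.
have dE (x : int) : dotz L (x *: e) = x by rewrite /dotz -scalemxAr mxE -/(dotz L e) Le mulr1.
have z0 : Lz L (tau, z') = 0.
  move: hz; rewrite {1}zE Lz_shift !dE [tau * _]mulrC -addrA => /eqP; rewrite -subr_eq0 addrK => /eqP //.
by rewrite zE (jac_ell hf) // (f0 (tau, z') t0 z0) mulr0.
Qed.

End Division.

Lemma jac_cast (R : realType) n k k' (M M' : 'M[int]_n) (f : R[i] * 'cV[R[i]]_n -> R[i]) :
  jac k M f -> k = k' -> M = M' -> jac k' M' f.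
Proof. by move=> h <- <-. Qed.

Lemma jacB (R : realType) n k (M : 'M[int]_n) (f g : R[i] * 'cV[R[i]]_n -> R[i]) :
  jac k M f -> jac k M g -> jac k M (fun p => f p - g p).
Proof.
by move=> hf hg; have := jacD hf (jacZ (-1) hg); congr jac; apply/funext => p; rewrite mulN1r.
Qed.

Lemma jac_neg (R : realType) n k (M : 'M[int]_n) (f : R[i] * 'cV[R[i]]_n -> R[i]) tau z :
  jac k M f -> 0 < complex.Im tau -> f (tau, - z) = (-1) ^ k * f (tau, z).
Proof.
move=> hf t0; have := jac_mod hf (a := -1) (b := 0) (c := 0) (d := -1) z _ t0.
rewrite mulrNN mulr1 mulr0 subr0 !mulr0z !mul0r add0r addr0 ee0 mulr1 => /(_ erefl).
by rewrite invrN1 scaleN1r !mulN1r mulrN1 opprK.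
Qed.

Section IndexZero.
Variable R : realType.
Local Notation pt := (R[i] * 'cV[R[i]]_1)%type.
Local Notation up := (@upper R 1).
Implicit Types (f : pt -> R[i]) (h : R[i] -> R[i]) (tau z w y : R[i]).

Lemma isF_lt2 f tau : isF f -> 0 < complex.Im tau -> exists h', lt2 (fun z => f (pt1 tau z)) h'.
Proof. by move=> hf t0; eexists; exact: fexp_lt2 (DopP (good_wz R 0) hf) t0. Qed.

Let g0 tau z := ee (z / 2) * ph 0 tau z.

Let g0_quasi tau : 0 < complex.Im tau -> exists g', quasi tau (g0 tau) g'.
Proof.
move=> t0; eexists; split.
- exact: lt2M (lt2_comp (@lt2_ee R) (lt2M (@lt2_id R) (lt2_cst 2^-1))) (lt2_ph 0 t0).
- move=> z; have eh : ee (1 / 2 : R[i]) = -1 by have := ee_half R 1; rewrite expr1z.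
  by rewrite /g0 (ph_add1 _ t0) mulrDl eeD eh mulrN1 mulrNN.
- move=> z; have := ph_ee 1 0 z t0; rewrite mulr0z addr0 mulr1z mulr1 => e1.
  rewrite /g0 e1 mulrDl eeD expr1z expr1n !mul1r eeD mulN1r.
  have e2 : ee (tau / 2) * ee (- (2^-1 * tau)) = 1 by rewrite -eeD [2^-1 * _]mulrC subrr ee0.
  transitivity (- (ee (tau / 2) * ee (- (2^-1 * tau)) * (ee (- z) * (ee (z / 2) * ph 0 tau z)))); last by rewrite e2 mul1r.
  by move: (ee _) (ee _) (ee _) (ee _) (ph _ _ _) => *; ring.
Qed.

Let g0_neq0 tau : 0 < complex.Im tau -> exists s, g0 tau s != 0.
Proof.
move=> t0; exists ('i%C * (complex.Im tau / 2)%:C); rewrite /g0 mulf_neq0 ?ee_neq0 //.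
have e : complex.Im ('i%C * (complex.Im tau / 2)%:C) = complex.Im tau / 2 by rewrite Im_iM.
apply: ph_neq0 => //; rewrite e; first by rewrite gt_eqF // divr_gt0.
by rewrite gtr0_norm ?divr_gt0 // ltr_pdivrMr // ltr_pMr // ltr1n.
Qed.

(* Multiplying by theta turns a function with constant multipliers into a section of a one-dimensional theta space. *)
Lemma quasi_periodic h h' tau y : 0 < complex.Im tau -> lt2 h h' -> (forall w, h (w + 1) = h w) ->
  (forall w, h (w + tau) = ee (- y) * h w) -> exists c, forall w, h w * ph 0 tau w = c * ph 0 tau (w + y).
Proof.
move=> t0 hl h1 ht; have [g' hq] := g0_quasi t0; have [l1 l2 l3] := hq.
have hlt := lt2M (lt2_comp hl (lt2D (@lt2_id R) (lt2_cst (- y)))) (lt2_comp l1 (lt2D (@lt2_id R) (lt2_cst (- y)))).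
set G := fun z => _ in hlt; set G' := fun z => _ in hlt.
have Gq : quasi tau G G'.
  split=> // z; rewrite /G.
    by rewrite addrAC h1 l2.
  rewrite [z + tau - y]addrAC ht l3.
  have -> : ee (- (z - y)) = ee (- z) * ee y by rewrite opprB addrC eeD.
  have e : ee (- y) * ee y = 1 by rewrite -eeD addNr ee0.
  transitivity (- (ee (- y) * ee y * (ee (- z) * (h (z - y) * g0 tau (z - y))))); last by rewrite e mul1r.
  by move: (ee _) (ee _) (ee _) (h _) (g0 _ _) => *; ring.
have [c hc] := quasi_unique hq Gq (g0_neq0 t0).
exists (c * ee (y / 2)) => w; have := hc (w + y); rewrite /G addrK /g0 mulrDl eeD => e.
apply: (mulfI (ee_neq0 (w / 2))); transitivity (h w * (ee (w / 2) * ph 0 tau w)); first by rewrite mulrCA.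
by rewrite e; move: (ee _) (ee _) (ph _ _ _) => *; ring.
Qed.

Lemma pt1_shift tau z (l m : int) : pt1 tau (z + tau * l%:~R + m%:~R) = (tau, const_mx z + tau *: intv R (const_mx l) + intv R (const_mx m)).
Proof. by congr (_, _); apply/matrixP => i j; rewrite !mxE. Qed.

Definition l1 : 'cV[int]_1 := const_mx 1.
Definition l2 : 'cV[int]_1 := const_mx 2.

Lemma Lz_l1 (p : pt) : Lz l1 p = p.2 0 0.
Proof. by rewrite /Lz big_ord1 mxE mul1r. Qed.

Lemma Lz_l2 (p : pt) : Lz l2 p = 2 * p.2 0 0.
Proof. by rewrite /Lz big_ord1 mxE. Qed.

Lemma l1k : l1 0 0 = (2 ^ 0)%N%:Z. Proof. by rewrite mxE. Qed.
Lemma l2k : l2 0 0 = (2 ^ 1)%N%:Z. Proof. by rewrite mxE. Qed.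

Lemma dot_l1 : dotz l1 l1 = 1.
Proof. by rewrite /dotz mxE big_ord1 !mxE. Qed.

Lemma ll1 : l1 *m l1^T = 1%:M.
Proof. by apply/matrixP => i j; rewrite !mxE big_ord1 !mxE !ord1. Qed.

Lemma ll2 : l2 *m l2^T = 4%:M.
Proof. by apply/matrixP => i j; rewrite !mxE big_ord1 !mxE !ord1. Qed.

Lemma scalar_bil (a : int) (x y : 'cV[R[i]]_1) : bil (intm R a%:M) x y = a%:~R * (x 0 0 * y 0 0).
Proof. by rewrite /bil !mxE big_ord1 !mxE big_ord1 !mxE mulr1n mulrCA mulrA. Qed.

Lemma scalar_int (a : int) (l : 'cV[int]_1) : (l^T *m a%:M *m l) 0 0 = a * (l 0 0 * l 0 0).
Proof. by rewrite !mxE big_ord1 !mxE big_ord1 !mxE mulr1n mulrCA mulrA. Qed.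

(** Liouville for doubly periodic functions, through [quasi_periodic] with y = 0: f phi is a
    constant multiple of phi, and [ph_cancel] removes phi also at its zeros. *)
Lemma jac_index0 k f tau z : jac k (0 : 'M[int]_1) f -> 0 < complex.Im tau -> f (pt1 tau z) = f (pt1 tau 0).
Proof.
move=> hf t0; have [h' hl] := isF_lt2 (jac_F hf) t0.
have el (l m : int) w : f (pt1 tau (w + tau * l%:~R + m%:~R)) = f (pt1 tau w).
  rewrite pt1_shift (jac_ell hf) // /quad /bil /intm map_mx0 !mulmx0 !mul0mx !mxE addr0 expr0z mul1r.
  by rewrite !mulr0 subr0 oppr0 ee0 mul1r.
have [|w|c hc] := @quasi_periodic (fun w => f (pt1 tau w)) h' tau 0 t0 hl.
- by move=> w; have := el 0 1 w; rewrite mulr0z mulr0 addr0.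
- by have := el 1 0 w; rewrite mulr0z mulr1 addr0 oppr0 ee0 mul1r.
have fc w : f (pt1 tau w) = c.
  have [d hd] := isF_line (const_mx w) (const_mx 1) (jac_F hf) t0.
  have hd' := cderD hd (cder_cst (- c) 0).
  have := @ph_cancel R tau w 1 _ _ t0 ltr01 hd'; rewrite scale0r addr0 => hh.
  apply/eqP; rewrite -subr_eq0; apply/eqP; apply: hh => u.
  have e : const_mx w + u *: const_mx 1 = const_mx (w + u) :> 'cV[R[i]]_1 by apply/matrixP => i j; rewrite !mxE mulr1.
  have := hc (w + u); rewrite addr0 mul1r e -/(pt1 tau (w + u)) mulrDr => e2.
  by rewrite [ph _ _ _ * f _]mulrC e2 mulrN [ph _ _ _ * c]mulrC subrr.
by rewrite !fc.
Qed.

(** phi^2 f has index 0, so it does not depend on z, and at z = 0 it vanishes. *)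
Lemma jac_index_neg2 k f : jac k ((-2)%:M : 'M[int]_1) f -> forall p, up p -> f p = 0.
Proof.
move=> hf.
have h2 := jacM (jac_phL R l1) (jacM (jac_phL R l1) hf).
have h0 : jac (-1 + (-1 + k)) (0 : 'M[int]_1) (fun p => phL l1 p * (phL l1 p * f p)).
  by apply: (jac_cast h2) => //; rewrite ll1 -!raddfD /=; apply/matrixP => i j; rewrite !mxE mul0rn.
apply: (phL_cancel l1k (jac_F hf)) => p Up.
apply: (phL_cancel l1k (f := fun p => ph 0 p.1 (Lz l1 p) * f p)) Up => [|{}p Up]; first exact: isF_M (isF_phz R l1 0) (jac_F hf).
have := jac_index0 (p.2 0 0) h0 Up; rewrite -pt1E !phLE // => ->.
by rewrite Lz_l1 mxE ph_0 // mul0r.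
Qed.

(** A 2-torsion point and its negative differ by a lattice vector, whose automorphy factor there is
    e(a l m) = 1 because the index entry is even. Odd weight then gives f = - f. *)
Lemma odd_vanish k (a : int) f tau z (l m : int) : (-1 : R[i]) ^ k = -1 -> jac k ((2 * a)%:M : 'M[int]_1) f ->
  0 < complex.Im tau -> 2 * z = l%:~R * tau + m%:~R -> f (pt1 tau z) = 0.
Proof.
move=> ok hf t0 hz.
have e1 : f (pt1 tau z) = f (pt1 tau (- z)).
  have {1}-> : z = - z + tau * l%:~R + m%:~R.
    by rewrite -addrA [tau * _]mulrC -hz; ring.
  have sg (x y : int) : (-1 : R[i]) ^ (2 * a * x + 2 * a * y) = 1 by rewrite -mulrDr -mulrA sgn_even.
  rewrite pt1_shift (jac_ell hf) // !scalar_int sg mul1r /quad !scalar_bil !mxE.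
  rewrite (_ : _ - _ = (a * l * m)%:~R) ?ee_int ?mul1r //.
  rewrite !rmorphM /=; transitivity (- (tau * (a%:~R * (l%:~R * l%:~R))) + a%:~R * (l%:~R * (2 * z))); first by field.
  by rewrite hz; ring.
have e2 : f (pt1 tau (- z)) = - f (pt1 tau z).
  have -> : pt1 tau (- z) = (tau, - const_mx z) by congr (_, _); apply/matrixP => i j; rewrite !mxE.
  by rewrite (jac_neg _ hf) // ok mulN1r.
by move: e1; rewrite e2 => /eqP; rewrite -subr_eq0 opprK -mulr2n mulrn_eq0 /= => /eqP.
Qed.

Lemma odd_divide k (a : int) f : (-1 : R[i]) ^ k = -1 -> jac k ((2 * a)%:M : 'M[int]_1) f ->
  exists g, jac (k + 1) ((2 * a - 4)%:M : 'M[int]_1) g /\ forall p, up p -> f p = ph 0 p.1 (2 * p.2 0 0) * g p.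
Proof.
move=> ok hf.
have [||g [hg e]] := @jac_divide R 1 l2 0 1 l2k (k + 1) ((2 * a - 4)%:M) f.
- apply: (jac_cast hf); first by rewrite addrK.
  by rewrite ll2 -raddfD /= subrK.
- by move=> p l m Up; rewrite Lz_l2 [p in f p]pt1E => hz; exact: odd_vanish ok hf Up hz.
by exists g; split=> // p Up; rewrite e // Lz_l2.
Qed.

Lemma odd_divide1 k (a : int) f : (-1 : R[i]) ^ k = -1 -> jac k ((a + 1)%:M : 'M[int]_1) f ->
  exists g, jac (k + 1) (a%:M : 'M[int]_1) g /\ forall p, up p -> f p = ph 0 p.1 (p.2 0 0) * g p.
Proof.
move=> ok hf.
have [||g [hg e]] := @jac_divide0 R 1 l1 0 0 l1k (k + 1) (a%:M) f l1 dot_l1.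
- by apply: (jac_cast hf); [rewrite addrK | rewrite ll1 -raddfD].
- move=> p Up; rewrite Lz_l1 [p in f p]pt1E => ->.
  have e0 : pt1 p.1 (0 : R[i]) = (p.1, - const_mx 0) by congr (_, _); apply/matrixP => i j; rewrite !mxE oppr0.
  have := @jac_neg R 1 k _ f p.1 (const_mx 0) hf Up; rewrite -e0 ok mulN1r => /eqP.
  by rewrite -subr_eq0 opprK -mulr2n mulrn_eq0 /= => /eqP.
by exists g; split=> // p Up; rewrite e // Lz_l1.
Qed.

End IndexZero.

(** * Restriction to w = 0 *)

Arguments nab : simpl never.

Section IndexForms.

(* [qf A B C] is the index with 2Q(z, w) = A z^2 + B w^2 + C (z + w)^2. *)
Definition qf (A B C : int) : 'M[int]_2 := sym2 (A + C) C (B + C).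

Lemma qfD A B C A' B' C' : qf A B C + qf A' B' C' = qf (A + A') (B + B') (C + C').
Proof. by apply/matrixP => i j; rewrite !mxE; case: ifP => _ //; case: ifP => _; rewrite addrACA. Qed.

Lemma qfZ a A B C : a *: qf A B C = qf (a * A) (a * B) (a * C).
Proof. by apply/matrixP => i j; rewrite !mxE; case: ifP => _ //; case: ifP => _; rewrite mulrDr. Qed.

Lemma qf_A : indexA = qf 1 1 1. Proof. by []. Qed.

Lemma ez2 : ez *m ez^T = qf 1 0 0.
Proof. by apply/matrixP => i j; rewrite !mxE big_ord1 !mxE; case: i => [[|[|//]] ?]; case: j => [[|[|//]] ?]. Qed.

Lemma ew2 : ew *m ew^T = qf 0 1 0.
Proof. by apply/matrixP => i j; rewrite !mxE big_ord1 !mxE; case: i => [[|[|//]] ?]; case: j => [[|[|//]] ?]. Qed.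

Lemma ezw2 : ezw *m ezw^T = qf 0 0 1.
Proof. by apply/matrixP => i j; rewrite !mxE big_ord1 !mxE; case: i => [[|[|//]] ?]; case: j => [[|[|//]] ?]. Qed.

Lemma dot_ew : dotz ew ew = 1.
Proof. by rewrite /dotz mxE big_ord_recl big_ord1 !mxE. Qed.

Lemma ord2P (P : 'I_2 -> Prop) : P 0 -> P 1 -> forall i, P i.
Proof. by move=> h0 h1 [[|[|//]] h]; [rewrite (_ : Ordinal h = 0) | rewrite (_ : Ordinal h = 1)] => //; apply/val_inj. Qed.

End IndexForms.

Section Restriction.
Variable R : realType.
Local Notation pt := (R[i] * 'cV[R[i]]_1)%type.
Local Notation pt2 := (R[i] * 'cV[R[i]]_2)%type.
Local Notation kap := (twopii R).
Implicit Types (f g : pt2 -> R[i]) (tau z w : R[i]) (A B C k : int).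

Lemma jac_res k A B C f : jac k (qf A B C) f -> jac k ((A + C)%:M : 'M[int]_1) (fun p => f (pull ez p)).
Proof.
move=> hf; apply: (jac_cast (jac_pull ez hf)) => //; apply/matrixP => i j; rewrite !ord1 int_sym2 !mxE /=.
by rewrite !mulr1 !mulr0 !addr0.
Qed.

Lemma pullT n (L : 'cV[int]_n) (p : R[i] * 'cV[R[i]]_n) : pull L^T p = pt1 p.1 (Lz L p).
Proof.
congr (_, _); apply/matrixP => i j; rewrite !ord1 !mxE /Lz.
by apply: eq_bigr => k' _; rewrite !mxE.
Qed.

Lemma jac_pullT k (a : int) (g : pt -> R[i]) (L : 'cV[int]_2) A B C : L *m L^T = qf A B C -> jac k (a%:M : 'M[int]_1) g ->
  jac k (qf (a * A) (a * B) (a * C)) (fun p => g (pull L^T p)).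
Proof.
move=> hL hg; apply: (jac_cast (jac_pull L^T hg)) => //.
by rewrite trmxK -scalemx1 -scalemxAr mulmx1 -scalemxAl hL qfZ.
Qed.

Lemma pull_ez (p : pt) : (pull ez p).2 0 0 = p.2 0 0 /\ (pull ez p).2 1 0 = 0.
Proof. by split; rewrite /= mxE big_ord1 !mxE /= ?mul1r ?mul0r. Qed.

Lemma on_ez (p : pt2) : p.2 1 0 = 0 -> p = pull ez (pt1 p.1 (p.2 0 0)).
Proof.
move=> h; rewrite [LHS]surjective_pairing; congr (_, _); apply/matrixP => i j; rewrite ord1.
by move: i; apply: ord2P; rewrite mxE big_ord1 !mxE /= ?mul1r ?mul0r.
Qed.

Lemma divide_w k A B C f : jac k (qf A B C) f -> (forall p, upper p -> f (pull ez p) = 0) ->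
  exists g, jac (k + 1) (qf A (B - 1) C) g /\ forall p, upper p -> f p = ph 0 p.1 (p.2 1 0) * g p.
Proof.
move=> hf f0.
have [|||g [hg e]] := @jac_divide0 R 2 ew 1 0 _ (k + 1) (qf A (B - 1) C) f ew dot_ew.
- by rewrite mxE.
- apply: (jac_cast hf); first by rewrite addrK.
  by rewrite ew2 qfD subrK !addr0.
- move=> p Up; have [_ -> _] := LzE p => h; rewrite (on_ez h); exact: f0.
by exists g; split=> // p Up; rewrite e //; have [_ -> _] := LzE p.
Qed.

Lemma ph_parity (k : nat) tau z : 0 < complex.Im tau -> ph k tau (- z) = (-1) ^+ k.+1 * ph k tau z.
Proof.
move=> t0; elim: k z => [|k IH] z; first by rewrite expr1 mulN1r ph_odd.
have h1 := cder_comp (cder_scale (-1) z) (ph_cder k (-1 * z) t0).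
have h2 := cderZ ((-1) ^+ k.+1) (ph_cder k z t0).
have e x : ph k tau (-1 * x) = (-1) ^+ k.+1 * ph k tau x by rewrite mulN1r IH.
have := cder_unique (cder_ext e h1) h2; rewrite mulN1r mulrN1 => e1.
apply: (mulfI (twopii_neq0 R)); rewrite -[LHS]opprK e1 [_ ^+ k.+2]exprS.
by move: (_ ^+ _) (ph _ _ _) kap => *; ring.
Qed.

Lemma ph_even0 (k : nat) tau : 0 < complex.Im tau -> ~~ odd k -> ph k tau 0 = 0.
Proof.
move=> t0 ok; have := ph_parity k 0 t0; rewrite oppr0 -signr_odd oddS ok expr1 mulN1r => /eqP.
by rewrite -subr_eq0 opprK -mulr2n mulrn_eq0 /= => /eqP.
Qed.

Lemma nab_w0 (k : nat) tau z : nab k tau z 0 0 = nabla k (fun i => ph i tau z) (fun i => ph i tau 0) (fun i => ph i tau z).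
Proof. by rewrite nabE addr0. Qed.

Lemma X_res (p : pt) : upper p -> Xf (pull ez p) = ph 0 p.1 (p.2 0 0) ^+ 2.
Proof.
move=> Up; have [e1 e2] := pull_ez p.
rewrite [pull ez p]surjective_pairing XfE // e1 e2 nab_w0 /= ph_0 // ph1_0 //.
by move: (ph _ _ _) (ph _ _ _) => *; ring.
Qed.

(** The Eichler-Zagier form phi_{0,1}, with q^0-term zeta + 10 + 1/zeta; a 1 x 1 matrix with entry 2
    means index 1 in their convention, and phi^2 is their phi_{-2,1}. *)
Definition Fr (p : pt) : R[i] := Yf (pull ez p).

Lemma jac_Fr : jac 0 (2%:M : 'M[int]_1) Fr.
Proof. by have := jac_Y R; rewrite qf_A => /jac_res. Qed.

Lemma FrE tau z : 0 < complex.Im tau -> Fr (pt1 tau z) = 12 * (ph 1 tau z ^+ 2 - ph 0 tau z * ph 2 tau z) + E2 tau * ph 0 tau z ^+ 2.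
Proof.
move=> t0; have [e1 e2] := pull_ez (pt1 tau z).
rewrite /Fr [pull ez _]surjective_pairing YfE // e1 e2 !mxE !nab_w0 /= !(ph_even0 _ (k := 0)) // !(ph_even0 _ (k := 2)) // !ph1_0 // !ph3_0 //.
by move: (ph 0 _ _) (ph 1 _ _) (ph 2 _ _) (ph 3 _ _) (E2 _) => *; field.
Qed.

Lemma Fr_0 tau : 0 < complex.Im tau -> Fr (pt1 tau 0) = 12.
Proof. by move=> t0; rewrite FrE // ph_0 // ph1_0 // mul0r subr0 expr1n expr0n /= mulr0 addr0 mulr1. Qed.

(** The first-order behaviour of X and of the third derivative in Y at w = 0, from which the value
    of N at w = 0 is computed. *)
Lemma nab_cderw tau z : 0 < complex.Im tau ->
  cder (fun w => nab 1 tau z w 0) 0 (kap * (ph 0 tau z * ph 1 tau z)) /\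
  cder (fun w => nab 3 tau z w 0) 0 (kap * (3 * (ph 0 tau z * ph 3 tau z - ph 1 tau z * ph 2 tau z) + E2 tau / 4 * (ph 0 tau z * ph 1 tau z))).
Proof.
move=> t0.
have T i j l : cder (fun w => ph i tau z * ph j tau w * ph l tau (z + w)) 0
   (kap * (ph i tau z * (ph j.+1 tau 0 * ph l tau z + ph j tau 0 * ph l.+1 tau z))).
  have h1 := cderZ (ph i tau z) (ph_cder j 0 t0).
  have h2 := cder_comp (cderD (cder_cst z 0) (cder_id 0)) (ph_cder l (z + 0) t0).
  apply: (cder_eq (cderM h1 h2)); rewrite addr0.
  by move: (ph _ _ _) (ph _ _ _) (ph _ _ _) (ph _ _ _) (ph _ _ _) kap => *; ring.
have e0 := ph_even0 t0 (k := 0) isT; have e2 := ph_even0 t0 (k := 2) isT; have e4 := ph_even0 t0 (k := 4) isT.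
split.
  apply: (cder_ext (F := fun w => nabla 1 (fun i => ph i tau z) (fun i => ph i tau w) (fun i => ph i tau (z + w)))) => [w|].
    by rewrite nabE.
  apply: (cder_eq (cderD (cderD (T _ _ _) (T _ _ _)) (cderZ _ (T _ _ _)))); rewrite e0 e2 !ph1_0 //.
  by move: (ph 0 _ _) (ph 1 _ _) (ph 2 _ _) kap => *; ring.
apply: (cder_ext (F := fun w => nabla 3 (fun i => ph i tau z) (fun i => ph i tau w) (fun i => ph i tau (z + w)))) => [w|].
  by rewrite nabE.
apply: (cder_eq (cderD (cderD (cderD (cderD (cderD (cderD (cderD (cderD (cderD (T _ _ _) (T _ _ _)) (cderZ _ (T _ _ _)))
    (cderZ _ (T _ _ _))) (cderZ _ (T _ _ _))) (cderZ _ (T _ _ _))) (cderZ _ (T _ _ _))) (cderZ _ (T _ _ _)))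
    (cderZ _ (T _ _ _))) (cderZ _ (T _ _ _)))); rewrite e0 e2 e4 !ph1_0 // !ph3_0 //.
by move: (ph 0 _ _) (ph 1 _ _) (ph 2 _ _) (ph 3 _ _) (ph 4 _ _) (E2 _) kap => *; field.
Qed.

(** The cross combination of X and Y that cancels at w = 0, where they restrict to phi^2 and
    [Fr]. *)
Definition Qf (p : pt2) : R[i] := Fr (pull ez^T p) * Xf p - phL ez p * phL ez p * Yf p.

Lemma jac_Qf : jac (-2) (qf 3 1 1) Qf.
Proof.
apply: jacB.
  by apply: (jac_cast (jacM (jac_pullT ez2 jac_Fr) (jac_X R))) => //; rewrite qf_A qfD.
have hz := jac_phL R ez; rewrite ez2 in hz.
by apply: (jac_cast (jacM (jacM hz hz) (jac_Y R))) => //; rewrite qf_A !qfD.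
Qed.

Lemma pull_ezT (p : pt) : pull ez^T (pull ez p) = p.
Proof.
rewrite pullT; have [-> _ _] := LzE (pull ez p); have [-> _] := pull_ez p.
by rewrite -pt1E.
Qed.

Lemma phL_ez_res (p : pt) : upper p -> phL ez (pull ez p) = ph 0 p.1 (p.2 0 0).
Proof. by move=> Up; rewrite phLE //; have [-> _ _] := LzE (pull ez p); have [-> _] := pull_ez p. Qed.

Lemma Qf_res (p : pt) : upper p -> Qf (pull ez p) = 0.
Proof. by move=> Up; rewrite /Qf pull_ezT X_res // phL_ez_res // -/(Fr p) expr2 mulrC subrr. Qed.

(** Since phi(0) = 0 and phi'(0) = 1, the value of N at w = 0 is the w-derivative of [Qf] there, in
    units of 2 pi i. *)
Lemma quotient_res (N : pt2 -> R[i]) tau z : isF N -> 0 < complex.Im tau ->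
  (forall p, upper p -> Qf p = ph 0 p.1 (p.2 1 0) * N p) ->
  N (pull ez (pt1 tau z)) = 6 * (ph 0 tau z * (2 * (ph 1 tau z * (ph 1 tau z * ph 1 tau z)) +
    (-3 * (ph 0 tau z * (ph 1 tau z * ph 2 tau z)) + ph 0 tau z * (ph 0 tau z * ph 3 tau z)))).
Proof.
move=> NF t0 e; set p0 := pull ez (pt1 tau z).
have [d hd] := isF_line p0.2 (intv R ew) NF t0.
have [hX hY] := nab_cderw z t0.
have p0E : p0 = (tau, p0.2) by [].
have [z0 w0] := pull_ez (pt1 tau z); rewrite -/p0 in z0 w0.
have {}z0 : p0.2 0 0 = z by rewrite z0 mxE.
have hL : cder (fun w => Fr (pt1 tau z) * nab 1 tau z w 0 + -1 * (ph 0 tau z * ph 0 tau z * (-2 * nab 3 tau z w 0 + 3 / 2 * E2 tau * nab 1 tau z w 0))) 0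
   (Fr (pt1 tau z) * (kap * (ph 0 tau z * ph 1 tau z)) + -1 * (ph 0 tau z * ph 0 tau z *
     (-2 * (kap * (3 * (ph 0 tau z * ph 3 tau z - ph 1 tau z * ph 2 tau z) + E2 tau / 4 * (ph 0 tau z * ph 1 tau z))) +
      3 / 2 * E2 tau * (kap * (ph 0 tau z * ph 1 tau z))))).
  exact: cderD (cderZ _ hX) (cderZ _ (cderZ _ (cderD (cderZ _ hY) (cderZ _ hX)))).
have eL w : Fr (pt1 tau z) * nab 1 tau z w 0 + -1 * (ph 0 tau z * ph 0 tau z * (-2 * nab 3 tau z w 0 + 3 / 2 * E2 tau * nab 1 tau z w 0)) =
   ph 0 tau w * N (tau, p0.2 + w *: intv R ew).
  have Up : upper (tau, p0.2 + w *: intv R ew) by [].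
  have q0 : (p0.2 + w *: intv R ew) 0 0 = z by rewrite [LHS]mxE z0 !mxE mulr0 addr0.
  have q1 : (p0.2 + w *: intv R ew) 1 0 = w by rewrite [LHS]mxE w0 !mxE mulr1 add0r.
  have := e _ Up; rewrite /= q1 => <-; rewrite /Qf XfE // YfE // phLE // pullT.
  by have [-> _ _] := LzE (tau, p0.2 + w *: intv R ew); rewrite /= q0 q1 mulN1r.
have := cder_unique (cder_ext eL hL) (cderM (ph_cder 0 0 t0) hd).
rewrite ph_0 // ph1_0 // mul0r addr0 mulr1 scale0r addr0 -p0E FrE // => e1.
apply: (mulfI (twopii_neq0 R)); rewrite -e1.
by move: (ph 0 _ _) (ph 1 _ _) (ph 2 _ _) (ph 3 _ _) (E2 _) kap => *; field.
Qed.

(** N(z, 0) has weight -1 and matrix entry 4, so after division by phi(2z) a form of index 0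
    remains, which is independent of z. Differentiating the formula of [quotient_res] at z = 0 shows
    that twice this constant is 12. *)
Lemma quotient_form : exists N, [/\ jac (-1) (qf 3 0 1) N, forall p, upper p -> Qf p = ph 0 p.1 (p.2 1 0) * N p &
  forall p, upper p -> N (pull ez p) = 6 * ph 0 p.1 (2 * p.2 0 0)].
Proof.
have [N [hN e]] := divide_w jac_Qf Qf_res.
exists N; split=> // p Up.
have hN' : jac (-1) ((2 * 2)%:M : 'M[int]_1) (fun p => N (pull ez p)) by exact: jac_res hN.
have [|S [hS eS]] := odd_divide _ hN'; first by rewrite exprN1 invrN1.
have hS0 : jac (-1 + 1) (0 : 'M[int]_1) S.
  by apply: (jac_cast hS) => //; apply/matrixP => i j; rewrite !mxE mul0rn.
rewrite [p]pt1E; move: (p.2 0 0) => z; have t0 : 0 < complex.Im p.1 by []; move: {Up} (p.1) t0 => {p} tau t0.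
have t1 x : upper (pt1 tau x) by [].
rewrite eS // (jac_index0 _ hS0) // /= !mxE [RHS]mulrC; congr (_ * _).
set s := S _.
have hR := cderM (cder_comp (cder_scale 2 0) (ph_cder 0 (2 * 0) t0)) (cder_cst s 0).
have eR x : ph 0 tau (2 * x) * s = 6 * (ph 0 tau x * (2 * (ph 1 tau x * (ph 1 tau x * ph 1 tau x)) +
    (-3 * (ph 0 tau x * (ph 1 tau x * ph 2 tau x)) + ph 0 tau x * (ph 0 tau x * ph 3 tau x)))).
  by rewrite -(quotient_res x (jac_F hN) t0 e) eS // (jac_index0 _ hS0) // /= !mxE.
have c (k : nat) := ph_cder k 0 t0.
have hL := cderZ 6 (cderM (c 0%N) (cderD (cderZ 2 (cderM (c 1%N) (cderM (c 1%N) (c 1%N))))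
   (cderD (cderZ (-3) (cderM (c 0%N) (cderM (c 1%N) (c 2%N)))) (cderM (c 0%N) (cderM (c 0%N) (c 3%N)))))).
have := cder_unique (cder_ext eR hR) hL; rewrite !mulr0 ph_0 // !ph1_0 // => e1.
have n0 : kap * 2 != 0 by rewrite mulf_neq0 ?twopii_neq0 // pnatr_eq0.
apply: (mulfI n0); move: e1; rewrite !mul0r !mulr0 !addr0 !mulr1 => ->.
by move: kap => x; ring.
Qed.

End Restriction.

(** * Forms of odd index *)

Section Structure.
Variable R : realType.
Local Notation pt := (R[i] * 'cV[R[i]]_1)%type.
Local Notation pt2 := (R[i] * 'cV[R[i]]_2)%type.
Local Notation ev k := ((-1 : R[i]) ^ (k : int) = 1).
Local Notation Fr := (@Fr R).
Implicit Types (f : pt2 -> R[i]) (k : int).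

Lemma ev_odd k : ev k -> (-1 : R[i]) ^ (k + 1) = -1.
Proof. by move=> ek; rewrite expfzDr ?m1_neq0 // ek expr1z mul1r. Qed.

Lemma ev_add2 k : ev k -> ev (k + 2).
Proof. by move=> ek; rewrite expfzDr ?m1_neq0 // ek mul1r -(mulr1 2) sgn_even. Qed.

Lemma scalarD (a b : int) : (a%:M : 'M[int]_1) + b%:M = (a + b)%:M.
Proof. by rewrite raddfD. Qed.

(** [Fr] / 12 takes the value 1 at z = 0, so its powers raise the index without changing the value
    at the origin. *)
Lemma origin_form k (a : nat) (h : pt -> R[i]) (c : R[i]) : jac k (0 : 'M[int]_1) h ->
  exists g, jac k ((2 * a%:Z)%:M : 'M[int]_1) g /\ forall tau, 0 < complex.Im tau -> g (pt1 tau 0) = c * h (pt1 tau 0).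
Proof.
move=> hh; elim: a => [|a [g [hg e]]].
  exists (fun p => c * h p); split=> //; apply: (jac_cast (jacZ c hh)) => //.
  by apply/matrixP => i j; rewrite !mxE mulr0 mul0rn.
exists (fun p => 12^-1 * Fr p * g p); split.
  apply: (jac_cast (jacM (jacZ 12^-1 (jac_Fr R)) hg)); first by rewrite add0r.
  by rewrite scalarD; congr (_%:M); lia.
by move=> tau t0; rewrite Fr_0 // mulVf ?pnatr_eq0 // mul1r e.
Qed.

(** [h1] is chosen to match h at the origin, so that h - Fr h1 vanishes there and is divisible by
    phi. The quotient has odd weight, vanishes at 0 as well, and can be divided by phi once more. *)
Lemma one_var k (a : nat) (h : pt -> R[i]) : ev k -> jac k ((2 * a.+1%:Z)%:M : 'M[int]_1) h ->
  exists h1 h2, [/\ jac k ((2 * a%:Z)%:M : 'M[int]_1) h1, jac (k + 2) ((2 * a%:Z)%:M : 'M[int]_1) h2 &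
    forall p, upper p -> h p = Fr p * h1 p + ph 0 p.1 (p.2 0 0) ^+ 2 * h2 p].
Proof.
move=> ek hh.
have h0 : jac k (0 : 'M[int]_1) (fun p => h (pull (0 : 'M[int]_1) p)).
  by apply: (jac_cast (jac_pull (0 : 'M[int]_1) hh)) => //; rewrite mulmx0.
have [h1 [jh1 e1]] := origin_form a 12^-1 h0.
pose r p := h p - Fr p * h1 p.
have p0 tau : pull (0 : 'M[int]_1) (pt1 tau 0) = pt1 tau (0 : R[i]).
  by congr (_, _); apply/matrixP => i j; rewrite !mxE big1 // => o _; rewrite !mxE mulr0.
have jr : jac k ((2 * a.+1%:Z)%:M : 'M[int]_1) r.
  apply: jacB hh _; apply: (jac_cast (jacM (jac_Fr R) jh1)); first by rewrite add0r.
  by rewrite scalarD; congr (_%:M); lia.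
have r0 tau : 0 < complex.Im tau -> r (pt1 tau 0) = 0.
  by move=> t0; rewrite /r Fr_0 // e1 // p0 mulVKf ?pnatr_eq0 // subrr.
have [||g [jg eg]] := @jac_divide0 R 1 l1 0 0 l1k (k + 1) ((2 * a%:Z + 1)%:M) r l1 dot_l1.
- apply: (jac_cast jr); first by rewrite addrK.
  by rewrite ll1 scalarD; congr (_%:M); lia.
- by move=> p Up; rewrite Lz_l1 [p in r p]pt1E => ->; exact: r0.
have [h2 [jh2 e2]] := odd_divide1 (ev_odd ek) jg.
exists h1, h2; split=> //; first by apply: (jac_cast jh2) => //; lia.
move=> p Up; have := eg p Up; rewrite e2 // Lz_l1 mulrA -expr2 /r => /eqP.
by rewrite subr_eq addrC => /eqP.
Qed.

Let Fr_pull (L : 'cV[int]_2) (p : pt2) := Fr (pull L^T p).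

Lemma res_ew (p : pt) : pull ew^T (pull ez p) = pt1 p.1 (0 : R[i]).
Proof. by rewrite pullT; have [_ -> _] := LzE (pull ez p); have [_ ->] := pull_ez p. Qed.

Lemma res_ezw (p : pt) : pull ezw^T (pull ez p) = p.
Proof.
rewrite pullT; have [_ _ ->] := LzE (pull ez p); have [-> ->] := pull_ez p.
by rewrite addr0 -pt1E.
Qed.

Lemma jac_phz (L : 'cV[int]_2) A B C : L *m L^T = qf A B C -> jac (-2) (qf (2 * A) (2 * B) (2 * C)) (fun p : pt2 => phL L p * phL L p).
Proof.
move=> e; have h := jac_phL R L; rewrite e in h.
by apply: (jac_cast (jacM h h)) => //; rewrite qfD; congr qf; lia.
Qed.

(** Factors [Fr](w) / 12 raise the coefficient of w^2 and equal 1 on w = 0. *)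
Lemma lift_const k (y : nat) (S : pt -> R[i]) : jac k (0 : 'M[int]_1) S ->
  exists g, jac k (qf 0 (2 * y%:Z) 0) g /\ forall p, upper p -> g (pull ez p) = S p.
Proof.
move=> hS; elim: y => [|y [g [hg e]]].
  exists (fun p => S (pull (0 : 'M[int]_(1, 2)) p)); split.
    apply: (jac_cast (jac_pull (0 : 'M[int]_(1, 2)) hS)) => //; rewrite mulmx0.
    by apply/matrixP => i j; rewrite !mxE mulr0 addr0; case: ifP => // _; case: ifP.
  move=> p Up; have -> : pull (0 : 'M[int]_(1, 2)) (pull ez p) = pt1 p.1 (0 : R[i]).
    by congr (_, _); apply/matrixP => i j; rewrite !mxE big1 // => o _; rewrite !mxE mul0r.
  by rewrite [in RHS](pt1E p) (jac_index0 _ hS).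
exists (fun p => 12^-1 * Fr_pull ew p * g p); split.
  apply: (jac_cast (jacM (jacZ 12^-1 (jac_pullT ew2 (jac_Fr R))) hg)); first by rewrite add0r.
  by rewrite qfD; congr qf; lia.
by move=> p Up; rewrite e // /Fr_pull res_ew Fr_0 // mulVf ?pnatr_eq0 // mul1r.
Qed.

(** At w = 0 both z and z + w become z, so the index a may be split between z^2 and (z + w)^2 in any
    way x + z = a: the one-variable generators are evaluated at z while x > 0, and at z + w
    afterwards. *)
Lemma lift (a : nat) k (x y z : nat) (S : pt -> R[i]) : ev k -> (x + z = a)%N -> jac k ((2 * a%:Z)%:M : 'M[int]_1) S ->
  exists g, jac k (qf (2 * x%:Z) (2 * y%:Z) (2 * z%:Z)) g /\ forall p, upper p -> g (pull ez p) = S p.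
Proof.
elim: a k x z S => [|a IH] k x z S ek xz hS.
  have [x0 z0] : x = 0%N /\ z = 0%N by lia.
  rewrite x0 z0; apply: lift_const; apply: (jac_cast hS) => //.
  by apply/matrixP => i j; rewrite !mxE mulr0 mul0rn.
have [h1 [h2 [j1 j2 e]]] := one_var ek hS.
case: x xz => [|x] xz.
  case: z xz => [|z] xz; first by lia.
  have xz' : (0%N + z = a)%N by lia.
  have [g1 [jg1 e1]] := IH _ 0%N z _ ek xz' j1.
  have [g2 [jg2 e2]] := IH _ 0%N z _ (ev_add2 ek) xz' j2.
  exists (fun p => Fr_pull ezw p * g1 p + phL ezw p * phL ezw p * g2 p); split.
    apply: jacD; [apply: (jac_cast (jacM (jac_pullT ezw2 (jac_Fr R)) jg1)) | apply: (jac_cast (jacM (jac_phz ezw2) jg2))];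
      by [lia | rewrite qfD; congr qf; lia].
  move=> p Up; rewrite e // e1 // e2 // /Fr_pull res_ezw phLE //.
  by have [_ _ ->] := LzE (pull ez p); have [-> ->] := pull_ez p; rewrite addr0 expr2.
have xz' : (x + z = a)%N by lia.
  have [g1 [jg1 e1]] := IH _ x z _ ek xz' j1.
have [g2 [jg2 e2]] := IH _ x z _ (ev_add2 ek) xz' j2.
exists (fun p => Fr_pull ez p * g1 p + phL ez p * phL ez p * g2 p); split.
  apply: jacD; [apply: (jac_cast (jacM (jac_pullT ez2 (jac_Fr R)) jg1)) | apply: (jac_cast (jacM (jac_phz ez2) jg2))];
    by [lia | rewrite qfD; congr qf; lia].
by move=> p Up; rewrite e // e1 // e2 // /Fr_pull pull_ezT phL_ez_res // expr2.
Qed.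

(** Freezing z at a complex number is not an integral substitution. The frequency in z is instead
    absorbed as an exponential into the coefficient, and terms are collected by their frequency in
    w. *)
Lemma isF_fix f (z : R[i]) : isF f -> isF (fun p : pt => f (p.1, \col_i (if i == 0 then z else p.2 0 0))).
Proof.
move=> [c hc].
pose e (i : nat * 'cV[int]_2) : nat * 'cV[int]_1 := (i.1, const_mx (i.2 1 0)).
exists (gcoef e (fun i => c i * ee ((i.2 0 0)%:~R / 2 * z))).
apply: gexp => p Up; apply: (eq_has_sum (hc _ (Up : upper (p.1, \col_i (if i == 0 then z else p.2 0 0))))) => i.
rewrite -mulrA; congr (_ * _); rewrite !monoE !linE big_ord1 big_ord_recl big_ord1 lift01 !mxE /= !expi_ee -eeD.
by congr ee; rewrite addrCA.
Qed.

(* For fixed z the form is multiplied by exp(-2 pi i z) under w -> w + tau, so f phi(w) is proportional to phi(z + w). *)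
Lemma base_vanish k f : jac k (qf 1 (-1) 1) f -> forall p, upper p -> f p = 0.
Proof.
move=> hf.
have kw : ew 1 0 = (2 ^ 0)%N%:Z by rewrite mxE.
have kz : ez 0 0 = (2 ^ 0)%N%:Z by rewrite mxE.
apply: (phL_cancel kz (jac_F hf)) => p Up.
apply: (phL_cancel kw (f := fun p => ph 0 p.1 (Lz ez p) * f p)) Up => [|{}p Up]; first exact: isF_M (isF_phz R ez 0) (jac_F hf).
have t0 : 0 < complex.Im p.1 by [].
pose P w : 'cV[R[i]]_2 := \col_i (if i == 0 then p.2 0 0 else w).
have el (l m : int) w : f (p.1, P (w + p.1 * l%:~R + m%:~R)) = ee (- (l%:~R * p.2 0 0)) * f (p.1, P w).
  pose v (x : int) : 'cV[int]_2 := \col_i (if i == 0 then 0 else x).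
  have -> : P (w + p.1 * l%:~R + m%:~R) = P w + p.1 *: intv R (v l) + intv R (v m).
    by apply/matrixP => i j; rewrite !mxE; case: ifP => _; rewrite ?mulr0 ?addr0.
  rewrite (jac_ell hf) // !int_sym2 quad_sym2 bil_sym2 !mxE /= !mulr0 !mul0r !addr0 !add0r mul1r.
  by rewrite !mulr0 oppr0 sub0r add0r mulr1z mul1r.
have [h' hl] := isF_lt2 (isF_fix (p.2 0 0) (jac_F hf)) t0.
have hE w : f ((pt1 p.1 w).1, \col_i (if i == 0 then p.2 0 0 else (pt1 p.1 w).2 0 0)) = f (p.1, P w).
  by congr (f (_, _)); apply/matrixP => i j; rewrite !mxE.
have [|w|c hc] := @quasi_periodic R _ h' p.1 (p.2 0 0) t0 hl.
- by move=> w; rewrite !hE; have := el 0 1 w; rewrite mulr0z mulr0 addr0 mul0r oppr0 ee0 mul1r.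
- by rewrite !hE; have := el 1 0 w; rewrite mulr0z mulr1 addr0 mul1r.
have c0 : c * ph 0 p.1 (p.2 0 0) = 0 by have := hc 0; rewrite ph_0 // mulr0 add0r => <-.
have pE : p = (p.1, P (p.2 1 0)).
  rewrite [LHS]surjective_pairing; congr (_, _); apply/matrixP => i j; rewrite ord1.
  by move: i; apply: ord2P; rewrite mxE.
have := hc (p.2 1 0); rewrite hE -pE => e; have [-> -> _] := LzE p.
by rewrite [LHS]mulrC -mulrA e mulrA [ph 0 p.1 (p.2 0 0) * c]mulrC c0 mul0r.
Qed.

Definition spanned (x y z : nat) := forall k f, ev k -> jac k (qf (2 * x%:Z + 1) (2 * y%:Z + 1) (2 * z%:Z + 1)) f ->
  exists g h, [/\ jac (k + 2) (qf (2 * x%:Z) (2 * y%:Z) (2 * z%:Z)) g, jac k (qf (2 * x%:Z) (2 * y%:Z) (2 * z%:Z)) h &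
    forall p, upper p -> f p = g p * Xf p + h p * Yf p].

Section Symmetry.
Variable (s : 'M[int]_2).
Hypothesis s_inv : forall p : pt2, pull s (pull s p) = p.
Hypothesis s_X : forall p : pt2, upper p -> Xf (pull s p) = Xf p.
Hypothesis s_Y : forall p : pt2, upper p -> Yf (pull s p) = Yf p.

Lemma spanned_sym x y z x' y' z' :
  (forall a, s^T *m qf (2 * x%:Z + a) (2 * y%:Z + a) (2 * z%:Z + a) *m s = qf (2 * x'%:Z + a) (2 * y'%:Z + a) (2 * z'%:Z + a)) ->
  (forall a, s^T *m qf (2 * x'%:Z + a) (2 * y'%:Z + a) (2 * z'%:Z + a) *m s = qf (2 * x%:Z + a) (2 * y%:Z + a) (2 * z%:Z + a)) ->
  spanned x y z -> spanned x' y' z'.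
Proof.
move=> e e' hs k f ek hf.
have hf' := jac_pull s hf; rewrite e' in hf'.
have [g [h [jg jh eq]]] := hs k _ ek hf'.
have e0 := e 0; rewrite !addr0 in e0.
have jg' := jac_pull s jg; have jh' := jac_pull s jh; rewrite e0 in jg' jh'.
exists (fun p => g (pull s p)), (fun p => h (pull s p)); split=> // p Up.
by rewrite -{1}(s_inv p) (eq (pull s p)) // s_X // s_Y.
Qed.

End Symmetry.

Definition swap12 : 'M[int]_2 := \matrix_(i, j) (i != j)%:Z.
(** The substitution (z, w) -> (z + w, -w), which exchanges the squares z^2 and (z + w)^2 and fixes
    w^2. *)
Definition swap13 : 'M[int]_2 := \matrix_(i, j) (if i == 0 then 1 else if j == 0 then 0 else -1).

Lemma pull_swap12 (p : pt2) : (pull swap12 p).2 0 0 = p.2 1 0 /\ (pull swap12 p).2 1 0 = p.2 0 0.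
Proof. by split; rewrite /= mxE big_ord_recl big_ord1 lift01 !mxE /= ?mul1r ?mul0r ?add0r ?addr0. Qed.

Lemma pull_swap13 (p : pt2) : (pull swap13 p).2 0 0 = p.2 0 0 + p.2 1 0 /\ (pull swap13 p).2 1 0 = - p.2 1 0.
Proof. by split; rewrite /= mxE big_ord_recl big_ord1 lift01 !mxE /= ?mul1r ?mul0r ?add0r ?addr0 ?mulN1r. Qed.

Lemma pt2_eq (p q : pt2) : p.1 = q.1 -> p.2 0 0 = q.2 0 0 -> p.2 1 0 = q.2 1 0 -> p = q.
Proof.
case: p q => [t u] [t' u'] /= -> h0 h1; congr (_, _); apply/matrixP => i j; rewrite ord1.
by move: i; apply: ord2P.
Qed.

Lemma qf_conj (s : 'M[int]_2) a b c i j : (s^T *m sym2 a b c *m s) i j =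
  a * (s 0 i * s 0 j) + b * (s 0 i * s 1 j + s 1 i * s 0 j) + c * (s 1 i * s 1 j).
Proof.
rewrite !mxE big_ord_recl big_ord1 !mxE !big_ord_recl !big_ord0 !mxE lift01 /=.
by move: (s 0 i) (s 0 j) (s 1 i) (s 1 j) => *; ring.
Qed.

Lemma spanned12 x y z : spanned x y z -> spanned y x z.
Proof.
have ec A B C : swap12^T *m qf A B C *m swap12 = qf B A C.
  by apply/matrixP => i j; rewrite qf_conj !mxE; move: i j; apply: ord2P; apply: ord2P => /=; ring.
apply: (@spanned_sym swap12) => // p.
- have [a1 a2] := pull_swap12 p; have [b1 b2] := pull_swap12 (pull swap12 p).
  by apply: pt2_eq; rewrite ?b1 ?b2 ?a1 ?a2.
- move=> Up; have [a1 a2] := pull_swap12 p; rewrite [pull swap12 p]surjective_pairing [in RHS](surjective_pairing p) !XfE // a1 a2 !nabE addrC /=.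
  by move: (ph _ _ _) (ph _ _ _) (ph _ _ _) (ph _ _ _) (ph _ _ _) (ph _ _ _) => *; ring.
move=> Up; have [a1 a2] := pull_swap12 p; rewrite [pull swap12 p]surjective_pairing [in RHS](surjective_pairing p) !YfE // a1 a2 !nabE [p.2 1 0 + _]addrC /=.
by move: (E2 _) (ph 0 _ _) (ph 0 _ _) (ph 0 _ _) (ph 1 _ _) (ph 1 _ _) (ph 1 _ _) (ph 2 _ _) (ph 2 _ _) (ph 2 _ _) (ph 3 _ _) (ph 3 _ _) (ph 3 _ _) => *; ring.
Qed.

Lemma spanned13 x y z : spanned x y z -> spanned z y x.
Proof.
have ec A B C : swap13^T *m qf A B C *m swap13 = qf C B A.
  by apply/matrixP => i j; rewrite qf_conj !mxE; move: i j; apply: ord2P; apply: ord2P => /=; ring.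
apply: (@spanned_sym swap13) => // p.
- have [a1 a2] := pull_swap13 p; have [b1 b2] := pull_swap13 (pull swap13 p).
  by apply: pt2_eq; rewrite ?b1 ?b2 ?a1 ?a2 ?opprK ?addrK.
- move=> Up; have [a1 a2] := pull_swap13 p; have t0 : 0 < complex.Im p.1 by [].
  rewrite [pull swap13 p]surjective_pairing [in RHS](surjective_pairing p) !XfE // a1 a2 !nabE addrK /= !ph_parity //.
  by move: (ph _ _ _) (ph _ _ _) (ph _ _ _) (ph _ _ _) (ph _ _ _) (ph _ _ _) => *; ring.
move=> Up; have [a1 a2] := pull_swap13 p; have t0 : 0 < complex.Im p.1 by [].
rewrite [pull swap13 p]surjective_pairing [in RHS](surjective_pairing p) !YfE // a1 a2 !nabE addrK /= !ph_parity //.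
by move: (E2 _) (ph 0 _ _) (ph 0 _ _) (ph 0 _ _) (ph 1 _ _) (ph 1 _ _) (ph 1 _ _) (ph 2 _ _) (ph 2 _ _) (ph 2 _ _) (ph 3 _ _) (ph 3 _ _) (ph 3 _ _) => *; ring.
Qed.

Let even_index (x y z : nat) := qf (2 * x%:Z) (2 * y%:Z) (2 * z%:Z).

(** Two divisions by phi(w). The first is prepared by the lifts [g2] and [g1] of the one-variable
    decomposition of f(z, 0). The second needs a correction of index two lower on z^2, for which
    there is room because z <= x. *)
Lemma reduce_twice k (x y z : nat) f : (z <= x)%N -> ev k -> jac k (qf (2 * x%:Z + 1) (2 * y%:Z + 1) (2 * z%:Z + 1)) f ->
  exists g h f', [/\ jac (k + 2) (even_index x y z) g, jac k (even_index x y z) h,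
    jac (k + 2) (qf (2 * x%:Z + 1) (2 * y%:Z - 1) (2 * z%:Z + 1)) f' &
    forall p, upper p -> f p = g p * Xf p + h p * Yf p + ph 0 p.1 (p.2 1 0) ^+ 2 * f' p].
Proof.
move=> zx ek hf.
have hr : jac k ((2 * (x + z).+1%:Z)%:M : 'M[int]_1) (fun p => f (pull ez p)).
  by apply: (jac_cast (jac_res hf)) => //; congr (_%:M); lia.
have [h1 [h2 [j1 j2 e]]] := one_var ek hr.
have [g1 [jg1 eg1]] := lift y ek (erefl (x + z)%N) j1.
have [g2 [jg2 eg2]] := lift y (ev_add2 ek) (erefl (x + z)%N) j2.
pose f1 p := f p - (g2 p * Xf p + g1 p * Yf p).
have jf1 : jac k (qf (2 * x%:Z + 1) (2 * y%:Z + 1) (2 * z%:Z + 1)) f1.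
  apply: jacB hf _; apply: jacD.
    by apply: (jac_cast (jacM jg2 (jac_X R))); [lia | rewrite qf_A qfD].
  by apply: (jac_cast (jacM jg1 (jac_Y R))); [lia | rewrite qf_A qfD].
have [|g [jg eg]] := divide_w jf1.
  move=> p Up; rewrite /f1 e // eg1 // eg2 // X_res // -/(Fr p).
  by move: (Fr p) (h1 p) (h2 p) (ph _ _ _) => *; ring.
have jgr : jac (k + 1) ((2 * (x + z).+1%:Z)%:M : 'M[int]_1) (fun p => g (pull ez p)).
  by apply: (jac_cast (jac_res jg)) => //; congr (_%:M); lia.
have [S [jS eS]] := odd_divide (ev_odd ek) jgr.
have [N [jN eN rN]] := quotient_form R.
(* A combination of X and Y that is divisible by phi(w), with a quotient [L3] that agrees with [g]
   on w = 0; then [g] - [L3] is divisible by phi(w) again. *)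
suff [L1 [L2 [L3 [j1' j2' j3' e1' e3']]]] : exists L1 L2 L3 : pt2 -> R[i],
  [/\ jac (k + 2) (even_index x y z) L1, jac k (even_index x y z) L2,
      jac (k + 1) (qf (2 * x%:Z + 1) (2 * y%:Z + 1 - 1) (2 * z%:Z + 1)) L3,
      (forall p, upper p -> L1 p * Xf p + L2 p * Yf p = ph 0 p.1 (p.2 1 0) * L3 p) &
      forall p, upper p -> L3 (pull ez p) = g (pull ez p)].
  have [|f' [jf' ef']] := divide_w (jacB jg j3'); first by move=> p Up; rewrite e3' // subrr.
  exists (fun p => g2 p + L1 p), (fun p => g1 p + L2 p), f'; split; try exact: jacD.
    by apply: (jac_cast jf'); [lia | congr qf; lia].
  move=> p Up; rewrite expr2 -mulrA -ef' // mulrBr -eg // -e1' // /f1.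
  by move: (f p) (g1 p) (g2 p) (Xf p) (Yf p) (L1 p) (L2 p) => *; ring.
move: zx jS; clear - Fr_pull ek eS eN rN jN; case: x => [|x] zx jS.
  have z0 : z = 0%N by lia.
  exists (fun=> 0), (fun=> 0), (fun=> 0); split; try exact: jac0.
    by move=> p _; rewrite !mul0r addr0 mulr0.
  move=> p Up; rewrite eS // (@jac_index_neg2 R (k + 1 + 1) S) // ?mulr0 //.
  by apply: (jac_cast jS) => //; congr (_%:M); lia.
(* The factor 1/6 offsets N(z, 0) = 6 phi(2z). Dividing by phi(2z) took 4 off the entry 2 (x + z +
   2), which leaves exactly the index of a lift to (2x, 2y, 2z). *)
have jS' : jac (k + 2) ((2 * (x + z)%N%:Z)%:M : 'M[int]_1) (fun p => 6^-1 * S p).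
  by apply: jacZ; apply: (jac_cast jS); [lia | congr (_%:M); lia].
have [L [jL eL]] := lift y (ev_add2 ek) (erefl (x + z)%N) jS'.
exists (fun p => Fr_pull ez p * L p), (fun p => -1 * (phL ez p * phL ez p) * L p), (fun p => N p * L p); split.
- by apply: (jac_cast (jacM (jac_pullT ez2 (jac_Fr R)) jL)); [lia | rewrite qfD; congr qf; lia].
- by apply: (jac_cast (jacM (jacZ (-1) (jac_phz ez2)) jL)); [lia | rewrite qfD; congr qf; lia].
- by apply: (jac_cast (jacM jN jL)); [lia | rewrite qfD; congr qf; lia].
- move=> p Up; rewrite mulrA -eN // /Qf /Fr_pull.
  by move: (Fr _) (L p) (Xf p) (Yf p) (phL _ _) => *; ring.
move=> p Up; rewrite rN // eL // eS //.
have n6 : (6 : R[i]) != 0 by rewrite pnatr_eq0.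
by move: (ph _ _ _) (S p) => a b; field.
Qed.

(** Only the coefficient of w^2 decreases. When y = 0 the ordering forces x = z = 0, and the
    remainder has index (1, -1, 1), so it vanishes by [base_vanish]. *)
Lemma spanned_sorted x y z : (z <= x)%N -> (x <= y)%N -> (forall y', (y = y'.+1)%N -> spanned x y' z) -> spanned x y z.
Proof.
move=> zx xy IH k f ek hf.
have [g [h [f' [jg jh jf' e]]]] := reduce_twice zx ek hf.
case: y xy IH hf jg jh jf' => [|y] xy IH hf jg jh jf'.
  have [x0 z0] : x = 0%N /\ z = 0%N by lia.
  exists g, h; split=> // p Up; rewrite e // (@base_vanish (k + 2) f') ?mulr0 ?addr0 //.
  by move: jf'; rewrite x0 z0.
have jf'' : jac (k + 2) (qf (2 * x%:Z + 1) (2 * y%:Z + 1) (2 * z%:Z + 1)) f'.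
  by apply: (jac_cast jf') => //; congr qf; lia.
have [g' [h' [jg' jh' e']]] := IH y erefl _ f' (ev_add2 ek) jf''.
exists (fun p => g p + phL ew p * phL ew p * g' p), (fun p => h p + phL ew p * phL ew p * h' p); split.
- by apply: jacD jg _; apply: (jac_cast (jacM (jac_phz ew2) jg')); [lia | rewrite qfD; congr qf; lia].
- by apply: jacD jh _; apply: (jac_cast (jacM (jac_phz ew2) jh')); [lia | rewrite qfD; congr qf; lia].
move=> p Up; rewrite e // e' // phLE //; have [_ -> _] := LzE p.
by move: (g p) (h p) (g' p) (h' p) (Xf p) (Yf p) (ph _ _ _) => *; ring.
Qed.

Theorem all_spanned x y z : spanned x y z.
Proof.
have [N] := ubnP (x + y + z)%N; elim: N x y z => // N IH x y z hN.
have sorted x' y' z' : (x' + y' + z' = x + y + z)%N -> (z' <= x')%N -> (x' <= y')%N -> spanned x' y' z'.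
  by move=> h1 h2 h3; apply: spanned_sorted => // y'' e; apply: IH; lia.
have [xy|yx] := leqP x y; have [zx|xz] := leqP z x; have [zy|yz] := leqP z y; try by lia.
- by apply: sorted; lia.
- by apply: spanned13; apply: sorted; lia.
- by apply: spanned13; apply: spanned12; apply: sorted; lia.
- by apply: spanned12; apply: sorted; lia.
- by apply: spanned12; apply: spanned13; apply: sorted; lia.
- by apply: spanned12; apply: spanned13; apply: spanned12; apply: sorted; lia.
Qed.

End Structure.

(** * The graded module *)

Section Grading.
Variable R : realType.
Implicit Types (d e : degree) (f : form2 R) (G : degree -> form2 R).

Lemma gmul_homog G d0 f d p : gmul G (homog d0 f) d p = G (d - d0) p * f p.
Proof.
rewrite /gmul -(@fsbig_widen _ _ _ _ [set d - d0]) //.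
  by rewrite fsbig_set1 /homog opprB addrCA subrr addr0 eqxx.
move=> e [_ ne]; rewrite /= /homog; case: eqP => [h|_]; last by rewrite mulr0.
by exfalso; apply: ne; rewrite /= -h opprB addrCA subrr addr0.
Qed.

Lemma even_to_odd (k : int) e : (2 %| k)%Z -> even_degree e -> odd_degree (e + (k, indexA)).
Proof.
move=> hk [ek [a [b [c [bm eM]]]]]; split; first by rewrite rpredD.
exists a.+1, b, c.+1; split; first by lia.
rewrite /= eM; apply/matrixP => i j; rewrite !mxE; case: ifP => _; last by [].
by case: ifP => _; lia.
Qed.

(** In the coordinates of [qf] the off-diagonal entry is C = 2b + 1, and b < min(a, c) says
    precisely that A = 2a - C and B = 2c - C are positive; they are odd as well. *)
Lemma odd_index (a b c : nat) : (b < minn a c)%N -> sym2 (2 * a%:Z) (2 * b%:Z + 1) (2 * c%:Z) =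
  qf (2 * (a - b.+1)%N%:Z + 1) (2 * (c - b.+1)%N%:Z + 1) (2 * b%:Z + 1).
Proof. by move=> h; congr sym2; lia. Qed.

Lemma odd_to_even (k : int) d (a b c : nat) : (2 %| k)%Z -> (2 %| d.1)%Z -> (b < minn a c)%N ->
  d.2 = sym2 (2 * a%:Z) (2 * b%:Z + 1) (2 * c%:Z) ->
  even_degree (d - (k, indexA)) /\ (d - (k, indexA)).2 = qf (2 * (a - b.+1)%N%:Z) (2 * (c - b.+1)%N%:Z) (2 * b%:Z).
Proof.
move=> hk hd bm eM.
have e2 : (d - (k, indexA)).2 = sym2 (2 * a.-1%:Z) (2 * b%:Z) (2 * c.-1%:Z).
  rewrite /= eM; apply/matrixP => i j; rewrite !mxE; case: ifP => _; last by rewrite addrK.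
  by case: ifP => _; lia.
split; last by rewrite e2; congr sym2; lia.
by split; [rewrite rpredB | exists a.-1, b, c.-1; split => //; lia].
Qed.

Lemma jac_Phi_m2 : jac (-2) indexA (@Phi_m2 R).
Proof. by rewrite Phi_m2_X; exact: jacZ (jac_X R). Qed.

Lemma jac_Phi_0 : jac 0 indexA (@Phi_0 R).
Proof. by rewrite Phi_0_Y; exact: jacZ (jac_Y R). Qed.

Lemma odd_decomposition d f : odd_degree d -> jac d.1 d.2 f ->
  exists g h, [/\ even_degree (d - (-2, indexA)), even_degree (d - (0, indexA)),
    jac (d - (-2, indexA)).1 (d - (-2, indexA)).2 g, jac (d - (0, indexA)).1 (d - (0, indexA)).2 h &
    forall p, f p = g p * Phi_m2 p + h p * Phi_0 p].
Proof.
move=> [dk [a [b [c [bm eM]]]]] hf.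
have [ev1 i1] := @odd_to_even (-2) d a b c isT dk bm eM.
have [ev2 i2] := @odd_to_even 0 d a b c isT dk bm eM.
have ek : (-1 : R[i]) ^ d.1 = 1 by have [q ->] := dvdzP dk; rewrite mulrC sgn_even.
have hf' : jac d.1 (qf (2 * (a - b.+1)%N%:Z + 1) (2 * (c - b.+1)%N%:Z + 1) (2 * b%:Z + 1)) f.
  by apply: (jac_cast hf) => //; rewrite eM odd_index.
have [g [h [jg jh e]]] := all_spanned ek hf'.
have jg' := jacZ (twopii R)^-1 jg; have jh' := jacZ (twopii R)^-1 jh.
exists (fun p => (twopii R)^-1 * g p), (fun p => (twopii R)^-1 * h p); split=> //.
- by apply: (jac_cast jg') => //; rewrite i1.
- by apply: (jac_cast jh'); [rewrite /= subr0 | rewrite i2].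
move=> p; rewrite Phi_m2_X Phi_0_Y; have [Up|Up] := boolP (0 < complex.Im p.1).
  rewrite e //; move: (twopii_neq0 R) (g p) (h p) (Xf p) (Yf p); move: (twopii R) => x x0 *; field.
  by rewrite x0.
by rewrite -(jac_onH hf) /Xf /Yf /onH (negPf Up) !mulr0 addr0.
Qed.

End Grading.

Theorem theorem5p3 (R : realType) :
  @jacobi_dsum R odd_degree =
  [set F | exists G H : degree -> form2 R,
     [/\ jacobi_dsum even_degree G, jacobi_dsum even_degree H &
         F = gadd (gmul G (homog (-2, indexA) (@Phi_m2 R)))
                  (gmul H (homog (0, indexA) (@Phi_0 R)))]].
Proof.
apply/seteqP; split=> [F [fin hF]|_ [G [H [[finG hG] [finH hH] ->]]]].
(* The pair is required to be zero where F is zero, so that the chosen families inherit the finite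
   support of F. *)
- have hd (d : degree) : exists gh : form2 R * form2 R,
    [/\ F d <> (fun=> 0) -> even_degree (d - (-2, indexA)) /\ jac (d - (-2, indexA)).1 (d - (-2, indexA)).2 gh.1,
        F d <> (fun=> 0) -> even_degree (d - (0, indexA)) /\ jac (d - (0, indexA)).1 (d - (0, indexA)).2 gh.2,
        F d = (fun=> 0) -> gh = ((fun=> 0), (fun=> 0)) &
        forall p, F d p = gh.1 p * Phi_m2 p + gh.2 p * Phi_0 p].
    have [F0|F0] := pselect (F d = (fun=> 0)).
      by exists ((fun=> 0), (fun=> 0)); split=> // p; rewrite F0 /= !mul0r addr0.
    have od : odd_degree d.
      by apply: contrapT => nd; apply: F0; have [_] := hF d; exact.
    have [+ _] := hF d; move=> /(_ od) /jacP jF.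
    by have [g [h [e1 e2 jg jh e]]] := odd_decomposition od jF; exists (g, h); split.
  have [gh hgh] := choice hd.
  have dK (d d0 : degree) : d + d0 - d0 = d by rewrite addrK.
  (* The coefficient of a generator in degree e is the one chosen for F in degree e plus the degree
     of that generator. *)
  exists (fun e => (gh (e + (-2, indexA))).1), (fun e => (gh (e + (0, indexA))).2); split.
  + split.
      apply: (@sub_finite_set _ _ ((fun d => d - (-2, indexA)) @` [set d | F d <> (fun=> 0)])); last exact: finite_image.
      move=> e /= he; exists (e + (-2, indexA)); last exact: dK.
      by move=> F0; apply: he; have [_ _ h _] := hgh (e + (-2, indexA)); rewrite h.
    move=> e; have [h1 _ h2 _] := hgh (e + (-2, indexA)); rewrite dK in h1.
    have [F0|F0] := pselect (F (e + (-2, indexA)) = (fun=> 0)).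
      by rewrite h2 //; split=> // _; apply/jacP; exact: jac0.
    by have [ev jg] := h1 F0; split=> // _; apply/jacP.
  + split.
      apply: (@sub_finite_set _ _ ((fun d => d - (0, indexA)) @` [set d | F d <> (fun=> 0)])); last exact: finite_image.
      move=> e /= he; exists (e + (0, indexA)); last exact: dK.
      by move=> F0; apply: he; have [_ _ h _] := hgh (e + (0, indexA)); rewrite h.
    move=> e; have [_ h1 h2 _] := hgh (e + (0, indexA)); rewrite dK in h1.
    have [F0|F0] := pselect (F (e + (0, indexA)) = (fun=> 0)).
      by rewrite h2 //; split=> // _; apply/jacP; exact: jac0.
    by have [ev jg] := h1 F0; split=> // _; apply/jacP.
  apply/funext => d; apply/funext => p; rewrite /gadd !gmul_homog !subrK.
  by have [_ _ _ ->] := hgh d.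
have hE d p : gadd (gmul G (homog (-2, indexA) (@Phi_m2 R))) (gmul H (homog (0, indexA) (@Phi_0 R))) d p =
   G (d - (-2, indexA)) p * Phi_m2 p + H (d - (0, indexA)) p * Phi_0 p by rewrite /gadd !gmul_homog.
set F := gadd _ _ in hE *.
(* Off the even degrees the component is 0, which satisfies the laws of every weight and index, so
   products may be formed without a case distinction. *)
have jG (K : degree -> form2 R) : (forall d, (even_degree d -> weak_jacobi d.1 d.2 (K d)) /\ (~ even_degree d -> K d = (fun=> 0))) ->
   forall e, jac e.1 e.2 (K e).
  move=> hK e; have [h1 h2] := hK e; have [ev|nev] := pselect (even_degree e); first by apply/jacP; exact: h1.
  by rewrite h2 //; exact: jac0.
split.
  apply: (@sub_finite_set _ _ (((fun e => e + (-2, indexA)) @` [set e | G e <> (fun=> 0)]) `|`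
     ((fun e => e + (0, indexA)) @` [set e | H e <> (fun=> 0)]))).
    move=> d /= Fd; have [G0|G0] := pselect (G (d - (-2, indexA)) = (fun=> 0)); last first.
      by left; exists (d - (-2, indexA)) => //; rewrite subrK.
    have [H0|H0] := pselect (H (d - (0, indexA)) = (fun=> 0)); last first.
      by right; exists (d - (0, indexA)) => //; rewrite subrK.
    by exfalso; apply: Fd; apply/funext => p; rewrite hE G0 H0 !mul0r addr0.
  by rewrite finite_setU; split; exact: finite_image.
move=> d; have FE : F d = fun p => G (d - (-2, indexA)) p * Phi_m2 p + H (d - (0, indexA)) p * Phi_0 p.
  by apply/funext => p.
split=> od.
  apply/jacP; rewrite FE; apply: jacD.
    by apply: (jac_cast (jacM (jG G hG _) (jac_Phi_m2 R))); rewrite /= subrK.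
  by apply: (jac_cast (jacM (jG H hH _) (jac_Phi_0 R))); rewrite /= subrK.
(* Adding the degree of a generator to an even degree gives an odd one, so below a degree that is
   not odd there is no even degree and the component is 0. *)
have zero (K : degree -> form2 R) (k : int) : (2 %| k)%Z ->
   (forall d, (even_degree d -> weak_jacobi d.1 d.2 (K d)) /\ (~ even_degree d -> K d = (fun=> 0))) -> K (d - (k, indexA)) = (fun=> 0).
  move=> hk hK; have [_] := hK (d - (k, indexA)); apply=> ev; apply: od.
  by have := even_to_odd hk ev; rewrite subrK.
by rewrite FE (zero G (-2)) // (zero H 0) //; apply/funext => p; rewrite !mul0r addr0.
Qed.
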